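(* (1) Let $\psi\in\mathcal N$. Then the linear span of $(\mathcal P_n)_{n\ge0}$ is dense in $L^2(\nu)$ and $(\mathcal P_n)_{n\ge0}$ is a Bessel sequence, but it is not a Riesz basis in $L^2(\nu)$. (2) Let $\psi\in\mathcal N_\infty$. Then the sequence $(\mathcal V_n)_{n\ge0}$ is a minimal Riesz--Fischer sequence in $L^2(\nu)$ and $(\mathcal P_n)_{n\ge0}$ is exact. Moreover $(\mathcal V_n)_{n\ge0}$ is the unique sequence biorthogonal to $(\mathcal P_n)_{n\ge0}$ in $L^2(\nu)$. (3) Let $\psi\in\mathcal N_P\cup\mathcal N_{\alpha,\mathfrak m}^{d_\phi}$. Then the linear span of $(\mathcal V_n)_{n\ge0}$ is dense in $L^2(\nu)$, hence $(\mathcal V_n)_{n\ge0}$ is also exact and $(\mathcal P_n)_{n\ge0}$ is its unique biorthogonal sequence in $L^2(\nu)$. (4) Let $t\ge0$ and $\mathcal E_t=\{e^{-nt}:n\ge0\}$. (a) For any $\psi\in\mathcal N$, $\mathcal E_t\subseteq S_p(P_t)$ and $S_r(P_t)=\emptyset$. (b) Moreover, if $\psi\in\mathcal N_\infty$, then $\mathcal E_t\subseteq S_p(P_t^* )$ with $\mathfrak M_a(e^{-nt},P_t^* )=\mathfrak M_g(e^{-nt},P_t^* )=1$. (c) If $\psi\in\mathcal N_P\cup\mathcal N_{\alpha,\mathfrak m}^{d_\phi}$, then $\mathcal E_t=S_p(P_t)=S_p(P_t^* )$, $\mathfrak M_a(e^{-nt},P_t)=\mathfrak M_a(e^{-nt},P_t^*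 )=1$, and $S_r(P_t)=S_r(P_t^* )=\emptyset$. (d) Finally, if $\psi\in\mathcal N_\infty^c$ with $N_{\mathfrak r}\ge1$, then $$\Big\{e^{-nt}:0\le n<\frac{\overline\Pi(0^+)}{2\mathfrak r}\Big\}\subseteq S_p(P_t^* )\quad\text{and}\quad\Big\{e^{-nt}:n>\frac{\overline\Pi(0^+)}{2\mathfrak r}\Big\}\subseteq S_r(P_t^* ).$$
   Context: $\mathcal N$ is the set of functions $\psi(z)=\sigma^2z^2+mz+\int_0^\infty(e^{-zy}-1+zy)\Pi(dy)$ (for $z\in i\mathbb R$, extended to $\Re z\ge0$), with $\sigma\ge0$, $m\ge0$ and $\Pi$ a $\sigma$-finite positive measure concentrated on $(0,\infty)$ with $\int_0^\infty(y^2\wedge y)\Pi(dy)<\infty$. $\overline\Pi(y)=\int_y^\infty\Pi(dr)$, $\overline{\overline\Pi}(y)=\int_y^\infty\overline\Pi(r)dr$, $\phi(z)=\psi(z)/z=m+\sigma^2z+\int_0^\infty(1-e^{-zy})\overline\Pi(y)dy$, $\mathfrak r=\phi(\infty)$ ($=m+\overline{\overline\Pi}(0^+)$ if $\sigma=0$), $N_{\mathfrak r}=\lceil\overline\Pi(0^+)/\mathfrak r\rceil-1$ when $\mathfrak r<\infty$ ($=\infty$ if $\overline\Pi(0^+)=\infty$), $W_\phi(1)=1$, $W_\phi(n+1)=\prod_{k=1}^n\phi(k)$, $d_\phi=\sup\{u\le0:\phi(u)=-\infty\text{ or }\phi(u)=0\}\in[-\infty,0]$. $P=(P_t)_{t\ge0}$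 is the generalized Laguerre semigroup associated with $\psi$: the Feller semigroup on $C_0([0,\infty))$ characterized by its generator, given at least for $f$ with $x\mapsto f(e^x)$ in $C^2([-\infty,\infty])$ ($C^2$ with finite limits at $\pm\infty$ of the function and its first two derivatives) by $\mathbf Gf(x)=\sigma^2xf''(x)+(m+\sigma^2-x)f'(x)+\int_0^\infty(f(e^{-y}x)-f(x)+yxf'(x))\frac{\Pi(dy)}x$. It has a unique invariant measure, a probability measure with density $\nu$ (positive on $(0,\mathfrak r)$, support $[0,\mathfrak r]$), determined by its moments $\int x^n\nu(x)dx=W_\phi(n+1)$. $P$ also denotes its extension to $L^2(\nu)=L^2((0,\mathfrak r),\nu(x)dx)$; $P_t^*$ is the adjoint. $\mathcal P_n(x)=\sum_{k=0}^n(-1)^k\frac{\binom nk}{W_\phi(k+1)}x^k$, $\mathcal V_n(x)=\frac{(x^n\nu(x))^{(n)}}{n!\,\nu(x)}$. Classes: $\mathcal N_P=\{\sigma^2>0\}$; $\mathcal N_\infty=\{\sigma^2>0\text{ or }\overline\Pi(0^+)=\infty\}$; $\mathcal N_\infty^c=\mathcal N\setminus\mathcal N_\infty$; for $(\alpha,\mathfrak m)$ with $\alpha\in(0,1]$, $\mathfrak m\ge1-\frac1\alpha$, $\mathcal N_{\alpha,\mathfrak m}$ is the set of $\psi\in\mathcal N$ such that $u\mapsto\phi^R_{\alpha,\mathfrak m}(u)/\phi(u)$ is completely monotone on $(0,\infty)$, where $\phi^R_{\alpha,\mathfrak m}(u)=\frac{\Gamma(\alpha u+\alpha\mathfrak m+1)}{\Gamma(\alpha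 u+\alpha\mathfrak m+1-\alpha)}$; $\mathcal N_{\alpha,\mathfrak m}^{d_\phi}=\{\psi\in\mathcal N_{\alpha,\mathfrak m}:d_\phi<1-\frac{\mathfrak m}2-\frac1{2\alpha}\}$. Sequences in $L^2(\nu)$: $(P_n),(V_n)$ are biorthogonal if $\langle P_n,V_k\rangle_\nu=\delta_{nk}$; a sequence is minimal if it admits a biorthogonal sequence; exact if minimal and complete (dense span); Bessel if $\sum_n|\langle f,P_n\rangle_\nu|^2\le B\|f\|_\nu^2$ for some $B>0$ and all $f$; a Riesz basis (Riesz sequence in the paper's terminology) if it is minimal and satisfies $A\|f\|_\nu^2\le\sum_n|\langle f,P_n\rangle_\nu|^2\le B\|f\|^2_\nu$ for some $A,B>0$ and all $f$; Riesz--Fischer if there is $B>0$ with $B\sum|c_n|^2\le\|\sum c_nV_n\|_\nu^2$ for all finite scalar sequences. Spectrum of a bounded operator $A$: $\lambda\in S_p(A)$ if $\mathrm{Ker}(A-\lambda)\ne\{0\}$; $\lambda\in S_r(A)$ if $\mathrm{Ker}(A-\lambda)=\{0\}$ and the closure of the range of $A-\lambda$ is a proper subspace. $\mathfrak M_g(\lambda,A)=\dim\mathrm{Ker}(A-\lambda)$, $\mathfrak M_a(\lambda,A)=\dim\bigcup_{k\ge1}\mathrm{Ker}(A-\lambda)^k$.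
   Formalization: ''Not a Riesz basis'' in (1) excludes m=0, Π=0 (ψ=σ²z²), where (P_n) is the orthonormal Laguerre basis; the multiplicity claims in (4)(b),(c) and the second inclusion in (4)(d) are stated for t>0 only, since they fail at t=0, where P_0 is the identity. *)

(* Defs.v *)
From HB Require Import structures.
From mathcomp Require Import all_boot all_order all_algebra.
From mathcomp Require Export complex.
From mathcomp Require Import all_classical all_reals all_analysis.
Set Implicit Arguments.
Unset Strict Implicit.
Unset Printing Implicit Defensive.
Import Order.TTheory GRing.Theory Num.Theory.
Import numFieldNormedType.Exports.
Local Open Scope classical_set_scope.
Local Open Scope ring_scope.
Local Open Scope complex_scope.

(* The elements psi of the class N, given by their (unique) characteristics. *)
Record laguerre_exponent (R : realType) := LaguerreExponent {
  lsigma : R;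
  ldrift : R;
  lPi : {sigma_finite_measure set (measurableTypeR R) -> \bar R};
  lsigma_ge0 : 0 <= lsigma;
  ldrift_ge0 : 0 <= ldrift;
  lPi_conc : lPi [set y | y <= 0] = 0%E;
  lPi_int : (\int[lPi]_(y in `]0%R, +oo[) (Num.min (y ^+ 2)%R y)%:E < +oo)%E }.

Section Exponent.
Context {R : realType}.
Implicit Types (p : laguerre_exponent R) (u y a mm : R) (n : nat).

(* psi on the real axis. The integrand is nonnegative, so this makes sense as
   an extended real for u < 0 too; it is finite for u >= 0. *)
Definition psi p u : \bar R :=
  (((lsigma p) ^+ 2 * u ^+ 2 + ldrift p * u)%R%:E +
   \int[lPi p]_(y in `]0%R, +oo[) (expR (- (u * y)) - 1 + u * y)%R%:E)%E.

(* phi(u) = psi(u) / u, with phi(0) = psi'(0+) = m. By Tonelli,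
   phi(u) = m + sigma^2 u + \int_0^oo (1 - e^(-uy)) Pibar(y) dy for every real
   u, both sides being -oo when u < 0 and the integral diverges. *)
Definition phi p u : \bar R :=
  if u == 0 then (ldrift p)%:E else ((u^-1)%:E * psi p u)%E.

Definition Pibar p y : \bar R := lPi p `]y, +oo[%classic.
Definition Pibar0 p : \bar R := lim (Pibar p y @[y --> 0^'+]).

Definition phi_infty p : \bar R := lim (phi p u @[u --> +oo]).

(* +oo unless both Pibar(0+) and phi(oo) are finite; only meaningful when
   phi(oo) < +oo. *)
Definition Nr p : \bar R :=
  match Pibar0 p, phi_infty p with
  | a%:E, r%:E => ((Num.ceil (a / r))%:~R - 1)%:E
  | _, _ => +oo%E
  end.

Definition Wphi p n : R := \prod_(1 <= k < n) fine (phi p k%:R).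

Definition d_phi p : \bar R :=
  ereal_sup [set u%:E | u in [set u : R | u <= 0 /\
                                 (phi p u = -oo%E \/ phi p u = 0%E)]].

Definition classNP p : Prop := 0 < lsigma p ^+ 2.

Definition classNinfty p : Prop := 0 < lsigma p ^+ 2 \/ Pibar0 p = +oo%E.

Definition Gamma (x : R) : R :=
  \int[lebesgue_measure]_(t in `]0, +oo[) (t `^ (x - 1) * expR (- t)).

Definition phiR a mm u : R :=
  Gamma (a * u + a * mm + 1) / Gamma (a * u + a * mm + 1 - a).

Definition completely_monotone (f : R -> R) : Prop :=
  forall n u, 0 < u ->
    derivable (derive1n n f) u 1 /\ 0 <= (-1) ^+ n * (derive1n n f) u.

Definition classNam a mm p : Prop :=
  completely_monotone (fun u => phiR a mm u / fine (phi p u)).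

Definition classNamd a mm p : Prop :=
  classNam a mm p /\ (d_phi p < (1 - mm / 2 - (2 * a)^-1)%:E)%E.

Definition polP p n (x : R) : R :=
  \sum_(0 <= k < n.+1) (-1) ^+ k * ('C(n, k)%:R / Wphi p k.+1) * x ^+ k.

Definition rodV (nu : R -> R) n (x : R) : R :=
  derive1n n (fun y : R => y ^+ n * nu y) x / (n`!%:R * nu x).

End Exponent.

Section Semigroup.
Context {R : realType}.
Implicit Types (f g h : R -> R) (P : R -> (R -> R) -> R -> R).

(* A function on [0,oo) is represented by its extension by 0 to R. *)
Definition C0 f : Prop :=
  [/\ {within `[0, +oo[, continuous f},
      f x @[x --> +oo] --> (0 : R) &
      forall x, x < 0 -> f x = 0].

Definition C2_ext h : Prop :=
  [/\ forall x, derivable h x 1 /\ derivable (derive1 h) x 1,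
      continuous (derive1n 2 h) &
      forall k, (k <= 2)%N -> cvg (derive1n k h x @[x --> +oo]) /\
                              cvg (derive1n k h x @[x --> -oo])].

Record feller_semigroup P : Prop := FellerSemigroup {
  feller_C0 : forall t f, 0 <= t -> C0 f -> C0 (P t f);
  feller_linear : forall t (a : R) f g, 0 <= t -> C0 f -> C0 g ->
    forall x, P t (fun y => a * f y + g y) x = a * P t f x + P t g x;
  feller_contr : forall t f, 0 <= t -> C0 f ->
    (forall x, 0 <= f x <= 1) -> forall x, 0 <= P t f x <= 1;
  feller_id : forall f, C0 f -> forall x, P 0 f x = f x;
  feller_comp : forall s t f, 0 <= s -> 0 <= t -> C0 f ->
    forall x, P (s + t) f x = P s (P t f) x;
  feller_cont : forall f, C0 f -> forall e : R, 0 < e ->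
    \forall t \near 0^'+, forall x, `|P t f x - f x| <= e }.

(* f is in the domain of the (strong) generator of P, which maps f to g *)
Definition generates P f g : Prop :=
  [/\ C0 f, C0 g & forall e : R, 0 < e ->
    \forall t \near 0^'+, forall x, `|(P t f x - f x) / t - g x| <= e].

Definition lagG (p : laguerre_exponent R) f (x : R) : R :=
  (lsigma p) ^+ 2 * x * derive1n 2 f x +
  (ldrift p + (lsigma p) ^+ 2 - x) * derive1 f x +
  (\int[lPi p]_(y in `]0, +oo[)
     (f (expR (- y) * x) - f x + y * x * derive1 f x)) / x.

(* lagG p f is only defined on (0,oo), and need not extend to an element of
   C_0 (e.g. for f(x) = sqrt x near 0): g is that extension when it exists. *)
Definition generalized_laguerre (p : laguerre_exponent R) P : Prop :=
  feller_semigroup P /\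
  forall f g, C0 f -> C2_ext (fun x => f (expR x)) -> C0 g ->
    (forall x, 0 < x -> g x = lagG p f x) -> generates P f g.

(* mu is the invariant measure of P, nu its density. Continuity on (0,r)
   selects the representative of nu that is differentiated in rodV. *)
Record invariant_density (p : laguerre_exponent R) P
    (mu : probability (measurableTypeR R) R) (nu : R -> R) : Prop :=
  InvariantDensity {
  inv_mu : forall t f, 0 <= t -> C0 f ->
    \int[mu]_x P t f x = \int[mu]_x f x;
  nu_meas : measurable_fun setT nu;
  nu_ge0 : forall x, 0 <= nu x;
  nu_density : forall A : set (measurableTypeR R), measurable A ->
    mu A = (\int[lebesgue_measure]_(x in A) (nu x)%:E)%E;
  nu_pos : forall x, 0 < x -> (x%:E < phi_infty p)%E -> 0 < nu x;
  nu_cont : forall x, 0 < x -> (x%:E < phi_infty p)%E -> {for x, continuous nu};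
  nu_supp : forall x, x < 0 \/ (phi_infty p < x%:E)%E -> nu x = 0;
  nu_moments : forall n,
    (\int[mu]_x (x ^+ n)%:E = (Wphi p n.+1)%:E)%E }.

End Semigroup.

(* L^2(mu) over the complex numbers: functions R -> R[i], up to equality
   mu-almost everywhere. *)
Section L2.
Context {R : realType} (mu : probability (measurableTypeR R) R).
Implicit Types (f g h : R -> R[i]) (u v w : nat -> R -> R[i]) (c : nat -> R[i]).
Implicit Types (A B : (R -> R[i]) -> R -> R[i]) (z : R[i]).

Definition ofR (f : R -> R) : R -> R[i] := fun x => (f x)%:C.

Definition L2 f : Prop :=
  ((fun x => complex.Re (f x)) : measurableTypeR R -> R) \in Lfun mu 2%:E /\
  ((fun x => complex.Im (f x)) : measurableTypeR R -> R) \in Lfun mu 2%:E.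

Definition aeq f g : Prop := f = g %[ae mu].

Definition sqabs z : R := (complex.Re z) ^+ 2 + (complex.Im z) ^+ 2.

Definition inner f g : R[i] :=
  (\int[mu]_x complex.Re (f x * (g x)^*)) +i*
  (\int[mu]_x complex.Im (f x * (g x)^*)).

Definition L2norm f : R := Num.sqrt (\int[mu]_x sqabs (f x)).

Definition dense_in_L2 (S : set (R -> R[i])) : Prop :=
  forall f, L2 f -> forall e : R, 0 < e ->
    exists2 g, S g & L2norm (fun x => f x - g x) < e.

Definition lincomb (n : nat) c u : R -> R[i] :=
  fun x => \sum_(k < n) c k * u k x.

Definition lspan u : set (R -> R[i]) :=
  [set g | exists n c, g = lincomb n c u].

Definition L2seq u : Prop := forall n, L2 (u n).

Definition complete_seq u : Prop := L2seq u /\ dense_in_L2 (lspan u).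

Definition biorthogonal u v : Prop :=
  [/\ L2seq u, L2seq v & forall n k, inner (u n) (v k) = (n == k)%:R].

Definition minimal_seq u : Prop := exists v, biorthogonal u v.

Definition unique_biorthogonal u v : Prop :=
  biorthogonal u v /\
  forall w, biorthogonal u w -> forall n, aeq (w n) (v n).

Definition exact_seq u : Prop := minimal_seq u /\ complete_seq u.

Definition bessel u : Prop := L2seq u /\
  exists2 b : R, 0 < b & forall f, L2 f ->
    (\sum_(0 <= n <oo) (sqabs (inner f (u n)))%:E <= (b * L2norm f ^+ 2)%:E)%E.

Definition riesz_basis u : Prop := minimal_seq u /\
  exists a b : R, [/\ 0 < a, 0 < b & forall f, L2 f ->
    ((a * L2norm f ^+ 2)%:E <= \sum_(0 <= n <oo) (sqabs (inner f (u n)))%:E /\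
    \sum_(0 <= n <oo) (sqabs (inner f (u n)))%:E <= (b * L2norm f ^+ 2)%:E)%E].

Definition riesz_fischer u : Prop := L2seq u /\
  exists2 b : R, 0 < b & forall n c,
    b * \sum_(k < n) sqabs (c k) <= L2norm (lincomb n c u) ^+ 2.

Definition bounded_op A : Prop :=
  [/\ forall f, L2 f -> L2 (A f),
      forall z f g, L2 f -> L2 g ->
        aeq (A (fun x => z * f x + g x)) (fun x => z * A f x + A g x) &
      exists b : R, forall f, L2 f -> L2norm (A f) <= b * L2norm f].

Definition adjoint A B : Prop :=
  bounded_op B /\
  forall f g, L2 f -> L2 g -> inner (A f) g = inner f (B g).

(* A is the bounded extension to L^2(mu) of the operator T on C_0 *)
Definition L2_extension (T : (R -> R) -> R -> R) A : Prop :=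
  bounded_op A /\
  forall f : R -> R, C0 f -> aeq (A (ofR f)) (ofR (T f)).

Definition sub_scalar A z : (R -> R[i]) -> R -> R[i] :=
  fun f x => A f x - z * f x.

Definition Ker A : set (R -> R[i]) :=
  [set f | L2 f /\ aeq (A f) (fun=> 0)].

Definition point_spectrum A : set R[i] :=
  [set z | exists2 f, Ker (sub_scalar A z) f & ~ aeq f (fun=> 0)].

Definition residual_spectrum A : set R[i] :=
  [set z | (forall f, Ker (sub_scalar A z) f -> aeq f (fun=> 0)) /\
           ~ dense_in_L2 (sub_scalar A z @` L2)].

(* K, a linear subspace of L^2(mu), has dimension n *)
Definition has_dim (K : set (R -> R[i])) (n : nat) : Prop :=
  exists b : nat -> R -> R[i],
    [/\ forall k, (k < n)%N -> K (b k),
        forall c, aeq (lincomb n c b) (fun=> 0) ->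
          forall k, (k < n)%N -> c k = 0 &
        forall f, K f -> exists c, aeq f (lincomb n c b)].

Definition geom_mult z A (n : nat) : Prop := has_dim (Ker (sub_scalar A z)) n.

Definition alg_mult z A (n : nat) : Prop :=
  has_dim [set f | exists2 k, (1 <= k)%N & Ker (iter k (sub_scalar A z)) f] n.

End L2.

Definition expnt {R : realType} (t : R) (n : nat) : R[i] :=
  (expR (- (n%:R * t)))%:C.

Definition Et {R : realType} (t : R) : set R[i] := [set expnt t n | n in setT].

(* Submission.v *)
(* Write [W n] for the moments of [nu]. Everything about [(P_n)] follows from the
   positive definiteness of [n! / W n] (Berg-Duran, Schoenberg): the Bessel bound
   is the Schur product of this kernel with the classical Laguerre case, and
   [W (2 N) / ('C(2 N, N) W N ^ 2)] tending to 0 excludes a lower bound.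
   A biorthogonal vector of index [n] exists if and only if the functional
   [q |-> \int x ^ n q^(n) / n!] is bounded on polynomials; it is bounded when [W]
   is a Beta or Gamma moment sequence times a positive definite one, and iterated
   primitives together with moment determinacy identify its Riesz representative
   with the Rodrigues expression [V_n].
   Completeness of [(V_n)]: a polynomial functional orthogonal to all [V_n] is
   propagated along dilations from [a = 1] down to [a = 0].
   The semigroup is diagonal on [(P_n)], since
   [|| P_t f - exp (- n t) f || <= t || G f + n f ||] holds for
   [f = x ^ k exp (- e x)], with [e] tending to 0; the spectral claims are then
   statements on operators diagonal along a biorthogonal system. *)
Require Import Defs.
From mathcomp Require Import all_boot all_order all_algebra.
From mathcomp Require Import all_classical all_reals all_analysis.
From mathcomp Require Import measurable_realfun.
From mathcomp Require Import ring lra zify.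
Import Order.TTheory GRing.Theory Num.Theory.
Import numFieldNormedType.Exports.
Set Implicit Arguments.
Unset Strict Implicit.
Local Open Scope classical_set_scope.
Local Open Scope ring_scope.

Local Notation mR := measurableTypeR.

(** * Positive semidefinite kernels and Hankel sequences *)

Section PositiveKernels.
Context {R : realType}.
Implicit Types (K L : nat -> nat -> R) (a b s x y : nat -> R) (c : nat -> R).

(** Bounds are proved on real polynomials, as positivity of explicit kernels built from the moments
    [W]; density and Riesz representation carry them to [L^2]. Since [W n] is the product of the
    [phi(k)], passing from [phi(u)] to [phi(u) (1 + A / (u + b))] extracts a Beta law, and the
    remaining product is positive definite when the new function is still of Bernstein type. The
    functional of index [n] is bounded for this Beta law when [2 n < A]. All [A] are allowed if
    sigma is positive or [Pi] has infinite mass; otherwise [A] must stay below [Pibar(0+) / r],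
    which is the origin of the threshold [Pibar(0+) / (2 r)]. In the completeness proof, polynomials
    [q_j] tend to an [f] orthogonal to all [V_n]. The coefficients of [P_t q_j] are, up to factors,
    the dilated functionals at [a = 1 - exp (- t)]. Once these tend to 0 for a small [a], [P_t q_j]
    tends to 0 locally uniformly for a small [t], and continuity at time 0 gives [f = 0]. Each
    dilation step is a Taylor expansion whose convergence needs dual norms growing at most
    geometrically in [n]; this is why constants are tracked. *)

Definition quad (n : nat) c K : R := \sum_(i < n) \sum_(j < n) c i * c j * K i j.

Definition psd K := (forall i j, K i j = K j i) /\ forall n c, 0 <= quad n c K.

(** By Hamburger's theorem these are the moment sequences of measures on the line. The Hankel form
    is kept because products, limits and mixtures then need no representing measure. *)
Definition hpsd a := psd (fun i j => a (i + j)%N).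

Lemma quadS n c K : (forall i j, K i j = K j i) ->
  quad n.+1 c K =
  quad n c K + 2 * c n * (\sum_(i < n) c i * K i n) + c n ^+ 2 * K n n.
Proof.
move=> Ks; rewrite /quad big_ord_recr/=.
under eq_bigr do rewrite big_ord_recr/=.
rewrite big_split/= [X in _ + X]big_ord_recr/=.
rewrite -!addrA; congr (_ + _); rewrite addrA expr2; congr (_ + _).
rewrite mulr_sumr -big_split/=; apply: eq_bigr => i _.
by rewrite (Ks n i); ring.
Qed.

Lemma eq_quad n c c' K L : (forall i j, (i < n)%N -> (j < n)%N ->
    c i * c j * K i j = c' i * c' j * L i j) -> quad n c K = quad n c' L.
Proof. by move=> e; apply: eq_bigr => i _; apply: eq_bigr => j _; apply: e. Qed.

(* Gaussian elimination of the last index: [K] is a rank-one kernel plus a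
   positive kernel on fewer indices. *)
Lemma quad_mul_ge0 n K L : (forall i j, K i j = K j i) ->
  (forall c, 0 <= quad n c K) -> psd L ->
  forall c, 0 <= quad n c (fun i j => K i j * L i j).
Proof.
elim: n K => [|n IH] K Ks Kp [Ls Lp] c; first by rewrite /quad big_ord0.
have Kn k : (k <= n)%N -> 0 <= K k k.
  move=> kn; have := Kp (fun i => (i == k)%:R).
  rewrite /quad (bigD1 (Ordinal (kn : (k < n.+1)%N)))//= [X in _ + X]big1; last first.
    move=> i ik; rewrite big1// => j _.
    by rewrite -val_eqE/= in ik; rewrite (negbTE ik) !mul0r.
  rewrite addr0 (bigD1 (Ordinal (kn : (k < n.+1)%N)))//= [X in _ + X]big1; last first.
    by move=> i ik; rewrite -val_eqE/= in ik; rewrite (negbTE ik) mulr0 mul0r.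
  by rewrite addr0 eqxx !mul1r.
have KLs i j : K i j * L i j = K j i * L j i by rewrite Ks Ls.
(* A zero last diagonal entry forces the last column to vanish, and the last index drops out. *)
have [d0|d0] := eqVneq (K n n) 0.
  have Kin i : (i < n)%N -> K i n = 0.
    move=> ilt; apply/eqP/negPn/negP => k0.
    (* Chosen so that the form at the vector with entries 1 at [i] and [t] at [n] takes the value
       -1. *)
    pose t := - (K i i + 1) / (2 * K i n).
    pose c' := fun k : nat => if k == i then 1 else if k == n then t else 0.
    have := Kp c'; rewrite quadS// d0 mulr0 addr0.
    have c'n : c' n = t by rewrite /c' eqxx gtn_eqF.
    have c'i : c' i = 1 by rewrite /c' eqxx.
    have c'0 j : (j < n)%N -> j != i -> c' j = 0.
      by move=> jn ji; rewrite /c' (negbTE ji) ltn_eqF.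
    have -> : quad n c' K = K i i.
      rewrite /quad (bigD1 (Ordinal ilt))//= [X in _ + X]big1; last first.
        move=> j ji; rewrite big1// => k _.
        by rewrite c'0 ?mul0r.
      rewrite addr0 (bigD1 (Ordinal ilt))//= [X in _ + X]big1; last first.
        by move=> j ji; rewrite (c'0 j) ?mulr0 ?mul0r.
      by rewrite c'i !mul1r addr0.
    rewrite (bigD1 (Ordinal ilt))//= [X in c' i * K i n + X]big1; last first.
      by move=> j ji; rewrite (c'0 j) ?mul0r.
    rewrite c'n c'i mul1r !addr0.
    have -> : K i i + 2 * t * K i n = -1 by rewrite /t; field.
    by rewrite ler0N1.
  rewrite quadS// d0 mul0r mulr0 addr0 big1 ?mulr0 ?addr0//; last first.
    by move=> i _; rewrite Kin// mul0r mulr0.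
  apply: IH => // c'; pose c'' k := if (k < n)%N then c' k else 0.
  suff -> : quad n c' K = quad n.+1 c'' K by exact: Kp.
  rewrite quadS// /c'' ltnn mulr0 !mul0r expr0n/= mul0r !addr0.
  by apply: eq_quad => i j i_n j_n; rewrite i_n j_n.
have dgt : 0 < K n n by rewrite lt_neqAle eq_sym d0 Kn.
(* Schur complement of the last diagonal entry. *)
pose K' i j := K i j - K i n * K j n / K n n.
have K's i j : K' i j = K' j i by rewrite /K' Ks; congr (_ - _); rewrite (mulrC (K i n)).
have -> : quad n.+1 c (fun i j => K i j * L i j) =
    quad n c (fun i j => K' i j * L i j) +
    (K n n)^-1 * quad n.+1 (fun i => c i * K i n) L.
  rewrite !quadS//= mulrDr mulrDr !addrA; congr (_ + _ + _).
  - rewrite /quad mulr_sumr -big_split/=; apply: eq_bigr => i _.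
    rewrite mulr_sumr -big_split/=; apply: eq_bigr => j _.
    by rewrite /K'; ring.
  - rewrite !mulr_sumr; apply: eq_bigr => i _; by field.
  - by field.
apply: addr_ge0; last by rewrite mulr_ge0// invr_ge0 ltW.
apply: IH => // c'.
pose s := \sum_(i < n) c' i * K i n.
(* The last coordinate minimizes the form of [K], and the minimum is the form of [K'] at [c']. *)
pose c'' k := if (k < n)%N then c' k else - s / K n n.
suff <- : quad n.+1 c'' K = quad n c' K' by exact: Kp.
have c''n : c'' n = - s / K n n by rewrite /c'' ltnn.
rewrite quadS// c''n.
have -> : \sum_(i < n) c'' i * K i n = s.
  by apply: eq_bigr => i _; rewrite /c'' ltn_ord.
have -> : quad n c'' K = quad n c' K.
  by apply: eq_quad => i j i_n j_n; rewrite /c'' i_n j_n.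
have -> : quad n c' K' = quad n c' K - s ^+ 2 / K n n.
  rewrite expr2 {1}/s mulr_suml mulr_suml -sumrN -big_split/=.
  apply: eq_bigr => i _.
  rewrite /s mulr_sumr mulr_suml -sumrN -big_split/=.
  by apply: eq_bigr => j _; rewrite /K'; ring.
by field.
Qed.

Lemma psd_mul K L : psd K -> psd L -> psd (fun i j => K i j * L i j).
Proof.
move=> [Ks Kp] pL; split => [i j|n c]; first by rewrite Ks pL.1.
exact: quad_mul_ge0.
Qed.

Lemma quad_rank1 n c y :
  quad n c (fun i j => y i * y j) = (\sum_(i < n) c i * y i) ^+ 2.
Proof.
rewrite expr2 mulr_suml; apply: eq_bigr => i _.
by rewrite mulr_sumr; apply: eq_bigr => j _; ring.
Qed.

Lemma psd_rank1 y : psd (fun i j => y i * y j).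
Proof.
by split => [i j|n c]; [rewrite mulrC|rewrite quad_rank1 sqr_ge0].
Qed.

Lemma quadD n c K L :
  quad n c (fun i j => K i j + L i j) = quad n c K + quad n c L.
Proof.
rewrite /quad -big_split; apply: eq_bigr => i _; rewrite -big_split.
by apply: eq_bigr => j _; rewrite mulrDr.
Qed.

Lemma quadZ n c r K : quad n c (fun i j => r * K i j) = r * quad n c K.
Proof.
rewrite /quad mulr_sumr; apply: eq_bigr => i _; rewrite mulr_sumr.
by apply: eq_bigr => j _; rewrite mulrCA.
Qed.

Lemma psdD K L : psd K -> psd L -> psd (fun i j => K i j + L i j).
Proof.
move=> [Ks Kp] [Ls Lp]; split => [i j|n c]; first by rewrite Ks Ls.
by rewrite quadD addr_ge0.
Qed.

Lemma psdZ r K : 0 <= r -> psd K -> psd (fun i j => r * K i j).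
Proof.
by move=> r0 [Ks Kp]; split => [i j|n c]; [rewrite Ks|rewrite quadZ mulr_ge0].
Qed.

Lemma eq_psd K L : (forall i j, K i j = L i j) -> psd K -> psd L.
Proof.
move=> e [Ks Kp]; split => [i j|n c]; first by rewrite -!e.
by rewrite -(eq_quad (c := c) (K := K))// => i j _ _; rewrite e.
Qed.

Lemma hpsdE a : (forall n c, 0 <= quad n c (fun i j => a (i + j)%N)) -> hpsd a.
Proof. by move=> h; split => // i j; rewrite addnC. Qed.

Lemma eq_hpsd a b : a =1 b -> hpsd a -> hpsd b.
Proof. by move=> e; apply: eq_psd => i j; rewrite e. Qed.

Lemma hpsd_mul a b : hpsd a -> hpsd b -> hpsd (fun n => a n * b n).
Proof. exact: psd_mul. Qed.

Lemma hpsdD a b : hpsd a -> hpsd b -> hpsd (fun n => a n + b n).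
Proof. exact: psdD. Qed.

Lemma hpsdZ r a : 0 <= r -> hpsd a -> hpsd (fun n => r * a n).
Proof. exact: psdZ. Qed.

Lemma hpsd_exp (r : R) : hpsd (fun n => r ^+ n).
Proof. by apply: eq_psd (psd_rank1 (fun n => r ^+ n)) => i j; rewrite exprD. Qed.

Lemma hpsd_cst (r : R) : 0 <= r -> hpsd (fun=> r).
Proof.
move=> r0; apply: (eq_hpsd (a := fun n => r * 1 ^+ n)) => [n|].
  by rewrite expr1n mulr1.
exact: hpsdZ (hpsd_exp 1).
Qed.

Lemma hpsd_prod (a : nat -> nat -> R) N : (forall k, (k < N)%N -> hpsd (a k)) ->
  hpsd (fun n => \prod_(k < N) a k n).
Proof.
elim: N => [|N IH] h.
  by apply: (eq_hpsd (a := fun=> 1)); [move=> n; rewrite big_ord0|exact: hpsd_cst].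
apply: (eq_hpsd (a := fun n => (\prod_(k < N) a k n) * a N n)).
  by move=> n; rewrite big_ord_recr.
by apply: hpsd_mul; [apply: IH => k kN; apply: h; apply: ltnW|apply: h].
Qed.

Lemma hpsd_sum (a : nat -> nat -> R) N : (forall k, (k < N)%N -> hpsd (a k)) ->
  hpsd (fun n => \sum_(k < N) a k n).
Proof.
elim: N => [|N IH] h.
  by apply: (eq_hpsd (a := fun=> 0)); [move=> n; rewrite big_ord0|exact: hpsd_cst].
apply: (eq_hpsd (a := fun n => (\sum_(k < N) a k n) + a N n)).
  by move=> n; rewrite big_ord_recr.
by apply: hpsdD; [apply: IH => k kN; apply: h; apply: ltnW|apply: h].
Qed.

Lemma hpsd_pow a N : hpsd a -> hpsd (fun n => a n ^+ N).
Proof.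
move=> ha; apply: (eq_hpsd (a := fun n => \prod_(k < N) a n)).
  by move=> n; rewrite prodr_const card_ord.
by apply: (hpsd_prod (a := fun=> a)).
Qed.

Lemma psd_cvg {T} {F : set_system T} {FF : ProperFilter F}
    (K : T -> nat -> nat -> R) L :
  (\forall t \near F, psd (K t)) -> (forall i j, K t i j @[t --> F] --> L i j) ->
  psd L.
Proof.
move=> hK KL; split => [i j|n c].
  have h := KL j i.
  have h' : K t i j @[t --> F] --> L j i.
    apply: cvg_trans h; apply: near_eq_cvg.
    by apply: filterS hK => t [->].
  by apply: (cvg_unique _ (KL i j) h').
have : quad n c (K t) @[t --> F] --> quad n c L.
  rewrite /quad.
  apply: cvg_big => [|i _]; first exact: add_continuous.
  apply: cvg_big => [|j _]; first exact: add_continuous.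
  by apply: cvgM; [exact: cvg_cst|exact: KL].
move=> h; apply: (cvgr_to_ge h).
by apply: filterS hK => t -[_]; apply.
Qed.

Lemma hpsd_cvg {T} {F : set_system T} {FF : ProperFilter F} (a : T -> nat -> R) b :
  (\forall t \near F, hpsd (a t)) -> (forall n, a t n @[t --> F] --> b n) -> hpsd b.
Proof. by move=> ha ab; apply: (psd_cvg ha) => i j; apply: ab. Qed.

Lemma psd_sum N (K : nat -> nat -> nat -> R) : (forall k, psd (K k)) ->
  psd (fun i j => \sum_(k < N) K k i j).
Proof.
move=> h; elim: N => [|N IH].
  apply: (eq_psd (K := fun _ _ => 0)) (hpsd_cst (lexx 0)) => i j.
  by rewrite big_ord0.
by apply: eq_psd (psdD IH (h N)) => i j; rewrite big_ord_recr.
Qed.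

(* [1 / (x + y)] is [2 / ((1 + x) (1 + y))] times the geometric series of
   [r x * r y] where [r x = (1 - x) / (1 + x)]. *)
Lemma psd_cauchy x : (forall i, 0 < x i) -> psd (fun i j => (x i + x j)^-1).
Proof.
move=> x0; pose r i := (1 - x i) / (1 + x i).
have r1 i : `|r i| < 1.
  have := x0 i => xi; rewrite ltr_norml ltr_pdivlMr ?ltr_pdivrMr; first lra.
  by lra.
  by lra.
apply: (psd_cvg (F := \oo) (K := fun N i j =>
    (2 * (1 + x i)^-1 * (1 + x j)^-1) * \sum_(k < N) (r i ^+ k * r j ^+ k))).
  near=> N; apply: (psd_mul (K := fun i j => 2 * (1 + x i)^-1 * (1 + x j)^-1)).
    apply: (eq_psd (K := fun i j => 2 * ((1 + x i)^-1 * (1 + x j)^-1))).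
      by move=> i j; rewrite mulrA.
    exact: psdZ (psd_rank1 (fun i => (1 + x i)^-1)).
  by apply: (psd_sum N (K := fun k i j => r i ^+ k * r j ^+ k)) => k; apply: psd_rank1.
move=> i j.
have rr : `|r i * r j| < 1.
  by rewrite normrM mulr_ilt1.
have := cvg_geometric_series rr (a := 2 * (1 + x i)^-1 * (1 + x j)^-1).
have -> : 2 * (1 + x i)^-1 * (1 + x j)^-1 / (1 - r i * r j) = (x i + x j)^-1.
  have xi := x0 i; have xj := x0 j; rewrite /r.
  have h1 : 1 + x i != 0 by rewrite gt_eqF//; lra.
  have h2 : 1 + x j != 0 by rewrite gt_eqF//; lra.
  have h3 : x i + x j != 0 by rewrite gt_eqF//; lra.
  field; rewrite h1 h2 h3/=.
  rewrite (_ : _ - _ = 2 * (x i + x j)); last by ring.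
  by rewrite mulf_neq0.
apply: cvg_trans; apply: near_eq_cvg; near=> N.
rewrite seriesEord/= mulr_sumr; apply: eq_bigr => k _.
by rewrite /geometric/= exprMn.
Unshelve. all: by end_near. Qed.

Lemma hpsd_invr_addn (t : R) : 0 < t -> hpsd (fun n => (n%:R + t)^-1).
Proof.
move=> t0; apply: eq_psd (psd_cauchy (x := fun i => i%:R + t / 2) _).
  by move=> i j; congr (_^-1); rewrite natrD; field.
by move=> i; apply: ltr_wpDl => //; rewrite divr_gt0.
Qed.

(* Berg-Duran: for [b] bounded below, [1 / (b 1 ... b n)] is the limit of
   [l ^- n * \prod_(j <= N) (b (n + j) / b j)] as [N] grows, [l] being the
   limit of [b], and each factor [b (n + j)] is a moment sequence in [n]. *)
Lemma hpsd_inv_prod_lb a (e : R) : 0 < e -> (forall k, (0 < k)%N -> e <= a k) ->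
  (forall k, (0 < k)%N -> a k.+1 <= a k) ->
  (forall j, (0 < j)%N -> hpsd (fun n => a (n + j)%N)) ->
  hpsd (fun n => \prod_(k < n) (a k.+1)^-1).
Proof.
move=> e0 ea adec ha.
have ap k : (0 < k)%N -> 0 < a k by move=> k0; apply: lt_le_trans (ea k k0).
have [l [l0 al]] : exists l : R, 0 < l /\ a n.+1 @[n --> \oo] --> l.
  have : cvgn (fun n => a n.+1).
    apply: nonincreasing_is_cvgn.
      by apply/nonincreasing_seqP => n; apply: adec.
    by exists e => _ [n _ <-]; apply: ea.
  move=> c; exists (limn (fun n => a n.+1)); split => //.
  apply: lt_le_trans e0 _; apply: limr_ge => //.
  by near=> n; apply: ea.
apply: (hpsd_cvg (F := \oo)
  (a := fun N n => (l^-1) ^+ n * \prod_(j < N) (a (n + j.+1)%N / a j.+1))).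
  near=> N; apply: hpsd_mul; first exact: hpsd_exp.
  apply: (hpsd_prod (a := fun j n => a (n + j.+1)%N / a j.+1)) => k _.
  apply: (eq_hpsd (a := fun n => (a k.+1)^-1 * a (n + k.+1)%N)).
    by move=> n; rewrite mulrC.
  by apply: hpsdZ; [rewrite invr_ge0 ltW ?ap|apply: ha].
move=> n.
(* Both sides are the quotient of [a 1 ... a (N + n)] by [(a 1 ... a N) (a 1 ... a n)]. On the right
   the number of factors does not depend on [N], so the limit can be taken in each of them. *)
have E N : \prod_(j < N) (a (n + j.+1)%N / a j.+1) =
    \prod_(k < n) (a (N + k.+1)%N / a k.+1).
  elim: N => [|N IH].
    rewrite big_ord0 big1// => k _; rewrite add0n divff//.
    by rewrite gt_eqF// ap.
  rewrite big_ord_recr/= IH.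
  case: n {IH} => [|n].
    by rewrite !big_ord0 mul1r add0n divff// gt_eqF// ap.
  rewrite !prodf_div big_ord_recl/= (big_ord_recr n)/=.
  have -> : \prod_(i < n) a (N + (lift ord0 i).+1)%N = \prod_(i < n) a (N.+1 + i.+1)%N.
    by apply: eq_bigr => i _; congr a; rewrite /= /bump; lia.
  rewrite [in RHS]big_ord_recr/= addn1 (addnC N.+1 n.+1).
  have : a N.+1 != 0 by rewrite gt_eqF// ap.
  have : a n.+1 != 0 by rewrite gt_eqF// ap.
  have : \prod_(i < n) a i.+1 != 0.
    by apply/prodf_neq0 => i _; rewrite gt_eqF// ap.
  by move=> h1 h2 h3; field; rewrite h1 h2 h3.
have -> : (fun N => l^-1 ^+ n * \prod_(j < N) (a (n + j.+1)%N / a j.+1)) =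
    (fun N => l^-1 ^+ n * \prod_(k < n) (a (N + k.+1)%N / a k.+1)).
  by apply/funext => N; rewrite E.
have -> : \prod_(k < n) (a k.+1)^-1 = l^-1 ^+ n * \prod_(k < n) (l / a k.+1).
  rewrite big_split/= prodr_const card_ord mulrA -exprMn mulVf ?expr1n ?mul1r//.
  by rewrite gt_eqF.
apply: cvgM; first exact: cvg_cst.
apply: cvg_big => [|k _]; first exact: mul_continuous.
apply: cvgM; last exact: cvg_cst.
rewrite (_ : (fun N => a (N + k.+1)%N) = (fun N => a (N + k).+1)); last first.
  by apply/funext => N; rewrite addnS.
by rewrite (cvg_shiftn k (fun n => a n.+1) (nbhs l)).
Unshelve. all: by end_near. Qed.

(** The previous lemma applies to [a + e], which is bounded below by [e]; then [e] decreases to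
    0. *)
Lemma hpsd_inv_prod a : (forall k, (0 < k)%N -> 0 < a k) ->
  (forall k, (0 < k)%N -> a k.+1 <= a k) ->
  (forall j, (0 < j)%N -> hpsd (fun n => a (n + j)%N)) ->
  hpsd (fun n => \prod_(k < n) (a k.+1)^-1).
Proof.
move=> ap adec ha.
apply: (hpsd_cvg (F := 0^'+) (a := fun e n => \prod_(k < n) (a k.+1 + e)^-1)).
  near=> e; have e0 : 0 < e by near: e; exact: nbhs_right_gt.
  apply: (@hpsd_inv_prod_lb (fun k => a k + e) e) => //.
  - by move=> k k0; rewrite lerDr ltW ?ap.
  - by move=> k k0; rewrite lerD2r adec.
  - by move=> j j0; apply: hpsdD (ha _ j0) (hpsd_cst (ltW e0)).
move=> n; apply: cvg_big => [|k _]; first exact: mul_continuous.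
apply: cvgV; first by rewrite gt_eqF// ap.
rewrite -[X in _ --> X]addr0; apply: cvgD; first exact: cvg_cst.
exact: cvg_at_right_filter cvg_id.
Unshelve. all: by end_near. Qed.

End PositiveKernels.

(** * Functionals on polynomials and their boundedness *)

Section MomentFunctionals.
Context {R : realType}.
Implicit Types (x y s : nat -> R) (p q : {poly R}) (B : R).

(** The integral of [p] against any measure with moments [x]. *)
Definition mom x p : R := \sum_(i < size p) p`_i * x i.

Lemma momE x p n : (size p <= n)%N -> mom x p = \sum_(i < n) p`_i * x i.
Proof.
move=> /subnKC <-; rewrite big_split_ord/= [X in _ + X]big1 ?addr0// => i _.
by rewrite nth_default ?mul0r// leq_addr.
Qed.

Lemma momD x p q : mom x (p + q) = mom x p + mom x q.
Proof.
pose n := maxn (size p) (size q).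
rewrite !(@momE x _ n) ?leq_maxl ?leq_maxr ?size_polyD// -big_split/=.
by apply: eq_bigr => i _; rewrite coefD mulrDl.
Qed.

Lemma momZ x r p : mom x (r *: p) = r * mom x p.
Proof.
rewrite !(@momE x _ (size p)) ?size_scale_leq// mulr_sumr.
by apply: eq_bigr => i _; rewrite coefZ mulrA.
Qed.

Lemma mom0 x : mom x 0 = 0.
Proof. by rewrite /mom size_poly0 big_ord0. Qed.

Lemma momB x p q : mom x (p - q) = mom x p - mom x q.
Proof. by rewrite -scaleN1r momD momZ mulN1r. Qed.

Lemma mom_sum x (I : Type) (r : seq I) (P : pred I) (f : I -> {poly R}) :
  mom x (\sum_(i <- r | P i) f i) = \sum_(i <- r | P i) mom x (f i).
Proof. by apply: (big_morph _ (momD x) (mom0 x)). Qed.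

Lemma momXn x n : mom x 'X^n = x n.
Proof.
rewrite (@momE x _ n.+1) ?size_polyXn// big_ord_recr/= big1 ?add0r.
  by rewrite coefXn eqxx mul1r.
by move=> i _; rewrite coefXn ltn_eqF ?mul0r.
Qed.

Lemma mom_ext x (f : {poly R} -> R) :
  (forall p q, f (p + q) = f p + f q) -> (forall r p, f (r *: p) = r * f p) ->
  (forall n, f 'X^n = x n) -> forall p, f p = mom x p.
Proof.
move=> fD fZ fX p; rewrite -[in LHS](coefK p) poly_def.
have f0 : f 0 = 0 by rewrite -(scale0r 0) fZ mul0r.
rewrite (big_morph _ fD f0); apply: eq_bigr => i _.
by rewrite fZ fX.
Qed.

Lemma mom_addseq x y p : mom (fun n => x n + y n) p = mom x p + mom y p.
Proof. by rewrite -big_split/=; apply: eq_bigr => i _; rewrite mulrDr. Qed.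

Lemma mom_scaleseq r x p : mom (fun n => r * x n) p = r * mom x p.
Proof. by rewrite mulr_sumr; apply: eq_bigr => i _; rewrite mulrCA. Qed.

Lemma eq_mom x y p : x =1 y -> mom x p = mom y p.
Proof. by move=> e; apply: eq_bigr => i _; rewrite e. Qed.

Lemma mom_mulXn x j p : mom x ('X^j * p) = mom (fun n => x (n + j)%N) p.
Proof.
apply: (mom_ext (f := fun p => mom x ('X^j * p))) => [p1 p2|r q|n].
- by rewrite mulrDr momD.
- by rewrite -scalerAr momZ.
- by rewrite -exprD momXn addnC.
Qed.

Lemma quad_mom n (c : nat -> R) x :
  quad n c (fun i j => x (i + j)%N) = mom x ((\poly_(i < n) c i) ^+ 2).
Proof.
rewrite poly_def expr2 mulr_suml mom_sum; apply: eq_bigr => i _.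
rewrite mulr_sumr mom_sum; apply: eq_bigr => j _.
have -> : c i *: 'X^i * (c j *: 'X^j) = (c i * c j) *: 'X^(i + j) :> {poly R}.
  by rewrite -scalerAl -scalerAr scalerA exprD.
by rewrite momZ momXn.
Qed.

Lemma mom_sqr_ge0 x p : hpsd x -> 0 <= mom x (p ^+ 2).
Proof. by move=> [_ /(_ (size p) (fun i => p`_i))]; rewrite quad_mom coefK. Qed.

Lemma hpsd_mom x : (forall p, 0 <= mom x (p ^+ 2)) -> hpsd x.
Proof. by move=> h; apply: hpsdE => n c; rewrite quad_mom. Qed.

Lemma mom_cauchy x p q : hpsd x ->
  mom x (p * q) ^+ 2 <= mom x (p ^+ 2) * mom x (q ^+ 2).
Proof.
move=> hx; set a := mom x _; set b := mom x _; set d := mom x _.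
have h t : 0 <= b - 2 * t * a + t ^+ 2 * d.
  rewrite (_ : _ + _ = mom x ((p - t *: q) ^+ 2)); first exact: mom_sqr_ge0.
  rewrite sqrrB exprZn momD momB momZ -scalerAr mulr2n momD momZ -/a -/b -/d.
  by ring.
have d0 : 0 <= d by apply: mom_sqr_ge0.
have [dz|dz] := eqVneq d 0.
  have [az|az] := eqVneq a 0; first by rewrite az dz expr0n/= mulr0.
  have := h ((b + 1) / (2 * a)); rewrite dz mulr0 addr0.
  have -> : b - 2 * ((b + 1) / (2 * a)) * a = -1 by field.
  by rewrite ler0N1.
have dp : 0 < d by rewrite lt_neqAle eq_sym dz.
have := h (a / d).
have -> : b - 2 * (a / d) * a + (a / d) ^+ 2 * d = (b * d - a ^+ 2) / d by field.
by rewrite pmulr_lge0 ?invr_gt0// subr_ge0.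
Qed.

(* [p |-> mom y p] is bounded by [B] for the Hilbert seminorm of [x] *)
Definition bfun x y B :=
  0 <= B /\ forall p, `|mom y p| <= B * Num.sqrt (mom x (p ^+ 2)).

Lemma bfun_sqr x y B p : hpsd x -> bfun x y B ->
  mom y p ^+ 2 <= B ^+ 2 * mom x (p ^+ 2).
Proof.
move=> hx [B0 /(_ p) h]; rewrite -real_normK ?num_real//.
rewrite -[X in _ * X]sqr_sqrtr ?mom_sqr_ge0// -exprMn.
by rewrite lerXn2r ?nnegrE ?mulr_ge0 ?sqrtr_ge0.
Qed.

Lemma bfunP x y B : hpsd x -> 0 <= B ->
  (forall p, mom y p ^+ 2 <= B ^+ 2 * mom x (p ^+ 2)) -> bfun x y B.
Proof.
move=> hx B0 h; split => // p; rewrite -(@ler_sqr _ _ (_ * _)) ?nnegrE ?mulr_ge0 ?sqrtr_ge0//.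
by rewrite real_normK ?num_real// exprMn sqr_sqrtr ?mom_sqr_ge0.
Qed.

Lemma bfunD x y1 y2 B1 B2 : bfun x y1 B1 -> bfun x y2 B2 ->
  bfun x (fun n => y1 n + y2 n) (B1 + B2).
Proof.
move=> [p1 h1] [p2 h2]; split => [|p]; first exact: addr_ge0.
rewrite mom_addseq mulrDl; apply: le_trans (ler_normD _ _) _.
exact: lerD.
Qed.

Lemma bfunZ x y r B : bfun x y B -> bfun x (fun n => r * y n) (`|r| * B).
Proof.
move=> [p1 h1]; split => [|p]; first exact: mulr_ge0.
by rewrite mom_scaleseq normrM -mulrA ler_wpM2l.
Qed.

Lemma bfun_le x y B B' : B <= B' -> bfun x y B -> bfun x y B'.
Proof.
move=> BB' [B0 h]; split => [|p]; first exact: le_trans BB'.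
by apply: le_trans (h p) _; rewrite ler_wpM2r ?sqrtr_ge0.
Qed.

Lemma eq_bfun x y y' B : y =1 y' -> bfun x y B -> bfun x y' B.
Proof. by move=> e [B0 h]; split => // p; rewrite -(eq_mom p e). Qed.

Lemma eq_bfunl x x' y B : x =1 x' -> bfun x y B -> bfun x' y B.
Proof. by move=> e [B0 h]; split => // p; rewrite -(eq_mom (p ^+ 2) e). Qed.

(** Cauchy-Schwarz between a polynomial and the constant 1. This is what compares [s_i s_j] with
    [s_(i + j)] inside Schur products. *)
Lemma hpsd_sub_rank1 s : hpsd s -> s 0%N = 1 ->
  psd (fun i j => s (i + j)%N - s i * s j).
Proof.
move=> hs s0; split => [i j|n c]; first by rewrite addnC (mulrC (s i)).
rewrite (_ : quad _ _ _ = quad n c (fun i j => s (i + j)%N + -1 * (s i * s j))); last first.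
  by apply: eq_quad => i j _ _; rewrite mulN1r.
rewrite quadD quadZ quad_rank1 mulN1r quad_mom.
have -> : \sum_(i < n) c i * s i = mom s (\poly_(i < n) c i).
  rewrite (momE s (size_poly _ _)); apply: eq_bigr => i _.
  by rewrite coef_poly ltn_ord.
set p := \poly_(_ < _) _; rewrite subr_ge0.
have := @mom_cauchy s 1 p hs; rewrite mul1r expr1n -(expr0 'X) momXn s0 mul1r.
by [].
Qed.

(** Turns a norm bound into the positivity of a kernel, on which Schur products act. *)
Lemma psd_bfun x y B : hpsd x ->
  bfun x y B -> psd (fun i j => B ^+ 2 * x (i + j)%N - y i * y j).
Proof.
move=> hx b; split => [i j|n c]; first by rewrite addnC (mulrC (y i)).
rewrite (_ : quad _ _ _ = quad n c (fun i j => B ^+ 2 * x (i + j)%N + -1 * (y i * y j))); last first.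
  by apply: eq_quad => i j _ _; rewrite mulN1r.
rewrite quadD !quadZ quad_rank1 mulN1r quad_mom.
have -> : \sum_(i < n) c i * y i = mom y (\poly_(i < n) c i).
  rewrite (momE y (size_poly _ _)); apply: eq_bigr => i _.
  by rewrite coef_poly ltn_ord.
by rewrite subr_ge0; apply: bfun_sqr.
Qed.

(* Schur products with [s] and with [y_i y_j], using [s_i s_j <= s_(i + j)] as
   kernels. *)
Lemma bfun_mul x y s B : hpsd x -> hpsd s -> s 0%N = 1 -> bfun x y B ->
  bfun (fun n => x n * s n) (fun n => y n * s n) B.
Proof.
move=> hx hs s0 b; have B0 := b.1.
apply: bfunP => // [|p]; first exact: hpsd_mul.
have h1 := psd_mul (psd_bfun hx b) hs.
have h2 := psd_mul (psd_rank1 y) (hpsd_sub_rank1 hs s0).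
have [_ /(_ (size p) (fun i => p`_i))] := psdD h1 h2.
rewrite (_ : quad _ _ _ = quad (size p) (fun i => p`_i)
   (fun i j => B ^+ 2 * (x (i + j)%N * s (i + j)%N) + -1 * ((y i * s i) * (y j * s j)))).
  rewrite quadD !quadZ quad_rank1 (quad_mom _ _ (fun n => x n * s n)) coefK.
  by rewrite mulN1r subr_ge0.
by apply: eq_quad => i j _ _; ring.
Qed.

(** Iterates [(k + 1) 'C(n, k + 1) = (n - k) 'C(n, k)]. Multiplication by [n] does not preserve
    boundedness, but the hypothesis on [mu] trades it for one increment of [j], as an integration by
    parts does. Each of the [K] steps uses one unit of the budget [k + j <= K] and costs a factor
    [T / (k + 1)]. *)
Lemma binom_bfun x (mu : nat -> nat -> R) (w v b : nat -> R) (T : R) (K : nat) :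
  0 <= T -> (forall n, mu n 0%N = x n) ->
  (forall n j, (j < K)%N -> n%:R * mu n j = w j * mu n j.+1 - v j * mu n j) ->
  (forall j, (j <= K)%N -> bfun x (mu^~ j) (b j)) ->
  (forall j, (j < K)%N -> `|w j| * b j.+1 + (`|v j| + K%:R) * b j <= T * b j) ->
  bfun x (fun n => 'C(n, K)%:R * x n) (T ^+ K / K`!%:R * b 0%N).
Proof.
move=> T0 mu0 murec mub T_ge.
suff h k j : (k + j <= K)%N ->
    bfun x (fun n => 'C(n, k)%:R * mu n j) (T ^+ k / k`!%:R * b j).
  have := h K 0%N; rewrite addn0 leqnn => /(_ isT).
  by apply: eq_bfun => n; rewrite mu0.
elim: k j => [|k IH] j kjK.
  rewrite expr0 fact0 divr1 mul1r; apply: eq_bfun (mub j kjK) => n.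
  by rewrite bin0 mul1r.
have jK : (j < K)%N by rewrite (leq_trans _ kjK)// addSn ltnS leq_addl.
have b1 := IH j.+1; rewrite addnS -addSn kjK in b1; have {}b1 := b1 isT.
have b2 := IH j; rewrite (leq_trans _ kjK) ?addSn// in b2; have {}b2 := b2 isT.
have hb := bfunD (bfunZ (w j / k.+1%:R) b1) (bfunZ (- (v j + k%:R) / k.+1%:R) b2).
have bj0 : 0 <= b j by have [] := mub j (ltnW jK).
have T1 : 0 <= T ^+ k by rewrite exprn_ge0.
have f0 : k`!%:R != 0 :> R by rewrite pnatr_eq0 -lt0n fact_gt0.
have k1 : 1 + k%:R != 0 :> R by rewrite nat1r pnatr_eq0.
apply: bfun_le (eq_bfun _ hb).
  rewrite factS natrM exprS.
  rewrite (_ : T * _ / _ * _ = (k.+1%:R)^-1 * (T ^+ k / k`!%:R) * (T * b j)); last first.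
    by field; rewrite f0 k1.
  rewrite !normrM normrN (ger0_norm (x := _^-1)) ?invr_ge0//.
  apply: (@le_trans _ _ ((k.+1%:R)^-1 * (T ^+ k / k`!%:R) *
     (`|w j| * b j.+1 + (`|v j| + K%:R) * b j))).
    rewrite mulrDr; apply: lerD; first by rewrite le_eqVlt; apply/orP; left; apply/eqP; ring.
    rewrite (_ : `|v j + k%:R| * k.+1%:R^-1 * _ =
      k.+1%:R^-1 * (T ^+ k / k`!%:R) * (`|v j + k%:R| * b j)); last by ring.
    rewrite ler_wpM2l ?mulr_ge0 ?divr_ge0 ?invr_ge0//.
    rewrite ler_wpM2r//; apply: le_trans (ler_normD _ _) _.
    by rewrite lerD2l normr_nat ler_nat (leq_trans _ kjK)// addSn ltnW// ltnS leq_addr.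
  by rewrite ler_wpM2l ?mulr_ge0 ?divr_ge0 ?invr_ge0// T_ge.
move=> n /=.
have e : 'C(n, k.+1)%:R = (n%:R - k%:R) * 'C(n, k)%:R / k.+1%:R :> R.
  have := mul_bin_left n k => /(congr1 (fun z => z%:R : R)); rewrite !natrM => e.
  have [kn|nk] := leqP k n.
    by rewrite -natrB// -e; field; rewrite k1.
  by rewrite !bin_small// ?mulr0 ?mul0r// ltnW.
have := murec n j jK => e2.
have -> : w j / k.+1%:R * ('C(n, k)%:R * mu n j.+1) +
   - (v j + k%:R) / k.+1%:R * ('C(n, k)%:R * mu n j) =
   'C(n, k)%:R / k.+1%:R * ((w j * mu n j.+1 - v j * mu n j) - k%:R * mu n j).
  by field; rewrite k1.
by rewrite -e2 e; field; rewrite k1.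
Qed.

End MomentFunctionals.

(** * Beta moment sequences *)

Section BetaFactor.
Context {R : realType}.
Variable b : R.
Hypothesis b0 : 0 <= b.
Ltac blra := have := b0; lra.
Ltac nz := repeat (apply/andP; split); rewrite gt_eqF//; blra.
Implicit Types (A : R).

(** Moments of the Beta law with parameters [b + 1] and [A], of density proportional to
    [x ^ b (1 - x) ^ (A - 1)]. *)
Definition bet A n : R := \prod_(k < n) ((k.+1%:R + b) / (k.+1%:R + b + A)).

Lemma betS A n : bet A n.+1 = bet A n * ((n.+1%:R + b) / (n.+1%:R + b + A)).
Proof. by rewrite /bet big_ord_recr. Qed.

Lemma bet0 A : bet A 0 = 1. Proof. by rewrite /bet big_ord0. Qed.

Lemma hpsd_bet A : 0 < A -> hpsd (bet A).
Proof.
move=> A0.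
have bk (k : nat) : (0 < k)%N -> 0 < k%:R + b by move=> k0; rewrite ltr_wpDr// ltr0n.
apply: (eq_hpsd (a := fun n => \prod_(k < n) (1 + A * (k.+1%:R + b)^-1)^-1)).
  move=> n; apply: eq_bigr => k _.
  have := bk k.+1 isT => h.
  have h' : 0 < k.+1%:R + b + A by rewrite addr_gt0.

  have e1 : k.+1%:R + b != 0 by rewrite gt_eqF.
  have e2 : k.+1%:R + b + A != 0 by rewrite gt_eqF.
  rewrite (_ : 1 + _ = (k.+1%:R + b + A) / (k.+1%:R + b)) ?invf_div//.
  by rewrite mulrDl divff.
apply: (@hpsd_inv_prod _ (fun k => 1 + A * (k%:R + b)^-1)).
- by move=> k k0; rewrite addr_gt0 ?mulr_gt0 ?invr_gt0 ?bk.
- move=> k k0; rewrite lerD2l ler_wpM2l ?(ltW A0)//.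
  by rewrite lef_pV2 ?posrE ?bk// lerD2r ler_nat.
- move=> j j0; apply: hpsdD (hpsd_cst ler01) _; apply: hpsdZ (ltW A0) _.
  apply: eq_hpsd (hpsd_invr_addn (t := j%:R + b) _) => [n|]; last exact: bk.
  by rewrite natrD addrA.
Qed.

(** Multiplying the density by [1 - x] gives the Beta density of parameter [A + 1], up to the ratio
    of the normalizations. *)
Lemma bet_diff A n : 0 < A -> bet A n - bet A n.+1 = A / (b + 1 + A) * bet (A + 1) n.
Proof.
move=> A0; elim: n => [|n IH].
  rewrite betS !bet0; field.
  by nz.
have n0 : 0 <= n%:R :> R by [].
have e1 : b + 1 + A != 0 by nz.
have e2 : 1 + n%:R + b + A != 0 by nz.
have e3 : 1 + n%:R + b != 0 by nz.
have e4 : 1 + n%:R + b + (A + 1) != 0 by nz.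
have E : bet A n * (A / (1 + n%:R + b + A)) = A / (b + 1 + A) * bet (A + 1) n.
  by rewrite -IH betS -nat1r; field.
rewrite !betS [in RHS]mulrA -E -!nat1r; field.
by nz.
Qed.

Lemma bet_shift A n : 1 < A ->
  (b + A) * bet (A - 1) n.+1 = (n.+1%:R + b) * bet A n.
Proof.
move=> A1; elim: n => [|n IH].
  rewrite betS !bet0; field.
  by nz.
have n0 : 0 <= n%:R :> R by [].
rewrite betS mulrA IH betS -!nat1r; field.
by nz.
Qed.

(** Ratio of the normalizations of the Beta laws of parameters [A] and [A - j]. It makes [bmu A n j]
    the integral of [x ^ n (x / (1 - x)) ^ j] against the Beta law of parameter [A], finite for
    [j < A]. *)
Definition kap A j : R := \prod_(i < j) ((b + A - i%:R) / (A - 1 - i%:R)).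

Definition bmu A n j : R := kap A j * bet (A - j%:R) (n + j).

Lemma kapS A j : kap A j.+1 = kap A j * ((b + A - j%:R) / (A - 1 - j%:R)).
Proof. by rewrite /kap big_ord_recr. Qed.

Lemma kap_gt0 A j : j%:R < A -> 0 < kap A j.
Proof.
move=> jA; apply: prodr_gt0 => i _.
have : (i%:R + 1 <= j%:R :> R) by rewrite natr1 ler_nat.
by move=> h; rewrite divr_gt0; blra.
Qed.

Lemma bmu0 A n : bmu A n 0 = bet A n.
Proof. by rewrite /bmu /kap big_ord0 mul1r subr0 addn0. Qed.

(** Integration by parts for [x d/dx], carried out algebraically; this is the recursion that
    [binom_bfun] consumes. *)
Lemma bmu_rec A n j : j.+1%:R < A ->
  n%:R * bmu A n j = (A - 1 - j%:R) * bmu A n j.+1 - (j.+1%:R + b) * bmu A n j.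
Proof.
rewrite -natr1 => jA.
have j0 : 0 <= j%:R :> R by [].
have := @bet_shift (A - j%:R) (n + j); rewrite ltrBrDl jA => /(_ isT) e.
rewrite /bmu kapS addnS (_ : A - j.+1%:R = A - j%:R - 1); last first.
  by rewrite -natr1; ring.
have -> : (A - 1 - j%:R) *
   (kap A j * ((b + A - j%:R) / (A - 1 - j%:R)) * bet (A - j%:R - 1) (n + j).+1) =
   kap A j * ((b + (A - j%:R)) * bet (A - j%:R - 1) (n + j).+1).
  by field; rewrite gt_eqF//; blra.
by rewrite e -!natr1 natrD; ring.
Qed.

Lemma mom_1subX A p : 0 < A ->
  mom (bet A) ((1 - 'X) * p) = A / (b + 1 + A) * mom (bet (A + 1)) p.
Proof.
move=> A0; rewrite -mom_scaleseq.
apply: (mom_ext (f := fun p => mom (bet A) ((1 - 'X) * p))) => [p1 p2|r q|n].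
- by rewrite mulrDr momD.
- by rewrite -scalerAr momZ.
- by rewrite mulrBl mul1r -exprS momB !momXn bet_diff.
Qed.

Lemma mom_1subXn A j M p : (j + M)%:R < A ->
  kap A (j + M) * mom (bet (A - (j + M)%:R)) ((1 - 'X) ^+ M * p) =
  kap A j * mom (bet (A - j%:R)) p.
Proof.
elim: M p => [|M IH] p jM; first by rewrite addn0 expr0 mul1r.
have h : (j + M)%:R < A by rewrite (lt_trans _ jM)// ltr_nat addnS.
rewrite -(IH p h) exprS -mulrA mom_1subX ?subr_gt0// addnS kapS.
rewrite addnS -natr1 in jM.
have jM0 : 0 <= (j + M)%:R :> R by [].
rewrite (_ : A - (j + M).+1%:R + 1 = A - (j + M)%:R); last by rewrite -natr1; ring.
rewrite -natr1; field.
by nz.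
Qed.

Lemma bmu_gt0 A n j : j%:R < A -> 0 < bmu A n j.
Proof.
move=> jA; rewrite mulr_gt0 ?kap_gt0//; apply: prodr_gt0 => k _.
have k0 : 0 < k.+1%:R :> R by rewrite ltr0n.
by rewrite divr_gt0; blra.
Qed.

(** [(x / (1 - x)) ^ j] has squared norm [bmu A 0 (2 j)], finite for [2 j < A]. As it is not a
    polynomial, Cauchy-Schwarz is applied at parameter [A - 2 j], where both factors become
    polynomials. *)
Lemma bfun_bmu A j : (j.*2)%:R < A ->
  bfun (bet A) (fun n => bmu A n j) (Num.sqrt (bmu A 0 j.*2)).
Proof.
move=> jA.
have jA' : j%:R < A by rewrite (le_lt_trans _ jA)// ler_nat -addnn leq_addr.
have A0 : 0 < A by rewrite (le_lt_trans _ jA).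
have b2 : hpsd (bet (A - j.*2%:R)) by apply: hpsd_bet; rewrite subr_gt0.
have k2 := kap_gt0 jA.
have m0 := ltW (bmu_gt0 0 jA).
apply: bfunP => [||p]; [exact: hpsd_bet|exact: sqrtr_ge0|].
rewrite sqr_sqrtr// mom_scaleseq.
have e1 := @mom_1subXn A j j ('X^j * p); rewrite addnn in e1.
rewrite -mom_mulXn -(e1 jA).
have e2 := @mom_1subXn A 0 j.*2 (p ^+ 2); rewrite add0n in e2.
rewrite /kap big_ord0 mul1r subr0 in e2.
rewrite -(e2 jA) -/(kap A j.*2).
have := @mom_cauchy _ _ 'X^j ((1 - 'X) ^+ j * p) b2.
rewrite exprMn -exprM muln2 -exprM muln2 momXn => h.
rewrite exprMn expr2 /bmu add0n -mulrA -[in leRHS]mulrA ler_pM2l//.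
rewrite [leRHS]mulrCA ler_pM2l//.
by rewrite mulrCA.
Qed.

Lemma bmu0S A j : j.+1%:R < A ->
  (A - 1 - j%:R) * bmu A 0 j.+1 = (j.+1%:R + b) * bmu A 0 j.
Proof.
by move=> h; have := bmu_rec 0 h; rewrite mul0r => /eqP; rewrite eq_sym subr_eq0 => /eqP.
Qed.

Lemma bfun_bet A K T : 0 <= T -> (K.*2)%:R < A ->
  (forall j, (j < K)%N -> (A - 1 - j%:R) * Num.sqrt (bmu A 0 j.+1.*2) +
    (j.+1%:R + b + K%:R) * Num.sqrt (bmu A 0 j.*2) <= T * Num.sqrt (bmu A 0 j.*2)) ->
  bfun (bet A) (fun n => 'C(n, K)%:R * bet A n) (T ^+ K / K`!%:R).
Proof.
move=> T0 KA hT.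
have := @binom_bfun R (bet A) (bmu A) (fun j => A - 1 - j%:R) (fun j => j.+1%:R + b)
  (fun j => Num.sqrt (bmu A 0 j.*2)) T K T0 (bmu0 A).
rewrite bmu0 bet0 sqrtr1 mulr1; apply.
- move=> n j jK; apply: bmu_rec; apply: le_lt_trans KA; rewrite ler_nat.
  by rewrite (leq_trans jK)// -addnn leq_addr.
- move=> j jK; apply: bfun_bmu; apply: le_lt_trans KA; rewrite ler_nat.
  by rewrite leq_double.
- move=> j jK; have := hT j jK; congr (_ * _ + _ * _ <= _).
    rewrite ger0_norm// -addrA -opprD subr_ge0 nat1r; apply/ltW/le_lt_trans/KA.
    by rewrite ler_nat (leq_trans jK)// -addnn leq_addr.
  by rewrite ger0_norm ?addr_ge0.
Qed.

Lemma bfun_bet_ex A K : (K.*2)%:R < A ->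
  exists B, bfun (bet A) (fun n => 'C(n, K)%:R * bet A n) B.
Proof.
move=> KA.
pose s j := Num.sqrt (bmu A 0 j.*2).
pose g j := `|(A - 1 - j%:R) * s j.+1 / s j| + (j.+1%:R + b + K%:R).
have g0 j : 0 <= g j by rewrite addr_ge0// !addr_ge0.
exists ((\sum_(j < K) g j) ^+ K / K`!%:R); apply: bfun_bet => //.
  by rewrite sumr_ge0.
move=> j jK; have sj : 0 < s j.
  rewrite sqrtr_gt0; apply: bmu_gt0; apply: le_lt_trans KA; rewrite ler_nat.
  by rewrite leq_double ltnW.
apply: (@le_trans _ _ (g j * s j)); last first.
  rewrite ler_wpM2r ?(ltW sj)// (bigD1 (Ordinal jK))//= lerDl.
  by rewrite sumr_ge0.
rewrite /g [leRHS]mulrDl; apply: lerD => //.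
apply: (@le_trans _ _ ((A - 1 - j%:R) * s j.+1 / s j * s j)).
  by rewrite divfK// gt_eqF.
by rewrite ler_wpM2r ?(ltW sj)// ler_norm.
Qed.

(** With the margin [4 K + 4 <= A] in place of [2 K < A], [A - 1 - j] is at most twice the geometric
    mean of [A - 2 - 2 j] and [A - 1 - 2 j], so [T] can be taken affine in [b] and [K]. If [b] is of
    order [K], the bound then grows geometrically. *)
Lemma bfun_bet_growth A K : (4 * K + 4)%:R <= A ->
  bfun (bet A) (fun n => 'C(n, K)%:R * bet A n) ((3 * b + 6 * K%:R + 5) ^+ K / K`!%:R).
Proof.
rewrite natrD natrM => KA; have K0 : 0 <= K%:R :> R by [].
apply: bfun_bet => [||j jK]; first by blra.
  by rewrite -muln2 natrM; blra.
have jK' : j%:R + 1 <= K%:R :> R by rewrite natr1 ler_nat.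
have j0 : 0 <= j%:R :> R by [].
set m := bmu A 0 j.*2.
have mp : 0 < m by apply: bmu_gt0; rewrite -muln2 natrM; blra.
have e1 := @bmu0S A j.*2; have e2 := @bmu0S A j.*2.+1.
rewrite -!natr1 -!muln2 !natrM in e1 e2.
have {}e1 := e1 ltac:(blra); have {}e2 := e2 ltac:(blra).
rewrite doubleS -muln2.
rewrite muln2 -/m in e1.
have m2 : bmu A 0 (j * 2).+2 =
   (j%:R * 2 + 1 + 1 + b) * (j%:R * 2 + 1 + b) / ((A - 2 - j%:R * 2) * (A - 1 - j%:R * 2)) * m.
  rewrite -(@mulfK _ (A - 1 - (j%:R * 2 + 1)) _ (bmu A 0 (j * 2).+2)); last first.
    by nz.
  rewrite (mulrC (bmu _ _ _)) e2 -(@mulfK _ (A - 1 - j%:R * 2) _ (bmu A 0 (j * 2).+1)); last first.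
    by nz.
  rewrite muln2 (mulrC (bmu _ _ j.*2.+1)) e1; field.
  by nz.
have key : (A - 1 - j%:R) * Num.sqrt (bmu A 0 (j * 2).+2) <= (2 * (j%:R * 2 + 2 + b)) * Num.sqrt m.
  rewrite -(@ler_sqr _ (_ * _)) ?nnegrE ?mulr_ge0 ?sqrtr_ge0//; try blra.
  rewrite !exprMn !sqr_sqrtr ?(ltW mp)//; last first.
    by apply/ltW/bmu_gt0; rewrite -!natr1 natrM; blra.
  rewrite m2 mulrA ler_pM2r// mulrA ler_pdivrMr; last by rewrite mulr_gt0; blra.
  have l1 : (A - 1 - j%:R) ^+ 2 <= 2 ^+ 2 * ((A - 2 - j%:R * 2) * (A - 1 - j%:R * 2)).
    rewrite expr2 expr2 mulrACA; apply: ler_pM; blra.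
  have l2 : (j%:R * 2 + 1 + 1 + b) * (j%:R * 2 + 1 + b) <= (j%:R * 2 + 2 + b) ^+ 2.
    by rewrite expr2; apply: ler_pM; blra.
  apply: le_trans (ler_pM _ _ l1 l2) _; rewrite ?sqr_ge0//; first by rewrite mulr_ge0//; blra.
  by rewrite le_eqVlt; apply/orP; left; apply/eqP; ring.
have sm : 0 <= Num.sqrt m by [].
rewrite -natr1; apply: le_trans (lerD key (lexx _)) _.
rewrite -mulrDl ler_wpM2r//; blra.
Qed.

End BetaFactor.

(** * Exponentials, reciprocals and log-convexity *)

Section InverseKernels.
Context {R : realType}.
Implicit Types (a F : nat -> R) (K : nat -> nat -> R).

Lemma psd_pow K N : psd K -> psd (fun i j => K i j ^+ N).
Proof.
move=> hK; elim: N => [|N IH].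
  apply: eq_psd (hpsd_cst (ler01 : 0 <= 1 :> R)) => i j.
  by rewrite expr0.
by apply: eq_psd (psd_mul hK IH) => i j; rewrite exprS.
Qed.

Lemma psd_expR K : psd K -> psd (fun i j => expR (K i j)).
Proof.
move=> hK; apply: (psd_cvg (F := \oo)
    (K := fun N i j => \sum_(k < N) (k`!%:R)^-1 * K i j ^+ k)).
  near=> N; apply: (psd_sum N (K := fun k i j => (k`!%:R)^-1 * K i j ^+ k)) => k.
  by apply: (psdZ (K := fun i j => K i j ^+ k)); [rewrite invr_ge0|exact: psd_pow].
move=> i j; have := is_cvg_series_exp_coeff (K i j).
apply: cvg_trans; apply: near_eq_cvg; near=> N.
rewrite seriesEord/=; apply: eq_bigr => k _.
by rewrite /exp_coeff/= mulrC.
Unshelve. all: by end_near. Qed.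

(* Schoenberg: the kernel [F i + F j - F 0 - F (i + j)] is positive. *)
Lemma hpsd_expRN F (s : R) : 0 <= s ->
  (forall n (c : nat -> R), \sum_(i < n) c i = 0 -> quad n c (fun i j => F (i + j)%N) <= 0) ->
  hpsd (fun n => expR (- (s * F n))).
Proof.
move=> s0 hF; pose K i j := F i + F j - F 0%N - F (i + j)%N.
have hK : psd K.
  split => [i j|n c]; first by rewrite /K (addrC (F i)) addnC.
  case: n => [|n]; first by rewrite /quad big_ord0.
  pose S := \sum_(i < n.+1) c i.
  (* Removing the total mass [S] at index 0 makes the coefficients sum to 0; the form of [F] at [c']
     is then minus the form of [K] at [c]. *)
  pose c' i := c i - (i == 0%N)%:R * S.
  have d0 (g : nat -> R) : \sum_(i < n.+1) (nat_of_ord i == 0%N)%:R * S * g i = S * g 0%N.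
    rewrite big_ord_recl/= mul1r big1 ?addr0// => i _.
    by rewrite /= mul0r mul0r.
  have c'0 : \sum_(i < n.+1) c' i = 0.
    rewrite sumrB -/S; rewrite (eq_bigr (fun i : 'I_n.+1 => (nat_of_ord i == 0%N)%:R * S * 1)).
      by rewrite (d0 (fun=> 1)) mulr1 subrr.
    by move=> i _; rewrite mulr1.
  have := hF n.+1 c' c'0; rewrite -oppr_ge0; congr (0 <= _).
  pose T := \sum_(i < n.+1) c i * F i.
  pose Q := quad n.+1 c (fun i j => F (i + j)%N).
  have e1 : quad n.+1 c' (fun i j => F (i + j)%N) = Q - S * T - S * T + S * S * F 0%N.
    have in1 i : \sum_(j < n.+1) c' i * c' j * F (i + j)%N =
        \sum_(j < n.+1) c i * c j * F (i + j)%N - S * c i * F i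
        - (i == 0%N)%:R * S * (T - S * F 0%N).
      under eq_bigr => j _.
        rewrite (_ : _ * _ = c i * c j * F (i + j)%N -
          ((nat_of_ord j == 0%N)%:R * S * (c i * F (i + j)%N)) -
          (i == 0%N)%:R * S * (c j * F (i + j)%N - (nat_of_ord j == 0%N)%:R * S * F (i + j)%N)).
          over.
        by rewrite /c'; ring.
      rewrite sumrB sumrB (d0 (fun j => c i * F (i + j)%N)) addn0 -mulr_sumr sumrB.
      rewrite (d0 (fun j => F (i + j)%N)) addn0.
      have [->|] := eqVneq i 0%N; first by rewrite !mul1r /T mulrA.
      by rewrite !mul0r !subr0 mulrA.
    rewrite /quad; under eq_bigr do rewrite in1.
    rewrite sumrB sumrB (d0 (fun i => T - S * F 0%N)) (_ : \sum_i _ = Q)//.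
    have -> : \sum_(i < n.+1) S * c i * F i = S * T.
      by rewrite mulr_sumr; apply: eq_bigr => i _; rewrite mulrA.
    by ring.
  have e2 : quad n.+1 c K = S * T + S * T - S * S * F 0%N - Q.
    have in2 (i : nat) : \sum_(j < n.+1) c i * c j * K i j =
      S * (c i * F i) + T * c i - S * F 0%N * c i - \sum_(j < n.+1) c i * c j * F (i + j)%N.
      under eq_bigr => j _.
        rewrite (_ : _ * _ = c j * (c i * F i) + (c j * F j) * c i - c j * (F 0%N * c i)
           - c i * c j * F (i + j)%N); first by over.
        by rewrite /K; ring.
      rewrite sumrB sumrB big_split/= -!mulr_suml -/S -/T.
      by ring.
    rewrite /quad; under eq_bigr do rewrite in2.
    rewrite sumrB sumrB big_split/= -!mulr_sumr -/S -/T.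
    rewrite [X in _ - X = _](_ : _ = Q)//; by ring.
  by rewrite e1 e2; ring.
apply: eq_psd (psd_mul (psd_rank1 (fun i => expR (- (s * (F i - F 0%N / 2)))))
  (psd_expR (psdZ s0 hK))) => i j.
by rewrite -!expRD /K; congr expR; field.
Qed.

(* [1 / x] is the limit of the Riemann sums [(1 / N) \sum_k exp (- k x / N)] *)
Lemma hpsd_invr_cnd F : (forall n, 0 < F n) ->
  (forall n (c : nat -> R), \sum_(i < n) c i = 0 -> quad n c (fun i j => F (i + j)%N) <= 0) ->
  hpsd (fun n => (F n)^-1).
Proof.
move=> F0 hF.
apply: (hpsd_cvg (F := \oo)
   (a := fun N n => N.+1%:R^-1 * (1 - expR (- (N.+1%:R^-1 * F n)))^-1)).
  near=> N; set h := N.+1%:R^-1; have h0 : 0 < h by rewrite invr_gt0.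
  apply: hpsdZ; first exact: ltW.
  apply: (hpsd_cvg (F := \oo)
     (a := fun M n => \sum_(k < M) expR (- (h * F n)) ^+ k)).
    near=> M; apply: (hpsd_sum (a := fun k n => expR (- (h * F n)) ^+ k)) => k _.
    by apply: (hpsd_pow (a := fun n => expR (- (h * F n)))); apply: hpsd_expRN => //; apply: ltW.
  move=> n.
  have e1 : `|expR (- (h * F n))| < 1.
    by rewrite ger0_norm ?expR_ge0// -expR0 ltr_expR oppr_lt0 mulr_gt0.
  have := cvg_geometric_series e1 (a := 1); rewrite mul1r.
  apply: cvg_trans; apply: near_eq_cvg; near=> M.
  by rewrite seriesEord/=; apply: eq_bigr => k _; rewrite /geometric/= mul1r.
move=> n; apply/cvgrPdist_le => /= e e0.
have Fn := F0 n.
near=> N.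
have he : N.+1%:R^-1 <= e.
  by near: N; apply: filterS (near_infty_natSinv_lt (PosNum e0)) => N; apply: ltW.
move: he; set h := N.+1%:R^-1 => he.
have h0 : 0 < h by rewrite invr_gt0.
have z0 : 0 < h * F n by rewrite mulr_gt0.
(* The inner geometric series, multiplied by [h], has sum [h / (1 - exp (- h F))], which lies
   between [1 / F] and [1 / F + h]. *)
have l1 : 1 - expR (- (h * F n)) <= h * F n.
  by have := expR_ge1Dx (- (h * F n)); lra.
have l2 : h * F n / (1 + h * F n) <= 1 - expR (- (h * F n)).
  have e1 := expR_ge1Dx (h * F n).
  rewrite expRN lerBrDr -lerBrDl; apply: (@le_trans _ _ (1 + h * F n)^-1).
    by rewrite lef_pV2 ?posrE ?expR_gt0//; lra.
  rewrite le_eqVlt; apply/orP; left; apply/eqP; field.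
  by rewrite gt_eqF//; lra.
have d0 : 0 < 1 - expR (- (h * F n)).
  by apply: lt_le_trans l2; rewrite divr_gt0//; lra.
have l3 : (F n)^-1 <= h / (1 - expR (- (h * F n))).
  by rewrite ler_pdivlMr// mulrC ler_pdivrMr// mulrC -mulrC.
have l4 : h / (1 - expR (- (h * F n))) <= (F n)^-1 + h.
  rewrite ler_pdivrMr//; apply: (@le_trans _ _ (((F n)^-1 + h) * (h * F n / (1 + h * F n)))).
    rewrite le_eqVlt; apply/orP; left; apply/eqP; field.
    by rewrite !gt_eqF//; lra.
  by apply: ler_wpM2l => //; rewrite addr_ge0 ?invr_ge0 // ltW.
rewrite distrC ger0_norm ?subr_ge0// lerBlDl.
by apply: le_trans l4 _; rewrite lerD2l.
Unshelve. all: by end_near. Qed.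

(** A positive Hankel sequence is log-convex, so its successive ratios never decrease; one ratio
    above 1 would force geometric growth. *)
Lemma hpsd_bounded_nonincr a (M : R) : (forall k, (0 < k)%N -> 0 < a k <= M) ->
  (forall j, (0 < j)%N -> hpsd (fun n => a (n + j)%N)) ->
  forall k, (0 < k)%N -> a k.+1 <= a k.
Proof.
move=> aM ha k k0; rewrite leNgt; apply/negP => akk.
have ap j : (0 < j)%N -> 0 < a j by move=> /aM/andP[].
pose r := a k.+1 / a k.
have r1 : 1 < r by rewrite ltr_pdivlMr ?ap// mul1r.
have step j : (k <= j)%N -> r * a j <= a j.+1.
  elim: j => [|j IH]; first by rewrite leqn0 => /eqP k00; rewrite k00 in k0.
  rewrite leq_eqVlt => /orP[/eqP <-|kj].
    by rewrite /r divfK// gt_eqF// ap.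
  have {}IH := IH kj.
  have j0 : (0 < j)%N by rewrite (leq_trans k0).
  have := mom_cauchy 1 'X (ha j j0).
  rewrite mul1r expr1n -{1}(expr1 'X) -(expr0 'X) !momXn add0n add1n.
  rewrite (_ : (2 + j)%N = j.+2)// => lc.
  rewrite -(ler_pM2l (ap j j0)); apply: le_trans lc.
  rewrite mulrCA mulrA expr2 ler_wpM2r// ltW// ap//.
have grow n : r ^+ n * a k <= a (n + k)%N.
  elim: n => [|n IH]; first by rewrite mul1r.
  rewrite exprS -mulrA; apply: le_trans (step _ (leq_addl n k)).
  by rewrite ler_wpM2l// ltW// (lt_trans ltr01).
have [N hN] : exists N, M / a k < r ^+ N.
  have r0 : 0 < r - 1 by rewrite subr_gt0.
  have [N hN] : exists N : nat, M / a k / (r - 1) < N%:R.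
    exists (Num.truncn `|M / a k / (r - 1)|).+1.
    by rewrite (le_lt_trans (ler_norm _))// truncnS_gt.
  exists N; rewrite ltr_pdivrMr// in hN; apply: lt_le_trans hN _.
  elim: N => [|N IH]; first by rewrite mul0r expr0 ler01.
  rewrite exprS -natr1.
  have h1 : (r - 1) * 1 <= (r - 1) * r ^+ N.
    by rewrite ler_wpM2l ?(ltW r0)// exprn_ege1// ltW.
  by nra.
have := grow N; rewrite leNgt => /negP; apply.
have /andP[_ h] := aM (N + k)%N ltac:(by rewrite addn_gt0 k0 orbT).
by apply: le_lt_trans h _; rewrite -ltr_pdivrMr// ap.
Qed.

Lemma hpsd_inv_prod_bounded a (M : R) : (forall k, (0 < k)%N -> 0 < a k <= M) ->
  (forall j, (0 < j)%N -> hpsd (fun n => a (n + j)%N)) ->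
  hpsd (fun n => \prod_(k < n) (a k.+1)^-1).
Proof.
move=> aM ha; apply: hpsd_inv_prod => //; first by move=> k /aM/andP[].
exact: hpsd_bounded_nonincr aM ha.
Qed.

End InverseKernels.

(** * Integrals of positive kernels *)

Section IntegralOfKernels.
Context d (T : measurableType d) (R : realType) (mu : {measure set T -> \bar R}).

Lemma integrable_sumr (D : set T) n (f : nat -> T -> R) : measurable D ->
  (forall i, mu.-integrable D (EFin \o f i)) ->
  mu.-integrable D (EFin \o (fun x => \sum_(i < n) f i x)).
Proof.
move=> mD h; elim: n => [|n IH].
  rewrite (_ : _ \o _ = cst 0%E); first exact: integrable0.
  by apply/funext => x /=; rewrite big_ord0.
rewrite (_ : _ \o _ = (EFin \o (fun x => \sum_(i < n) f i x)) \+ (EFin \o f n)).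
  exact: integrableD.
by apply/funext => x /=; rewrite big_ord_recr.
Qed.

Lemma Rintegral_sumr (D : set T) n (f : nat -> T -> R) : measurable D ->
  (forall i, mu.-integrable D (EFin \o f i)) ->
  \int[mu]_(x in D) (\sum_(i < n) f i x) = \sum_(i < n) \int[mu]_(x in D) f i x.
Proof.
move=> mD h; elim: n => [|n IH].
  rewrite big_ord0 (@eq_Rintegral _ _ _ mu D (cst 0)).
    by rewrite Rintegral_cst// mul0r.
  by move=> x _; rewrite big_ord0.
rewrite big_ord_recr/= -IH -RintegralD//; last exact: integrable_sumr.
by apply: eq_Rintegral => x _; rewrite big_ord_recr.
Qed.

Lemma integrableZlr (D : set T) (r : R) (f : T -> R) : measurable D ->
  mu.-integrable D (EFin \o f) -> mu.-integrable D (EFin \o (fun x => r * f x)).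
Proof.
move=> mD h; rewrite (_ : _ \o _ = (fun x => r%:E * (EFin \o f) x)%E).
  exact: integrableZl.
by apply/funext => x /=; rewrite EFinM.
Qed.

Lemma integrableDr (D : set T) (f g : T -> R) : measurable D ->
  mu.-integrable D (EFin \o f) -> mu.-integrable D (EFin \o g) ->
  mu.-integrable D (EFin \o (fun x => f x + g x)).
Proof. by move=> mD hf hg; apply: (integrableD mD hf hg). Qed.

Lemma integrableBr (D : set T) (f g : T -> R) : measurable D ->
  mu.-integrable D (EFin \o f) -> mu.-integrable D (EFin \o g) ->
  mu.-integrable D (EFin \o (fun x => f x - g x)).
Proof. by move=> mD hf hg; apply: (integrableB mD hf hg). Qed.

Lemma integrable_dominated (D : set T) (f g : T -> R) : measurable D ->
  measurable_fun D f -> (forall x, D x -> `|f x| <= g x) ->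
  mu.-integrable D (EFin \o g) -> mu.-integrable D (EFin \o f).
Proof.
move=> mD mf fg; apply: le_integrable => //; first exact/measurable_EFinP.
by move=> x Dx /=; rewrite lee_fin (le_trans (fg x Dx))// ler_norm.
Qed.

Lemma quad_Rintegral (D : set T) (f : nat -> T -> R) n c : measurable D ->
  (forall i, mu.-integrable D (EFin \o f i)) ->
  quad n c (fun i j => \int[mu]_(x in D) f (i + j)%N x) =
  \int[mu]_(x in D) quad n c (fun i j => f (i + j)%N x).
Proof.
move=> mD h.
have h1 i j : mu.-integrable D (EFin \o (fun x => c i * c j * f (i + j)%N x)).
  exact: integrableZlr.
rewrite /quad (Rintegral_sumr n (f := fun i x => \sum_(j < n) c i * c j * f (i + j)%N x))//; last first.
  by move=> i; apply: (integrable_sumr n (f := fun j x => c i * c j * f (i + j)%N x)).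
apply: eq_bigr => i _.
rewrite (Rintegral_sumr n (f := fun j x => c i * c j * f (i + j)%N x))//.
by apply: eq_bigr => j _; rewrite RintegralZl.
Qed.

Lemma hpsd_Rintegral (D : set T) (f : nat -> T -> R) : measurable D ->
  (forall i, mu.-integrable D (EFin \o f i)) ->
  (forall x, D x -> hpsd (fun n => f n x)) ->
  hpsd (fun n => \int[mu]_(x in D) f n x).
Proof.
move=> mD hi hf; apply: hpsdE => n c; rewrite quad_Rintegral//.
by apply: Rintegral_ge0 => x Dx; have [_] := hf x Dx; apply.
Qed.

End IntegralOfKernels.

(** * Elementary inequalities and one-variable calculus *)

Section ElementaryInequalities.
Context {R : realType}.
Implicit Types x y z u v t : R.

(** The compensated exponential, integrand of [psi]. *)
Definition ecomp z : R := expR (- z) - 1 + z.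

Lemma ecomp_ge0 z : 0 <= ecomp z.
Proof. by rewrite /ecomp; have := expR_ge1Dx (- z); lra. Qed.

Lemma expRN_le1 z : 0 <= z -> expR (- z) <= 1.
Proof. by move=> z0; rewrite -expR0 ler_expR oppr_le0. Qed.

Lemma ecomp_le z : 0 <= z -> ecomp z <= Num.min (z ^+ 2) z.
Proof.
move=> z0; rewrite le_min /ecomp; apply/andP; split; last first.
  by have := expRN_le1 z0; lra.
have h : 1 + z <= expR z := expR_ge1Dx z.
have zp : 0 < 1 + z by lra.
have : expR (- z) <= (1 + z)^-1 by rewrite expRN lef_pV2 ?posrE ?expR_gt0.
have : (1 + z)^-1 <= 1 - z + z ^+ 2.
  rewrite -div1r ler_pdivrMr//.
  have : 0 <= z ^+ 3 by rewrite exprn_ge0.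
  by rewrite exprSr; nra.
by lra.
Qed.

Lemma minsq_ge0 y : 0 <= y -> 0 <= Num.min (y ^+ 2) y.
Proof. by move=> y0; rewrite le_min sqr_ge0. Qed.

End ElementaryInequalities.

Section ElementaryInequalities2.
Context {R : realType}.
Implicit Types x y z u v t : R.

Lemma minsqM u y : 0 <= u -> 0 <= y ->
  Num.min ((u * y) ^+ 2) (u * y) <= (u ^+ 2 + u) * Num.min (y ^+ 2) y.
Proof.
move=> u0 y0.
have [h|h] := leP (y ^+ 2) y.
  apply: (@le_trans _ _ ((u * y) ^+ 2)); first by rewrite ge_min lexx.
  by rewrite exprMn ler_wpM2r ?sqr_ge0// lerDl.
apply: (@le_trans _ _ (u * y)); first by rewrite ge_min lexx orbT.
by rewrite ler_wpM2r// lerDr sqr_ge0.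
Qed.

Lemma ecomp_leM u y : 0 <= u -> 0 <= y ->
  ecomp (u * y) <= (u ^+ 2 + u) * Num.min (y ^+ 2) y.
Proof.
move=> u0 y0; apply: le_trans (minsqM u0 y0).
exact: ecomp_le (mulr_ge0 u0 y0).
Qed.

Lemma measurable_ecompM u (D : set (mR R)) :
  measurable_fun D (fun y : mR R => ecomp (u * y)).
Proof.
apply: measurable_funD => /=; last exact: measurable_funM.
apply: measurable_funD => //=; apply: measurableT_comp => //.
by apply: measurableT_comp => //; apply: measurable_funM.
Qed.

Lemma is_derive_expRM u (x : R) :
  is_derive x 1 (fun v => expR (- (u * v))) (- u * expR (- (u * x))).
Proof.
have -> : (fun v => expR (- (u * v))) = expR \o (fun v => (- u) * v).
  by apply/funext => v /=; rewrite mulNr.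
have h : is_derive x 1 (fun v : R => - u * v) (- u).
  by have := is_deriveZ (-u) (is_derive_id x 1); rewrite /GRing.scale/= mulr1.
have := @is_derive1_comp _ expR (fun v : R => - u * v) x _ _ (is_derive_expR _) h.
by rewrite /= mulNr mulrC; move=> H; exact: H.
Qed.

Lemma continuous_expRM u : continuous (fun v : R => expR (- (u * v))).
Proof.
move=> x; apply: differentiable_continuous; apply/derivable1_diffP.
by have [] := is_derive_expRM u x.
Qed.

Lemma derive_continuous (F f : R -> R) : (forall x : R, is_derive x 1 F (f x)) ->
  continuous F.
Proof.
move=> dF x; apply: differentiable_continuous; apply/derivable1_diffP.
by have [] := dF x.
Qed.

Lemma continuous_integrable_itv (f : R -> R) (a b : R) : continuous f ->
  lebesgue_measure.-integrable `[a, b] (EFin \o f).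
Proof.
move=> cf; apply: continuous_compact_integrable; first exact: segment_compact.
exact: continuous_subspaceT.
Qed.

Lemma FTC2_derive (F f : R -> R) (a b : R) : a <= b ->
  (forall x : R, is_derive x 1 F (f x)) -> continuous f ->
  \int[lebesgue_measure]_(x in `[a, b]) f x = F b - F a.
Proof.
move=> ab dF cf; have [<-|nab] := eqVneq a b.
  by rewrite subrr set_itv1 Rintegral_set1.
have {}ab : a < b by rewrite lt_neqAle nab.
have cF := derive_continuous dF.
rewrite /Rintegral (@continuous_FTC2 _ f F a b)//.
- exact: continuous_subspaceT.
- split; first by move=> x _; have [] := dF x.
    exact: cvg_at_right_filter (cF a).
  exact: cvg_at_left_filter (cF b).
- by move=> x _; have [_] := dF x; rewrite derive1E.
Qed.

Lemma FTC2y_derive (F f : R -> R) (a l : R) :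
  (forall x : R, is_derive x 1 F (f x)) -> continuous f ->
  (forall x, a <= x -> 0 <= f x) -> F x @[x --> +oo] --> l ->
  \int[lebesgue_measure]_(x in `[a, +oo[) f x = l - F a /\
  lebesgue_measure.-integrable `[a, +oo[ (EFin \o f).
Proof.
move=> dF cf f0 Fl; have cF := derive_continuous dF.
have E : (\int[lebesgue_measure]_(x in `[a, +oo[) (f x)%:E = l%:E - (F a)%:E)%E.
  have dF' x : a < x -> derivable F x 1 by have [] := dF x.
  apply: ge0_continuous_FTC2y => //.
  - exact: continuous_subspaceT.
  - exact: cvg_at_right_filter (cF a).
  - by move=> x _; have [_] := dF x; rewrite derive1E.
split; first by rewrite /Rintegral E.
apply/integrableP; split.
  apply/measurable_EFinP; apply: measurable_funTS; exact: continuous_measurable_fun.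
have -> : (\int[lebesgue_measure]_(x in `[a, +oo[) `|(EFin \o f) x| =
    \int[lebesgue_measure]_(x in `[a, +oo[) (f x)%:E)%E.
  apply: eq_integral => x; rewrite inE/= in_itv/= andbT => ax.
  by rewrite ger0_norm ?f0.
by rewrite E ltry.
Qed.

End ElementaryInequalities2.

(** * The Bernstein function [phi] and the moments [W] *)

Section BernsteinFunction.
Context {R : realType} (p : laguerre_exponent R).
Implicit Types (u y t : R).

Local Notation D := (`]0%R, +oo[%classic : set (mR R)).

Definition pint (f : R -> R) : R := \int[lPi p]_(y in D) f y.

Definition pintegrable (f : R -> R) := (lPi p).-integrable D (EFin \o f).

Lemma pD y : D y = (0 < y) :> Prop.
Proof. by rewrite /= in_itv/= andbT. Qed.

Lemma measurable_minsq (E : set (mR R)) :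
  measurable_fun E (fun y : mR R => Num.min (y ^+ 2) y).
Proof.
apply: (@measurable_funTS _ _ _ _ E).
have -> : (fun y : mR R => Num.min (y ^+ 2) y) =
   (fun y : R => y ^+ 2) \min (fun y : R => y) by [].
by apply: measurable_minr.
Qed.

Lemma pintegrable_minsq : pintegrable (fun y => Num.min (y ^+ 2) y).
Proof.
apply/integrableP; split.
  by apply/measurable_EFinP; apply: measurable_minsq.
rewrite (_ : (\int[_]_(x in _) _ = \int[lPi p]_(y in D) (Num.min (y ^+ 2) y)%:E)%E).
  exact: lPi_int.
apply: eq_integral => y; rewrite inE pD => y0 /=.
by rewrite ger0_norm// minsq_ge0// ltW.
Qed.

Lemma pintegrableZ r f : pintegrable f -> pintegrable (fun y => r * f y).
Proof. exact: integrableZlr. Qed.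

Lemma pintegrable_dom (f : R -> R) (C : R) :
  measurable_fun D (f : mR R -> R) ->
  (forall y, 0 < y -> `|f y| <= C * Num.min (y ^+ 2) y) -> pintegrable f.
Proof.
move=> mf fC.
apply: (integrable_dominated (T := mR R) (g := fun y : R => C * Num.min (y ^+ 2) y)) => //.
  by move=> y; rewrite pD; apply: fC.
exact: pintegrableZ pintegrable_minsq.
Qed.

Lemma pintegrable_ecomp u : 0 <= u -> pintegrable (fun y => ecomp (u * y)).
Proof.
move=> u0; apply: (pintegrable_dom (C := u ^+ 2 + u)).
  exact: measurable_ecompM.
by move=> y y0; rewrite ger0_norm ?ecomp_ge0// ecomp_leM// ltW.
Qed.

Lemma pintZ r f : pintegrable f -> pint (fun y => r * f y) = r * pint f.
Proof. by move=> h; rewrite /pint RintegralZl. Qed.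

Lemma pintD f g : pintegrable f -> pintegrable g ->
  pint (fun y => f y + g y) = pint f + pint g.
Proof. by move=> hf hg; rewrite /pint RintegralD. Qed.

Lemma pintB f g : pintegrable f -> pintegrable g ->
  pint (fun y => f y - g y) = pint f - pint g.
Proof. by move=> hf hg; rewrite /pint RintegralB. Qed.

Lemma eq_pint f g : (forall y, 0 < y -> f y = g y) -> pint f = pint g.
Proof. by move=> fg; apply: eq_Rintegral => y; rewrite inE pD; apply: fg. Qed.

Lemma le_pint f g : pintegrable f -> pintegrable g ->
  (forall y, 0 < y -> f y <= g y) -> pint f <= pint g.
Proof.
by move=> hf hg fg; apply: le_Rintegral => // y; rewrite pD; apply: fg.
Qed.

Lemma pint_ge0 f : (forall y, 0 < y -> 0 <= f y) -> 0 <= pint f.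
Proof. by move=> f0; apply: Rintegral_ge0 => y; rewrite pD; apply: f0. Qed.

Definition phir u : R := ldrift p + lsigma p ^+ 2 * u + u^-1 * pint (fun y => ecomp (u * y)).

Lemma phiE u : 0 < u -> phi p u = (phir u)%:E.
Proof.
move=> u0; rewrite /phi gt_eqF// /psi.
have -> : (\int[lPi p]_(y in `]0%R, +oo[) (expR (- (u * y)) - 1 + u * y)%:E)%E =
    (pint (fun y => ecomp (u * y)))%:E.
  rewrite /pint /Rintegral fineK//.
  exact: integrable_fin_num (pintegrable_ecomp (ltW u0)).
rewrite -EFinD -EFinM /phir; congr EFin; field.
by rewrite gt_eqF.
Qed.

Lemma phir_nat (n : nat) : fine (phi p n.+1%:R) = phir n.+1%:R.
Proof. by rewrite phiE ?ltr0n. Qed.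

(** [Wphi] with its index lowered by one, so that [W n] is the moment of order [n]. *)
Definition W n : R := \prod_(k < n) phir k.+1%:R.

Lemma WphiE n : Wphi p n.+1 = W n.
Proof.
rewrite /Wphi /W big_add1/= big_mkord; apply: eq_bigr => k _.
exact: phir_nat.
Qed.

Lemma WS n : W n.+1 = W n * phir n.+1%:R.
Proof. by rewrite /W big_ord_recr. Qed.

Lemma W0 : W 0 = 1. Proof. by rewrite /W big_ord0. Qed.

Lemma phir_divE u : 0 < u -> phir u / u =
  lsigma p ^+ 2 + ldrift p * u^-1 + pint (fun y => (u ^+ 2)^-1 * ecomp (u * y)).
Proof.
move=> u0; rewrite pintZ; last exact: pintegrable_ecomp (ltW u0).
by rewrite /phir; field; rewrite gt_eqF.
Qed.

(** The contribution of a jump of size [y] to [phi(u) / u] is the Laplace transform of the density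
    [y - v] on [[0, y]]; sampled at integers it is a moment sequence in [exp (- v)]. *)
Lemma ecomp_divE u y : 0 < u -> 0 < y -> (u ^+ 2)^-1 * ecomp (u * y) =
  \int[lebesgue_measure]_(v in `[0, y]) ((y - v) * expR (- (u * v))).
Proof.
move=> u0 y0.
pose F := fun v => - u^-1 * ((y - v) * expR (- (u * v))) + (u ^+ 2)^-1 * expR (- (u * v)).
have dE v := is_derive_expRM u v.
have dF (v : R) : is_derive v 1 F ((y - v) * expR (- (u * v))).
  rewrite /F; apply: is_derive_eq.
  rewrite /GRing.scale/=; field.
  by rewrite gt_eqF.
rewrite (FTC2_derive (ltW y0) dF).
  rewrite /F mulr0 oppr0 expR0 /ecomp.
  by field; rewrite gt_eqF.
move=> v; apply: cvgM; last exact: continuous_expRM.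
by apply: cvgB; [exact: cvg_cst|exact: cvg_id].
Qed.

Lemma hpsd_ecomp_div j y : (0 < j)%N -> 0 < y ->
  hpsd (fun n => (((n + j)%:R : R) ^+ 2)^-1 * ecomp ((n + j)%:R * y)).
Proof.
move=> j0 y0.
pose f n v : R := (y - v) * expR (- ((n + j)%:R * v)).
apply: (eq_hpsd (a := fun n => \int[lebesgue_measure]_(v in `[0, y]) f n v)).
  by move=> n; rewrite ecomp_divE// ltr0n addn_gt0 j0 orbT.
apply: hpsd_Rintegral => // [n|v].
  apply: continuous_integrable_itv => v; apply: cvgM; last exact: continuous_expRM.
  by apply: cvgB; [exact: cvg_cst|exact: cvg_id].
rewrite /= in_itv/= => /andP[v0 vy].
apply: hpsdZ; first by rewrite subr_ge0.
apply: (eq_hpsd (a := fun n => expR (- (j%:R * v)) * expR (- v) ^+ n)).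
  move=> n; rewrite -expRM_natl -expRD; congr expR.
  by rewrite natrD; ring.
by apply: hpsdZ; [exact: expR_ge0|exact: hpsd_exp].
Qed.

Lemma hpsd_phir_div j : (0 < j)%N -> hpsd (fun n => phir (n + j)%:R / (n + j)%:R).
Proof.
move=> j0; have nj n : 0 < (n + j)%:R :> R by rewrite ltr0n addn_gt0 j0 orbT.
apply: (eq_hpsd (a := fun n => lsigma p ^+ 2 + ldrift p * (n%:R + j%:R)^-1 +
    pint (fun y => ((n + j)%:R ^+ 2)^-1 * ecomp ((n + j)%:R * y)))).
  by move=> n; rewrite phir_divE// natrD.
apply: hpsdD; first apply: hpsdD.
- by apply: hpsd_cst; rewrite sqr_ge0.
- by apply: hpsdZ (ldrift_ge0 p) _; apply: hpsd_invr_addn; rewrite ltr0n.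
- apply: hpsd_Rintegral => // [n|y]; last by rewrite pD; apply: hpsd_ecomp_div.
  apply: pintegrableZ.
  exact: pintegrable_ecomp (ltW (nj n)).
Qed.

Lemma phir_ge0 u : 0 < u -> 0 <= phir u.
Proof.
move=> u0; have h : 0 <= pint (fun y => ecomp (u * y)).
  by apply: pint_ge0 => y _; apply: ecomp_ge0.
rewrite /phir; apply: addr_ge0; last by rewrite mulr_ge0// invr_ge0 ltW.
by rewrite addr_ge0 ?ldrift_ge0// mulr_ge0 ?sqr_ge0// ltW.
Qed.

Lemma phir_mono1 k : (0 < k)%N -> phir 1 <= phir k%:R.
Proof.
move=> k0; have kp : 0 < k%:R :> R by rewrite ltr0n.
rewrite /phir -!addrA lerD2l; apply: lerD.
  by rewrite ler_wpM2l ?sqr_ge0// ler1n.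
rewrite invr1 mul1r -pintZ; last exact: pintegrable_ecomp (ltW kp).
apply: le_pint.
- exact: pintegrable_ecomp.
- apply: pintegrableZ.
  exact: pintegrable_ecomp (ltW kp).
move=> y y0; rewrite mul1r ler_pdivlMl// /ecomp -mulrN expRM_natl.
(* Bernoulli's inequality, used with [w = exp (- y)]. *)
have h (w : R) n : 0 <= w <= 1 -> 1 + n%:R * (w - 1) <= w ^+ n.
  move=> /andP[w0 w1]; elim: n => [|n IH]; first by rewrite mul0r addr0.
  rewrite exprS -natr1.
  have n0 : 0 <= n%:R :> R by [].
  have h1 : 0 <= n%:R * ((w - 1) * (w - 1)) by rewrite mulr_ge0// -expr2 sqr_ge0.
  have := ler_wpM2l w0 IH; lra.
have := h (expR (- y)) k; rewrite expR_ge0 expRN_le1 ?(ltW y0)// => /(_ isT).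
by lra.
Qed.

Lemma phir_div_bounded : exists2 M, 0 < M & forall k, (0 < k)%N -> phir k%:R / k%:R <= M.
Proof.
exists (lsigma p ^+ 2 + ldrift p + 2 * pint (fun y => Num.min (y ^+ 2) y) + 1).
  rewrite ltr_wpDl// !addr_ge0 ?sqr_ge0 ?ldrift_ge0// mulr_ge0//.
  by apply: pint_ge0 => y y0; apply: minsq_ge0; apply: ltW.
move=> k k0; have kp : 0 < k%:R :> R by rewrite ltr0n.
have k1 : 1 <= k%:R :> R by rewrite ler1n.
rewrite phir_divE// -[leLHS]addr0 lerD// lerD//; first rewrite lerD2l.
  by rewrite ler_piMr ?ldrift_ge0// invf_le1.
rewrite -pintZ; last exact: pintegrable_minsq.
apply: le_pint.
- apply: pintegrableZ.
  exact: pintegrable_ecomp (ltW kp).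
- exact: pintegrableZ pintegrable_minsq.
move=> y y0; rewrite ler_pdivrMl ?exprn_gt0//.
apply: le_trans (ecomp_leM (ltW kp) (ltW y0)) _; rewrite mulrA ler_wpM2r ?minsq_ge0 ?(ltW y0)//.
have : k%:R <= k%:R ^+ 2 :> R by rewrite expr2 ler_peMr// ltW.
by lra.
Qed.

Hypothesis phi1 : 0 < phir 1.

Lemma phir_gt0 k : 0 < phir k.+1%:R.
Proof. exact: lt_le_trans (phir_mono1 _). Qed.

Lemma W_gt0 n : 0 < W n.
Proof. by apply: prodr_gt0 => k _; apply: phir_gt0. Qed.

(* moments of the exponential functional of the subordinator with Laplace
   exponent [phi] *)
Lemma hpsd_fact_div_W : hpsd (fun n => n`!%:R / W n).
Proof.
have [M _ hM] := phir_div_bounded.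
apply: (eq_hpsd (a := fun n => \prod_(k < n) (phir k.+1%:R / k.+1%:R)^-1)).
  move=> n; elim: n => [|n IH]; first by rewrite big_ord0 W0 fact0 divr1.
  rewrite big_ord_recr/= IH factS WS natrM invf_div.
  by field; rewrite !gt_eqF// ?W_gt0 ?phir_gt0.
apply: (@hpsd_inv_prod_bounded _ (fun k => phir k%:R / k%:R) M).
  by move=> [//|k] _; rewrite hM// divr_gt0 ?phir_gt0.
exact: hpsd_phir_div.
Qed.

End BernsteinFunction.

(** * Decay of the moment ratio relative to the Laguerre case *)

Section RatioDecay.
Context {R : realType}.
Implicit Types (y : R).

(** The two sides agree for [k = 1], and the right-hand side grows by [(k + 1) w ^ k (1 - w) ^ 2]
    from [k] to [k + 1]. *)
Lemma powS_conv_ge (w : R) k : 0 <= w <= 1 -> (0 < k)%N ->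
  (1 - w) ^+ 2 <= 1 - k.+1%:R * w ^+ k + k%:R * w ^+ k.+1.
Proof.
move=> /andP[w0 w1]; case: k => // k _; elim: k => [|k IH].
  by rewrite le_eqVlt; apply/orP; left; apply/eqP; ring.
apply: le_trans IH _; rewrite -subr_ge0.
rewrite (_ : _ - _ = k.+2%:R * w ^+ k.+1 * (1 - w) ^+ 2); last first.
  by rewrite !exprS -!natr1; ring.
by rewrite mulr_ge0 ?sqr_ge0// mulr_ge0 ?exprn_ge0.
Qed.

(** The previous inequality at [w = exp (- v)], integrated over [[0, y]]. Integrated against [Pi],
    it says that [k (k + 1) (phi(k) / k - phi(k + 1) / (k + 1))] is smallest at [k = 1]. *)
Lemma ecomp_conv k y : (0 < k)%N -> 0 <= y ->
  2 * ecomp y - 2^-1 * ecomp (2 * y) <=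
  k.+1%:R / k%:R * ecomp (k%:R * y) - k%:R / k.+1%:R * ecomp (k.+1%:R * y).
Proof.
move=> k0 y0; rewrite -subr_ge0.
pose F v := k.+1%:R / k%:R * (expR (- (k%:R * v)) - 1 + k%:R * v)
  - k%:R / k.+1%:R * (expR (- (k.+1%:R * v)) - 1 + k.+1%:R * v)
  - (2 * (expR (- (1 * v)) - 1 + 1 * v) - 2^-1 * (expR (- (2 * v)) - 1 + 2 * v)) : R.
pose f v := 1 - k.+1%:R * expR (- (k%:R * v)) + k%:R * expR (- (k.+1%:R * v))
   - (1 - 2 * expR (- (1 * v)) + expR (- (2 * v))) : R.
have k1 : k%:R != 0 :> R by rewrite pnatr_eq0 -lt0n.
have k2 : 1 + k%:R != 0 :> R by rewrite nat1r pnatr_eq0.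
have dF (v : R) : is_derive v 1 F (f v).
  have d1 := is_derive_expRM k%:R v; have d2 := is_derive_expRM k.+1%:R v.
  have d3 := is_derive_expRM 1 v; have d4 := is_derive_expRM 2 v.
  rewrite /F; apply: is_derive_eq.
  rewrite /GRing.scale/= /f; field.
  by rewrite k1 k2.
have cf : continuous f.
  move=> v; rewrite /f; apply: cvgB; apply: cvgD.
  - apply: cvgB; first exact: cvg_cst.
    by apply: cvgM; [exact: cvg_cst|exact: continuous_expRM].
  - by apply: cvgM; [exact: cvg_cst|exact: continuous_expRM].
  - apply: cvgB; first exact: cvg_cst.
    by apply: cvgM; [exact: cvg_cst|exact: continuous_expRM].
  - exact: continuous_expRM.
have := FTC2_derive y0 dF cf.
rewrite /F !mulr0 oppr0 expR0 subrr !addr0 !mulr0 !subr0 mul1r /ecomp => <-.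
apply: Rintegral_ge0 => v; rewrite /= in_itv/= => /andP[v0 _].
have e n : expR (- (n%:R * v)) = expR (- v) ^+ n by rewrite -mulrN expRM_natl.
rewrite /f mul1r !e (_ : - v = - v)//.
have := @powS_conv_ge (expR (- v)) k; rewrite expR_ge0 expRN_le1// => /(_ isT k0).
by rewrite sqrrB expr1n mul1r -mulr_natl; lra.
Qed.

Variable p : laguerre_exponent R.

Lemma phir_conv k : (0 < k)%N ->
  (2 * phir p 1 - phir p 2) / (k%:R * k.+1%:R) <=
  phir p k%:R / k%:R - phir p k.+1%:R / k.+1%:R.
Proof.
move=> k0.
have kp : 0 < k%:R :> R by rewrite ltr0n.
have k1p : 0 < k.+1%:R :> R by rewrite ltr0n.
rewrite ler_pdivrMr ?mulr_gt0// /phir.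
have h n : pintegrable p (fun y => ecomp (n%:R * y)) by apply: pintegrable_ecomp.
have h1 := h 1%N; have h2 := h 2%N; have h3 := h k; have h4 := h k.+1.
have : 2 * pint p (fun y => ecomp (1 * y)) - 2^-1 * pint p (fun y => ecomp (2 * y)) <=
  k.+1%:R / k%:R * pint p (fun y => ecomp (k%:R * y)) -
  k%:R / k.+1%:R * pint p (fun y => ecomp (k.+1%:R * y)).
  rewrite -!pintZ// -!pintB//; try exact: pintegrableZ.
  apply: le_pint.
  - by apply: integrableBr => //; apply: pintegrableZ.
  - by apply: integrableBr => //; apply: pintegrableZ.
  by move=> y y0; rewrite mul1r; apply: ecomp_conv => //; apply: ltW.
set P1 := pint p _; set P2 := pint p _; set P3 := pint p _; set P4 := pint p _ => H.
rewrite [leRHS](_ : _ = ldrift p + (k.+1%:R / k%:R * P3 - k%:R / k.+1%:R * P4)); last first.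
  by rewrite -!nat1r; field; rewrite nat1r !gt_eqF.
rewrite [leLHS](_ : _ = ldrift p + (2 * P1 - 2^-1 * P2)) ?lerD2l//.
by rewrite invr1; ring.
Qed.

Lemma phir_div_diff j N : (0 < j)%N ->
  (2 * phir p 1 - phir p 2) * (j%:R^-1 - (N + j)%:R^-1) <=
  phir p j%:R / j%:R - phir p (N + j)%:R / (N + j)%:R.
Proof.
move=> j0; elim: N => [|N IH]; first by rewrite !subrr mulr0.
have nj : (0 < N + j)%N by rewrite addn_gt0 j0 orbT.
have := phir_conv nj.
have n0 : (N + j)%:R != 0 :> R by rewrite pnatr_eq0 -lt0n.
have n1 : 1 + (N + j)%:R != 0 :> R by rewrite nat1r pnatr_eq0.
have j1 : j%:R != 0 :> R by rewrite pnatr_eq0 -lt0n.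
rewrite addSn (_ : _ / (_ * _) = (2 * phir p 1 - phir p 2) *
  ((N + j)%:R^-1 - (N + j).+1%:R^-1)); last first.
  by rewrite -(nat1r (N + j)); move: ((N + j)%:R) n0 n1 => x x0 x1; field; rewrite x0 x1.
by move=> H; have := lerD IH H; congr (_ <= _); ring.
Qed.

(** Primitive of [(1 - exp (- v)) ^ 2]; its integral against [Pi], plus the drift, is
    [2 phi(1) - phi(2)]. *)
Definition cvx_gap y : R := 2 * ecomp (1 * y) - 2^-1 * ecomp (2 * y).

Lemma cvx_gap_gt0 y : 0 < y -> 0 < cvx_gap y.
Proof.
move=> y0; pose f v : R := (1 - expR (- (1 * v))) ^+ 2.
have dF (v : R) : is_derive v 1 cvx_gap (f v).
  have d3 := is_derive_expRM 1 v; have d4 := is_derive_expRM 2 v.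
  rewrite /cvx_gap /ecomp; apply: is_derive_eq.
  rewrite /GRing.scale/= /f.
  have -> : expR (- (2 * v)) = expR (- (1 * v)) ^+ 2.
    by rewrite mul1r -mulrN expRM_natl.
  by field.
have cf : continuous f.
  have c1 : continuous (fun v : R => 1 - expR (- (1 * v))).
    by move=> v; apply: cvgB; [exact: cvg_cst|exact: continuous_expRM].
  rewrite (_ : f = fun v => (1 - expR (- (1 * v))) * (1 - expR (- (1 * v)))).
    by move=> v; apply: cvgM; exact: c1.
  by apply/funext => v; rewrite /f expr2.
have y20 : 0 <= y / 2 by rewrite divr_ge0// ltW.
have y2 : y / 2 <= y by lra.
have := FTC2_derive y20 dF cf; have := FTC2_derive y2 dF cf.
have -> : cvx_gap 0 = 0 by rewrite /cvx_gap /ecomp !mulr0 oppr0 expR0; ring.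
move=> e2 e1.
have l1 : 0 <= cvx_gap (y / 2).
  by rewrite -[cvx_gap _]subr0 -e1; apply: Rintegral_ge0 => v _; rewrite /f sqr_ge0.
suff l2 : (1 - expR (- (y / 2))) ^+ 2 * (y / 2) <= cvx_gap y - cvx_gap (y / 2).
  have : 0 < (1 - expR (- (y / 2))) ^+ 2 * (y / 2).
    rewrite mulr_gt0 ?exprn_gt0 ?divr_gt0// subr_gt0 -expR0 ltr_expR.
    by rewrite oppr_lt0 divr_gt0.
  by lra.
rewrite -e2.
have -> : (1 - expR (- (y / 2))) ^+ 2 * (y / 2) =
    \int[lebesgue_measure]_(v in `[y / 2, y]) cst ((1 - expR (- (y / 2))) ^+ 2) v.
  rewrite Rintegral_cst//; congr (_ * _).
  have := lebesgue_measure_itv `[y / 2, y]; rewrite /= lte_fin.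
  have -> : y / 2 < y by lra.
  by move=> ->; rewrite -EFinB/=; field.
apply: le_Rintegral => //.
- by apply: continuous_integrable_itv => v; exact: cvg_cst.
- exact: continuous_integrable_itv.
move=> v; rewrite /= in_itv/= => /andP[v1 v2].
have hl : 0 <= 1 - expR (- (y / 2)) by rewrite subr_ge0 expRN_le1.
have hm : 1 - expR (- (y / 2)) <= 1 - expR (- (1 * v)).
  by rewrite lerD2l lerN2 ler_expR lerN2 mul1r.
by rewrite /f lerXn2r ?nnegrE// (le_trans hl).
Qed.

(** The quantity [2 phi(1) - phi(2)] measures how far [phi] is from [sigma^2 u]. Without drift it is
    the integral of [cvx_gap], which is positive on [(0, oo)], so a zero value would force
    [Pi = 0]. *)
Lemma phir_conv_gt0 : ~ (ldrift p = 0 /\ lPi p setT = 0%E) ->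
  0 < 2 * phir p 1 - phir p 2.
Proof.
move=> nz.
have h n : pintegrable p (fun y => ecomp (n%:R * y)) by apply: pintegrable_ecomp.
have h1 := h 1%N; have h2 := h 2%N.
have iC : pintegrable p cvx_gap by apply: integrableBr => //; apply: pintegrableZ.
have -> : 2 * phir p 1 - phir p 2 = ldrift p + pint p cvx_gap.
  rewrite /cvx_gap pintB ?pintZ//; try exact: pintegrableZ.
  by rewrite /phir; field.
have P0 : 0 <= pint p cvx_gap by apply: pint_ge0 => y /cvx_gap_gt0/ltW.
have [m0|m0] := eqVneq (ldrift p) 0; last first.
  by rewrite ltr_wpDr// lt_neqAle eq_sym m0 ldrift_ge0.
rewrite m0 add0r lt_neqAle P0 andbT eq_sym; apply/eqP => PC0; apply: nz; split => //.
pose D := `]0%R, +oo[%classic : set (mR R).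
have mD : measurable D by exact: measurable_itv.
have mC : measurable_fun D (EFin \o cvx_gap) by apply: (measurable_int _ iC).
have aeD : ae_eq (lPi p) D (EFin \o cvx_gap) (cst 0%E).
  apply/(ae_eq_integral_abs (lPi p) mD mC).
  have E2 : (\int[lPi p]_(x in D) (cvx_gap x)%:E = 0)%E.
    have := PC0; rewrite /pint /Rintegral => /eqP; rewrite fine_eq0 => [/eqP//|].
    exact: integrable_fin_num iC.
  rewrite -[RHS]E2; apply: eq_integral => y; rewrite inE /D pD => y0 /=.
  by rewrite ger0_norm// ltW// cvx_gap_gt0.
have D0 : lPi p D = 0%E.
  case: aeD => N [mN N0 sub].
  apply: (subset_measure0 _ mN) => // y Dy; apply: sub => /= /(_ Dy)[] /eqP.
  by move: Dy; rewrite /D pD => /cvx_gap_gt0 /gt_eqF ->.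
have -> : (setT : set (mR R)) = [set y | y <= 0] `|` D.
  by apply/seteqP; split => // y _; case: (leP y 0) => hy; [left|right; rewrite /D pD].
have mN : measurable ([set y | y <= 0] : set (mR R)).
  have -> : [set y | y <= 0] = `]-oo, 0%R]%classic :> set R.
    by apply/seteqP; split => y; rewrite /= in_itv.
  exact: measurable_itv.
by rewrite measureU0//; exact: lPi_conc.
Qed.

Hypothesis phi1 : 0 < phir p 1.

Lemma W_ratio_prod N : W p (N + N) =
  'C(N + N, N)%:R * W p N ^+ 2 *
  \prod_(j < N) ((phir p (N + j.+1)%:R / (N + j.+1)%:R) / (phir p j.+1%:R / j.+1%:R)).
Proof.
have Wf n : W p n = n`!%:R * \prod_(k < n) (phir p k.+1%:R / k.+1%:R).
  elim: n => [|n IH]; first by rewrite W0 big_ord0 fact0 mulr1.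
  rewrite WS IH big_ord_recr/= factS natrM; field.
  by rewrite nat1r pnatr_eq0.
have P0 n : \prod_(k < n) (phir p k.+1%:R / k.+1%:R) != 0.
  by apply/prodf_neq0 => k _; rewrite mulf_neq0 ?invr_eq0 ?pnatr_eq0// gt_eqF// phir_gt0.
rewrite [in LHS]Wf big_split_ord/= [X in _ = _ * X]prodf_div.
have -> : \prod_(i < N) (phir p (N + i).+1%:R / (N + i).+1%:R) =
   \prod_(i < N) (phir p (N + i.+1)%:R / (N + i.+1)%:R).
  by apply: eq_bigr => i _; rewrite addnS.
rewrite Wf -(bin_fact (leq_addr N N)) addKn !natrM.
have f0 : N`!%:R != 0 :> R by rewrite pnatr_eq0 -lt0n fact_gt0.
by field; rewrite P0.
Qed.

(** Each factor in [W_ratio_prod] is at most [exp (- (c / M) (1 / j - 1 / (N + j)))] for [j] from 1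
    to [N]. The terms [1 / (N + j)] add up to at most 1, and the harmonic series diverges. *)
Lemma W_ratio_decay (a : R) : 0 < a -> 0 < 2 * phir p 1 - phir p 2 ->
  exists N, W p (N + N) < a * 'C(N + N, N)%:R * W p N ^+ 2.
Proof.
move=> a0 c0; set c := _ - _ in c0.
have [M M0 hM] := phir_div_bounded p.
have bd N : \prod_(j < N) ((phir p (N + j.+1)%:R / (N + j.+1)%:R) / (phir p j.+1%:R / j.+1%:R)) <=
    expR (- (c / M * (\sum_(j < N) j.+1%:R^-1 - 1))).
  apply: (@le_trans _ _ (\prod_(j < N) expR (- (c / M * (j.+1%:R^-1 - (N + j.+1)%:R^-1))))).
    apply: ler_prod => j _.
    have bj : 0 < phir p j.+1%:R / j.+1%:R by rewrite divr_gt0 ?phir_gt0.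
    have bN : 0 < phir p (N + j.+1)%:R / (N + j.+1)%:R.
      by rewrite addnS divr_gt0 ?phir_gt0.
    rewrite divr_ge0 ?(ltW bj) ?(ltW bN)//=.
    apply: le_trans (expR_ge1Dx _); rewrite ler_pdivrMr//.
    have := @phir_div_diff j.+1 N isT; rewrite -/c.
    have jM := hM j.+1 isT.
    have d0 : 0 <= j.+1%:R^-1 - (N + j.+1)%:R^-1 :> R.
      by rewrite subr_ge0 lef_pV2 ?posrE ?ltr0n ?addnS// ler_nat ltnS leq_addl.
    move: d0 jM bj; set dl := _ - _; set b1 := _ / _; set b2 := _ / _ => d0 jM bj h.
    have : c / M * dl * b1 <= c * dl.
      rewrite (_ : c / M * dl * b1 = c * dl * (b1 / M)); last by ring.
      by rewrite ler_piMr ?mulr_ge0 ?(ltW c0)// ler_pdivrMr// mul1r.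
    by lra.
  rewrite -expR_sum ler_expR sumrN lerN2 -mulr_sumr ler_pM2l ?divr_gt0//.
  rewrite sumrB lerD2l lerN2.
  apply: (@le_trans _ _ (\sum_(j < N) N%:R^-1)).
    apply: ler_sum => j _; case: N j => [[//]|N j].
    by rewrite lef_pV2 ?posrE ?ltr0n// ler_nat leq_addr.
  rewrite sumr_const card_ord; case: N => [|N]; first by rewrite mulr0n.
  by rewrite -(mulr_natr (N.+1%:R^-1)) mulVf// pnatr_eq0.
have [N hN] : exists N, expR (- (c / M * (\sum_(j < N) j.+1%:R^-1 - 1))) < a.
  apply: contrapT => hno.
  apply: (@dvg_harmonic R).
  apply: nondecreasing_is_cvgn.
    by apply/nondecreasing_seqP => n; rewrite !seriesEord/= big_ord_recr/= lerDl invr_ge0.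
  exists (1 - M / c * ln a) => _ [n _ <-].
  rewrite seriesEord/= leNgt; apply/negP => h; apply: hno; exists n.
  rewrite -[ltRHS](lnK (x := a)) ?posrE// ltr_expR.
  have : ln a + c / M * (\sum_(j < n) j.+1%:R^-1 - 1) > 0.
    rewrite (_ : _ + _ = c / M * (\sum_(j < n) j.+1%:R^-1 - (1 - M / c * ln a))); last first.
      by field; rewrite !gt_eqF.
    by rewrite mulr_gt0 ?divr_gt0// subr_gt0.
  by lra.
exists N; rewrite W_ratio_prod [ltRHS](_ : _ = 'C(N + N, N)%:R * W p N ^+ 2 * a).
  rewrite ltr_pM2l; first exact: le_lt_trans (bd N) hN.
  by rewrite mulr_gt0 ?exprn_gt0 ?W_gt0// ltr0n bin_gt0 leq_addr.
by ring.
Qed.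

End RatioDecay.

(** * Laplace transforms of the kernels of the Levy density *)

Section LaplaceIntegrals.
Context {R : realType}.
Implicit Types (u v y t b : R).
Local Notation leb := (@lebesgue_measure R).
Local Notation D := (`]0%R, +oo[%classic : set (mR R)).

Definition lint (f : R -> R) : R := \int[leb]_(t in D) f t.
Definition lintegrable (f : R -> R) := leb.-integrable D (EFin \o f).

Lemma expRM_y u : 0 < u -> expR (- (u * v)) @[v --> +oo] --> (0 : R).
Proof.
move=> u0.
have h : u * x @[x --> +oo] --> +oo.
  apply/cvgryPge => A; apply: filterS (nbhs_pinfty_ge (num_real (u^-1 * A))) => x.
  by rewrite ler_pdivrMl.
exact: cvg_comp h (@cvgr_expR R).
Qed.

Lemma lint_expy u y : 0 < u ->
  \int[leb]_(t in `[y, +oo[) expR (- (u * t)) = u^-1 * expR (- (u * y)) /\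
  leb.-integrable `[y, +oo[ (EFin \o (fun t => expR (- (u * t)))).
Proof.
move=> u0; pose F v := - u^-1 * expR (- (u * v)).
have dF (v : R) : is_derive v 1 F (expR (- (u * v))).
  have dE := is_derive_expRM u v.
  rewrite /F; apply: is_derive_eq; rewrite /GRing.scale/=; field.
  by rewrite gt_eqF.
have Fy : F x @[x --> +oo] --> (0 : R).
  by rewrite -(mulr0 (- u^-1)); apply: cvgM; [exact: cvg_cst|exact: expRM_y].
have [e i] := FTC2y_derive (a := y) dF (continuous_expRM (u := u)) (fun x _ => expR_ge0 _) Fy.
by split => //; rewrite e /F; ring.
Qed.

Lemma Dcy (y : R) : 0 < y -> D = `]0, y[%classic `|` `[y, +oo[%classic.
Proof.
move=> y0; apply/seteqP; split => t /=; rewrite !in_itv/= ?andbT.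
  by move=> t0; case: (ltP t y) => h; [left; rewrite t0|right].
by case=> [/andP[]//|yt]; exact: lt_le_trans yt.
Qed.

Lemma lintegrable_exp u : 0 < u -> lintegrable (fun t => expR (- (u * t))).
Proof.
move=> u0; apply: integrableS (lint_expy 0 u0).2 => //.
by move=> t /=; rewrite !in_itv/= !andbT; apply: ltW.
Qed.

Lemma lint_exp u : 0 < u -> lint (fun t => expR (- (u * t))) = u^-1.
Proof.
move=> u0; have [e i] := lint_expy 0 u0.
rewrite /lint (Rintegral_itv_obnd_cbnd (lintegrable_exp u0)) e.
by rewrite mulr0 oppr0 expR0 mulr1.
Qed.

Lemma lint_split (g g1 F1 : R -> R) y : 0 < y -> lintegrable g ->
  (forall t, 0 < t < y -> g t = g1 t) ->
  (forall t : R, is_derive t 1 F1 (g1 t)) -> continuous g1 ->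
  lint g = F1 y - F1 0 + \int[leb]_(t in `[y, +oo[) g t.
Proof.
move=> y0 ig gg1 dF c1.
rewrite /lint (Dcy y0) Rintegral_setU//.
- congr (_ + _); rewrite -(FTC2_derive (ltW y0) dF c1).
  transitivity (\int[leb]_(t in `]0, y[) g1 t).
    by apply: eq_Rintegral => t; rewrite inE/= in_itv/=; apply: gg1.
  have i1 : leb.-integrable `[0, y] (EFin \o g1) by exact: continuous_integrable_itv.
  rewrite Rintegral_itv_bndo_bndc; last first.
    apply: integrableS i1 => // t; rewrite /= !in_itv/=.
    by move=> /andP[a b]; rewrite !ltW.
  rewrite Rintegral_itv_obnd_cbnd//.
  apply: integrableS i1 => // t; rewrite /= !in_itv/=.
  by move=> /andP[a ->]; rewrite !ltW.
- by rewrite -Dcy.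
- apply/disj_setPS => t /=; rewrite !in_itv/= andbT => -[/andP[_ a] b].
  by have := lt_le_trans a b; rewrite ltxx.
Qed.

Lemma measurable_expM u (E : set (mR R)) :
  measurable_fun E (fun t : mR R => expR (- (u * t))).
Proof.
apply: measurable_funTS; apply: continuous_measurable_fun.
exact: continuous_expRM.
Qed.

(** Integrated in [y] against [Pi], [step t] gives [Pibar t] and [ramp t] the iterated tail.
    [Gcap b t y] is the integral of [exp (b s) - 1] for [s] from 0 to [min t y]; it collects what
    multiplication by [1 / (u + b)] adds to the Levy density. *)
Definition step t y : R := (t < y)%R%:R.
Definition ramp t y : R := Num.max (y - t) 0.
Definition Gcap b t y : R := b^-1 * ecomp (- (b * Num.min t y)).

Lemma step_ge0 t y : 0 <= step t y. Proof. by rewrite /step. Qed.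
Lemma ramp_ge0 t y : 0 <= ramp t y. Proof. by rewrite /ramp le_max lexx orbT. Qed.
Lemma Gcap_ge0 b t y : 0 < b -> 0 <= Gcap b t y.
Proof. by move=> b0; rewrite mulr_ge0 ?ecomp_ge0// invr_ge0 ltW. Qed.

Lemma ecompN_mono z1 z2 : 0 <= z1 <= z2 -> ecomp (- z1) <= ecomp (- z2) :> R.
Proof.
move=> /andP[z0 z12]; rewrite /ecomp !opprK.
have h : expR z1 * (1 + (z2 - z1)) <= expR z2.
  rewrite -{2}(subrK z1 z2) expRD mulrC ler_wpM2r ?expR_ge0//.
  exact: expR_ge1Dx.
have : 1 <= expR z1 by rewrite -expR0 ler_expR.
by nra.
Qed.

Lemma measurable_step2 :
  measurable_fun setT (fun x : mR R * mR R => step x.1 x.2).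
Proof.
have -> : (fun x : mR R * mR R => step x.1 x.2) =
    (fun x => if (x.1 < x.2)%R then 1 else 0 : R).
  by apply/funext => x; rewrite /step; case: ifP.
apply: measurable_fun_ifT => //.
by apply: measurable_fun_ltr.
Qed.

Lemma measurable_ramp2 :
  measurable_fun setT (fun x : mR R * mR R => ramp x.1 x.2).
Proof.
by apply: measurable_maxr => //; apply: measurable_funB.
Qed.

Lemma measurable_Gcap2 b :
  measurable_fun setT (fun x : mR R * mR R => Gcap b x.1 x.2).
Proof.
have -> : (fun x : mR R * mR R => Gcap b x.1 x.2) =
   (fun z : mR R => b^-1 * ecomp (- b * z)) \o
   (fun x : mR R * mR R => Num.min (x.1 : R) (x.2 : R)).
  by apply/funext => x /=; rewrite /Gcap mulNr.
apply: measurableT_comp; last first.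
  by apply: measurable_minr.
by apply: measurable_funM => //; exact: measurable_ecompM.
Qed.

Lemma measurable_sec1 (f : R -> R -> R) y (E : set (mR R)) :
  measurable_fun setT (fun x : mR R * mR R => f x.1 x.2) ->
  measurable_fun E (fun t : mR R => f t y).
Proof.
move=> mf; apply: measurable_funTS.
by apply: (measurableT_comp mf (g := fun t => (t, y))); exact: measurable_pair2.
Qed.

Lemma measurable_sec2 (f : R -> R -> R) t (E : set (mR R)) :
  measurable_fun setT (fun x : mR R * mR R => f x.1 x.2) ->
  measurable_fun E (fun y : mR R => f t y).
Proof.
move=> mf; apply: measurable_funTS.
by apply: (measurableT_comp mf (g := fun y => (t, y))); exact: measurable_pair1.
Qed.

Lemma lintegrable_expM u (g : R -> R) (C : R) : 0 < u ->
  measurable_fun D (g : mR R -> R) ->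
  (forall t, 0 < t -> 0 <= g t <= C) ->
  lintegrable (fun t => expR (- (u * t)) * g t).
Proof.
move=> u0 mg gC.
apply: (integrable_dominated (T := mR R) (g := fun t : R => C * expR (- (u * t)))) => //.
- by apply: measurable_funM => //; exact: measurable_expM.
- move=> t; rewrite /= in_itv/= andbT => t0.
  have /andP[g0 g1] := gC t t0.
  rewrite ger0_norm ?mulr_ge0 ?expR_ge0// mulrC ler_wpM2r ?expR_ge0//.
by apply: integrableZlr => //; exact: lintegrable_exp.
Qed.

Lemma lintegrable_step u y : 0 < u -> lintegrable (fun t => expR (- (u * t)) * step t y).
Proof.
move=> u0; apply: (lintegrable_expM (C := 1)) => //.
  by apply: (measurable_sec1 (f := step)); exact: measurable_step2.
by move=> t _; rewrite /step; case: ltP => _; rewrite /= ?lexx ?ler01.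
Qed.

Lemma lint_step u y : 0 < u -> 0 < y ->
  lint (fun t => expR (- (u * t)) * step t y) = u^-1 * (1 - expR (- (u * y))).
Proof.
move=> u0 y0; pose F v := - u^-1 * expR (- (u * v)).
have dF (v : R) : is_derive v 1 F (expR (- (u * v))).
  have dE := is_derive_expRM u v.
  rewrite /F; apply: is_derive_eq; rewrite /GRing.scale/=; field.
  by rewrite gt_eqF.
rewrite (lint_split y0 (lintegrable_step y u0) _ dF (continuous_expRM (u := u))).
  rewrite (@eq_Rintegral _ _ _ _ _ (cst 0)).
    by rewrite Rintegral_cst// mul0r addr0 /F mulr0 oppr0 expR0; ring.
  move=> t; rewrite inE/= in_itv/= andbT => yt.
  by rewrite /step ltNge yt mulr0.
by move=> t /andP[_ ty]; rewrite /step ty mulr1.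
Qed.

Lemma lintegrable_ramp u y : 0 < u -> 0 < y ->
  lintegrable (fun t => expR (- (u * t)) * ramp t y).
Proof.
move=> u0 y0; apply: (lintegrable_expM (C := y)) => //.
  by apply: (measurable_sec1 (f := ramp)); exact: measurable_ramp2.
move=> t t0; rewrite ramp_ge0/= /ramp ge_max (ltW y0) andbT.
by rewrite lerBlDr lerDl ltW.
Qed.

Lemma lint_ramp u y : 0 < u -> 0 < y ->
  lint (fun t => expR (- (u * t)) * ramp t y) = (u ^+ 2)^-1 * ecomp (u * y).
Proof.
move=> u0 y0.
pose F := fun v => - u^-1 * ((y - v) * expR (- (u * v))) + (u ^+ 2)^-1 * expR (- (u * v)).
have dF (v : R) : is_derive v 1 F (expR (- (u * v)) * (y - v)).
  have dE := is_derive_expRM u v.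
  rewrite /F; apply: is_derive_eq.
  rewrite /GRing.scale/=; field.
  by rewrite gt_eqF.
rewrite (lint_split y0 (lintegrable_ramp u0 y0) _ dF).
- rewrite (@eq_Rintegral _ _ _ _ _ (cst 0)).
    rewrite Rintegral_cst// mul0r addr0 /F mulr0 oppr0 expR0 /ecomp.
    by field; rewrite gt_eqF.
  move=> t; rewrite inE/= in_itv/= andbT => yt.
  by rewrite /ramp max_r ?subr_le0// mulr0.
- by move=> t /andP[_ ty]; rewrite /ramp max_l// subr_ge0 ltW.
- move=> v; apply: cvgM; first exact: continuous_expRM.
  by apply: cvgB; [exact: cvg_cst|exact: cvg_id].
Qed.

Lemma Gcap_le b t y : 0 < b -> 0 < t -> 0 < y -> 0 <= Gcap b t y <= Gcap b y y.
Proof.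
move=> b0 t0 y0; rewrite Gcap_ge0//= /Gcap minxx ler_wpM2l ?invr_ge0 ?(ltW b0)//.
apply: ecompN_mono; rewrite ler_wpM2l ?(ltW b0)// ?ge_min ?lexx ?orbT//.
by rewrite mulr_ge0 ?(ltW b0)// le_min !ltW.
Qed.

Lemma lintegrable_Gcap v b y : 0 < v -> 0 < b -> 0 < y ->
  lintegrable (fun t => expR (- (v * t)) * Gcap b t y).
Proof.
move=> v0 b0 y0; apply: (lintegrable_expM (C := Gcap b y y)) => //.
  by apply: (measurable_sec1 (f := Gcap b)); exact: (measurable_Gcap2 b).
by move=> t t0; apply: Gcap_le.
Qed.

(** Read from right to left: the jump part of [phi(u)] multiplied by [1 / (u + b)] is the transform
    of [ramp] at [u + b] minus that of [Gcap]. *)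
Lemma lint_Gcap u b y : 0 < u -> 0 < b -> 0 < y ->
  lint (fun t => expR (- ((u + b) * t)) * Gcap b t y) =
  ((u + b) ^+ 2)^-1 * ecomp ((u + b) * y) - (u + b)^-1 * (u^-1 * ecomp (u * y)).
Proof.
move=> u0 b0 y0; set v := u + b.
have v0 : 0 < v by rewrite addr_gt0.
pose F s := - (b * u)^-1 * expR (- (u * s)) + (b * v)^-1 * expR (- (v * s))
   + v^-1 * (s * expR (- (v * s))) + (v ^+ 2)^-1 * expR (- (v * s)).
pose g s := b^-1 * (expR (- (u * s)) - expR (- (v * s))) - s * expR (- (v * s)).
have dF (s : R) : is_derive s 1 F (g s).
  have d1 := is_derive_expRM u s; have d2 := is_derive_expRM v s.
  rewrite /F; apply: is_derive_eq.
  rewrite /GRing.scale/= /g; field.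
  by rewrite !gt_eqF.
have ee s : expR (b * s) * expR (- (v * s)) = expR (- (u * s)).
  by rewrite -expRD; congr expR; rewrite /v; ring.
rewrite (lint_split y0 (lintegrable_Gcap v0 b0 y0) _ dF).
- have -> : \int[leb]_(t in `[y, +oo[) (expR (- (v * t)) * Gcap b t y) =
      Gcap b y y * (v^-1 * expR (- (v * y))).
    have [<- i] := lint_expy y v0; rewrite -RintegralZl//.
    apply: eq_Rintegral => t; rewrite inE/= in_itv/= andbT => yt.
    by rewrite /Gcap minxx min_r// mulrC.
  rewrite /Gcap minxx /F /ecomp !mulr0 !oppr0 expR0 !opprK mul0r mulr0 addr0.
  have -> : b^-1 * (expR (b * y) - 1 - b * y) * (v^-1 * expR (- (v * y))) =
     b^-1 * v^-1 * (expR (b * y) * expR (- (v * y)) - expR (- (v * y)) - b * y * expR (- (v * y))).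
    by ring.
  rewrite ee (_ : b = v - u) ?/v; last by ring.
  field.
  by rewrite !gt_eqF//; lra.
- move=> t /andP[t0 ty]; rewrite /Gcap min_l ?(ltW ty)// /g /ecomp opprK.
  have -> : expR (- (v * t)) * (b^-1 * (expR (b * t) - 1 - b * t)) =
     b^-1 * (expR (b * t) * expR (- (v * t)) - expR (- (v * t)) - b * t * expR (- (v * t))).
    by ring.
  by rewrite ee; field; rewrite gt_eqF.
- move=> s; apply: cvgB; apply: cvgM; try exact: cvg_cst; try exact: cvg_id.
    by apply: cvgB; exact: continuous_expRM.
  exact: continuous_expRM.
Qed.

End LaplaceIntegrals.

(** * Exchange of the integrals over [t] and against [Pi] *)

Section Tonelli.
Context {R : realType} (p : laguerre_exponent R).
Local Notation leb := (@lebesgue_measure R).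
Local Notation D := (`]0%R, +oo[%classic : set (mR R)).

Lemma lint_pint_swap (h : R -> R -> R) :
  measurable_fun setT (fun x : mR R * mR R => h x.1 x.2) ->
  (forall t y, 0 < t -> 0 < y -> 0 <= h t y) ->
  (forall y, 0 < y -> lintegrable (h^~ y)) ->
  (forall t, 0 < t -> pintegrable p (h t)) ->
  pintegrable p (fun y => lint (h^~ y)) ->
  lintegrable (fun t => pint p (h t)) /\
  lint (fun t => pint p (h t)) = pint p (fun y => lint (h^~ y)).
Proof.
move=> mh h0 hy ht hyt.
have memD (t : R) : 0 < t -> (t \in D) = true by move=> t0; rewrite mem_set// pD.
have memND (t : R) : ~~ (0 < t) -> (t \in D) = false.
  by move=> t0; rewrite memNset// pD; exact/negP.
(* Extension by 0 off the open quadrant, so that Tonelli's theorem on the whole plane applies. *)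
pose H (x : mR R * mR R) : R :=
  if (0 < x.1) && (0 < x.2) then h x.1 x.2 else 0.
have mH : measurable_fun setT (EFin \o H).
  apply/measurable_EFinP; apply: measurable_fun_ifT => //.
  by apply: measurable_and; apply: measurable_fun_ltr.
have H0 x : (0 <= (EFin \o H) x)%E.
  by rewrite /H /= lee_fin; case: ifP => // /andP[a b]; apply: h0.
have FT := @fubini_tonelli _ _ _ _ R leb (lPi p) (EFin \o H) mH H0.
have E1 : (\int[leb]_t \int[lPi p]_y (EFin \o H) (t, y) =
    \int[leb]_(t in D) (pint p (h t))%:E)%E.
  rewrite [RHS]integral_mkcond; apply: eq_integral => t _.
  rewrite patchE; have [t0|t0] := boolP (0 < t); [rewrite ifT; last exact: memD|rewrite ifF; last exact: memND].
    rewrite /pint /Rintegral fineK; last exact: integrable_fin_num (ht t t0).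
    rewrite [RHS]integral_mkcond; apply: eq_integral => y _.
    rewrite patchE /H /= t0; have [y0|y0] := boolP (0 < y).
      by rewrite ifT; last exact: memD.
    by rewrite [RHS]ifF; last exact: memND.
  by rewrite integral0_eq// => y _; rewrite /H /= (negbTE t0).
have E2 : (\int[lPi p]_y \int[leb]_t (EFin \o H) (t, y) =
    \int[lPi p]_(y in D) (lint (h^~ y))%:E)%E.
  rewrite [RHS]integral_mkcond; apply: eq_integral => y _.
  rewrite patchE; have [y0|y0] := boolP (0 < y); [rewrite ifT; last exact: memD|rewrite ifF; last exact: memND].
    rewrite /lint /Rintegral fineK; last exact: integrable_fin_num (hy y y0).
    rewrite [RHS]integral_mkcond; apply: eq_integral => t _.
    rewrite patchE /H /= y0 andbT; have [t0|t0] := boolP (0 < t).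
      by rewrite ifT; last exact: memD.
    by rewrite [RHS]ifF; last exact: memND.
  by rewrite integral0_eq// => t _; rewrite /H /= (negbTE y0) andbF.
have FTm : measurable_fun D (fun t => pint p (h t)).
  have := @measurable_fun_fubini_tonelli_F _ _ _ _ R (lPi p) _ mH H0.
  move=> mF; apply/measurable_EFinP.
  apply: (eq_measurable_fun (fubini_F (lPi p) (EFin \o H))) => [t|]; last exact: measurable_funTS.
  rewrite inE pD => t0; rewrite /fubini_F /= /pint /Rintegral.
  have := integrable_fin_num _ (ht t t0) => /(_ _) fin.
  rewrite fineK ?fin//.
  rewrite [in RHS]integral_mkcond; apply: eq_integral => y _.
  rewrite patchE /H /= t0; have [y0|y0] := boolP (0 < y).
      by rewrite ifT; last exact: memD.
    by rewrite [RHS]ifF; last exact: memND.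
have p0 t : 0 < t -> 0 <= pint p (h t).
  by move=> t0; apply: pint_ge0 => y; apply: h0.
have E3 : (\int[leb]_(t in D) (pint p (h t))%:E = (pint p (fun y => lint (h^~ y)))%:E)%E.
  rewrite -E1 FT E2 /pint /Rintegral fineK//.
  exact: integrable_fin_num hyt.
split; last by rewrite /lint /Rintegral E3.
apply/integrableP; split; first exact/measurable_EFinP.
have := ltry (pint p (fun y => lint (h^~ y))); rewrite -E3; congr (_ < _)%E.
apply: eq_integral => t; rewrite inE pD => t0 /=.
by rewrite ger0_norm ?p0.
Qed.

End Tonelli.

(** * The transform [phi(u) (1 + A / (u + b))] *)

Section BernsteinTransform.
Context {R : realType} (p : laguerre_exponent R).
Implicit Types (A b t y u : R).
Local Notation D := (`]0%R, +oo[%classic : set (mR R)).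

Lemma pintegrableD f g : pintegrable p f -> pintegrable p g ->
  pintegrable p (fun y => f y + g y).
Proof. exact: integrableDr. Qed.

Lemma pintegrableB f g : pintegrable p f -> pintegrable p g ->
  pintegrable p (fun y => f y - g y).
Proof. exact: integrableBr. Qed.

Lemma lintegrableZ (r : R) f : lintegrable f -> lintegrable (fun y => r * f y).
Proof. exact: integrableZlr. Qed.

Lemma lintegrableD (f g : R -> R) : lintegrable f -> lintegrable g ->
  lintegrable (fun y => f y + g y).
Proof. exact: integrableDr. Qed.

Lemma minsq_bound t y (r : R) : 0 < t -> 0 < y -> r <= y ->
  (y <= t -> r <= 0) -> r <= (1 + t^-1) * Num.min (y ^+ 2) y.
Proof.
move=> t0 y0 ry rt; have ti : 0 < t^-1 by rewrite invr_gt0.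
have [yt|ty] := leP y t.
  apply: le_trans (rt yt) _; rewrite mulr_ge0 ?minsq_ge0 ?ltW//.
  by rewrite addr_gt0.
have h1 : y <= t^-1 * y ^+ 2.
  by rewrite expr2 mulrA ler_peMl ?(ltW y0)// ler_pdivlMl// mulr1 ltW.
have [h|h] := leP (y ^+ 2) y; rewrite mulrDl mul1r; apply: le_trans ry _.
  by rewrite ler_wpDl ?sqr_ge0.
by rewrite lerDl mulr_ge0 ?ltW.
Qed.

Lemma pintegrable_ramp t : 0 < t -> pintegrable p (ramp t).
Proof.
move=> t0; apply: (@pintegrable_dom _ p _ (1 + t^-1)).
  by apply: (measurable_sec2 (f := ramp)); exact: measurable_ramp2.
move=> y y0; rewrite ger0_norm ?ramp_ge0//; apply: minsq_bound => //.
  by rewrite /ramp ge_max (ltW y0) andbT lerBlDr lerDl ltW.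
by move=> yt; rewrite /ramp max_r// subr_le0.
Qed.

Lemma pintegrable_step t : 0 < t -> pintegrable p (step t).
Proof.
move=> t0; have t1 : 0 < t^-1 by rewrite invr_gt0.
apply: (@pintegrable_dom _ p _ (t^-1 + (t ^+ 2)^-1)).
  by apply: (measurable_sec2 (f := step)); exact: measurable_step2.
move=> y y0; rewrite ger0_norm ?step_ge0// /step.
have t2 : 0 < (t ^+ 2)^-1 by rewrite invr_gt0 exprn_gt0.
have c0 : 0 < t^-1 + (t ^+ 2)^-1 by rewrite addr_gt0.
case: ltP => ty /=; last by rewrite mulr_ge0 ?minsq_ge0 ?ltW.
have h1 : 1 <= t^-1 * y by rewrite ler_pdivlMl// mulr1 ltW.
have h2 : 1 <= (t ^+ 2)^-1 * y ^+ 2.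
  by rewrite ler_pdivlMl ?exprn_gt0// mulr1 lerXn2r ?nnegrE ?ltW.
have [h|h] := leP (y ^+ 2) y; rewrite mulrDl.
  by rewrite ler_wpDl// mulr_ge0 ?sqr_ge0 ?ltW.
by rewrite ler_wpDr// mulr_ge0 ?ltW.
Qed.

(* By monotonicity it is enough to bound [Gcap b t y] where [y <= t], and there
   [exp (b y) - 1 - b y <= (b y) ^ 2 exp (b t)]. *)
Lemma pintegrable_Gcap b t : 0 < b -> 0 < t -> pintegrable p (Gcap b t).
Proof.
move=> b0 t0.
apply: (@pintegrable_dom _ p _ (b * expR (b * t) * (1 + t))).
  by apply: (measurable_sec2 (f := Gcap b)); exact: measurable_Gcap2.
move=> y y0; rewrite ger0_norm ?Gcap_ge0// /Gcap.
set w := Num.min t y.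
have w0 : 0 < w by rewrite lt_min t0 y0.
have wt : w <= t by rewrite ge_min lexx.
have wy : w <= y by rewrite ge_min lexx orbT.
have h : ecomp (- (b * w)) <= (b * w) ^+ 2 * expR (b * t).
  have z0 : 0 <= b * w by rewrite mulr_ge0 ?ltW.
  apply: (@le_trans _ _ ((b * w) ^+ 2 * expR (b * w))); last first.
    by rewrite ler_wpM2l ?sqr_ge0// ler_expR ler_pM2l.
  move: (b * w) z0 => z z0; rewrite /ecomp opprK.
  have h1 := expR_ge1Dx (- z).
  have e1 : expR (- z) * expR z = 1 by rewrite -expRD addNr expR0.
  have h2 : expR z * (1 - z) <= 1 by rewrite -[leRHS]e1 mulrC ler_wpM2r ?expR_ge0.
  have := mulr_ge0 z0 (ltW (expR_gt0 z)).
  have [z1|z1] := leP z 1; last first.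
    have : expR z <= z ^+ 2 * expR z.
      by rewrite ler_peMl ?expR_ge0// expr2; nra.
    by lra.
  by have := ler_wpM2l z0 h2; have := ler_wpM2r z0 h2; nra.
have m1 : w ^+ 2 <= (1 + t) * Num.min (y ^+ 2) y.
  have [hh|hh] := leP (y ^+ 2) y.
    apply: (@le_trans _ _ (y ^+ 2)); first by rewrite lerXn2r ?nnegrE ?(ltW w0) ?(ltW y0).
    by rewrite ler_peMl ?sqr_ge0// lerDl ltW.
  apply: (@le_trans _ _ (t * y)); first by rewrite expr2 ler_pM ?(ltW w0).
  by rewrite ler_wpM2r ?(ltW y0)// lerDr.
rewrite ler_pdivrMl//; apply: le_trans h _.
rewrite exprMn (_ : b ^+ 2 * w ^+ 2 * _ = b * (b * expR (b * t)) * w ^+ 2); last by ring.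
rewrite -!mulrA ler_pM2l// ler_pM2l// ler_pM2l ?expR_gt0//.
Qed.

Lemma hpsd_expR_shift j t : hpsd (fun n => expR (- ((n + j)%:R * t)) : R).
Proof.
apply: (eq_hpsd (a := fun n => expR (- (j%:R * t)) * expR (- t) ^+ n)).
  by move=> n; rewrite -expRM_natl -expRD; congr expR; rewrite natrD; ring.
by apply: hpsdZ; [exact: expR_ge0|exact: hpsd_exp].
Qed.

(** The factor left at [u = k] when the Beta ratio [(k + b) / (k + b + A)] is taken out of
    [phi(k)]. *)
Definition phit A b u := phir p u * (1 + A / (u + b)).

(* nonnegativity of the Levy density of [phit A b], multiplied by [exp (b t)] *)
Definition density_ge0 A b := forall t, 0 < t ->
  A * (ldrift p + pint p (ramp t)) <=
  expR (b * t) * pint p (step t) + A * b * lsigma p ^+ 2 + A * pint p (Gcap b t).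

Lemma lint_quad n c (f : nat -> R -> R) : (forall i, lintegrable (f i)) ->
  lint (fun t => quad n c (fun i j => f (i + j)%N t)) =
  quad n c (fun i j => lint (f (i + j)%N)) /\
  lintegrable (fun t => quad n c (fun i j => f (i + j)%N t)).
Proof.
move=> h; split.
  by rewrite /lint -(quad_Rintegral (T := mR R)).
apply: (integrable_sumr (T := mR R) n
  (f := fun i x => \sum_(j < n) c i * c j * f (i + j)%N x)) => // i.
apply: (integrable_sumr (T := mR R) n
  (f := fun j x => c i * c j * f (i + j)%N x)) => // j.
by apply: (integrableZlr (T := mR R)) => //; exact: h.
Qed.

Lemma pint_quad n c (f : nat -> R -> R) : (forall i, pintegrable p (f i)) ->
  pint p (fun t => quad n c (fun i j => f (i + j)%N t)) =
  quad n c (fun i j => pint p (f (i + j)%N)) /\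
  pintegrable p (fun t => quad n c (fun i j => f (i + j)%N t)).
Proof.
move=> h; split.
  by rewrite /pint -(quad_Rintegral (T := mR R)).
apply: (integrable_sumr (T := mR R) n
  (f := fun i x => \sum_(j < n) c i * c j * f (i + j)%N x)) => // i.
apply: (integrable_sumr (T := mR R) n
  (f := fun j x => c i * c j * f (i + j)%N x)) => // j.
by apply: (integrableZlr (T := mR R)) => //; exact: h.
Qed.

(** For coefficients of zero sum the affine part of [phit] cancels. What remains is minus the
    integral over [t] of the difference of the two sides of [density_ge0] against the nonnegative
    function [exp (- b t) E t]. Zero-sum coefficients are what [hpsd_invr_cnd] asks for. *)
Lemma phit_cnd A b j n (c : nat -> R) : 0 < A -> 0 < b -> (0 < j)%N ->
  density_ge0 A b -> \sum_(i < n) c i = 0 ->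
  quad n c (fun i k => phit A b (i + k + j)%:R) <= 0.
Proof.
move=> A0 b0 j0 dens c0.
pose u m : R := (m + j)%:R.
have u0 m : 0 < u m by rewrite ltr0n addn_gt0 j0 orbT.
have ub m : 0 < u m + b by rewrite addr_gt0.
pose E t := quad n c (fun i k => expR (- (u (i + k)%N * t))).
have E0 t : 0 <= E t by have [_] := hpsd_expR_shift j t; apply.
have Eb t : expR (- (b * t)) * E t = quad n c (fun i k => expR (- ((u (i + k)%N + b) * t))).
  rewrite -quadZ; apply: eq_quad => i k _ _.
  by rewrite -expRD; congr (_ * expR _); ring.
have mE : measurable_fun setT (E : mR R -> R).
  apply: continuous_measurable_fun => t.
  apply: cvg_big => [|i _]; first exact: add_continuous.
  apply: cvg_big => [|k _]; first exact: add_continuous.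
  by apply: cvgM; [exact: cvg_cst|exact: continuous_expRM].
(* [h1] and [h2] are the [Pi]-integrands of the two sides of [density_ge0], multiplied by
   [exp (- b t) E t]. Both are nonnegative, so Tonelli applies to each separately. *)
pose h1 t y := E t * step t y + A * (expR (- (b * t)) * E t * Gcap b t y).
pose h2 t y := A * (expR (- (b * t)) * E t * ramp t y).
have mE1 : measurable_fun setT (fun x : mR R * mR R => E x.1).
  by apply: measurableT_comp => //; exact: measurable_fst.
have mE2 : measurable_fun setT
    (fun x : mR R * mR R => expR (- (b * x.1)) * E x.1).
  apply: measurable_funM => //.
  apply: (measurableT_comp (f := fun t : mR R => expR (- (b * t)))).
    exact: measurable_expM.
  exact: measurable_fst.
have mh1 : measurable_fun setT
    (fun x : mR R * mR R => h1 x.1 x.2).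
  apply: measurable_funD; first by apply: measurable_funM => //; exact: measurable_step2.
  by apply: measurable_funM => //; apply: measurable_funM => //; exact: measurable_Gcap2.
have mh2 : measurable_fun setT
    (fun x : mR R * mR R => h2 x.1 x.2).
  by apply: measurable_funM => //; apply: measurable_funM => //; exact: measurable_ramp2.
have h10 t y : 0 < t -> 0 < y -> 0 <= h1 t y.
  move=> _ _; apply: addr_ge0; first by rewrite mulr_ge0 ?step_ge0.
  by rewrite mulr_ge0 ?(ltW A0)// mulr_ge0 ?Gcap_ge0// mulr_ge0 ?expR_ge0.
have h20 t y : 0 < t -> 0 < y -> 0 <= h2 t y.
  move=> _ _; rewrite /h2.
  by rewrite mulr_ge0 ?(ltW A0)// mulr_ge0 ?ramp_ge0// mulr_ge0 ?expR_ge0.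
have i1 y m : 0 < y -> lintegrable (fun t => expR (- (u m * t)) * step t y).
  by move=> _; apply: lintegrable_step.
have i2 y m : 0 < y -> lintegrable (fun t => expR (- ((u m + b) * t)) * Gcap b t y).
  by move=> y0; apply: lintegrable_Gcap.
have i3 y m : 0 < y -> lintegrable (fun t => expR (- ((u m + b) * t)) * ramp t y).
  by move=> y0; apply: lintegrable_ramp.
pose k m y : R := (u m)^-1 * ecomp (u m * y).
pose l m y : R := ((u m + b) ^+ 2)^-1 * ecomp ((u m + b) * y).
have ik m : pintegrable p (k m).
  by apply: pintegrableZ; apply: pintegrable_ecomp; apply: ltW.
have il m : pintegrable p (l m).
  by apply: pintegrableZ; apply: pintegrable_ecomp; apply: ltW.
have h1E y : 0 < y -> lintegrable (h1^~ y) /\ lint (h1^~ y) =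
    quad n c (fun i m => - k (i + m)%N y + A * (l (i + m)%N y - (u (i + m)%N + b)^-1 * k (i + m)%N y)).
  move=> y0.
  have [q1 q1'] := lint_quad n c (fun m => i1 y m y0).
  have [q2 q2'] := lint_quad n c (fun m => i2 y m y0).
  have e1 : (fun t => E t * step t y) =
      (fun t => quad n c (fun i m => expR (- (u (i + m)%N * t)) * step t y)).
    apply/funext => t; rewrite mulrC -quadZ; apply: eq_quad => i m _ _.
    by rewrite (mulrC (step _ _)).
  have e2 : (fun t => expR (- (b * t)) * E t * Gcap b t y) =
      (fun t => quad n c (fun i m => expR (- ((u (i + m)%N + b) * t)) * Gcap b t y)).
    apply/funext => t; rewrite Eb mulrC -quadZ; apply: eq_quad => i m _ _.
    by rewrite (mulrC (Gcap _ _ _)).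
  have j1 : lintegrable (fun t => E t * step t y) by rewrite e1.
  have j2 : lintegrable (fun t => expR (- (b * t)) * E t * Gcap b t y) by rewrite e2.
  split; first by apply: lintegrableD => //; apply: lintegrableZ.
  rewrite /lint RintegralD//; last exact: lintegrableZ.
  rewrite RintegralZl// -/(lint _) -/(lint _) e1 e2 q1 q2 -quadZ quadD.
  congr (_ + _); last first.
    by apply: eq_quad => i m _ _; rewrite lint_Gcap.
  rewrite (_ : quad n c (fun i m => lint _) = quad n c (fun i m => y + -1 * k (i + m)%N y)).
    rewrite quadD [X in X + _](_ : _ = 0) ?add0r; last first.
      rewrite /quad big1// => i _; rewrite -mulr_suml -mulr_sumr c0.
      by rewrite mulr0 mul0r.
    by apply: eq_quad => i m _ _; rewrite mulN1r.
  apply: eq_quad => i m _ _; rewrite lint_step// /k /ecomp; congr (_ * _).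
  by move: (u (i + m)%N) (u0 (i + m)%N) => x x0; field; rewrite gt_eqF.
have h2E y : 0 < y -> lintegrable (h2^~ y) /\ lint (h2^~ y) =
    quad n c (fun i m => A * l (i + m)%N y).
  move=> y0.
  have [q3 q3'] := lint_quad n c (fun m => i3 y m y0).
  have e2 : (fun t => expR (- (b * t)) * E t * ramp t y) =
      (fun t => quad n c (fun i m => expR (- ((u (i + m)%N + b) * t)) * ramp t y)).
    apply/funext => t; rewrite Eb mulrC -quadZ; apply: eq_quad => i m _ _.
    by rewrite (mulrC (ramp _ _)).
  have j2 : lintegrable (fun t => expR (- (b * t)) * E t * ramp t y) by rewrite e2.
  split; first exact: lintegrableZ.
  rewrite /lint RintegralZl// -/(lint _) e2 q3 -quadZ.
  by apply: eq_quad => i m _ _; rewrite lint_ramp.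
have g1 m : pintegrable p (fun y => - k m y + A * (l m y - (u m + b)^-1 * k m y)).
  apply: pintegrableD => //.
    rewrite (_ : (fun y => - k m y) = (fun y => -1 * k m y)); first exact: pintegrableZ.
    by apply/funext => y; rewrite mulN1r.
  by apply: pintegrableZ; apply: pintegrableB => //; apply: pintegrableZ.
have g2 m : pintegrable p (fun y => A * l m y) by exact: pintegrableZ.
have [P1 P1'] := pint_quad n c g1.
have [P2 P2'] := pint_quad n c g2.
have s1 : pintegrable p (fun y => lint (h1^~ y)).
  apply: eq_integrable P1' => // y; rewrite inE pD => y0 /=.
  by rewrite (h1E y y0).2.
have s2 : pintegrable p (fun y => lint (h2^~ y)).
  apply: eq_integrable P2' => // y; rewrite inE pD => y0 /=.
  by rewrite (h2E y y0).2.
have r1 t : 0 < t -> pintegrable p (h1 t).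
  move=> t0; apply: pintegrableD => //; first by apply: pintegrableZ; exact: pintegrable_step.
  by apply: pintegrableZ; apply: pintegrableZ; exact: pintegrable_Gcap.
have r2 t : 0 < t -> pintegrable p (h2 t).
  by move=> t0; apply: pintegrableZ; apply: pintegrableZ; exact: pintegrable_ramp.
have [S1 S1'] := lint_pint_swap mh1 h10 (fun y (y0 : 0 < y) => (h1E y y0).1) r1 s1.
have [S2 S2'] := lint_pint_swap mh2 h20 (fun y (y0 : 0 < y) => (h2E y y0).1) r2 s2.
have iv m : lintegrable (fun t => expR (- ((u m + b) * t))) by apply: lintegrable_exp.
have [V V'] := lint_quad n c iv.
have iEb : lintegrable (fun t => expR (- (b * t)) * E t).
  by rewrite (_ : (fun t => _) = (fun t => quad n c (fun i m => expR (- ((u (i + m)%N + b) * t)))))//; apply/funext => t; rewrite Eb.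
have lEb : lint (fun t => expR (- (b * t)) * E t) = quad n c (fun i m => (u (i + m)%N + b)^-1).
  rewrite (_ : (fun t => _) = (fun t => quad n c (fun i m => expR (- ((u (i + m)%N + b) * t))))).
    by rewrite V; apply: eq_quad => i m _ _; rewrite lint_exp.
  by apply/funext => t; rewrite Eb.
have main : A * ldrift p * lint (fun t => expR (- (b * t)) * E t) + lint (fun t => pint p (h2 t)) <=
   lint (fun t => pint p (h1 t)) + A * b * lsigma p ^+ 2 * lint (fun t => expR (- (b * t)) * E t).
  rewrite /lint -!RintegralZl// -!RintegralD//; try exact: lintegrableZ.
  apply: le_Rintegral => //.
  - by apply: lintegrableD => //; apply: lintegrableZ.
  - by apply: lintegrableD => //; apply: lintegrableZ.
  move=> t; rewrite (pD t) => t0.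
  rewrite /h1 /h2 pintD; last 2 first.
  - by apply: pintegrableZ; exact: pintegrable_step.
  - by apply: pintegrableZ; apply: pintegrableZ; exact: pintegrable_Gcap.
  have q0 := pintegrable_Gcap b0 t0; have q1 := pintegrable_step t0.
  have q2 := pintegrable_ramp t0.
  rewrite (pintZ (E t) q1) (pintZ A (pintegrableZ (expR (- (b * t)) * E t) q0)).
  rewrite (pintZ (expR (- (b * t)) * E t) q0).
  rewrite (pintZ A (pintegrableZ (expR (- (b * t)) * E t) q2)).
  rewrite (pintZ (expR (- (b * t)) * E t) q2).
  have x0 : 0 <= expR (- (b * t)) * E t by rewrite mulr_ge0 ?expR_ge0.
  have := ler_wpM2l x0 (dens t t0).
  have e1 : expR (- (b * t)) * expR (b * t) = 1 by rewrite -expRD addNr expR0.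
  have e2 : E t * pint p (step t) =
      expR (- (b * t)) * expR (b * t) * (E t * pint p (step t)) by rewrite e1 mul1r.
  by rewrite e2; congr (_ <= _); ring.
rewrite S1' S2' lEb in main.
rewrite (eq_pint p (fun y (y0 : 0 < y) => (h1E y y0).2)) (eq_pint p (fun y (y0 : 0 < y) => (h2E y y0).2)) in main.
rewrite P1 P2 in main.
pose K m := pint p (k m). pose L m := pint p (l m).
have PK m : pint p (fun y => - k m y + A * (l m y - (u m + b)^-1 * k m y)) =
   - K m + A * (L m - (u m + b)^-1 * K m).
  rewrite (_ : (fun y => _) = (fun y => -1 * k m y + A * (l m y - (u m + b)^-1 * k m y))).
    have a2 := pintegrableZ (u m + b)^-1 (ik m).
    have a3 := pintegrableB (il m) a2.
    rewrite (pintD (pintegrableZ (-1) (ik m)) (pintegrableZ A a3)) (pintZ A a3).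
    by rewrite (pintB (il m) a2) (pintZ (u m + b)^-1 (ik m)) (pintZ (-1) (ik m)) mulN1r.
  by apply/funext => y; rewrite mulN1r.
have PL m : pint p (fun y => A * l m y) = A * L m by rewrite pintZ.
have Q1 : quad n c (fun i m => pint p (fun y => - k (i + m)%N y +
     A * (l (i + m)%N y - (u (i + m)%N + b)^-1 * k (i + m)%N y))) =
   quad n c (fun i m => - K (i + m)%N + A * (L (i + m)%N - (u (i + m)%N + b)^-1 * K (i + m)%N)).
  by apply: eq_quad => i m _ _; rewrite PK.
have Q2 : quad n c (fun i m => pint p (fun y => A * l (i + m)%N y)) =
   quad n c (fun i m => A * L (i + m)%N).
  by apply: eq_quad => i m _ _; rewrite PL.
rewrite Q1 Q2 -!quadZ -!quadD in main.
rewrite -subr_le0 in main.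
set X := quad n c _ in main; set Y := quad n c _ in main.
have XY : X - Y = quad n c (fun i m => phit A b (u (i + m)%N)
    - (ldrift p + lsigma p ^+ 2 * A + lsigma p ^+ 2 * u (i + m)%N)).
  rewrite -[X in _ - X]mul1r -mulNr -quadZ /X -quadD; apply: eq_quad => i m _ _.
  congr (_ * _); rewrite /phit /phir -/(K _) (_ : (u _)^-1 * _ = K (i + m)%N); last first.
    by rewrite /K /k pintZ//; apply: pintegrable_ecomp; exact: ltW.
  move: (u0 (i + m)%N) (ub (i + m)%N).
  move: (u (i + m)%N) (K (i + m)%N) (L (i + m)%N) => x Kx Lx x0 xb.
  by field; rewrite gt_eqF.
have lin0 : quad n c (fun i m => ldrift p + lsigma p ^+ 2 * A + lsigma p ^+ 2 * u (i + m)%N) = 0.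
  rewrite (_ : quad _ _ _ = quad n c (fun i m =>
     (ldrift p + lsigma p ^+ 2 * A + lsigma p ^+ 2 * (i + j)%:R) + lsigma p ^+ 2 * m%:R)).
    rewrite quadD /quad [X in X + _]big1 ?add0r.
      rewrite exchange_big/= big1// => i _.
      under eq_bigr do rewrite -mulrA.
      by rewrite -mulr_suml c0 mul0r.
    move=> i _; rewrite -mulr_suml -mulr_sumr c0.
    by rewrite mulr0 mul0r.
  by apply: eq_quad => i m _ _; rewrite /u !natrD; congr (_ * _); ring.
have : quad n c (fun i k0 => phit A b (i + k0 + j)%:R) = X - Y.
  rewrite XY -[LHS]subr0 -{1}lin0 -[X in _ - X]mul1r -mulNr -quadZ -quadD.
  by apply: eq_quad => i m _ _; rewrite mulN1r.
by move=> ->.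
Qed.

End BernsteinTransform.

(** * Splitting off the Beta factor *)

Section BetaFactorization.
Context {R : realType} (p : laguerre_exponent R).
Implicit Types (A b t y u : R).
Hypothesis phi1 : 0 < phir p 1.

(** [1 / phit] is Hankel positive as the reciprocal of a conditionally negative sequence. The
    product of the [phit] is a product of reciprocals of [1 / phit], to which the Berg-Duran
    argument applies. *)
Lemma hpsd_prod_phit A b : 0 < A -> 0 < b -> density_ge0 p A b ->
  hpsd (fun n => \prod_(k < n) phit p A b k.+1%:R).
Proof.
move=> A0 b0 dens.
have pg k : (0 < k)%N -> phir p 1 <= phit p A b k%:R.
  move=> k0; have kp : 0 < k%:R :> R by rewrite ltr0n.
  apply: le_trans (phir_mono1 _ k0) _; rewrite /phit ler_peMr ?phir_ge0//.
  by rewrite lerDl divr_ge0 ?addr_ge0 ?ltW.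
apply: (eq_hpsd (a := fun n => \prod_(k < n) ((phit p A b k.+1%:R)^-1)^-1)).
  by move=> n; apply: eq_bigr => k _; rewrite invrK.
apply: (@hpsd_inv_prod_bounded _ (fun k => (phit p A b k%:R)^-1) (phir p 1)^-1).
  move=> k k0; have h := pg k k0.
  by rewrite invr_gt0 (lt_le_trans phi1 h)/= lef_pV2 ?posrE ?(lt_le_trans phi1 h).
move=> j j0; apply: (hpsd_invr_cnd (F := fun n => phit p A b (n + j)%:R)).
  by move=> n; apply: lt_le_trans phi1 (pg _ _); rewrite addn_gt0 j0 orbT.
by move=> n c c0; apply: phit_cnd.
Qed.

Lemma W_bet A b n : 0 < A -> 0 <= b ->
  W p n = bet b A n * \prod_(k < n) phit p A b k.+1%:R.
Proof.
move=> A0 b0; rewrite /W /bet -big_split/=; apply: eq_bigr => k _.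
have k0 : 0 < k.+1%:R :> R by rewrite ltr0n.
move: (k.+1%:R) k0 => x x0; rewrite /phit; field.
by apply/andP; split; rewrite gt_eqF//; lra.
Qed.

Lemma bfun_W A b K B : 0 < A -> 0 < b -> density_ge0 p A b ->
  bfun (bet b A) (fun n => 'C(n, K)%:R * bet b A n) B ->
  bfun (W p) (fun n => 'C(n, K)%:R * W p n) B.
Proof.
move=> A0 b0 dens h.
have := bfun_mul (hpsd_bet (ltW b0) A0) (hpsd_prod_phit A0 b0 dens) _ h.
rewrite big_ord0 => /(_ erefl) h'.
apply: eq_bfunl (eq_bfun _ h') => n; first by rewrite -W_bet// ltW.
by rewrite /= (W_bet n A0 (ltW b0)) mulrA.
Qed.

(** For [A = 1] the Beta moments are [(b + 1) / (n + b + 1)], so the Beta factor is just a division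
    by [n + b + 1]. This is the input for bounding dilations. *)
Lemma hpsd_addn_W b : 0 < b -> density_ge0 p 1 b ->
  hpsd (fun n => (n%:R + (b + 1)) * W p n).
Proof.
move=> b0 dens.
apply: (eq_hpsd (a := fun n => (b + 1) * \prod_(k < n) phit p 1 b k.+1%:R)).
  move=> n; rewrite (W_bet n ltr01 (ltW b0)) mulrA; congr (_ * _).
  elim: n => [|n IH]; first by rewrite bet0 add0r mulr1.
  rewrite {1}IH betS -nat1r.
  have n0 : 0 <= n%:R :> R by [].
  by field; rewrite gt_eqF//; lra.
by apply: hpsdZ (hpsd_prod_phit ltr01 b0 dens); lra.
Qed.

(** Drift plus iterated tail of [Pi], the quantity multiplied by [A] on the left of
    [density_ge0]. *)
Definition tail2 t := ldrift p + pint p (ramp t).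

Lemma tail2_ge0 t : 0 <= tail2 t.
Proof. by rewrite addr_ge0 ?ldrift_ge0//; apply: pint_ge0 => y _; apply: ramp_ge0. Qed.

Lemma tail2_le t s : 0 < t -> t <= s -> tail2 s <= tail2 t.
Proof.
move=> t0 ts; rewrite lerD2l; apply: le_pint; try exact: pintegrable_ramp.
  by apply: pintegrable_ramp; apply: lt_le_trans ts.
move=> y y0; rewrite /ramp ge_max; apply/andP; split; rewrite le_max; apply/orP.
  by left; lra.
by right.
Qed.

(* If [tail2 t] is large compared with its derivative [- pint p (step t)], then
   it has not decayed much at distance [1 / (2 A)] from [t]. *)
Lemma tail2_bad A t : 0 < A -> 0 < t -> pint p (step t) < A * tail2 t ->
  tail2 t <= 2 * tail2 (2 * A)^-1.
Proof.
move=> A0 t0 bad; set d := (2 * A)^-1.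
have d0 : 0 < d by rewrite invr_gt0 mulr_gt0.
have td : 0 < t + d by rewrite addr_gt0.
have h : tail2 t <= tail2 (t + d) + d * pint p (step t).
  rewrite /tail2 -addrA lerD2l -pintZ; last exact: pintegrable_step.
  have i1 := pintegrable_ramp p td; have i2 := pintegrableZ d (pintegrable_step p t0).
  rewrite -pintD//; apply: le_pint; first exact: pintegrable_ramp.
    exact: pintegrableD.
  move=> y y0; rewrite /ramp /step ge_max; case: ltP => ty.
    rewrite mulr1; apply/andP; split; last by rewrite addr_ge0 ?(ltW d0)// le_max lexx orbT.
    rewrite -lerBlDr le_max; apply/orP; left; lra.
  rewrite mulr0 addr0; apply/andP; split; rewrite le_max; apply/orP; right => //; lra.
have := tail2_le d0 (_ : d <= t + d); rewrite lerDr (ltW t0) => /(_ isT) h2.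
have h3 : d * pint p (step t) <= 2^-1 * tail2 t.
  apply: (@le_trans _ _ (d * (A * tail2 t))); first by rewrite ler_wpM2l// ltW.
  rewrite le_eqVlt; apply/orP; left; apply/eqP; rewrite /d; field.
  by rewrite gt_eqF.
by lra.
Qed.

(** Where [pint p (step t)] does not dominate [A tail2 t], [tail2_bad] bounds [tail2 t] by
    [2 tail2 (1 / (2 A))], of order [1 + A], and the term [A b sigma^2] absorbs it. That [b] grows
    only linearly in [A] is what yields geometric bounds in [chain_hyp_NP]. *)
Lemma density_sigma : 0 < lsigma p ^+ 2 ->
  exists2 C : R, 0 <= C & forall A, 0 < A ->
    exists b, [/\ 0 < b, b <= C * (1 + A) & density_ge0 p A b].
Proof.
move=> s0; set M := pint p (fun y => Num.min (y ^+ 2) y).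
have M0 : 0 <= M by apply: pint_ge0 => y y0; apply: minsq_ge0; exact: ltW.
have m0 := ldrift_ge0 p.
exists (2 * (ldrift p + 2 * M) / lsigma p ^+ 2 + 1).
  by rewrite addr_ge0// divr_ge0 ?(ltW s0)// mulr_ge0// addr_ge0// mulr_ge0.
move=> A A0; have d0 : 0 < (2 * A)^-1 by rewrite invr_gt0 mulr_gt0.
have t2 : tail2 (2 * A)^-1 <= (ldrift p + 2 * M) * (1 + A).
  apply: (@le_trans _ _ (ldrift p + (1 + 2 * A) * M)).
    rewrite lerD2l /M -pintZ; last exact: pintegrable_minsq.
    apply: le_pint; first exact: pintegrable_ramp.
      by apply: pintegrableZ; exact: pintegrable_minsq.
    move=> y y0; have := @minsq_bound _ (2 * A)^-1 y (ramp (2 * A)^-1 y) d0 y0.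
    rewrite invrK; apply.
      by rewrite /ramp ge_max (ltW y0) andbT lerBlDr lerDl ltW.
    by move=> yt; rewrite /ramp max_r// subr_le0.
  by nra.
set b := 2 * tail2 (2 * A)^-1 / lsigma p ^+ 2 + 1.
have b0 : 0 < b by rewrite ltr_wpDl// divr_ge0 ?(ltW s0)// mulr_ge0 ?tail2_ge0.
exists b; split => //.
  rewrite /b [leRHS]mulrDl mul1r; apply: lerD; last by rewrite lerDl ltW.
  by rewrite [leRHS]mulrAC ler_pM2r ?invr_gt0// -mulrA ler_pM2l.
move=> t t0.
have e1 : 1 <= expR (b * t) by rewrite -expR0 ler_expR mulr_ge0 ?ltW.
have P0 : 0 <= pint p (step t) by apply: pint_ge0 => y _; apply: step_ge0.
have G0 : 0 <= pint p (Gcap b t) by apply: pint_ge0 => y _; apply: Gcap_ge0.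
have AG : 0 <= A * pint p (Gcap b t) by rewrite mulr_ge0// ltW.
have S0 : 0 <= A * b * lsigma p ^+ 2 by apply: mulr_ge0; [apply: mulr_ge0|]; apply: ltW.
have P1 : pint p (step t) <= expR (b * t) * pint p (step t) by rewrite ler_peMl.
rewrite -/(tail2 t).
have [good|bad] := leP (A * tail2 t) (pint p (step t)); first by lra.
have h := tail2_bad A0 t0 bad.
have : A * tail2 t <= A * b * lsigma p ^+ 2.
  rewrite -mulrA ler_pM2l// /b mulrDl divfK ?gt_eqF// mul1r.
  by apply: le_trans h _; rewrite lerDl ltW.
by lra.
Qed.

Lemma ecompN_ge (z : R) : 0 <= z -> 2^-1 * z ^+ 2 <= ecomp (- z).
Proof.
move=> z0; rewrite -subr_ge0.
pose F (v : R) := expR (- (- 1 * v)) - 1 - v - 2^-1 * v ^+ 2.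
pose f (v : R) := expR (- (- 1 * v)) - 1 - v.
have dF (v : R) : is_derive v 1 F (f v).
  have d1 := is_derive_expRM (-1) v.
  rewrite /F; apply: is_derive_eq; rewrite /GRing.scale/= /f.
  by field.
have cf : continuous f.
  move=> v; apply: cvgB; last exact: cvg_id.
  by apply: cvgB; [exact: continuous_expRM|exact: cvg_cst].
have := FTC2_derive z0 dF cf.
rewrite /F !mulN1r !opprK expR0 expr0n/= mulr0 !subr0 subrr subr0 /ecomp opprK => <-.
apply: Rintegral_ge0 => v _; rewrite /f mulN1r opprK.
by have := expR_ge1Dx v; lra.
Qed.

(** The inequality is assumed on [(0, e]]. Beyond [e], [tail2] is at most [tail2 e] while the
    integral of [Gcap b t] is at least [b] times a positive constant, so a large [b] suffices. *)
Lemma density_small A e : 0 < A -> 0 < e -> 0 < pint p (step e) ->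
  (forall t, 0 < t <= e -> A * tail2 t <= pint p (step t)) ->
  exists2 b, 0 < b & density_ge0 p A b.
Proof.
move=> A0 e0 Pe good.
pose c := 2^-1 * e ^+ 2 * pint p (step e).
have c0 : 0 < c by rewrite !mulr_gt0 ?invr_gt0// exprn_gt0.
pose b := tail2 e / c + 1.
have b0 : 0 < b by rewrite ltr_wpDl// divr_ge0 ?tail2_ge0 ?ltW.
exists b => // t t0.
have P0 : 0 <= pint p (step t) by apply: pint_ge0 => y _; apply: step_ge0.
have G0 : 0 <= pint p (Gcap b t) by apply: pint_ge0 => y _; apply: Gcap_ge0.
have AG : 0 <= A * pint p (Gcap b t) by rewrite mulr_ge0// ltW.
have S0 : 0 <= A * b * lsigma p ^+ 2 by apply: mulr_ge0; [apply: mulr_ge0; apply: ltW|exact: sqr_ge0].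
have e1 : 1 <= expR (b * t) by rewrite -expR0 ler_expR mulr_ge0 ?ltW.
have P1 : pint p (step t) <= expR (b * t) * pint p (step t) by rewrite ler_peMl.
rewrite -/(tail2 t).
have [te|et] := leP t e; first by have := good t; rewrite t0 te => /(_ isT); lra.
suff : A * tail2 t <= A * pint p (Gcap b t) by lra.
rewrite ler_pM2l//; apply: le_trans (tail2_le e0 (ltW et)) _.
apply: (@le_trans _ _ (b * c)).
  by rewrite /b mulrDl divfK ?gt_eqF// mul1r lerDl ltW.
rewrite /c mulrA -pintZ; last exact: pintegrable_step.
apply: le_pint; first by apply: pintegrableZ; exact: pintegrable_step.
  exact: pintegrable_Gcap.
move=> y y0; rewrite /step; case: ltP => ey; last by rewrite mulr0 Gcap_ge0.
rewrite mulr1 /Gcap.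
have w0 : e <= Num.min t y by rewrite le_min !ltW.
have bw : 0 <= b * Num.min t y by rewrite mulr_ge0 ?(ltW b0)// (le_trans (ltW e0)).
apply: le_trans (_ : b^-1 * (2^-1 * (b * Num.min t y) ^+ 2) <= _); last first.
  by rewrite ler_pM2l ?invr_gt0//; apply: ecompN_ge.
rewrite exprMn [leRHS](_ : _ = b * (2^-1 * Num.min t y ^+ 2)); last first.
  by field; rewrite gt_eqF.
rewrite ler_pM2l// ler_pM2l ?invr_gt0// lerXn2r ?nnegrE ?(ltW e0)//.
by rewrite (le_trans (ltW e0)).
Qed.

End BetaFactorization.

(** * The density inequality in each class *)

Section Classes.
Context {R : realType} (p : laguerre_exponent R).
Implicit Types (A b t y u : R).
Local Notation D := (`]0%R, +oo[%classic : set (mR R)).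

Lemma PibarE t : 0 < t -> Pibar p t = (pint p (step t))%:E.
Proof.
move=> t0; rewrite /pint /Rintegral fineK; last first.
  exact: integrable_fin_num (pintegrable_step p t0).
transitivity (\int[lPi p]_(y in D) (\1_(`]t, +oo[%classic : set (mR R)) y)%:E)%E.
  rewrite integral_indic// /Pibar setIidl// => y /=; rewrite !in_itv/= !andbT.
  exact: lt_trans.
apply: eq_integral => y _; symmetry; rewrite indicE /step; congr ((nat_of_bool _)%:R%:E).
by apply/idP/idP; rewrite inE/= in_itv/= andbT.
Qed.

Lemma step_le t s : 0 < t -> t <= s -> pint p (step s) <= pint p (step t).
Proof.
move=> t0 ts; apply: le_pint; try exact: pintegrable_step.
  by apply: pintegrable_step; apply: lt_le_trans ts.
move=> y y0; rewrite /step; case: ltP => // sy.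
by rewrite (le_lt_trans ts sy).
Qed.

Lemma Pibar0E : Pibar p y @[y --> 0^'+] --> Pibar0 p /\
  Pibar0 p = ereal_sup (Pibar p @` `]0%R, +oo[%classic).
Proof.
have h : Pibar p y @[y --> 0^'+] --> ereal_sup (Pibar p @` `]0%R, +oo[%classic).
  apply: nonincreasing_at_right_cvge => // t s; rewrite !in_itv/= !andbT => t0 s0 ts.
  by rewrite !PibarE// lee_fin step_le.
have e : Pibar0 p = ereal_sup (Pibar p @` `]0%R, +oo[%classic).
  by rewrite /Pibar0; apply/cvg_lim.
by rewrite e.
Qed.

Lemma Pibar0_infty (M : R) : Pibar0 p = +oo%E ->
  exists2 e : R, 0 < e & forall t, 0 < t <= e -> M <= pint p (step t).
Proof.
have [_ ->] := Pibar0E => sup_oo.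
have : (M%:E < ereal_sup (Pibar p @` `]0%R, +oo[%classic))%E by rewrite sup_oo ltry.
move=> /ereal_sup_gt[y [e]]; rewrite /= in_itv/= andbT => e0 <-.
rewrite PibarE// lte_fin => Me; exists e => // t /andP[t0 te].
by apply: le_trans (ltW Me) _; apply: step_le.
Qed.

(** For infinite Levy mass, [pint p (step t)] exceeds near 0 the bound that [tail2_bad] puts on
    [A tail2 t], so there is no bad point near 0. *)
Lemma density_infty A : classNinfty p -> 0 < A -> exists2 b, 0 < b & density_ge0 p A b.
Proof.
move=> h A0.
have [s0|s0] := boolP (0 < lsigma p ^+ 2).
  have [C _ /(_ A A0) [b [b0 _ hb]]] := density_sigma s0.
  by exists b.
case: h => [h|h]; first by rewrite h in s0.
have [e e0 he] := Pibar0_infty (1 + A * (2 * tail2 p (2 * A)^-1)) h.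
have T0 : 0 <= A * (2 * tail2 p (2 * A)^-1).
  by rewrite mulr_ge0 ?(ltW A0)// mulr_ge0// tail2_ge0.
apply: (density_small A0 e0).
  by apply: lt_le_trans (he e _); rewrite ?e0 ?lexx//; lra.
move=> t /andP[t0 te]; rewrite leNgt; apply/negP => bad.
have := tail2_bad A0 t0 bad; rewrite -(ler_pM2l A0) => h1.
have := he t; rewrite t0 te => /(_ isT) h2.
by lra.
Qed.

(** * No Gaussian part and finite Levy mass *)

Section FiniteLevyMass.
Hypothesis s0 : ~ classNinfty p.

Lemma sigma0 : lsigma p = 0.
Proof.
apply/eqP; rewrite -sqrf_eq0; apply: contra_notT s0 => h.
by left; rewrite lt_neqAle eq_sym h sqr_ge0.
Qed.

Definition mass : R := fine (Pibar0 p).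

Lemma massE : Pibar0 p = mass%:E.
Proof.
rewrite /mass fineK// fin_numE; apply/andP; split; last first.
  by apply/eqP => h; apply: s0; right.
have [_ ->] := Pibar0E; rewrite -ltNye.
apply: (@lt_le_trans _ _ (Pibar p 1)); first by rewrite PibarE// ltNyr.
by apply: ereal_sup_ubound; exists 1 => //; rewrite /= in_itv/= andbT.
Qed.

Lemma step_le_mass t : 0 < t -> pint p (step t) <= mass.
Proof.
move=> t0; rewrite -lee_fin -massE (Pibar0E.2) -PibarE//.
by apply: ereal_sup_ubound; exists t => //; rewrite /= in_itv/= andbT.
Qed.

Lemma mass_ge0 : 0 <= mass.
Proof.
apply: le_trans (step_le_mass ltr01).
by apply: pint_ge0 => y _; apply: step_ge0.
Qed.

Lemma mass_gt M : M < mass -> exists2 e : R, 0 < e & forall t, 0 < t <= e -> M <= pint p (step t).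
Proof.
rewrite -lte_fin -massE (Pibar0E.2).
move=> /ereal_sup_gt[y [e]]; rewrite /= in_itv/= andbT => e0 <-.
rewrite PibarE// lte_fin => Me; exists e => // t /andP[t0 te].
by apply: le_trans (ltW Me) _; apply: step_le.
Qed.

Lemma lPi_mass : (lPi p D <= mass%:E)%E.
Proof.
pose F n : set (mR R) := `]n.+1%:R^-1, +oo[%classic.
have FD : \bigcup_n F n = D.
  apply/seteqP; split => [y [n _]|y]; rewrite /F /= !in_itv/= !andbT.
    by apply: lt_trans; rewrite invr_gt0.
  move=> y0; have := near_infty_natSinv_lt (PosNum y0) => -[n _ /(_ n (leqnn n))/= hn].
  by exists n => //=; rewrite in_itv/= andbT.
have : lPi p (F n) @[n --> \oo] --> lPi p (\bigcup_n F n).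
  apply: nondecreasing_cvg_mu => //.
    by move=> n; exact: measurable_itv.
    by rewrite FD; exact: measurable_itv.
  move=> n m nm; apply/subsetPset => y; rewrite /F /= !in_itv/= !andbT.
  by apply: le_lt_trans; rewrite lef_pV2 ?posrE// ler_nat ltnS.
rewrite FD => h; apply: (cvge_to_le h); near=> n.
have -> : lPi p (F n) = (pint p (step n.+1%:R^-1))%:E.
  by rewrite -PibarE// invr_gt0.
by rewrite lee_fin; apply: step_le_mass; rewrite invr_gt0.
Unshelve. all: by end_near. Qed.

Lemma pintegrable_cst (r : R) : pintegrable p (cst r).
Proof.
apply/integrableP; split; first by apply/measurable_EFinP; exact: measurable_cst.
under eq_integral do rewrite /=.
rewrite integral_cst//; apply: lte_mul_pinfty => //.
by apply: le_lt_trans lPi_mass _; rewrite ltry.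
Qed.

Lemma pint_1 : pint p (cst 1) <= mass.
Proof.
rewrite /pint Rintegral_cst// mul1r -lee_fin fineK ?lPi_mass//.
rewrite ge0_fin_numE//; exact: le_lt_trans lPi_mass (ltry _).
Qed.

Lemma pintegrable_id : pintegrable p (fun y => y).
Proof.
apply: (integrable_dominated (T := mR R)
  (g := fun y : R => 1 + Num.min (y ^+ 2) y)) => //.
  move=> y; rewrite pD => y0; rewrite ger0_norm ?(ltW y0)//.
  have [h|h] := leP (y ^+ 2) y; last by rewrite lerDr.
  have : 0 <= (1 - y) ^+ 2 by apply: sqr_ge0.
  by rewrite sqrrB expr1n mul1r mulr2n; have := sqr_ge0 y; nra.
apply: pintegrableD; first exact: pintegrable_cst.
exact: pintegrable_minsq.
Qed.

(** The number [r]: the first moment of [Pi] is its iterated tail at 0+. *)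
Definition phi_lim : R := ldrift p + pint p (fun y => y).

Lemma tail2_rad t : 0 < t -> tail2 p t <= phi_lim.
Proof.
move=> t0; rewrite lerD2l; apply: le_pint; [exact: pintegrable_ramp|exact: pintegrable_id|].
by move=> y y0; rewrite /ramp ge_max (ltW y0) andbT lerBlDr lerDl ltW.
Qed.

(** [u^-1 ecomp (u y)] falls short of [y] by at most [1 / u], and [Pi] has total mass at most
    [mass]. The rate [mass / u] decides the exponent in [binom_unbounded]. *)
Lemma phir_rad u : 0 < u -> phir p u <= phi_lim /\ phi_lim - mass / u <= phir p u.
Proof.
move=> u0; have ui : 0 < u^-1 by rewrite invr_gt0.
have i1 := pintegrableZ u^-1 (pintegrable_ecomp p (ltW u0)).
rewrite /phir sigma0 expr0n/= mul0r addr0 -pintZ; last exact: pintegrable_ecomp (ltW u0).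
have E y : u^-1 * ecomp (u * y) = y - u^-1 * (1 - expR (- (u * y))).
  by rewrite /ecomp; field; rewrite gt_eqF.
split.
  rewrite lerD2l; apply: le_pint => //; first exact: pintegrable_id.
  move=> y y0; rewrite E gerBl mulr_ge0 ?(ltW ui)// subr_ge0 expRN_le1//.
  by rewrite mulr_ge0 ?ltW.
apply: (@le_trans _ _ (ldrift p + (pint p (fun y => y) - pint p (cst u^-1)))).
  rewrite /phi_lim -addrA lerD2l lerD2l lerN2.
  rewrite (_ : cst _ = fun y => u^-1 * cst 1 y); last by apply/funext => y; rewrite mulr1.
  rewrite pintZ; last exact: pintegrable_cst.
  by rewrite mulrC ler_wpM2r ?pint_1// ltW.
rewrite lerD2l -pintB; [|exact: pintegrable_id|exact: pintegrable_cst].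
apply: le_pint => //.
  by apply: pintegrableB; [exact: pintegrable_id|exact: pintegrable_cst].
move=> y y0; rewrite E lerD2l lerN2 ler_piMr ?(ltW ui)//.
Qed.

Lemma phi_inftyE : phi_infty p = phi_lim%:E.
Proof.
rewrite /phi_infty; apply/cvg_lim => //.
have : phir p u @[u --> +oo] --> phi_lim.
  apply: (@squeeze_cvgr _ _ _ _ (fun u => phi_lim - mass / u) (fun=> phi_lim)).
  - near=> u; have u0 : 0 < u by near: u; exact: nbhs_pinfty_gt.
    by have [-> ->] := phir_rad u0.
  - rewrite -[X in _ --> X]subr0; apply: cvgB; first exact: cvg_cst.
    rewrite -[X in _ --> X](mulr0 mass); apply: cvgM; first exact: cvg_cst.
    apply/(gtr0_cvgV0 (f := fun u : R => u)); first exact: nbhs_pinfty_gt.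
    exact: cvg_id.
  - exact: cvg_cst.
move=> h; have {}h : (EFin \o phir p) @ +oo --> phi_lim%:E by apply: cvg_EFin; [exact: filterE|exact: h].
apply: cvg_trans h; apply: near_eq_cvg; near=> u.
by rewrite /= phiE//; near: u; exact: nbhs_pinfty_gt.
Unshelve. all: by end_near. Qed.

(** Near 0 the tail is as close as wanted to the total mass, while [tail2] never exceeds [phi_lim].
    The condition [A phi_lim < mass], combined with [2 n < A], is the threshold on [n]. *)
Lemma density_mass A : 0 < A -> 0 < mass -> A * phi_lim < mass ->
  exists2 b, 0 < b & density_ge0 p A b.
Proof.
move=> A0 m0 Am.
have [e1 e10 h1] := mass_gt Am.
have m2 : mass / 2 < mass by rewrite ltr_pdivrMr// mulr_natr mulr2n ltrDl.
have [e2 e20 h2] := mass_gt m2.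
pose e := Num.min e1 e2.
have e0 : 0 < e by rewrite lt_min e10 e20.
apply: (density_small A0 e0).
  apply: lt_le_trans (h2 e _); first by rewrite divr_gt0.
  by rewrite e0 ge_min lexx orbT.
move=> t /andP[t0 te]; apply: le_trans (h1 t _); last first.
  by rewrite t0 (le_trans te)// ge_min lexx.
by rewrite ler_pM2l// tail2_rad.
Qed.

Hypothesis phi1 : 0 < phir p 1.

Lemma phi_lim_gt0 : 0 < phi_lim.
Proof. by apply: lt_le_trans phi1 (phir_rad ltr01).1. Qed.

Lemma W_double n : W p (n + n) <= W p n * phi_lim ^+ n.
Proof.
rewrite /W big_split_ord/= ler_pM2l; last by apply: prodr_gt0 => k _; exact: phir_gt0.
rewrite -[X in phi_lim ^+ X]card_ord -prodr_const; apply: ler_prod => k _.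
by rewrite (ltW (phir_gt0 phi1 _))/= (phir_rad _).1.
Qed.

(* With [q = mass / phi_lim], [W_k / phi_lim ^ k] is at least of order [k ^ (- q)],
   while [W_(2k) <= W_k phi_lim ^ k] and ['C(k, n)] is of order [k ^ n]. *)
Lemma binom_unbounded n (B : R) : mass < 2 * n%:R * phi_lim ->
  exists k, B * W p (k + k) < ('C(k, n)%:R * W p k) ^+ 2.
Proof.
move=> mn; have r0 := phi_lim_gt0.
pose q := mass / phi_lim.
have qn : q < 2 * n%:R by rewrite ltr_pdivrMr.
have q0 : 0 <= q by rewrite divr_ge0 ?mass_ge0// ltW.
have n0 : (0 < n)%N.
  by rewrite lt0n; apply/eqP => n00; rewrite n00 in qn; lra.
pose rho k := 'C(k, n)%:R ^+ 2 * (W p k / phi_lim ^+ k) : R.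
have rho0 k : (n <= k)%N -> 0 < rho k.
  by move=> nk; rewrite mulr_gt0 ?exprn_gt0 ?divr_gt0 ?W_gt0 ?exprn_gt0 ?ltr0n ?bin_gt0.
suff [k nk Bk] : exists2 k, (n <= k)%N & B < rho k.
  exists k; have Wk := W_gt0 phi1 k.
  have W2 := W_double k.
  have rk : 0 < phi_lim ^+ k by rewrite exprn_gt0.
  have : B * (W p k * phi_lim ^+ k) < ('C(k, n)%:R * W p k) ^+ 2.
    rewrite exprMn expr2 (_ : _ * (W p k * W p k) = rho k * (W p k * phi_lim ^+ k)).
      by rewrite ltr_pM2r// mulr_gt0.
    by rewrite /rho; field; rewrite gt_eqF.
  have [B0|B0] := leP 0 B; first by apply: le_lt_trans; rewrite ler_wpM2l.
  move=> _; apply: (@lt_le_trans _ _ 0); last exact: sqr_ge0.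
  by rewrite nmulr_rlt0// W_gt0.
(* Half of the growth exponent [2 n - q] of [rho]. The other half pays for the second-order terms,
   from the index [k1] on. *)
pose e := (2 * n%:R - q) / 2.
have e0 : 0 < e by rewrite divr_gt0// subr_gt0.
have nr : 0 < n%:R :> R by rewrite ltr0n.
have [k1 k1n hk1] : exists2 k1, (n <= k1)%N & (n%:R ^+ 2 * (1 + e)) / e <= k1%:R.
  pose x := (n%:R ^+ 2 * (1 + e)) / e.
  exists (n + (Num.truncn `|x|).+1)%N; first exact: leq_addr.
  rewrite natrD; apply: ler_wpDl => //.
  by apply: le_trans (ler_norm _) _; apply/ltW; exact: truncnS_gt.
have step k : (k1 <= k)%N -> rho k * (1 + e / k.+1%:R) <= rho k.+1.
  move=> kk; have nk : (n <= k)%N by rewrite (leq_trans k1n).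
  have kp : 0 < k.+1%:R :> R by rewrite ltr0n.
  have nk' : n%:R < k.+1%:R :> R by rewrite ltr_nat ltnS.
  have eC : ('C(k.+1, n)%:R : R) = 'C(k, n)%:R / (1 - n%:R / k.+1%:R).
    have := mul_bin_down k.+1 n => /(congr1 (fun z => z%:R : R)); rewrite !natrM.
    rewrite natrB ?(leq_trans nk)//.
    move=> h; apply: (mulfI (x := k.+1%:R - n%:R)); first by rewrite gt_eqF// subr_gt0.
    rewrite -h; move: (k.+1%:R : R) kp nk' => x x0 nx; field.
    have xn : 0 < x - n%:R by rewrite subr_gt0.
    by rewrite (gt_eqF x0) (gt_eqF xn).
  have [_ lo] := phir_rad kp.
  have y0 : 0 < 1 - n%:R / k.+1%:R :> R by rewrite subr_gt0 ltr_pdivrMr// mul1r.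
  rewrite /rho eC WS (exprS phi_lim).
  rewrite [leRHS](_ : _ =
     'C(k, n)%:R ^+ 2 * (W p k / phi_lim ^+ k) * (phir p k.+1%:R / phi_lim / (1 - n%:R / k.+1%:R) ^+ 2)); last first.
    move: (1 - n%:R / k.+1%:R : R) y0 => z z0; move: (phir p _) => f; field.
    by rewrite !gt_eqF ?exprn_gt0.
  rewrite ler_wpM2l ?(ltW (rho0 k nk))// ler_pdivlMr ?exprn_gt0//.
  apply: (@le_trans _ _ (1 - q / k.+1%:R)); last first.
    rewrite ler_pdivlMr// /q mulrBl mul1r.
    by apply: le_trans lo; rewrite lerD2l lerN2 mulrAC divfK// gt_eqF.
  have hk : n%:R ^+ 2 * (1 + e) <= e * k.+1%:R.
    have : k1%:R <= k.+1%:R :> R by rewrite ler_nat ltnW.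
    move=> h; have := le_trans hk1 h; by rewrite ler_pdivrMr// [_ * e]mulrC.
  have k1r : 1 <= k.+1%:R :> R by rewrite ler1n.
  move: (k.+1%:R) kp nk' y0 hk k1r => x x0 nx y0 hx x1.
  have z0 : 0 < x^-1 by rewrite invr_gt0.
  have hz : n%:R ^+ 2 * (1 + e) * x^-1 <= e by rewrite -ler_pdivlMr ?invr_gt0// invrK.
  have z1 : x^-1 <= 1 by rewrite invf_le1.
  have qe : q = 2 * n%:R - 2 * e by rewrite /e; field.
  move: (x^-1) z0 hz z1 => z z0 hz z1.
  rewrite qe sqrrB expr1n mul1r -mulr_natl exprMn.
  have a1 : n%:R ^+ 2 * (1 + e) * z * z <= e * z by rewrite ler_wpM2r// ltW.
  have a2 : 0 <= n%:R ^+ 2 * e * z * z * (1 - z).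
    apply: mulr_ge0; last by rewrite subr_ge0.
    have n2 := sqr_ge0 (n%:R : R).
    by apply: mulr_ge0 (ltW z0); apply: mulr_ge0 (ltW z0); apply: mulr_ge0 (ltW e0).
  have a3 : 0 <= 2 * n%:R * e * z * z by apply: mulr_ge0 (ltW z0); apply: mulr_ge0 (ltW z0); apply: mulr_ge0 (ltW e0); rewrite mulr_ge0.
  by nra.
have grow k : rho k1 * (1 + e * (\sum_(j < k) (k1 + j).+1%:R^-1)) <= rho (k1 + k)%N.
  elim: k => [|k IH]; first by rewrite big_ord0 mulr0 addr0 mulr1 addn0.
  rewrite addnS; apply: le_trans (step _ (leq_addr _ _)).
  have s1 : 0 <= e * \sum_(j < k) (k1 + j).+1%:R^-1.
    by rewrite mulr_ge0 ?(ltW e0)// sumr_ge0.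
  have c0 : 0 <= e / (k1 + k).+1%:R by rewrite divr_ge0// ltW.
  have c1 : 0 <= 1 + e / (k1 + k).+1%:R by rewrite addr_ge0.
  apply: le_trans (ler_wpM2r c1 IH).
  rewrite -[leRHS]mulrA; apply: ler_wpM2l; first exact: ltW (rho0 _ k1n).
  rewrite big_ord_recr/= mulrDr; clear c1; move: s1 c0.
  by move: (e * _) (e / _) => s c s1 c0; have := mulr_ge0 s1 c0; lra.
have [k hk] : exists k, B < rho k1 * (1 + e * (\sum_(j < k) (k1 + j).+1%:R^-1)).
  apply: contrapT => hno.
  apply: (@dvg_harmonic R).
  apply: nondecreasing_is_cvgn.
    by apply/nondecreasing_seqP => m; rewrite !seriesEord/= big_ord_recr/= lerDl invr_ge0.
  pose S := \sum_(j < k1) j.+1%:R^-1 : R.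
  exists (S + (B / rho k1 - 1) / e) => _ [m _ <-].
  rewrite seriesEord/=; apply: (@le_trans _ _ (\sum_(j < k1 + m) j.+1%:R^-1)).
    by rewrite addnC big_split_ord/= lerDl sumr_ge0.
  rewrite big_split_ord/= lerD2l leNgt; apply/negP => hm; apply: hno; exists m.
  move: hm; rewrite ltr_pdivrMr// ltrBlDr ltr_pdivrMr ?rho0// => /lt_le_trans; apply.
  by rewrite mulrC addrC [_ * e]mulrC.
exists (k1 + k)%N; first by rewrite (leq_trans k1n)// leq_addr.
exact: lt_le_trans hk (grow k).
Qed.

End FiniteLevyMass.
End Classes.

(** * Binomial identities and the polynomials [P_n] *)

Section BinomialSums.
Context {R : realType}.
Implicit Types (x : nat -> R) (p q : {poly R}) (c y : R).

Lemma sum_ord_widen (V : zmodType) n N (F : nat -> V) : (n <= N)%N ->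
  (forall i, (n <= i)%N -> F i = 0) -> \sum_(i < N) F i = \sum_(i < n) F i.
Proof.
move=> /subnKC <- F0; rewrite big_split_ord/= [X in _ + X]big1 ?addr0// => i _.
by rewrite F0// leq_addr.
Qed.

Lemma coef_addXn y n k : ((y%:P + 'X) ^+ n)`_k = 'C(n, k)%:R * y ^+ (n - k).
Proof.
have E i : (((y%:P ^+ (n - i) * 'X^i) *+ 'C(n, i)) : {poly R})`_k =
    y ^+ (n - i) * (k == i)%:R * 'C(n, i)%:R.
  by rewrite coefMn -polyC_exp coefCM coefXn -[LHS]mulr_natr.
rewrite exprDn coef_sum; under eq_bigr do rewrite E.
case: (leqP k n) => kn.
  rewrite (bigD1 (Ordinal (kn : (k < n.+1)%N)))//= eqxx mulr1 mulrC big1 ?addr0// => i.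
  by rewrite -val_eqE/= eq_sym => /negPf ->; rewrite mulr0 mul0r.
rewrite bin_small// mul0r big1// => i _.
by rewrite gtn_eqF ?mulr0 ?mul0r// (leq_ltn_trans _ kn)// -ltnS.
Qed.

(** Coefficient of ['X^k] in the two expansions of [(1 - (y + 'X)) ^ n]. *)
Lemma sbin n k y N : (n < N)%N ->
  \sum_(i < N) (-1) ^+ i * 'C(n, i)%:R * ('C(i, k)%:R * y ^+ (i - k)) =
  (-1) ^+ k * 'C(n, k)%:R * (1 - y) ^+ (n - k).
Proof.
move=> nN.
rewrite (sum_ord_widen (n := n.+1)
  (F := fun i => (-1) ^+ i * 'C(n, i)%:R * ('C(i, k)%:R * y ^+ (i - k))))//; last first.
  by move=> i ni; rewrite (bin_small ni) mulr0 mul0r.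
have sg p i : (- p) ^+ i = (-1) ^+ i *: p ^+ i :> {poly R} by rewrite -scaleN1r exprZn.
have E i : (-1) ^+ i * 'C(n, i)%:R * ('C(i, k)%:R * y ^+ (i - k)) =
    ((1 ^+ (n - i) * (- (y%:P + 'X)) ^+ i) *+ 'C(n, i) : {poly R})`_k.
  by rewrite expr1n mul1r coefMn sg coefZ -coef_addXn -mulr_natr; ring.
under eq_bigr do rewrite E.
rewrite -coef_sum -exprDn (_ : 1 + - (y%:P + 'X) = - ((y - 1)%:P + 'X)); last first.
  by rewrite rmorphB/= rmorph1; ring.
rewrite sg coefZ coef_addXn.
case: (leqP k n) => kn; last by rewrite bin_small// !(mul0r, mulr0).
rewrite -(opprB 1 y) (exprNn (1 - y)) -{1}(subnKC kn) exprD.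
have := sqrr_sign R (n - k); rewrite expr2.
move: ((-1) ^+ (n - k)) => s ss.
transitivity ((-1) ^+ k * 'C(n, k)%:R * (1 - y) ^+ (n - k) * (s * s)); first by ring.
by rewrite ss mulr1.
Qed.

Lemma sbin1 n k N : (n < N)%N ->
  \sum_(i < N) (-1) ^+ i * 'C(n, i)%:R * 'C(i, k)%:R = (-1) ^+ n * (n == k)%:R :> R.
Proof.
move=> /(@sbin n k 1) h.
transitivity (\sum_(i < N) (-1) ^+ i * 'C(n, i)%:R * ('C(i, k)%:R * 1 ^+ (i - k)) : R).
  by apply: eq_bigr => i _; rewrite expr1n mulr1.
rewrite h subrr expr0n subn_eq0; case: (ltngtP n k) => nk /=; rewrite ?mulr0 ?mulr1//.
  by rewrite bin_small// mulr0.
by rewrite -nk binn mulr1.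
Qed.

(** Vandermonde, read as the Cholesky factorization of the kernel ['C(i + j, i)]; this is the
    orthonormality of the classical Laguerre polynomials. *)
Lemma binDE i j N : (i < N)%N ->
  'C(i + j, i)%:R = \sum_(l < N) 'C(i, l)%:R * 'C(j, l)%:R :> R.
Proof.
move=> iN; rewrite (sum_ord_widen (n := i.+1) (F := fun l => 'C(i, l)%:R * 'C(j, l)%:R))//; last first.
  by move=> l il; rewrite bin_small ?mul0r.
rewrite addnC -binomial.Vandermonde natr_sum; apply: eq_bigr => l _.
have li : (l <= i)%N by rewrite -ltnS.
by rewrite natrM (bin_sub li) mulrC.
Qed.

Section Laguerre.
Variable x : nat -> R.
Hypothesis x_gt0 : forall n, 0 < x n.

Definition lpoly n : {poly R} :=
  \sum_(k < n.+1) ((-1) ^+ k * ('C(n, k)%:R / x k)) *: 'X^k.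

(** Value at ['X^n] of the functional [q |-> \int x ^ k q^(k) / k!]; up to the sign [(-1) ^ k] it is
    dual to [lpoly]. *)
Definition binw k n : R := 'C(n, k)%:R * x n.

Lemma lpolyE n N : (n < N)%N ->
  lpoly n = \sum_(k < N) ((-1) ^+ k * ('C(n, k)%:R / x k)) *: 'X^k.
Proof.
move=> nN; rewrite (sum_ord_widen (n := n.+1)
  (F := fun k => ((-1) ^+ k * ('C(n, k)%:R / x k)) *: 'X^k))// => i ni.
by rewrite bin_small// mul0r mulr0 scale0r.
Qed.

Lemma size_lpoly n : (size (lpoly n) <= n.+1)%N.
Proof.
apply: leq_trans (size_sum _ _ _) _; apply/bigmax_leqP => k _.
by apply: leq_trans (size_scale_leq _ _) _; rewrite size_polyXn.
Qed.

Lemma mom_lpoly (y : nat -> R) n N : (n < N)%N ->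
  mom y (lpoly n) = \sum_(i < N) (-1) ^+ i * 'C(n, i)%:R * (y i / x i).
Proof.
move=> nN; rewrite (lpolyE nN) mom_sum; apply: eq_bigr => i _.
by rewrite momZ momXn; ring.
Qed.

Lemma mom_binw_lpoly n k : mom (binw k) (lpoly n) = (-1) ^+ n * (n == k)%:R.
Proof.
rewrite (mom_lpoly _ (ltnSn n)) -(sbin1 k (ltnSn n)); apply: eq_bigr => i _.
by rewrite /binw mulfK// gt_eqF.
Qed.

Lemma Xn_lpoly n N : (n < N)%N ->
  'X^n = \sum_(k < N) (x n * ((-1) ^+ k * 'C(n, k)%:R)) *: lpoly k.
Proof.
move=> nN.
under eq_bigr => k _ do rewrite (lpolyE (ltn_ord k)) scaler_sumr.
rewrite exchange_big/= (bigD1 (Ordinal nN))//= [X in _ + X]big1 ?addr0; last first.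
  move=> i; rewrite -val_eqE/= => ni.
  under eq_bigr do rewrite scalerA.
  rewrite -scaler_suml (_ : \sum_(_ < _) _ = 0) ?scale0r//.
  have := sbin1 i nN; rewrite eq_sym (negPf ni) mulr0 => h.
  transitivity (x n * (-1) ^+ i / x i *
    \sum_(k < N) (-1) ^+ k * 'C(n, k)%:R * 'C(k, i)%:R); last by rewrite h mulr0.
  by rewrite mulr_sumr; apply: eq_bigr => k _; ring.
under eq_bigr do rewrite scalerA.
rewrite -scaler_suml (_ : \sum_(_ < _) _ = 1) ?scale1r//.
have := sbin1 n nN; rewrite eqxx mulr1 => h.
transitivity (x n * (-1) ^+ n / x n *
    \sum_(k < N) (-1) ^+ k * 'C(n, k)%:R * 'C(k, n)%:R).
  by rewrite mulr_sumr; apply: eq_bigr => k _; ring.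
rewrite h; have := sqrr_sign R n; rewrite expr2; move: ((-1) ^+ n) => s ss.
rewrite -[RHS]ss; field; exact: lt0r_neq0.
Qed.

Lemma poly_lpoly q N : (size q <= N)%N ->
  q = \sum_(k < N) ((-1) ^+ k * mom (binw k) q) *: lpoly k.
Proof.
move=> sq; have qE : q = \sum_(n < N) q`_n *: 'X^n.
  by rewrite -poly_def; apply/polyP => i; rewrite coef_poly; case: ltnP => // Ni;
    rewrite nth_default// (leq_trans sq).
rewrite {1}qE; under eq_bigr => n _ do rewrite (Xn_lpoly (ltn_ord n)) scaler_sumr.
rewrite exchange_big/=; apply: eq_bigr => k _; under eq_bigr do rewrite scalerA.
rewrite -scaler_suml; congr (_ *: _); rewrite (momE _ sq) mulr_sumr.
by apply: eq_bigr => n _; rewrite /binw; ring.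
Qed.

(* The Bessel inequality reduces by Schur's theorem to the orthonormality of
   the classical Laguerre polynomials, the case [x n = n!]. *)
Lemma bessel_lpoly N (c : nat -> R) : hpsd x -> hpsd (fun n => n`!%:R / x n) ->
  x 0%N = 1 -> mom x ((\sum_(n < N) c n *: lpoly n) ^+ 2) <= \sum_(n < N) c n ^+ 2.
Proof.
move=> hx hm x0.
pose a k : R := (-1) ^+ k * \sum_(n < N) c n * 'C(n, k)%:R.
pose m n : R := n`!%:R / x n.
have fp n : n`!%:R != 0 :> R by rewrite pnatr_eq0 -lt0n fact_gt0.
have -> : \sum_(n < N) c n *: lpoly n = \poly_(k < N) (a k / x k).
  under eq_bigr => n _ do rewrite (lpolyE (ltn_ord n)) scaler_sumr.
  rewrite exchange_big poly_def/=; apply: eq_bigr => k _.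
  under eq_bigr do rewrite scalerA.
  rewrite -scaler_suml; congr (_ *: _); rewrite /a mulr_sumr mulr_suml.
  by apply: eq_bigr => n _; ring.
rewrite -quad_mom.
pose d k := a k / k`!%:R.
(* Written with [m], both sides of the inequality are Schur products with [x], of the kernels
   [m_i m_j] and [m_(i + j)] respectively. *)
have q1 : quad N (fun k => a k / x k) (fun i j => x (i + j)%N) =
    quad N d (fun i j => x (i + j)%N * (m i * m j)).
  apply: eq_quad => i j _ _; rewrite /d /m; field.
  by rewrite !fp !lt0r_neq0.
have q2 : quad N d (fun i j => x (i + j)%N * m (i + j)%N) = \sum_(n < N) c n ^+ 2.
  transitivity (quad N a (fun i j => \sum_(l < N) 'C(i, l)%:R * 'C(j, l)%:R)).
    apply: eq_quad => i j iN _; rewrite -(binDE _ iN) /d /m.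
    have := bin_fact (leq_addr j i); rewrite addKn => /(congr1 (fun z => z%:R : R)).
    rewrite !natrM => <-.
    by field; rewrite !fp lt0r_neq0.
  transitivity (\sum_(l < N) (\sum_(i < N) a i * 'C(i, l)%:R) ^+ 2).
    transitivity (\sum_(l < N) quad N a (fun i j => 'C(i, l)%:R * 'C(j, l)%:R)).
      rewrite /quad [RHS]exchange_big/=; apply: eq_bigr => i _.
      by rewrite [RHS]exchange_big/=; apply: eq_bigr => j _; rewrite mulr_sumr.
    by apply: eq_bigr => l _; rewrite quad_rank1.
  apply: eq_bigr => l _; rewrite (_ : \sum_(i < N) _ = (-1) ^+ l * c l).
    by rewrite exprMn sqrr_sign mul1r.
  under eq_bigr do rewrite /a mulr_sumr mulr_suml.
  rewrite exchange_big/= (bigD1 l)//= [X in _ + X]big1 ?addr0.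
    have := sbin1 l (ltn_ord l); rewrite eqxx mulr1 => <-.
    by rewrite mulr_suml; apply: eq_bigr => i _; ring.
  move=> n nl; have := sbin1 l (ltn_ord n); rewrite -val_eqE/= in nl; rewrite (negPf nl) mulr0 => h.
  transitivity (c n * \sum_(i < N) (-1) ^+ i * 'C(n, i)%:R * 'C(i, l)%:R); last by rewrite h mulr0.
  by rewrite mulr_sumr; apply: eq_bigr => i _; ring.
rewrite q1 -q2 -subr_ge0 -mulN1r -quadZ -quadD.
have m0 : m 0%N = 1 by rewrite /m x0 fact0 divr1.
have [_ h] := psd_mul hx (hpsd_sub_rank1 hm m0).
rewrite (_ : quad _ _ _ = quad N d (fun i j => x (i + j)%N * (m (i + j)%N - m i * m j))) ?h//.
by apply: eq_quad => i j _ _; ring.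
Qed.

(* On polynomials, the semigroup at time [t], with [c = exp (- t)]. *)
Definition lag_sg c q : {poly R} :=
  \sum_(k < size q) (c ^+ k / x k * mom (fun n => (1 - c) ^+ (n - k) * binw k n) q) *: 'X^k.

Lemma mom_small (y : nat -> R) q k : (size q <= k)%N -> mom (fun n => y n * binw k n) q = 0.
Proof.
move=> qk; rewrite /mom big1// => i _.
by rewrite /binw bin_small ?mul0r ?mulr0// (leq_trans _ qk).
Qed.

Lemma lag_sgE c q N : (size q <= N)%N -> lag_sg c q =
  \sum_(k < N) (c ^+ k / x k * mom (fun n => (1 - c) ^+ (n - k) * binw k n) q) *: 'X^k.
Proof.
move=> qN; rewrite (sum_ord_widen (n := size q)
  (F := fun k => (c ^+ k / x k * mom (fun n => (1 - c) ^+ (n - k) * binw k n) q) *: 'X^k))// => i ni.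
by rewrite mom_small// mulr0 scale0r.
Qed.

Lemma lag_sgD c p q : lag_sg c (p + q) = lag_sg c p + lag_sg c q.
Proof.
pose N := maxn (size p) (size q).
rewrite !(@lag_sgE _ _ N) ?leq_maxl ?leq_maxr ?size_polyD// -big_split/=.
by apply: eq_bigr => k _; rewrite momD mulrDr scalerDl.
Qed.

Lemma lag_sgZ c r q : lag_sg c (r *: q) = r *: lag_sg c q.
Proof.
rewrite !(@lag_sgE _ _ (size q)) ?size_scale_leq// scaler_sumr.
by apply: eq_bigr => k _; rewrite momZ scalerA; congr (_ *: _); ring.
Qed.

Lemma lag_sg_sum c N (r : nat -> R) (f : nat -> {poly R}) :
  lag_sg c (\sum_(k < N) r k *: f k) = \sum_(k < N) r k *: lag_sg c (f k).
Proof.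
elim: N => [|N IH]; last by rewrite !big_ord_recr/= lag_sgD lag_sgZ IH.
by rewrite !big_ord0 /lag_sg size_poly0 big_ord0.
Qed.

(** [sbin] with [y = 1 - c]: the value [1 - y = c] supplies the missing power [c ^ (n - k)]. *)
Lemma lag_sg_lpoly c n : lag_sg c (lpoly n) = c ^+ n *: lpoly n.
Proof.
rewrite (lag_sgE _ (size_lpoly n)) /lpoly scaler_sumr; apply: eq_bigr => k _.
rewrite scalerA (mom_lpoly _ (ltnSn n)); congr (_ *: _).
have kn : (k <= n)%N by rewrite -ltnS.
transitivity (c ^+ k / x k * \sum_(i < n.+1) (-1) ^+ i * 'C(n, i)%:R *
    ('C(i, k)%:R * (1 - c) ^+ (i - k))).
  congr (_ * _); apply: eq_bigr => i _; rewrite /binw; field; exact: lt0r_neq0.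
have cE : c ^+ n = c ^+ k * c ^+ (n - k) by rewrite -exprD subnKC.
by rewrite sbin// subKr cE; ring.
Qed.

End Laguerre.
End BinomialSums.

(** * Dominated convergence for series *)

Section DominatedSums.
Context {R : realType}.

Lemma geo_half_le N K : \sum_(i < N) (2^-1 : R) ^+ (K + i) <= 2 * 2^-1 ^+ K.
Proof.
under eq_bigr do rewrite exprD.
rewrite -mulr_sumr mulrC ler_wpM2r ?exprn_ge0//.
suff -> : \sum_(i < N) (2^-1 : R) ^+ i = 2 - 2 * 2^-1 ^+ N by rewrite gerBl mulr_ge0// exprn_ge0.
elim: N => [|N IH]; first by rewrite big_ord0 expr0 mulr1 subrr.
by rewrite big_ord_recr/= IH exprS; field.
Qed.

Lemma cvg_geo_half (e : R) : 0 < e -> exists K, 2^-1 ^+ K < e.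
Proof.
move=> e0; have : (2^-1 : R) ^+ n @[n --> \oo] --> (0 : R).
  by apply: cvg_expr; rewrite ger0_norm// invf_lt1// ltr1n.
move=> /cvgr0_norm_lt /(_ _ e0) [K _ /(_ K (leqnn K))/=].
by rewrite ger0_norm ?exprn_ge0// => h; exists K.
Qed.

(** The bound is uniform in the number of terms, because it is applied to sums of length
    [size (q j)], over which there is no control as [j] varies. *)
Lemma sum_geo_dominated (u : nat -> nat -> R) (G : R) :
  (forall j k, `|u j k| <= G * 2^-1 ^+ k) ->
  (forall k e, 0 < e -> exists J, forall j, (J <= j)%N -> `|u j k| <= e) ->
  forall e, 0 < e -> exists J, forall j, (J <= j)%N -> forall N, \sum_(k < N) `|u j k| <= e.
Proof.
move=> uG u0 e e0.
have G0 : 0 <= G by have := le_trans (normr_ge0 _) (uG 0%N 0%N); rewrite expr0 mulr1.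
have G1 : 0 < G + 1 by rewrite ltr_wpDl.
have [K hK] : exists K, (2^-1 : R) ^+ K < e / 4 / (G + 1).
  by apply: cvg_geo_half; rewrite !divr_gt0.
have [J hJ] : exists J, forall j, (J <= j)%N -> \sum_(k < K) `|u j k| <= e / 2.
  pose e' := e / 2 / K.+1%:R.
  have e'0 : 0 < e' by rewrite !divr_gt0.
  pose Jk k := xget 0%N [set J | forall j, (J <= j)%N -> `|u j k| <= e'].
  have hJk k : forall j, (Jk k <= j)%N -> `|u j k| <= e'.
    by apply: (xgetPex 0%N) (u0 k e' e'0).
  exists (\max_(k < K) Jk k) => j hj.
  apply: (@le_trans _ _ (\sum_(k < K) e')).
    by apply: ler_sum => k _; apply: hJk; apply: leq_trans hj; exact: (leq_bigmax (F := fun k : 'I_K => Jk k)).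
  rewrite sumr_const card_ord -[leLHS]mulr_natr /e' (_ : _ * K%:R = e / 2 * (K.+1%:R^-1 * K%:R)); last by rewrite mulrA.
  apply: ler_piMr; first by rewrite divr_ge0// ltW.
  by rewrite mulrC ler_pdivrMr// mul1r ler_nat.
exists J => j hj N.
apply: (@le_trans _ _ (\sum_(k < K + N) `|u j k|)).
  by rewrite addnC big_split_ord/= lerDl sumr_ge0.
rewrite big_split_ord/= (splitr e) lerD ?hJ//.
apply: (@le_trans _ _ (\sum_(i < N) G * 2^-1 ^+ (K + i))); first exact: ler_sum.
rewrite -mulr_sumr; apply: (@le_trans _ _ ((G + 1) * (2 * 2^-1 ^+ K))).
  by apply: ler_pM; rewrite ?geo_half_le ?lerDl// sumr_ge0// => i _; rewrite exprn_ge0.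
apply: (@le_trans _ _ ((G + 1) * (2 * (e / 4 / (G + 1))))).
  by rewrite ler_pM2l// ler_pM2l// ltW.
by rewrite le_eqVlt; apply/orP; left; apply/eqP; field; rewrite gt_eqF.
Qed.

End DominatedSums.

Lemma bin_bin_sub n k i : (k + i <= n)%N ->
  ('C(n, k + i) * 'C(k + i, k) = 'C(n, k) * 'C(n - k, i))%N.
Proof.
move=> kin; have kn : (k <= n)%N := leq_trans (leq_addr _ _) kin.
have f1 := bin_fact kin; have f2 := bin_fact (leq_addr i k).
have f3 := bin_fact kn; have f4 : 'C(n - k, i) * (i`! * (n - k - i)`!) = (n - k)`!.
  by apply: bin_fact; rewrite -(leq_add2l k) subnKC.
apply/eqP; rewrite -(eqn_pmul2r (fact_gt0 k)) -(eqn_pmul2r (fact_gt0 i)).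
rewrite -(eqn_pmul2r (fact_gt0 (n - k - i))); apply/eqP.
rewrite addKn in f2; rewrite subnDA in f1.
transitivity n`!; first by rewrite -f1 -f2; ring.
by rewrite -f3 -f4; ring.
Qed.

(** * Propagation along dilations *)

Section Dilation.
Context {R : realType}.
Variables (x : nat -> R) (kap : nat) (B : nat -> R) (C M : R).
Hypotheses (x_gt0 : forall n, 0 < x n) (hx : hpsd x)
  (hkap : hpsd (fun n => (n + kap.+1)%:R * x n))
  (hB : forall k, bfun x (binw x k) (B k))
  (M1 : 1 <= M) (hBM : forall k, B k <= C * M ^+ k)
  (xgrow : forall L : R, 0 < L -> exists2 c, 0 < c & forall k, c * L ^+ k <= x k).
Implicit Types (a : R) (q : {poly R}).

(** The difference is the integral over [v] in [[a, 1]] of [(n + kap + 1) x_n v ^ (n + kap)], a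
    mixture of Hankel positive sequences by [hkap]. It bounds the norm of [q(a x)] by a power of
    [1 / a] times that of [q]. *)
Lemma hpsd_dilation a : 0 < a <= 1 ->
  hpsd (fun n => x n - a ^+ (n + kap.+1) * x n).
Proof.
move=> /andP[a0 a1].
have ctn n : continuous (fun v : R => (n + kap.+1)%:R * v ^+ (n + kap)).
  by move=> v; apply: cvgM; [exact: cvg_cst|exact: exprn_continuous].
have ii n : lebesgue_measure.-integrable `[a, 1] (EFin \o (fun v : R => (n + kap.+1)%:R * x n * v ^+ (n + kap))).
  apply: continuous_integrable_itv => v.
  by apply: cvgM; [exact: cvg_cst|exact: exprn_continuous].
have h : hpsd (fun n => \int[lebesgue_measure]_(v in `[a, 1]) ((n + kap.+1)%:R * x n * v ^+ (n + kap))).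
  apply: hpsd_Rintegral => // v; rewrite /= in_itv/= => /andP[av _].
  have v0 : 0 <= v by rewrite (le_trans (ltW a0)).
  apply: (eq_hpsd (a := fun n => v ^+ kap * (((n + kap.+1)%:R * x n) * v ^+ n))).
    by move=> n; rewrite exprD; ring.
  apply: hpsdZ; first exact: exprn_ge0.
  by apply: hpsd_mul => //; exact: hpsd_exp.
apply: eq_hpsd h => n.
pose F v : R := x n * v ^+ (n + kap.+1).
have dF (v : R) : is_derive v (1 : R) F ((n + kap.+1)%:R * x n * v ^+ (n + kap)).
  have -> : F = x n \*: (@id R ^+ (n + kap).+1).
    by apply/funext => w; rewrite /F addnS fctE.
  by apply: is_derive_eq; rewrite /GRing.scale/= addnS; ring.
rewrite (FTC2_derive a1 dF).
  by rewrite /F expr1n; ring.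
by move=> v; apply: cvgM; [exact: cvg_cst|exact: exprn_continuous].
Qed.

(** Value at ['X^n] of [q |-> \int x ^ k q^(k)(a x) / k!]. With [a = 1 - c] these functionals give,
    up to a factor, the coefficients of [lag_sg c q]. For [n < k] the truncated exponent is
    harmless, since [binw x k n] is 0. *)
Definition dilf a k n : R := a ^+ (n - k) * binw x k n.

Lemma dilf_le a k q : 0 < a <= 1 ->
  `|mom (dilf a k) q| <= B k * (a ^+ (k + kap.+1))^-1 * Num.sqrt (mom x (q ^+ 2)).
Proof.
move=> a01; have /andP[a0 a1] := a01.
pose qa := q \Po (a *: 'X).
have qaE (y : nat -> R) q' : mom y (q' \Po (a *: 'X)) = mom (fun n => a ^+ n * y n) q'.
  apply: (mom_ext (f := fun q' => mom y (q' \Po (a *: 'X)))) => [p1 p2|r p1|n].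
  - by rewrite comp_polyD momD.
  - by rewrite comp_polyZ momZ.
  - by rewrite comp_Xn_poly exprZn momZ momXn.
have qa2 : mom x (qa ^+ 2) = mom (fun n => a ^+ n * x n) (q ^+ 2).
  by rewrite -qaE rmorphXn.
have -> : mom (dilf a k) q = (a ^+ k)^-1 * mom (binw x k) qa.
  rewrite qaE -mom_scaleseq; apply: eq_mom => n; rewrite /dilf /binw.
  case: (leqP k n) => kn; last by rewrite bin_small// !(mul0r, mulr0).
  have -> : a ^+ n = a ^+ k * a ^+ (n - k) by rewrite -exprD subnKC.
  by rewrite -!mulrA mulKf// gt_eqF// exprn_gt0.
have [B0 hb] := hB k.
have ak : 0 < a ^+ k by rewrite exprn_gt0.
have e1 : `|(a ^+ k)^-1| = (a ^+ k)^-1 by rewrite ger0_norm// invr_ge0 ltW.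
rewrite normrM e1 [a ^+ (k + kap.+1)]exprD invfM.
rewrite [leRHS](_ : _ = (a ^+ k)^-1 * (B k * ((a ^+ kap.+1)^-1 * Num.sqrt (mom x (q ^+ 2))))); last by ring.
rewrite ler_pM2l ?invr_gt0//; apply: le_trans (hb qa) _.
apply: ler_wpM2l => //.
have kp : 0 < a ^+ kap.+1 by rewrite exprn_gt0.
have q0 := mom_sqr_ge0 q hx.
have h : a ^+ kap.+1 * mom x (qa ^+ 2) <= mom x (q ^+ 2).
  have := mom_sqr_ge0 q (hpsd_dilation a01).
  rewrite qa2 (_ : mom _ _ = mom x (q ^+ 2) - a ^+ kap.+1 * mom (fun n => a ^+ n * x n) (q ^+ 2)) ?subr_ge0//.
  rewrite -mulNr -mom_scaleseq -mom_addseq; apply: eq_mom => n.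
  by rewrite exprD; ring.
apply: (@le_trans _ _ (Num.sqrt ((a ^+ kap.+1)^-1 ^+ 2 * mom x (q ^+ 2)))).
  apply: ler_wsqrtr; apply: (@le_trans _ _ ((a ^+ kap.+1)^-1 * mom x (q ^+ 2))).
    by rewrite ler_pdivlMl.
  by apply: ler_wpM2r => //; rewrite expr2 ler_pMr ?invr_gt0// invf_ge1// exprn_ile1// ltW.
by rewrite sqrtrM ?sqr_ge0// sqrtr_sqr ger0_norm// invr_ge0 ltW.
Qed.

Section Chain.
Variables (q : nat -> {poly R}) (Q : R).
Hypotheses (q_bd : forall j, Num.sqrt (mom x (q j ^+ 2)) <= Q).

(** Convergence for each [k], without uniformity; the domination in [k] comes from [dilf_le_geo]. *)
Definition vanish a := forall k e, 0 < e ->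
  exists J, forall j, (J <= j)%N -> `|mom (dilf a k) (q j)| <= e.

Let Q0 : 0 <= Q. Proof. exact: le_trans (sqrtr_ge0 _) (q_bd 0%N). Qed.

Let C0 : 0 <= C.
Proof. by have := le_trans (hB 0%N).1 (hBM 0%N); rewrite expr0 mulr1. Qed.

Let M0 : 0 < M. Proof. exact: lt_le_trans ltr01 M1. Qed.

Lemma dilf_le_geo a k j : 0 < a <= 1 ->
  `|mom (dilf a k) (q j)| <= C * Q * (a ^+ kap.+1)^-1 * (M / a) ^+ k.
Proof.
move=> a01; have /andP[a0 a1] := a01.
apply: le_trans (dilf_le _ _ a01) _.
rewrite exprD invfM expr_div_n.
rewrite [leRHS](_ : _ = (C * M ^+ k) * ((a ^+ k)^-1 / a ^+ kap.+1) * Q); last by ring.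
have ap n : 0 <= (a ^+ n)^-1 by rewrite invr_ge0 exprn_ge0// ltW.
have z0 : 0 <= (a ^+ k)^-1 / a ^+ kap.+1 by apply: mulr_ge0.
apply: ler_pM (q_bd j) => //; last exact: ler_wpM2r.
  exact: mulr_ge0 (hB k).1 z0.
Qed.

(* Taylor expansion of [dilf] at [a] with step [- a / (4 M)] *)
Lemma vanish_step a : 0 < a <= 1 -> vanish a -> vanish (a * (1 - (4 * M)^-1)).
Proof.
move=> a01 va k e e0; have /andP[a0 a1] := a01.
pose h := - (a * (4 * M)^-1).
have taylor j : mom (dilf (a * (1 - (4 * M)^-1)) k) (q j) =
    \sum_(i < size (q j)) 'C(k + i, k)%:R * h ^+ i * mom (dilf a (k + i)) (q j).
  have -> : a * (1 - (4 * M)^-1) = a + h by rewrite /h; ring.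
  under eq_bigr do rewrite mulr_sumr.
  rewrite exchange_big/= /mom; apply: eq_bigr => n _.
  transitivity ((q j)`_n * x n * ('C(n, k)%:R * (a + h) ^+ (n - k))).
    by rewrite /dilf /binw; ring.
  transitivity ((q j)`_n * x n * \sum_(i < size (q j)) 'C(k + i, k)%:R * 'C(n, k + i)%:R * (a ^+ (n - (k + i)) * h ^+ i)); last first.
    by rewrite mulr_sumr; apply: eq_bigr => i _; rewrite /dilf /binw; ring.
  congr (_ * _).
  case: (leqP k n) => kn; last first.
    by rewrite bin_small// mul0r big1// => i _; rewrite (bin_small (n := n)) ?mulr0 ?mul0r// (leq_trans kn)// leq_addr.
  rewrite exprDn mulr_sumr (sum_ord_widen (n := (n - k).+1)
    (F := fun i => 'C(k + i, k)%:R * 'C(n, k + i)%:R * (a ^+ (n - (k + i)) * h ^+ i)));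
    [|by rewrite (leq_ltn_trans (leq_subr _ _))|]; last first.
    move=> i ni; rewrite (bin_small (n := n)) ?mulr0 ?mul0r//.
    by rewrite -(subnKC kn) ltn_add2l.
  apply: eq_bigr => i _; rewrite -mulr_natr subnDA.
  have ink : (i <= n - k)%N by rewrite -ltnS.
  have -> : 'C(k + i, k)%:R * 'C(n, k + i)%:R = 'C(n, k)%:R * 'C(n - k, i)%:R :> R.
    have := ink; rewrite -(leq_add2l k) (subnKC kn) => h1.
    by rewrite -!natrM mulnC bin_bin_sub.
  by ring.
pose u j i := 'C(k + i, k)%:R * h ^+ i * mom (dilf a (k + i)) (q j).
have C2 m n : 'C(m, n)%:R <= 2 ^+ m :> R.
  elim: m n => [|m IH] [|n]; rewrite ?bin0 ?bin0n ?exprn_ege1 ?ler1n//.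
  by rewrite binS natrD exprS mulrDl mul1r lerD.
have hE i : `|h ^+ i| = a ^+ i * (4 * M)^-1 ^+ i.
  by rewrite normrX normrN ger0_norm ?exprMn// mulr_ge0 ?invr_ge0 ?mulr_ge0 ?(ltW a0) ?(ltW M0).
(* The binomial contributes [2 ^ (k + i)], [dilf_le_geo] contributes [(M / a) ^ (k + i)], and the
   step [(a / (4 M)) ^ i]: the ratio in [i] is one half, which is the purpose of the constant 4. *)
pose G := C * Q * (a ^+ kap.+1)^-1 * (2 * M / a) ^+ k.
have uG j i : `|u j i| <= G * 2^-1 ^+ i.
  rewrite /u !normrM hE ger0_norm//.
  have d := dilf_le_geo (k + i) j a01.
  apply: (@le_trans _ _ (2 ^+ (k + i) * (a ^+ i * (4 * M)^-1 ^+ i) *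
     (C * Q * (a ^+ kap.+1)^-1 * (M / a) ^+ (k + i)))).
    apply: ler_pM => //; last first.
      by apply: ler_wpM2r => //; rewrite mulr_ge0 ?exprn_ge0 ?invr_ge0 ?mulr_ge0 ?(ltW a0) ?(ltW M0).
    by rewrite mulr_ge0// mulr_ge0 ?exprn_ge0 ?invr_ge0 ?mulr_ge0 ?(ltW a0) ?(ltW M0).
  rewrite /G !exprD !exprMn [_ ^-1 ^+ i]exprVn exprMn (_ : 4 ^+ i = 2 ^+ i * 2 ^+ i :> R); last first.
    by rewrite -exprMn; congr (_ ^+ _); ring.
  rewrite le_eqVlt; apply/orP; left; apply/eqP; rewrite !exprVn; field.
  by rewrite !expf_neq0 ?gt_eqF.
have u0 i e' : 0 < e' -> exists J, forall j, (J <= j)%N -> `|u j i| <= e'.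
  move=> e'0; pose z := `|'C(k + i, k)%:R * h ^+ i|.
  have [J hJ] := va (k + i)%N (e' / (z + 1)) (divr_gt0 e'0 (ltr_wpDl (normr_ge0 _) ltr01)).
  exists J => j /hJ hj; rewrite /u normrM -/z.
  have z0 : 0 <= z by exact: normr_ge0.
  apply: (@le_trans _ _ ((z + 1) * (e' / (z + 1)))).
    by apply: ler_pM => //; rewrite lerDl.
  by rewrite mulrC divfK// gt_eqF// ltr_wpDl.
have [J hJ] := sum_geo_dominated uG u0 e0.
exists J => j /hJ hj; rewrite taylor.
exact: le_trans (ler_norm_sum _ _ _) (hj _).
Qed.

Lemma vanish_pow m : vanish 1 -> vanish ((1 - (4 * M)^-1) ^+ m).
Proof.
move=> v1; elim: m => [|m IH]; first by rewrite expr0.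
have t0 : 0 < 1 - (4 * M)^-1.
  have := M1; have := M0 => m0 m1; rewrite subr_gt0 invf_lt1 ?mulr_gt0//.
  by apply: (@lt_le_trans _ _ 4); [rewrite ltr1n|rewrite ler_peMr].
rewrite exprSr; apply: vanish_step => //.
by rewrite exprn_gt0// exprn_ile1// ?(ltW t0)// gerBl invr_ge0 mulr_ge0// ltW.
Qed.

(** The coefficients of [lag_sg] carry a division by [x k], which outgrows every geometric sequence
    by [xgrow]. With [L = 2 (r + 1) M / a] the terms on [[0, r]] are dominated by powers of one
    half. *)
Lemma lag_sg_vanish a (r e : R) : 0 < a <= 1 -> vanish a -> 0 <= r -> 0 < e ->
  exists J, forall j, (J <= j)%N -> forall y, 0 <= y <= r ->
    `|(lag_sg x (1 - a) (q j)).[y]| <= e.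
Proof.
move=> a01 va r0 e0; have /andP[a0 a1] := a01.
pose L := 2 * (r + 1) * (M / a).
have r1 : 0 < r + 1 by rewrite ltr_wpDl.
have L0 : 0 < L.
  by apply: mulr_gt0; [rewrite mulr_gt0|apply: divr_gt0].
have [c c0 hc] := xgrow L0.
pose u j k := (r + 1) ^+ k / x k * mom (dilf a k) (q j).
have w0 k : 0 <= (r + 1) ^+ k / x k by rewrite divr_ge0 ?exprn_ge0 ?ltW.
have uG j k : `|u j k| <= C * Q * (a ^+ kap.+1)^-1 / c * 2^-1 ^+ k.
  rewrite /u normrM (ger0_norm (w0 _)).
  have d := dilf_le_geo k j a01.
  apply: le_trans (ler_wpM2l (w0 k) d) _.
  have cL : 0 < c * L ^+ k by rewrite mulr_gt0 ?exprn_gt0.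
  apply: (@le_trans _ _ ((r + 1) ^+ k / (c * L ^+ k) * (C * Q * (a ^+ kap.+1)^-1 * (M / a) ^+ k))).
    apply: ler_wpM2r.
      by rewrite !mulr_ge0 ?invr_ge0 ?exprn_ge0 ?divr_ge0 ?(ltW a0) ?(ltW M0).
    apply: ler_wpM2l; first by rewrite exprn_ge0 ?ltW.
    by rewrite lef_pV2 ?posrE.
  rewrite /L !exprMn exprVn le_eqVlt; apply/orP; left; apply/eqP; rewrite !exprVn; field.
  by rewrite !gt_eqF ?exprn_gt0.
have u0 k e' : 0 < e' -> exists J, forall j, (J <= j)%N -> `|u j k| <= e'.
  move=> e'0; pose z := (r + 1) ^+ k / x k.
  have [J hJ] := va k (e' / (z + 1)) (divr_gt0 e'0 (ltr_wpDl (w0 k) ltr01)).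
  exists J => j /hJ hj; rewrite /u normrM (ger0_norm (w0 k)) -/z.
  apply: (@le_trans _ _ ((z + 1) * (e' / (z + 1)))).
    by apply: ler_pM => //; rewrite ?w0 ?lerDl.
  by rewrite mulrC divfK// gt_eqF// ltr_wpDl ?w0.
have [J hJ] := sum_geo_dominated uG u0 e0.
exists J => j /hJ/(_ (size (q j))) hj y /andP[y0 yr].
rewrite /lag_sg horner_sum; apply: le_trans (ler_norm_sum _ _ _) _.
apply: le_trans hj; apply: ler_sum => k _.
rewrite hornerZ hornerXn subKr /u !normrM mulrAC.
apply: ler_wpM2r => //; rewrite mulrAC; apply: ler_wpM2r => //.
have a1' : 0 <= 1 - a by rewrite subr_ge0.
rewrite !normrX (ger0_norm a1') (ger0_norm y0) (ger0_norm (ltW r1)) -exprMn.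
apply: lerXn2r; rewrite ?nnegrE ?mulr_ge0 ?subr_ge0// ?(ltW r1)//.
apply: (@le_trans _ _ (1 * r)); last by rewrite mul1r lerDl.
by apply: ler_pM => //; rewrite gerBl ltW.
Qed.

End Chain.
End Dilation.

(** * Dominated convergence for real integrals *)

Section DominatedConvergence.
Context {R : realType} d (T : measurableType d) (m : {measure set T -> \bar R}).

Lemma ae_mono (P Q : T -> Prop) : (forall x, P x -> Q x) ->
  {ae m, forall x, P x} -> {ae m, forall x, Q x}.
Proof. by move=> PQ; apply: filterS. Qed.

Lemma ae_mono2 (P Q S : T -> Prop) : (forall x, P x -> Q x -> S x) ->
  {ae m, forall x, P x} -> {ae m, forall x, Q x} -> {ae m, forall x, S x}.
Proof. by move=> PQ; apply: filterS2. Qed.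

Lemma Rintegral_dominated (D : set T) (f_ : nat -> T -> R) (f g : T -> R) :
  measurable D -> (forall n, measurable_fun D (f_ n)) ->
  (forall x, D x -> f_ n x @[n --> \oo] --> f x) ->
  m.-integrable D (EFin \o g) -> (forall n x, D x -> `|f_ n x| <= g x) ->
  m.-integrable D (EFin \o f) /\
  (\int[m]_(x in D) f_ n x) @[n --> \oo] --> \int[m]_(x in D) f x.
Proof.
move=> mD mf cf ig fg.
have mf' n : measurable_fun D (EFin \o f_ n) by apply/measurable_EFinP.
have cf' x : D x -> (EFin \o f_ ^~ x) @ \oo --> (f x)%:E.
  by move=> Dx; apply: cvg_EFin; [exact: filterE|exact: cf].
have mlim : measurable_fun D (EFin \o f) by apply: (emeasurable_fun_cvg _ _ mf').
have [i1 _ i2] := dominated_convergence mD mf' mlim (aeW _ cf') ig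
  (aeW _ (fun x n Dx => fg n x Dx : (`|(f_ n x)%:E| <= (g x)%:E)%E)).
split => //.
apply: fine_cvg; rewrite /Rintegral fineK//.
exact: integrable_fin_num.
Qed.

End DominatedConvergence.

(** * Real [L^2(mu)]: inner product, norm, completeness *)

Section RealL2.
Context {R : realType} (mu : probability (mR R) R).
Implicit Types (f g h : R -> R) (a : R).

Definition l2 f := measurable_fun [set: mR R] (f : mR R -> R) /\
  mu.-integrable setT (EFin \o (fun x => f x ^+ 2)).

Definition ip f g : R := \int[mu]_x (f x * g x).

Definition nrm f : R := Num.sqrt (ip f f).

Lemma l2P f : l2 f <-> (f : mR R -> R) \in Lfun mu 2%:E.
Proof.
split => [[mf i]|h]; last first.
  split; last exact: Lfun2_integrable_sqr.
  by move: h; rewrite inE => /andP[]; rewrite inE.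
rewrite inE; apply/andP; split; first by rewrite inE.
rewrite inE/= /finite_norm unlock /Lnorm poweR_lty//=.
move/integrableP : i => [_]; apply: le_lt_trans; apply: ge0_le_integral => //.
- apply/measurable_EFinP.
  apply/(@measurableT_comp _ _ _ _ _ _ (fun x : R => x `^ 2)%R) => //.
  exact/measurableT_comp.
- apply: measurableT_comp => //; apply/measurable_EFinP; exact: measurable_funX.
- by move=> x _/=; rewrite lee_fin normrX powR_mulrn.
Qed.

Lemma ip_integrable f g : l2 f -> l2 g -> mu.-integrable setT (EFin \o (fun x => f x * g x)).
Proof.
move=> [mf i] [mg j].
apply: (integrable_dominated (T := mR R) (g := fun x : R => f x ^+ 2 + g x ^+ 2)) => //.
- exact: measurable_funM.
- move=> x _; rewrite normrM -(real_normK (num_real (f x))) -(real_normK (num_real (g x))).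
  by have := sqr_ge0 (`|f x| - `|g x|); have := normr_ge0 (f x); have := normr_ge0 (g x); nra.
- exact: integrableDr.
Qed.

Lemma l2_lin f a g : l2 f -> l2 g -> l2 (fun x => f x + a * g x).
Proof.
move=> lf lg; have ifg := ip_integrable lf lg; case: lf lg => [mf i] [mg j]; split.
  by apply: measurable_funD => //; apply: measurable_funM.
have -> : (fun x => (f x + a * g x) ^+ 2) =
    (fun x => (f x ^+ 2 + a ^+ 2 * g x ^+ 2) + 2 * a * (f x * g x)).
  by apply/funext => x; ring.
by apply: integrableDr => //; [apply: integrableDr => //|]; apply: integrableZlr.
Qed.

Lemma l2_cst a : l2 (cst a).
Proof.
split => //; exact: (finite_measure_integrable_cst mu (a ^+ 2)).
Qed.

Lemma l2Z a g : l2 g -> l2 (fun x => a * g x).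
Proof.
by move=> /(l2_lin a (l2_cst 0)); congr l2; apply/funext => x; rewrite /= add0r.
Qed.

Lemma l2D f g : l2 f -> l2 g -> l2 (fun x => f x + g x).
Proof.
by move=> lf /(l2_lin 1 lf); congr l2; apply/funext => x; rewrite mul1r.
Qed.

Lemma l2B f g : l2 f -> l2 g -> l2 (fun x => f x - g x).
Proof.
by move=> lf /(l2_lin (-1) lf); congr l2; apply/funext => x; rewrite mulN1r.
Qed.

Lemma l2_norm f : l2 f -> l2 (fun x => `|f x|).
Proof.
move=> [mf i]; split; first exact: measurableT_comp.
by congr (mu.-integrable _ _) : i; apply/funext => x /=; rewrite real_normK ?num_real.
Qed.

Lemma ipC f g : ip f g = ip g f.
Proof. by apply: eq_Rintegral => x _; rewrite mulrC. Qed.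

Lemma ip_linl f a g h : l2 f -> l2 g -> l2 h ->
  ip (fun x => f x + a * g x) h = ip f h + a * ip g h.
Proof.
move=> lf lg lh; have i1 := ip_integrable lf lh; have i2 := ip_integrable lg lh.
rewrite /ip -RintegralZl// -RintegralD//; last exact: integrableZlr.
by apply: eq_Rintegral => x _; ring.
Qed.

Lemma ip_linr f a g h : l2 f -> l2 g -> l2 h ->
  ip h (fun x => f x + a * g x) = ip h f + a * ip h g.
Proof. by move=> *; rewrite ipC ip_linl// ![ip h _]ipC. Qed.

Lemma ipZl a g h : l2 g -> l2 h -> ip (fun x => a * g x) h = a * ip g h.
Proof.
move=> lg lh; have := @ip_linl (cst 0) a g h (l2_cst 0) lg lh.
rewrite (_ : ip (cst 0) h = 0) ?add0r; last first.
  by rewrite /ip; under eq_Rintegral do rewrite /= mul0r; rewrite Rintegral_cst// mul0r.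
by move=> <-; apply: eq_Rintegral => x _; rewrite /= add0r.
Qed.

Lemma ipBl f g h : l2 f -> l2 g -> l2 h -> ip (fun x => f x - g x) h = ip f h - ip g h.
Proof.
move=> lf lg lh; rewrite -mulN1r -ip_linl//.
by apply: eq_Rintegral => x _; rewrite mulN1r.
Qed.

Lemma ip_ge0 f : 0 <= ip f f.
Proof. by apply: Rintegral_ge0 => x _; rewrite -expr2 sqr_ge0. Qed.

Lemma nrm_ge0 f : 0 <= nrm f. Proof. exact: sqrtr_ge0. Qed.

Lemma nrm_sqr f : nrm f ^+ 2 = ip f f.
Proof. by rewrite sqr_sqrtr// ip_ge0. Qed.

Lemma disc_le (A B C : R) : 0 <= C -> (forall a, 0 <= A + 2 * a * B + a ^+ 2 * C) ->
  B ^+ 2 <= A * C.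
Proof.
rewrite le_eqVlt => /predU1P[<-|C0] h.
  rewrite mulr0; suff -> : B = 0 by rewrite expr0n.
  apply: contrapT => /eqP B0; have := h (- (A + 1) / (2 * B)).
  rewrite mulr0 addr0 (_ : 2 * _ * B = - (A + 1)); last by field.
  by rewrite opprD addrA subrr add0r oppr_ge0 ler10.
have := h (- (B / C)); rewrite -(ler_pM2r C0) mul0r.
rewrite (_ : (A + 2 * - (B / C) * B + (- (B / C)) ^+ 2 * C) * C = A * C - B ^+ 2) ?subr_ge0//.
by field; rewrite gt_eqF.
Qed.

Lemma ip_cauchy f g : l2 f -> l2 g -> `|ip f g| <= nrm f * nrm g.
Proof.
move=> lf lg; rewrite -(@ler_sqr _ _ (_ * _)) ?nnegrE ?mulr_ge0 ?nrm_ge0//.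
rewrite real_normK ?num_real// exprMn !nrm_sqr; apply: disc_le => [|a]; first exact: ip_ge0.
have := ip_ge0 (fun x => f x + a * g x).
rewrite ip_linl ?ip_linr//; try exact: l2_lin.
by rewrite (ipC g f); congr (_ <= _); ring.
Qed.

Lemma nrmD f g : l2 f -> l2 g -> nrm (fun x => f x + g x) <= nrm f + nrm g.
Proof.
move=> lf lg; rewrite -ler_sqr ?nnegrE ?addr_ge0 ?nrm_ge0// nrm_sqr.
have -> : ip (fun x => f x + g x) (fun x => f x + g x) = ip f f + 2 * ip f g + ip g g.
  have E : (fun x => f x + g x) = (fun x => f x + 1 * g x) by apply/funext => x; rewrite mul1r.
  rewrite E ip_linl ?ip_linr//; try exact: l2_lin.
  by rewrite (ipC g f); ring.
rewrite sqrrD !nrm_sqr lerD2r lerD2l -[leRHS]mulr_natl ler_pM2l//.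
exact: le_trans (ler_norm _) (ip_cauchy lf lg).
Qed.

Lemma eq_nrm f g : f =1 g -> nrm f = nrm g.
Proof. by move=> /funext ->. Qed.

Lemma nrmZ a f : l2 f -> nrm (fun x => a * f x) = `|a| * nrm f.
Proof.
move=> lf; rewrite /nrm ipZl// 1?ipC ?ipZl//; try exact: l2Z.
by rewrite mulrA -expr2 sqrtrM ?sqr_ge0// sqrtr_sqr.
Qed.

Lemma nrmN f : l2 f -> nrm (fun x => - f x) = nrm f.
Proof.
move=> lf; rewrite -[RHS]mul1r -(normrN1 R) -nrmZ//; apply: eq_nrm => x.
by rewrite mulN1r.
Qed.

Lemma nrm_norm f : nrm (fun x => `|f x|) = nrm f.
Proof.
rewrite /nrm; congr (Num.sqrt _); apply: eq_Rintegral => x _.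
by rewrite -!expr2 real_normK ?num_real.
Qed.

Lemma nrmB_sym f g : l2 f -> l2 g -> nrm (fun x => f x - g x) = nrm (fun x => g x - f x).
Proof.
move=> lf lg; rewrite -nrmN; last exact: l2B.
by apply: eq_nrm => x; rewrite opprB.
Qed.

Lemma nrm_tri f g h : l2 f -> l2 g -> l2 h ->
  nrm (fun x => f x - h x) <= nrm (fun x => f x - g x) + nrm (fun x => g x - h x).
Proof.
move=> lf lg lh; apply: le_trans (nrmD (l2B lf lg) (l2B lg lh)).
by rewrite le_eqVlt; apply/orP; left; apply/eqP/eq_nrm => x; ring.
Qed.

Lemma nrm_sum n (f : nat -> R -> R) : (forall i, l2 (f i)) ->
  l2 (fun x => \sum_(i < n) f i x) /\
  nrm (fun x => \sum_(i < n) f i x) <= \sum_(i < n) nrm (f i).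
Proof.
move=> lf; elim: n => [|n [l IH]].
  have -> : (fun x : R => \sum_(i < 0) f i x) = cst 0 by apply/funext => x; rewrite big_ord0.
  split; first exact: l2_cst.
  rewrite big_ord0 /nrm /ip; under eq_Rintegral do rewrite /= mulr0.
  by rewrite Rintegral_cst// mul0r sqrtr0.
have -> : (fun x => \sum_(i < n.+1) f i x) = (fun x => (\sum_(i < n) f i x) + f n x).
  by apply/funext => x; rewrite big_ord_recr.
split; first exact: l2D.
by rewrite big_ord_recr/=; apply: le_trans (nrmD l (lf n)) _; rewrite lerD2r.
Qed.

Lemma ae_nrm0 f : l2 f -> nrm f = 0 -> f = cst 0 %[ae mu].
Proof.
move=> [mf i] /eqP; rewrite sqrtr_eq0 => h0.
have e0 : (\int[mu]_x `|(f x ^+ 2)%:E| = 0)%E.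
  transitivity (\int[mu]_x (f x * f x)%:E)%E.
    by apply: eq_integral => x _; rewrite /= -expr2 ger0_norm ?sqr_ge0.
  apply/eqP; rewrite eq_le integral_ge0 ?andbT; last first.
    by move=> x _; rewrite lee_fin -expr2 sqr_ge0.
  rewrite -[leLHS]fineK ?lee_fin//.
  exact: integrable_fin_num (ip_integrable (conj mf i) (conj mf i)).
have mf2 : measurable_fun setT (EFin \o (fun x : mR R => f x ^+ 2)).
  by apply/measurable_EFinP; exact: measurable_funX.
have := (ae_eq_integral_abs mu measurableT mf2).1 e0.
apply: filterS => x /(_ I)/= [] /eqP; rewrite sqrf_eq0 => /eqP fx _.
exact: fx.
Qed.

Lemma eq_ae_ip f g h : l2 f -> l2 g -> l2 h -> f = g %[ae mu] -> ip f h = ip g h.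
Proof.
move=> [mf _] [mg _] [mh _] fg; rewrite /ip /Rintegral; congr fine.
apply: ae_eq_integral => //.
- by apply/measurable_EFinP; apply: measurable_funM.
- by apply/measurable_EFinP; apply: measurable_funM.
have [N [mN N0 sN]] := fg; exists N; split => // x /= hx; apply: sN => /= h'.
by apply: hx => _; rewrite h'.
Qed.

Lemma eq_ae_nrm f g : l2 f -> l2 g -> f = g %[ae mu] -> nrm f = nrm g.
Proof.
by move=> lf lg fg; rewrite /nrm (eq_ae_ip lf lg lf fg) ipC (eq_ae_ip lf lg lg fg).
Qed.

(** The increments are summable in norm, so the squares of the absolute series [S n] have an
    integrable limit [G]. Off the null set where [G] is infinite the sequence converges, and [G]
    dominates all the squares. *)
Lemma l2_complete (g : nat -> R -> R) : (forall n, l2 (g n)) ->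
  (forall n, nrm (fun x => g n.+1 x - g n x) <= 2^-1 ^+ n) ->
  exists2 v, l2 v & forall e : R, 0 < e ->
    exists N, forall n, (N <= n)%N -> nrm (fun x => v x - g n x) <= e.
Proof.
move=> lg hg.
pose D i x := `|g i.+1 x - g i x|.
pose S n x : R := `|g 0%N x| + \sum_(i < n) D i x.
have lD i : l2 (D i) by apply: l2_norm; exact: l2B.
have lS n : l2 (S n) by apply: l2D; [exact: l2_norm|exact: (nrm_sum n lD).1].
have S0 n x : 0 <= S n x.
  by apply: addr_ge0; [exact: normr_ge0|apply: sumr_ge0 => i _; exact: normr_ge0].
have Sle n x : S n x <= S n.+1 x by rewrite lerD2l big_ord_recr/= lerDl; exact: normr_ge0.
have Sg n x : `|g n x| <= S n x.
  elim: n => [|n IH]; first by rewrite /S big_ord0 addr0.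
  rewrite /S big_ord_recr/= addrA -/(S n x) addrC.
  by apply: le_trans (lerD (lexx (D n x)) IH); rewrite -{1}(subrK (g n x) (g n.+1 x)) ler_normD.
pose C := nrm (g 0%N) + 2.
have SC n : nrm (S n) <= C.
  apply: le_trans (nrmD (l2_norm (lg 0%N)) (nrm_sum n lD).1) _.
  rewrite nrm_norm lerD2l; apply: le_trans (nrm_sum n lD).2 _.
  apply: (@le_trans _ _ (\sum_(i < n) (2^-1 : R) ^+ (0 + i))).
    by apply: ler_sum => i _; rewrite nrm_norm.
  by apply: le_trans (geo_half_le _ _) _; rewrite expr0 mulr1.
pose G (x : mR R) : \bar R := limn (fun n => (S n x ^+ 2)%:E).
have ndS x : nondecreasing_seq (fun n => (S n x ^+ 2)%:E).
  by apply/nondecreasing_seqP => n; rewrite lee_fin ler_sqr ?nnegrE.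
have mS n : measurable_fun [set: mR R] (fun x : mR R => (S n x ^+ 2)%:E).
  by apply/measurable_EFinP; apply: measurable_funX; exact: (lS n).1.
have mG : measurable_fun setT G.
  apply: (emeasurable_fun_cvg _ _ mS) => x _.
  exact: ereal_nondecreasing_is_cvgn.
have G0 x : (0 <= G x)%E.
  by apply: lime_ge; [exact: ereal_nondecreasing_is_cvgn|apply: nearW => n; rewrite lee_fin sqr_ge0].
have SG n x : ((S n x ^+ 2)%:E <= G x)%E by apply: lime_ge; [exact: ereal_nondecreasing_is_cvgn|exists n => // m /= nm; exact: ndS].
have iG : mu.-integrable setT G.
  apply/integrableP; split => //.
  apply: (@le_lt_trans _ _ (C ^+ 2)%:E); last by rewrite ltry.
  under eq_integral => x _ do rewrite gee0_abs ?G0//.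
  rewrite monotone_convergence//; last by move=> n x _; rewrite lee_fin sqr_ge0.
  apply: lime_le.
    apply: ereal_nondecreasing_is_cvgn => n m nm; apply: ge0_le_integral => //.
    - by move=> x _; rewrite lee_fin sqr_ge0.
    - by move=> x _; exact: ndS.
  apply: nearW => n; rewrite -[leLHS]fineK; last exact: integrable_fin_num (lS n).2.
  rewrite lee_fin; have h : nrm (S n) ^+ 2 <= C ^+ 2.
    by rewrite ler_sqr ?nnegrE ?nrm_ge0 ?addr_ge0 ?nrm_ge0.
  apply: le_trans h; rewrite nrm_sqr le_eqVlt; apply/orP; left; apply/eqP.
  by apply: (@eq_Rintegral _ _ _ mu setT (fun x => S n x * S n x) (fun x => S n x ^+ 2)) => x _; rewrite expr2.
pose A := [set x : mR R | G x \is a fin_num].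
have mA : measurable A.
  by rewrite -[A]setTI; exact: emeasurable_fin_num.
have aeA : {ae mu, forall x, A x} by apply: filterS (integrable_ae measurableT iG) => x /(_ I).
pose H x := fine (G x).
have iH : mu.-integrable setT (EFin \o H).
  apply: (le_integrable measurableT _ _ iG) => //.
    by apply/measurable_EFinP; exact: measurableT_comp.
  move=> x _; rewrite /= (gee0_abs (G0 x)) ger0_norm ?fine_ge0//.
  by rewrite /H; case: (G x) (G0 x) => //= _; rewrite leey.
(* The indicator of the good set makes the pointwise limit exist everywhere, so that [v] is
   measurable. *)
pose w n x := g n x * \1_A x.
have SH n x : A x -> S n x ^+ 2 <= H x.
  by move=> Ax; rewrite -lee_fin fineK.
have cw x : cvgn (w ^~ x).
  have [Ax|nAx] := pselect (A x); last first.
    have -> : w ^~ x = cst 0.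
      by apply/funext => n; rewrite /w indicE memNset// mulr0.
    exact: is_cvg_cst.
  pose u i := g i.+1 x - g i x.
  have -> : w ^~ x = (fun n => g 0%N x + series u n).
    apply/funext => n; rewrite /w indicE mem_set// mulr1 seriesEnat/= telescope_sumr//.
    by rewrite addrC subrK.
  apply: is_cvgD; first exact: is_cvg_cst.
  apply: normed_cvg; rewrite (_ : [normed series u] = series (fun i => `|u i|))//.
  apply: nondecreasing_is_cvgn.
    by apply/nondecreasing_seqP => n; rewrite !seriesEord/= big_ord_recr/= lerDl.
  exists (Num.sqrt (H x)) => _ [n _ <-]; rewrite seriesEord/=.
  apply: (@le_trans _ _ (S n x)); first by rewrite /S lerDr.
  by rewrite -(ger0_norm (S0 n x)) -sqrtr_sqr ler_wsqrtr// SH.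
pose v x := limn (w ^~ x).
have wv x : w n x @[n --> \oo] --> v x by exact: cw.
have m1 : measurable_fun [set: mR R] (\1_A : mR R -> R).
  exact: measurable_indic.
have mw n : measurable_fun [set: mR R] (w n : mR R -> R).
  by apply: measurable_funM => //; exact: (lg n).1.
have mv : measurable_fun [set: mR R] (v : mR R -> R).
  by apply: (measurable_fun_cvg mw) => x _; exact: wv.
have w2 n x : w n x ^+ 2 <= H x.
  rewrite /w indicE; have [Ax|nAx] := pselect (A x).
    rewrite mem_set// mulr1 -(real_normK (num_real (g n x))).
    by apply: le_trans (SH n x Ax); rewrite ler_sqr ?nnegrE.
  by rewrite memNset// mulr0 expr0n/= fine_ge0.
have cw2 x : w n x ^+ 2 @[n --> \oo] --> v x ^+ 2.
  by under eq_fun do rewrite expr2; rewrite expr2; apply: cvgM.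
have v2 x : v x ^+ 2 <= H x.
  by apply: (cvgr_to_le (cw2 x)); exact: nearW.
have lv : l2 v.
  split => //; apply: (integrable_dominated (T := mR R) (g := H)) => //.
    exact: measurable_funX.
  by move=> x _; rewrite ger0_norm ?sqr_ge0.
exists v => // e e0.
have cd x : (v x - w n x) ^+ 2 @[n --> \oo] --> (0 : R).
  have h : v x - w n x @[n --> \oo] --> 0.
    by rewrite -(subrr (v x)); apply: cvgB; [exact: cvg_cst|exact: wv].
  by under eq_fun do rewrite expr2; rewrite -(mulr0 0); apply: cvgM.
have bd n x : `|(v x - w n x) ^+ 2| <= 4 * H x.
  rewrite ger0_norm ?sqr_ge0//; have := v2 x; have := w2 n x.
  by have := sqr_ge0 (v x + w n x); lra.
have [_ hlim] := @Rintegral_dominated R _ _ mu setT (fun n x => (v x - w n x) ^+ 2) (cst 0)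
   (fun x => 4 * H x) measurableT
   (fun n => measurable_funX 2 (measurable_funB mv (mw n)))
   (fun x _ => cd x) (integrableZlr 4 measurableT iH) (fun n x _ => bd n x).
move: hlim; rewrite Rintegral_cst// mul0r => /cvgr0_norm_lt /(_ (e ^+ 2)) [|N _ hN].
  by rewrite exprn_gt0.
exists N => n /hN/=.
have -> : \int[mu]_x ((v x - w n x) ^+ 2) = nrm (fun x => v x - g n x) ^+ 2.
  rewrite nrm_sqr /ip /Rintegral; congr fine; apply: ae_eq_integral => //.
  - apply/measurable_EFinP; apply: measurable_funX; exact: measurable_funB.
  - apply/measurable_EFinP; have mb := measurable_funB mv (lg n).1.
    exact: measurable_funM.
  by apply: filterS aeA => x Ax _; rewrite /w indicE mem_set// mulr1 expr2.
rewrite ger0_norm ?sqr_ge0// ltr_sqr ?nnegrE ?nrm_ge0 ?(ltW e0)// => /ltW.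
exact.
Qed.

End RealL2.

(** * Riesz representation *)

Section Riesz.
Context {R : realType} (mu : probability (mR R) R).
Implicit Types (u v : R -> R) (p q : {poly R}) (a : R).
Local Notation l2 := (l2 mu).
Local Notation ip := (ip mu).
Local Notation nrm := (nrm mu).

Lemma le_eps0 (z : R) : (forall d, 0 < d -> `|z| <= d) -> z = 0.
Proof.
move=> h; apply/eqP; rewrite -normr_le0; apply/ler_addgt0Pr => d d0.
by rewrite add0r h.
Qed.

(* The vectors are parametrized by polynomials only for definiteness. *)
Lemma riesz (e : {poly R} -> R -> R) (c : {poly R} -> R) (B : R) :
  (forall q, l2 (e q)) ->
  (forall p a q x, e (p + a *: q) x = e p x + a * e q x) ->
  (forall p a q, c (p + a *: q) = c p + a * c q) ->
  (forall q, `|c q| <= B * nrm (e q)) ->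
  exists v, [/\ l2 v, (forall q, ip v (e q) = c q) &
    exists g : nat -> {poly R}, forall d, 0 < d ->
      exists N, forall n, (N <= n)%N -> nrm (fun x => v x - e (g n) x) <= d].
Proof.
move=> le elin clin cB.
(* The representative minimizes [||v||^2 - 2 c(v)]; by the parallelogram identity, minimizing
   sequences are Cauchy. *)
pose J q := ip (e q) (e q) - 2 * c q.
have JE p a q : J (p + a *: q) = J p + 2 * a * (ip (e p) (e q) - c q) + a ^+ 2 * ip (e q) (e q).
  have E : e (p + a *: q) = fun x => e p x + a * e q x by apply/funext => x; rewrite elin.
  rewrite /J clin E ip_linl ?ip_linr//; try exact: l2_lin.
  by rewrite (ipC mu (e q) (e p)); ring.
have Jlb q : - B ^+ 2 <= J q.
  have := cB q; rewrite ler_norml => /andP[_ h].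
  by rewrite /J -nrm_sqr; have := sqr_ge0 (nrm (e q) - B); nra.
pose I := inf (range J).
have hI : has_inf (range J).
  by split; [exists (J 0); exists 0|exists (- B ^+ 2) => _ [q _ <-]].
have IJ q : I <= J q by apply: ge_inf; [exact: hI.2|exists q].
(* The constant makes the bound [2 ep n + 2 ep (n + 1)] coming from [par] at most [(2 ^ (- n)) ^ 2],
   as [l2_complete] requires. *)
pose ep n : R := 4^-1 * (2^-1 ^+ n) ^+ 2.
have ep0 n : 0 < ep n by rewrite mulr_gt0// exprn_gt0// exprn_gt0.
have /choice[g hg] : forall n, exists q, J q < I + ep n.
  by move=> n; have [_ [q _ <-] h] := inf_adherent (ep0 n) hI; exists q.
have par p q : nrm (fun x => e q x - e p x) ^+ 2 <= 2 * (J p - I) + 2 * (J q - I).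
  have E : (fun x => e q x - e p x) = e (q + (-1) *: p).
    by apply/funext => x; rewrite elin mulN1r.
  have h := IJ (p + 2^-1 *: (q + (-1) *: p)).
  rewrite JE in h; rewrite E nrm_sqr.
  have e1 : ip (e p) (e (q + (-1) *: p)) = ip (e p) (e q) - ip (e p) (e p).
    rewrite (_ : e (q + (-1) *: p) = fun x => e q x + (-1) * e p x); last exact/funext/elin.
    by rewrite ip_linr// mulN1r.
  have e2 : c (q + (-1) *: p) = c q - c p by rewrite clin mulN1r.
  have e3 : ip (e (q + (-1) *: p)) (e (q + (-1) *: p)) = ip (e q) (e q) - 2 * ip (e p) (e q) + ip (e p) (e p).
    rewrite (_ : e (q + (-1) *: p) = fun x => e q x + (-1) * e p x); last exact/funext/elin.
    rewrite ip_linl ?ip_linr//; try exact: l2_lin.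
    by rewrite (ipC mu (e q) (e p)); ring.
  rewrite e1 e2 in h; move: h; rewrite e3 /J => h; lra.
have step n : nrm (fun x => e (g n.+1) x - e (g n) x) <= 2^-1 ^+ n.
  rewrite -ler_sqr ?nnegrE ?nrm_ge0 ?exprn_ge0//; apply: le_trans (par _ _) _.
  have h1 := hg n; have h2 := hg n.+1.
  have h3 : ep n.+1 <= ep n.
    rewrite ler_pM2l// ler_sqr ?nnegrE ?exprn_ge0// exprS ler_piMl ?exprn_ge0// invf_le1// ler1n//.
  have : (2^-1 ^+ n) ^+ 2 = 4 * ep n :> R by rewrite /ep mulrA mulfV ?mul1r.
  by move=> ->; lra.
have [v lv hv] := l2_complete (fun n => le (g n)) step.
exists v; split => // [p|]; last by exists g.
apply/eqP; rewrite -subr_eq0; apply/eqP/le_eps0 => d d0.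
pose N0 := nrm (e p) + 1.
have N00 : 0 < N0 by rewrite ltr_wpDl ?nrm_ge0.
(* First-order optimality of an almost minimizer: [J (g n + a p)] cannot fall below the infimum for
   any [a], and the discriminant in [a] gives the bound. *)
have gp n : `|ip (e (g n)) (e p) - c p| <= 2^-1 ^+ n * nrm (e p).
  rewrite -ler_sqr ?nnegrE ?mulr_ge0 ?nrm_ge0 ?exprn_ge0// real_normK ?num_real// exprMn nrm_sqr.
  apply: (@le_trans _ _ (ep n * ip (e p) (e p))); last first.
    by apply: ler_wpM2r; [exact: ip_ge0|rewrite /ep ler_piMl ?sqr_ge0// invf_le1// ler1n].
  apply: disc_le; first exact: ip_ge0.
  move=> a; have := IJ (g n + a *: p); rewrite JE; have := hg n; lra.
have [N hN] := hv (d / 2 / N0) (divr_gt0 (divr_gt0 d0 (ltr0Sn _ 1)) N00).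
have [K hK] : exists K, (2^-1 : R) ^+ K < d / 2 / N0 by apply: cvg_geo_half; rewrite !divr_gt0.
pose n := maxn N K.
have hn := hN n (leq_maxl _ _).
have hk : (2^-1 : R) ^+ n <= d / 2 / N0.
  apply: le_trans (ltW hK); apply: ler_wiXn2l; rewrite ?invr_ge0 ?invf_le1 ?ler1n// leq_maxr//.
rewrite (_ : ip v (e p) - c p = ip (fun x => v x - e (g n) x) (e p) + (ip (e (g n)) (e p) - c p)); last first.
  by rewrite ipBl//; ring.
apply: le_trans (ler_normD _ _) _.
have npN : nrm (e p) <= N0 by rewrite /N0 lerDl.
have dN : d / 2 / N0 * N0 = d / 2 by rewrite divfK// gt_eqF.
have dp : 0 <= d / 2 / N0 by rewrite !divr_ge0 ?(ltW d0) ?(ltW N00).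
rewrite (splitr d); apply: lerD.
  apply: le_trans (ip_cauchy (l2B lv (le _)) (le p)) _; rewrite -dN.
  by apply: ler_pM; rewrite ?nrm_ge0.
apply: le_trans (gp n) _; rewrite -dN.
by apply: ler_pM; rewrite ?nrm_ge0 ?exprn_ge0.
Qed.

(** The Riesz representative of [ip f] on the family is a limit of vectors [e q], and its difference
    with [f] is orthogonal to the family, hence null. *)
Lemma dense_of_orthogonal (e : {poly R} -> R -> R) (f : R -> R) :
  (forall q, l2 (e q)) ->
  (forall p a q x, e (p + a *: q) x = e p x + a * e q x) ->
  (forall h, l2 h -> (forall q, ip h (e q) = 0) -> h = cst 0 %[ae mu]) ->
  l2 f -> forall d, 0 < d -> exists q, nrm (fun x => f x - e q x) <= d.
Proof.
move=> le elin orth lf d d0.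
have [] := @riesz e (fun q => ip f (e q)) (nrm f) le elin.
- move=> p a q; rewrite -(@ip_linr _ _ (e p) a (e q))//; congr ip.
  by apply/funext => x; rewrite elin.
- by move=> q; exact: ip_cauchy.
move=> v [lv hv [g hg]].
have vf : (fun x => f x - v x) = cst 0 %[ae mu].
  apply: orth; first exact: l2B.
  by move=> q; rewrite ipBl// hv subrr.
have [N hN] := hg d d0; exists (g N).
apply: le_trans (hN N (leqnn N)); rewrite le_eqVlt; apply/orP; left; apply/eqP.
apply: eq_ae_nrm; [exact: l2B|exact: l2B|].
have [M [mM M0 sM]] := vf; exists M; split => // x /= hx; apply: sM => /= h; apply: hx => _.
by move: (h I) => /eqP; rewrite subr_eq0 => /eqP ->.
Qed.

End Riesz.

(** * Moment determinacy under exponential decay *)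

Section Determinacy.
Context {R : realType}.
Local Notation leb := (@lebesgue_measure R).
Implicit Types (g : R -> R) (c h x y z lam : R).

Lemma expr_le_expR k lam x : 0 < lam -> 0 <= x -> x ^+ k <= k`!%:R / lam ^+ k * expR (lam * x).
Proof.
move=> l0 x0; have lx : 0 <= lam * x by rewrite mulr_ge0// ltW.
case: k => [|k].
  by rewrite !expr0 fact0 divr1 mul1r -expR0 ler_expR.
have := expR_ge1Dxn k lx; rewrite exprMn => h.
have f0 : 0 < k.+1`!%:R :> R by rewrite ltr0n fact_gt0.
have lk : 0 < lam ^+ k.+1 by rewrite exprn_gt0.
rewrite mulrAC ler_pdivlMr// -ler_pdivrMl// mulrC [x ^+ k.+1 * _]mulrC.
by apply: le_trans h; rewrite lerDr.
Qed.

Lemma exprB_ge (y : R) M : 0 <= y <= 1 -> 1 - M%:R * y <= (1 - y) ^+ M.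
Proof.
move=> /andP[y0 y1]; elim: M => [|M IH]; first by rewrite mul0r subr0 expr0.
rewrite exprS; apply: (@le_trans _ _ ((1 - y) * (1 - M%:R * y))); last first.
  by rewrite ler_wpM2l// subr_ge0.
have : 0 <= M%:R * y * y by rewrite !mulr_ge0.
by rewrite -(natr1 M); lra.
Qed.

Lemma exprB_le (y : R) M : 0 <= y <= 1 -> (1 - y) ^+ M <= expR (- (M%:R * y)).
Proof.
move=> /andP[y0 y1]; rewrite -mulrN mulrC expRM_natr.
by apply: lerXn2r; rewrite ?nnegrE ?subr_ge0 ?expR_ge0//; exact: expR_ge1Dx.
Qed.

(* [(1 - u ^ k) ^ M] with [u = exp (- h x)] and [M] of order [k exp (h k c)]
   approximates the indicator of [x > c]. *)
Definition cutexp h c n : nat := Num.truncn (n.+1%:R * expR (h * n.+1%:R * c)).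

Definition cutoff h c n x : R := (1 - expR (- (h * x)) ^+ n.+1) ^+ cutexp h c n.

Lemma cutoff_itv h c n x : 0 < h -> 0 <= x -> 0 <= cutoff h c n x <= 1.
Proof.
move=> h0 x0.
have u1 : expR (- (h * x)) ^+ n.+1 <= 1.
  by rewrite exprn_ile1 ?expR_ge0// expRN_le1// mulr_ge0// ltW.
rewrite /cutoff exprn_ge0 ?subr_ge0// exprn_ile1 ?subr_ge0// gerBl exprn_ge0// expR_ge0.
Qed.

Lemma cutexp_itv h c n : (cutexp h c n)%:R <= n.+1%:R * expR (h * n.+1%:R * c) <
  ((cutexp h c n)%:R + 1 : R).
Proof.
have z0 : 0 <= n.+1%:R * expR (h * n.+1%:R * c) by rewrite mulr_ge0// expR_ge0.
by rewrite natr1; exact: truncn_itv.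
Qed.

Lemma cvg_cutoff h c x : 0 < h -> 0 <= x ->
  cutoff h c n x @[n --> \oo] --> ((c < x)%R%:R : R).
Proof.
move=> h0 x0.
have uE n : expR (- (h * x)) ^+ n.+1 = expR (- (h * n.+1%:R * x)).
  by rewrite -expRM_natr; congr expR; ring.
have uI n : 0 <= expR (- (h * x)) ^+ n.+1 <= 1.
  by rewrite exprn_ge0 ?expR_ge0// exprn_ile1 ?expR_ge0// expRN_le1// mulr_ge0// ltW.
have hcv := @cvg_harmonic R.
case: ltP => cx.
  pose de := h * (x - c).
  have de0 : 0 < de by rewrite mulr_gt0// subr_gt0.
  apply: (@squeeze_cvgr _ _ _ _ (fun n => 1 - 2 / de ^+ 2 * n.+1%:R^-1) (fun=> 1)).
  - apply: nearW => n; have [_ ->] := andP (cutoff_itv c n h0 x0); rewrite andbT.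
    apply: le_trans (exprB_ge _ (uI n)); rewrite lerD2l lerN2 uE.
    have [Mle _] := andP (cutexp_itv h c n).
    apply: le_trans (ler_wpM2r (expR_ge0 _) Mle) _.
    have E2 : expR (h * n.+1%:R * c) * expR (- (h * n.+1%:R * x)) = expR (- (de * n.+1%:R)).
      by rewrite -expRD; congr expR; rewrite /de; ring.
    rewrite -[leLHS]mulrA E2.
    have np : 0 < n.+1%:R :> R by rewrite ltr0n.
    move: (n.+1%:R : R) np => k k0.
    have := expR_ge1Dxn 1 (mulr_ge0 (ltW de0) (ltW k0)).
    rewrite expRN => h2.
    have E0 := expR_gt0 (de * k).
    rewrite ler_pdivrMr// mulrC.
    apply: (@le_trans _ _ ((de * k) ^+ 2 / 2`!%:R * (2 / de ^+ 2 / k))).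
      rewrite le_eqVlt; apply/orP; left; apply/eqP; rewrite (_ : 2`!%:R = 2 :> R)//.
      by field; rewrite !gt_eqF.
    apply: ler_wpM2r; first by rewrite !divr_ge0// ?exprn_ge0// ltW.
    by apply: le_trans h2; rewrite lerDr.
  - rewrite -[X in _ --> X]subr0; apply: cvgB; first exact: cvg_cst.
    rewrite -(mulr0 (2 / de ^+ 2)); apply: cvgM; first exact: cvg_cst.
    exact: hcv.
  - exact: cvg_cst.
apply: (@squeeze_cvgr _ _ _ _ (fun=> 0) (fun n => n.+1%:R^-1)).
- apply: nearW => n; have [-> _] := andP (cutoff_itv c n h0 x0); rewrite /=.
  apply: le_trans (exprB_le _ (uI n)) _; rewrite uE.
  have [_ Mgt] := andP (cutexp_itv h c n).
  have np : 0 < n.+1%:R :> R by rewrite ltr0n.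
  rewrite expRN lef_pV2 ?posrE ?expR_gt0//.
  apply: le_trans (expR_ge1Dx _).
  have e1 : expR (- (h * n.+1%:R * x)) <= 1 by rewrite -uE; have /andP[] := uI n.
  apply: (@le_trans _ _ (1 + (n.+1%:R * expR (h * n.+1%:R * c) - 1) * expR (- (h * n.+1%:R * x)))); last first.
    by rewrite lerD2l ler_wpM2r ?expR_ge0// lerBlDr ltW.
  have e2 : 1 <= expR (h * n.+1%:R * c) * expR (- (h * n.+1%:R * x)).
    by rewrite -expRD -expR0 ler_expR subr_ge0 ler_wpM2l// mulr_ge0// ltW.
  have := ler_wpM2l (ltW np) e2; rewrite mulr1 => e3.
  rewrite [leRHS](_ : _ = 1 - expR (- (h * n.+1%:R * x)) +
    n.+1%:R * (expR (h * n.+1%:R * c) * expR (- (h * n.+1%:R * x)))); last by ring.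
  by apply: le_trans e3 _; rewrite lerDr subr_ge0.
- exact: cvg_cst.
- exact: hcv.
Qed.

Section Exponential.
Variables (g : R -> R) (lam : R).
Hypotheses (lam0 : 0 < lam)
  (mg : measurable_fun [set: mR R] (g : mR R -> R))
  (g0 : forall x, x <= 0 -> g x = 0)
  (ig : leb.-integrable setT (EFin \o (fun x => g x * expR (lam * x))))
  (mom0 : forall k : nat, \int[leb]_x (g x * x ^+ k) = 0).

Lemma measurable_expRMl a : measurable_fun [set: mR R] (fun x : mR R => expR (a * x)).
Proof. by apply: measurableT_comp => //; apply: measurable_funM. Qed.

Lemma measurable_exprX k : measurable_fun [set: mR R] (fun x : mR R => x ^+ k).
Proof. exact: measurable_funX. Qed.

Lemma integrable_dom_exp (f : R -> R) (C : R) :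
  measurable_fun [set: mR R] (f : mR R -> R) ->
  (forall x, 0 <= x -> `|f x| <= C * expR (lam * x)) ->
  leb.-integrable setT (EFin \o (fun x => g x * f x)) /\
  leb.-integrable setT (EFin \o (fun x => C * `|g x * expR (lam * x)|)) /\
  forall x, `|g x * f x| <= C * `|g x * expR (lam * x)|.
Proof.
move=> mf hf.
have i2 : leb.-integrable setT (EFin \o (fun x => C * `|g x * expR (lam * x)|)).
  apply: integrableZlr => //.
  by have := integrable_norm ig.
have h x : `|g x * f x| <= C * `|g x * expR (lam * x)|.
  have [x0|/ltW x0] := leP x 0; first by rewrite g0// !mul0r normr0 mulr0.
  rewrite !normrM (ger0_norm (expR_ge0 _)) mulrCA ler_wpM2l//; exact: hf.
split => //; apply: (integrable_dominated (T := mR R)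
  (g := fun x : R => C * `|g x * expR (lam * x)|)) => //.
exact: measurable_funM.
Qed.

Definition mexp z := forall k : nat, \int[leb]_x (g x * (x ^+ k * expR (- (z * x)))) = 0.

(** Expand [exp (- h x)] under the integral: its partial sums are bounded by [exp (lam x / 2)], and
    the other half of the exponential weight controls [x ^ k]. Steps of fixed size [lam / 2] then
    reach every weight [exp (- j lam x / 2)] with [j] natural. *)
Lemma mexpD z h : 0 <= z -> 0 < h -> h <= lam / 2 -> mexp z -> mexp (z + h).
Proof.
move=> z0 h0 hl mz k.
pose s n x := \sum_(i < n) (i`!%:R)^-1 * (- (h * x)) ^+ i.
pose C := k`!%:R / (lam / 2) ^+ k.
have l2 : 0 < lam / 2 by rewrite divr_gt0.
have ms n : measurable_fun [set: mR R]
    (fun x : mR R => x ^+ k * expR (- (z * x)) * s n x).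
  apply: measurable_funM.
    apply: measurable_funM; first exact: measurable_exprX.
    by under eq_fun do rewrite -mulNr; exact: measurable_expRMl.
  apply: measurable_sum => i; apply: measurable_funM => //.
  by apply: measurable_funX; under eq_fun do rewrite -mulNr; apply: measurable_funM.
have bs n x : 0 <= x -> `|x ^+ k * expR (- (z * x)) * s n x| <= C * expR (lam * x).
  move=> x0; have hx : 0 <= h * x by rewrite mulr_ge0// ltW.
  have sb : `|s n x| <= expR (lam / 2 * x).
    apply: (@le_trans _ _ (expR (h * x))); last by rewrite ler_expR ler_wpM2r.
    apply: le_trans (ler_norm_sum _ _ _) _.
    apply: (@le_trans _ _ (series (exp_coeff (h * x)) n)).
      rewrite seriesEord/=; apply: ler_sum => i _.
      by rewrite normrM normrX normrN (ger0_norm hx) ger0_norm ?invr_ge0// /exp_coeff/= mulrC.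
    rewrite /expR; apply: nondecreasing_cvgn_le; last exact: is_cvg_series_exp_coeff.
    apply/nondecreasing_seqP => m; rewrite !seriesEord/= big_ord_recr/= lerDl.
    by rewrite /exp_coeff/= divr_ge0// exprn_ge0.
  rewrite !normrM (ger0_norm (expR_ge0 _)) (ger0_norm (exprn_ge0 _ x0)).
  rewrite (_ : lam * x = lam / 2 * x + lam / 2 * x); last by field.
  rewrite expRD mulrA; apply: ler_pM => //; first by rewrite mulr_ge0 ?exprn_ge0 ?expR_ge0.
  apply: le_trans (expr_le_expR k l2 x0); rewrite ler_piMr ?exprn_ge0// expRN_le1//.
  by rewrite mulr_ge0.
have dom n := integrable_dom_exp (ms n) (bs n).
have cvs x : g x * (x ^+ k * expR (- (z * x)) * s n x) @[n --> \oo] -->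
    g x * (x ^+ k * expR (- ((z + h) * x))).
  have -> : x ^+ k * expR (- ((z + h) * x)) = x ^+ k * expR (- (z * x)) * expR (- (h * x)).
    by rewrite mulrDl opprD expRD mulrA.
  apply: cvgM; first exact: cvg_cst.
  apply: cvgM; first exact: cvg_cst.
  rewrite (_ : (fun n => s n x) = series (exp_coeff (- (h * x)))).
    exact: is_cvg_series_exp_coeff.
  by apply/funext => n; rewrite seriesEord/=; apply: eq_bigr => i _; rewrite /exp_coeff/= mulrC.
have [_ hlim] := @Rintegral_dominated R _ _ leb setT _ _ _ measurableT
  (fun n => measurable_funM mg (ms n)) (fun x _ => cvs x) (dom 0%N).2.1 (fun n x _ => (dom n).2.2 x).
have hz n : \int[leb]_x (g x * (x ^+ k * expR (- (z * x)) * s n x)) = 0.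
  have E x : g x * (x ^+ k * expR (- (z * x)) * s n x) =
     \sum_(i < n) ((i`!%:R)^-1 * (- h) ^+ i) * (g x * (x ^+ (k + i) * expR (- (z * x)))).
    rewrite /s !mulr_sumr; apply: eq_bigr => i _; have hx : (- (h * x)) ^+ i = (- h) ^+ i * x ^+ i by rewrite -mulNr exprMn.
    by rewrite hx exprD; ring.
  under eq_Rintegral do rewrite E.
  have ii i : leb.-integrable setT (EFin \o (fun x => g x * (x ^+ (k + i) * expR (- (z * x))))).
    apply: (integrable_dom_exp (C := (k + i)`!%:R / lam ^+ (k + i)) _ _).1.
      apply: measurable_funM; first exact: measurable_exprX.
      by under eq_fun do rewrite -mulNr; exact: measurable_expRMl.
    move=> x x0; rewrite normrM (ger0_norm (expR_ge0 _)) (ger0_norm (exprn_ge0 _ x0)).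
    apply: le_trans (expr_le_expR _ lam0 x0); rewrite ler_piMr ?exprn_ge0// expRN_le1//.
    by rewrite mulr_ge0.
  rewrite (@Rintegral_sumr _ _ _ leb setT _ (fun i x => ((i`!%:R)^-1 * (- h) ^+ i) * (g x * (x ^+ (k + i) * expR (- (z * x))))))//; last first.
    by move=> i; exact: integrableZlr.
  by apply: big1 => i _; rewrite RintegralZl// mz mulr0.
move: hlim; under eq_fun do rewrite hz.
move=> /cvg_lim <-//; first by rewrite lim_cst.
Qed.

Let h := lam / 2.
Let h0 : 0 < h. Proof. by rewrite divr_gt0. Qed.

Lemma mexp_nat j : mexp (j%:R * h).
Proof.
elim: j => [|j IH].
  move=> k; rewrite -[RHS](mom0 k); apply: eq_Rintegral => x _.
  by rewrite !mul0r oppr0 expR0 mulr1.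
rewrite -natr1 mulrDl mul1r; apply: mexpD => //.
by rewrite mulr_ge0// ltW.
Qed.

Lemma int_poly_exp (q : {poly R}) : \int[leb]_x (g x * q.[expR (- (h * x))]) = 0.
Proof.
pose f i x := q`_i * (g x * (x ^+ 0 * expR (- (i%:R * h * x)))).
have E x : g x * q.[expR (- (h * x))] = \sum_(i < size q) f i x.
  rewrite horner_coef mulr_sumr; apply: eq_bigr => i _.
  by rewrite /f expr0 mul1r -expRM_natr (_ : - (h * x) * i%:R = - (i%:R * h * x)); ring.
under eq_Rintegral do rewrite E.
have ii i : leb.-integrable setT (EFin \o (fun x => g x * (x ^+ 0 * expR (- (i%:R * h * x))))).
  apply: (integrable_dom_exp (C := 1) _ _).1.
    apply: measurable_funM; first exact: measurable_exprX.
    by under eq_fun do rewrite -mulNr; exact: measurable_expRMl.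
  move=> x x0; rewrite expr0 !mul1r ger0_norm ?expR_ge0// ler_expR.
  apply: (@le_trans _ _ 0); last by rewrite mulr_ge0// ltW.
  by rewrite oppr_le0 !mulr_ge0// ltW.
rewrite (@Rintegral_sumr _ _ _ leb setT _ f)//; last by move=> i; exact: integrableZlr.
by apply: big1 => i _; rewrite /f RintegralZl// mexp_nat mulr0.
Qed.

(** The cut-offs are polynomials in [exp (- h x)], bounded by 1 on the half-line. *)
Lemma int_gt c : \int[leb]_x (g x * (c < x)%R%:R) = 0.
Proof.
have mc n : measurable_fun [set: mR R] (cutoff h c n : mR R -> R).
  apply: measurable_funX; apply: measurable_funB => //; apply: measurable_funX.
  by under eq_fun do rewrite -mulNr; exact: measurable_expRMl.
have bc n x : 0 <= x -> `|cutoff h c n x| <= 1 * expR (lam * x).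
  move=> x0; have /andP[c0 c1] := cutoff_itv c n h0 x0.
  rewrite ger0_norm// mul1r; apply: le_trans c1 _.
  by rewrite -expR0 ler_expR mulr_ge0// ltW.
have dom n := integrable_dom_exp (mc n) (bc n).
have cvc x : g x * cutoff h c n x @[n --> \oo] --> g x * (c < x)%R%:R.
  have [x0|/ltW x0] := leP x 0.
    by under eq_fun do rewrite g0// mul0r; rewrite g0// mul0r; exact: cvg_cst.
  by apply: cvgM; [exact: cvg_cst|exact: cvg_cutoff].
have [_ hlim] := @Rintegral_dominated R _ _ leb setT _ _ _ measurableT
  (fun n => measurable_funM mg (mc n)) (fun x _ => cvc x) (dom 0%N).2.1 (fun n x _ => (dom n).2.2 x).
have hz n : \int[leb]_x (g x * cutoff h c n x) = 0.
  rewrite -[RHS](int_poly_exp ((1 - 'X^(n.+1)) ^+ cutexp h c n)); apply: eq_Rintegral => x _.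
  by rewrite /cutoff horner_exp !hornerE.
move: hlim; under eq_fun do rewrite hz.
by move=> /cvg_lim <-//; rewrite lim_cst.
Qed.

(** The primitive of [g] vanishes identically by [int_gt], and Lebesgue differentiation recovers [g]
    almost everywhere. *)
Lemma ae0_of_moments : {ae leb, forall x, g x = 0}.
Proof.
have ig0 : leb.-integrable setT (EFin \o g).
  have h1 x : 0 <= x -> `|1 : R| <= 1 * expR (lam * x).
    by move=> x0; rewrite normr1 mul1r -expR0 ler_expR mulr_ge0// ltW.
  have [i _] := @integrable_dom_exp (fun=> 1) 1 (measurable_cst _) h1.
  by congr (leb.-integrable _ _) : i; apply/funext => x /=; rewrite mulr1.
have F0 y : \int[leb]_(t in `]-oo, y]) g t = 0.
  rewrite Rintegral_mkcond.
  have ic : leb.-integrable setT (EFin \o (fun x => g x * (y < x)%R%:R)).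
    have mi : measurable_fun [set: mR R] (fun x : mR R => (y < x)%R%:R : R).
      have -> : (fun x : mR R => (y < x)%R%:R : R) = \1_(`]y, +oo[%classic : set (mR R)).
        by apply/funext => x; rewrite indicE; congr (_%:R); congr nat_of_bool; apply/idP/idP; rewrite inE/= in_itv/= andbT.
      exact: measurable_indic.
    apply: (@integrable_dom_exp _ 1 mi _).1 => x x0; rewrite mul1r; apply: (@le_trans _ _ 1).
      by case: ltP; rewrite ?normr1 ?normr0.
    by rewrite -expR0 ler_expR mulr_ge0// ltW.
  transitivity (\int[leb]_x (g x - g x * (y < x)%R%:R)).
    apply: eq_Rintegral => x _; rewrite /patch; case: ifPn.
      by rewrite inE/= in_itv/= => xy; rewrite ltNge xy mulr0 subr0.
    by rewrite notin_setE/= in_itv/= => /negP; rewrite -ltNge => ->; rewrite mulr1 subrr.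
  rewrite RintegralB//= int_gt subr0 -[RHS](int_gt 0); apply: eq_Rintegral => x _.
  by case: ltP => x0; rewrite ?mulr1// g0// mul0r.
have i1 y : leb.-integrable `]-oo, y] (EFin \o g) by apply: integrableS ig0.
have locg : locally_integrable [set: R] g.
  by have := @integrable_locally R g setT measurableT ig0; rewrite patch_setT.
have := FTC1Ny i1 locg; apply: ae_mono => x [_ <-].
have -> : (fun x0 : R => \int[leb]_(t in `]-oo, x0]) g t) = cst 0 by apply/funext => y; exact: F0.
by rewrite derive1_cst.
Qed.

End Exponential.
End Determinacy.

(** * The invariant law and density of polynomials *)

Section InvariantDensity.
Context {R : realType} (p : laguerre_exponent R) (P : R -> (R -> R) -> R -> R)
  (mu : probability (mR R) R) (nu : R -> R).
Hypothesis Hnu : invariant_density p P mu nu.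
Local Notation leb := (@lebesgue_measure R).
Implicit Types (f : R -> R) (q : {poly R}).

Lemma mu_dominated : mu `<< leb.
Proof.
apply/null_content_dominatesP => A mA A0; rewrite (nu_density Hnu mA).
apply: null_set_integral => //; apply/measurable_EFinP; apply: measurable_funTS.
exact: nu_meas Hnu.
Qed.

Lemma integral_density (f : mR R -> R) : mu.-integrable setT (EFin \o f) ->
  leb.-integrable setT (EFin \o (fun x => f x * nu x)) /\
  \int[mu]_x f x = \int[leb]_x (f x * nu x).
Proof.
have mn : measurable_fun [set: mR R] (EFin \o nu : mR R -> \bar R).
  by apply/measurable_EFinP; exact: nu_meas Hnu.
have rn : ae_eq leb setT (Radon_Nikodym (charge_of_finite_measure mu) leb) (EFin \o nu).
  apply: integral_ae_eq => //.
    by apply: Radon_Nikodym_integrable; exact: mu_dominated.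
  move=> E _ mE; rewrite -(nu_density Hnu mE) -(Radon_Nikodym_integral (nu := charge_of_finite_measure mu))//.
  exact: mu_dominated.
have key (g : mR R -> R) : mu.-integrable setT (EFin \o g) ->
    (\int[mu]_x (g x)%:E = \int[leb]_x (g x * nu x)%:E)%E.
  move=> ig; rewrite -(Radon_Nikodym_change_of_variables mu_dominated measurableT ig).
  have mg : measurable_fun [set: mR R] g by apply/measurable_EFinP; case/integrableP : ig.
  apply: ae_eq_integral => //.
  - apply: emeasurable_funM; first by apply/measurable_EFinP.
    by apply: measurable_int; apply: Radon_Nikodym_integrable; exact: mu_dominated.
  - by apply/measurable_EFinP; apply: measurable_funM => //; exact: nu_meas Hnu.
  have [N [mN N0 sN]] := rn; exists N; split => // x /= hx; apply: sN => /= h; apply: hx => _.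
  by rewrite h.
move=> i; split; last by rewrite /Rintegral key.
have mf : measurable_fun [set: mR R] f by apply/measurable_EFinP; case/integrableP : i.
apply/integrableP; split.
  by apply/measurable_EFinP; apply: measurable_funM => //; exact: nu_meas Hnu.
have ia := integrable_norm i.
have := key (fun x => `|f x|) ia.
move=> E; under eq_integral => x _ do rewrite /= normrM (ger0_norm (nu_ge0 Hnu x)).
by rewrite -E; have /integrableP[_] := i.
Qed.

Lemma ae_transfer (Q : mR R -> Prop) :
  {ae leb, forall x, nu x != 0 -> Q x} -> {ae mu, forall x, Q x}.
Proof.
move=> [N [mN N0 sN]].
have mz : measurable ([set x : mR R | nu x = 0]).
  rewrite (_ : [set x | _] = nu @^-1` [set 0]); last by apply/seteqP; split.
  by rewrite -[X in measurable X]setTI; apply: (nu_meas Hnu).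
exists (N `|` [set x | nu x = 0]); split; first exact: measurableU.
  apply: null_set_setU => //; first by have /null_content_dominatesP := mu_dominated; apply.
  apply: (etrans (nu_density Hnu mz)); rewrite (eq_integral (cst 0%E)) ?integral0// => x.
  by rewrite inE/= => ->.
move=> x /= nQ; have [n0|n0] := eqVneq (nu x) 0; [by right|left].
by apply: sN => /= h; apply: nQ; apply: h.
Qed.

Lemma mu_pos : {ae mu, forall x, 0 < x}.
Proof.
apply: ae_transfer.
have l0 : leb [set 0 : R] = 0%E by exact: lebesgue_measure_set1.
exists [set 0]; split => // x /= hx; case: (ltgtP x 0) => // x0; exfalso; apply: hx.
by rewrite (nu_supp Hnu (or_introl x0)) eqxx.
Qed.

Lemma moment_integral n : (\int[mu]_x (x ^+ n)%:E = (W p n)%:E)%E.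
Proof. by rewrite (nu_moments Hnu) WphiE. Qed.

Lemma l2_Xn n : l2 mu (fun x => x ^+ n).
Proof.
have mX k : measurable_fun [set: mR R] (fun x : mR R => x ^+ k).
  exact: measurable_funX.
split => //; apply/integrableP; split.
  by apply/measurable_EFinP; exact: (measurable_funX 2 (mX n)).
under eq_integral => x _ do rewrite /= -exprM muln2 -addnn exprD ger0_norm -?expr2 ?sqr_ge0// expr2 -exprD.
by rewrite moment_integral ltry.
Qed.

Lemma l2_poly q : l2 mu (horner q).
Proof.
suff h N : l2 mu (fun x => \sum_(i < N) q`_i * x ^+ i).
  by have := h (size q); congr l2; apply/funext => x; rewrite horner_coef.
by apply: (nrm_sum N (f := fun i x => q`_i * x ^+ i) _).1 => i; apply: l2Z; exact: l2_Xn.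
Qed.

Lemma integrable_poly q : mu.-integrable setT (EFin \o horner q).
Proof.
have := ip_integrable (l2_poly q) (l2_cst mu 1); congr (mu.-integrable _ _).
by apply/funext => x; rewrite /= mulr1.
Qed.

Lemma Rintegral_poly q : \int[mu]_x q.[x] = mom (W p) q.
Proof.
apply: (mom_ext (f := fun q => \int[mu]_x q.[x])) => [q1 q2|r q1|n].
- under eq_Rintegral do rewrite hornerD.
  by rewrite RintegralD//; exact: integrable_poly.
- under eq_Rintegral do rewrite hornerZ.
  by rewrite RintegralZl//; exact: integrable_poly.
- rewrite /Rintegral -[RHS](_ : fine (W p n)%:E = _)// -moment_integral.
  by congr fine; apply: eq_integral => x _; rewrite hornerXn.
Qed.

Lemma ip_poly q1 q2 : ip mu (horner q1) (horner q2) = mom (W p) (q1 * q2).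
Proof. by rewrite -Rintegral_poly; apply: eq_Rintegral => x _; rewrite hornerM. Qed.

Lemma nrm_poly q : nrm mu (horner q) = Num.sqrt (mom (W p) (q ^+ 2)).
Proof. by rewrite /nrm ip_poly expr2. Qed.

Lemma hpsd_W : hpsd (W p).
Proof.
by apply: hpsd_mom => q; rewrite expr2 -ip_poly ip_ge0.
Qed.

(** If [phi(1)] were 0, the second moment [phi(1) phi(2)] would vanish and [mu] would sit at 0,
    against [mu_pos]. This is what makes all the moments positive. *)
Lemma phir1_gt0 : 0 < phir p 1.
Proof.
rewrite lt_neqAle phir_ge0// andbT; apply/eqP => h0.
have x0 : nrm mu (fun x => x) = 0.
  have := nrm_poly 'X; rewrite -['X ^+ 2]/('X^2) momXn.
  rewrite (_ : horner 'X = fun x => x); last by apply/funext => x; rewrite hornerX.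
  by move=> ->; rewrite WS WS -h0 mulr0 mul0r sqrtr0.
have lx : l2 mu (fun x => x) by have := l2_Xn 1; congr l2.
have := ae_nrm0 lx x0; have := mu_pos.
move=> [N [mN N0 sN]] [M [mM M0 sM]].
have : mu setT = 0%E.
  apply/eqP; rewrite eq_le measure_ge0 andbT.
  have NM : mu (N `|` M) = 0%E by apply: null_set_setU.
  rewrite -NM; apply: le_measure; rewrite ?inE//; first exact: measurableU.
  move=> x _; have [x0'|x0'] := ltP 0 x.
    by right; apply: sM => /= /(_ I) /= h; rewrite h ltxx in x0'.
  by left; apply: sN => /=; rewrite ltNge x0'.
by rewrite probability_setT => /eqP; rewrite onee_eq0.
Qed.

Lemma measurable_absR : measurable_fun [set: mR R] (fun x : mR R => `|x|).
Proof. exact: (@measurableT_comp _ _ _ _ _ _ (@Num.norm R R) _ (fun x : mR R => x)). Qed.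

Lemma exp_moment : exists2 lam : R, 0 < lam & l2 mu (fun x => expR (lam * `|x|)).
Proof.
have [M M0 hM] := phir_div_bounded p.
have WM n : W p n <= M ^+ n * n`!%:R.
  elim: n => [|n IH]; first by rewrite W0 expr0 fact0 mulr1.
  have W0n : 0 <= W p n by exact: ltW (W_gt0 phir1_gt0 n).
  have h : phir p n.+1%:R <= M * n.+1%:R by rewrite -ler_pdivrMr// hM.
  rewrite WS factS natrM exprS.
  apply: (@le_trans _ _ ((M ^+ n * n`!%:R) * (M * n.+1%:R))).
    by apply: ler_pM => //; exact: phir_ge0.
  by rewrite le_eqVlt; apply/orP; left; apply/eqP; ring.
(* As [W n <= M ^ n n!], the exponential series at [z |x|] with [z = 2 lam = 1 / (2 M)] has mean at
   most the sum of [2 ^ (- k)]. The factor 2 between [lam] and [z] accounts for the square in the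
   [L^2] norm. *)
pose lam := (4 * M)^-1.
have lam0 : 0 < lam by rewrite invr_gt0 mulr_gt0.
pose z := 2 * lam.
have z0 : 0 < z by rewrite mulr_gt0.
pose s n (x : mR R) : R := series (exp_coeff (z * `|x|)) n.
have sE n x : s n x = \sum_(k < n) (z ^+ k / k`!%:R) * `|x| ^+ k.
  by rewrite /s seriesEord/=; apply: eq_bigr => k _; rewrite /exp_coeff/= exprMn; ring.
have nz x : 0 <= z * `|x| by rewrite mulr_ge0// ltW.
have nds x : nondecreasing_seq (fun n => s n x).
  apply/nondecreasing_seqP => n; rewrite !sE big_ord_recr/= lerDl mulr_ge0 ?divr_ge0 ?exprn_ge0//.
  exact: ltW.
have s0 n x : 0 <= s n x.
  by rewrite sE sumr_ge0// => k _; rewrite mulr_ge0 ?divr_ge0 ?exprn_ge0// ltW.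
have ms n : measurable_fun [set: mR R] (s n).
  rewrite (_ : s n = fun x => \sum_(k < n) (z ^+ k / k`!%:R) * `|x| ^+ k); last by apply/funext => x; exact: sE.
  apply: measurable_sum => k; apply: measurable_funM => //; apply: measurable_funX.
  exact: measurable_absR.
have cs x : (s n x)%:E @[n --> \oo] --> (expR (z * `|x|))%:E.
  by apply: cvg_EFin; [exact: filterE|exact: is_cvg_series_exp_coeff].
have absm k : (\int[mu]_x (`|x| ^+ k)%:E = (W p k)%:E)%E.
  rewrite -moment_integral; apply: ae_eq_integral => //.
  - by apply/measurable_EFinP; apply: measurable_funX; exact: measurable_absR.
  - by apply/measurable_EFinP; apply: measurable_funX.
  have [N [mN N0 sN]] := mu_pos; exists N; split => // x /= hx; apply: sN => /= h; apply: hx => _.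
  by rewrite gtr0_norm.
have ints n : (\int[mu]_x (s n x)%:E <= 2%:E)%E.
  rewrite (eq_integral (fun x : mR R => \sum_(k < n) ((z ^+ k / k`!%:R) * `|x| ^+ k)%:E))%E; last first.
    by move=> x _; rewrite sE sumEFin.
  rewrite ge0_integral_sum//; last 2 first.
  - move=> k; apply/measurable_EFinP; apply: measurable_funM => //; apply: measurable_funX.
    exact: measurable_absR.
  - by move=> k x _; rewrite lee_fin mulr_ge0 ?divr_ge0 ?exprn_ge0// ltW.
  apply: (@le_trans _ _ (\sum_(k < n) ((2^-1 : R) ^+ (0 + k))%:E)%E); last first.
    by rewrite sumEFin lee_fin; apply: le_trans (geo_half_le _ _) _; rewrite expr0 mulr1.
  apply: lee_sum => k _; under eq_integral do rewrite EFinM.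
  have zk : (0 <= (z ^+ k / k`!%:R)%:E)%E by rewrite lee_fin divr_ge0 ?exprn_ge0// ltW.
  have mk : measurable_fun [set: mR R] (fun x : mR R => (`|x| ^+ k)%:E).
    by apply/measurable_EFinP; apply: measurable_funX; exact: measurable_absR.
  have pk (x : mR R) : setT x -> (0 <= (`|x| ^+ k)%:E)%E by rewrite lee_fin exprn_ge0.
  rewrite (ge0_integralZl mu measurableT mk pk zk).
  rewrite absm -EFinM lee_fin; apply: (@le_trans _ _ (z ^+ k / k`!%:R * (M ^+ k * k`!%:R))).
    by rewrite ler_wpM2l ?WM// divr_ge0 ?exprn_ge0// ltW.
  have f0 : k`!%:R != 0 :> R by rewrite pnatr_eq0 -lt0n fact_gt0.
  rewrite [leLHS](_ : _ = (z * M) ^+ k); last by rewrite [RHS]exprMn; field.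
  rewrite add0n (_ : z * M = 2^-1)// /z /lam; field.
  by rewrite gt_eqF.
have me : measurable_fun [set: mR R] (fun x : mR R => expR (lam * `|x|)).
  by apply: measurableT_comp => //; apply: measurable_funM => //; exact: measurable_absR.
exists lam => //; split => //; apply/integrableP; split.
  by apply/measurable_EFinP; exact: measurable_funX.
apply: (@le_lt_trans _ _ 2%:E); last by rewrite ltry.
rewrite (eq_integral (fun x : mR R => (expR (z * `|x|))%:E)); last first.
  by move=> x _; rewrite /= ger0_norm ?sqr_ge0// -expRM_natr; congr (expR _)%:E; rewrite /z; ring.
have E : (\int[mu]_x (expR (z * `|x|))%:E = limn (fun n => \int[mu]_x (s n x)%:E))%E.
  rewrite -monotone_convergence//.
  - by apply: eq_integral => x _; apply/esym/cvg_lim => //; exact: cs.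
  - by move=> n; apply/measurable_EFinP.
  - by move=> n x _; rewrite lee_fin.
  - by move=> x _ n m nm; rewrite lee_fin; exact: nds.
rewrite E; apply: lime_le; last exact: nearW.
apply: ereal_nondecreasing_is_cvgn => n m nm; apply: ge0_le_integral => //.
- by move=> x _; rewrite lee_fin.
- by apply/measurable_EFinP.
- by apply/measurable_EFinP.
- by move=> x _; rewrite lee_fin; exact: nds.
Qed.

(** The signed density [f nu] has all its moments equal to 0 and, by Cauchy-Schwarz between [f] and
    [exp (lam x)], an exponential moment; determinacy applies. *)
Lemma orth_poly f : l2 mu f -> (forall q, ip mu f (horner q) = 0) -> f = cst 0 %[ae mu].
Proof.
move=> lf hf; have [lam lam0 le] := exp_moment.
have mf := lf.1.
(* The value [nu 0] is unconstrained; this factor removes it. *)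
pose pos (x : mR R) : R := (0 < x)%R%:R.
have mpos : measurable_fun [set: mR R] pos.
  have -> : pos = \1_(`]0, +oo[%classic : set (mR R)).
    by apply/funext => x; rewrite indicE /pos; congr (_%:R); congr nat_of_bool; apply/idP/idP; rewrite inE/= in_itv/= andbT.
  exact: measurable_indic.
pose g x : R := f x * nu x * pos x.
have mg : measurable_fun [set: mR R] (g : mR R -> R).
  by do 2 apply: measurable_funM => //; exact: nu_meas Hnu.
have gpos x : pos x = 0 \/ (pos x = 1 /\ 0 < x).
  by rewrite /pos; case: ltP => _; [right|left].
have [ig _] := integral_density (ip_integrable lf le).
have hg := @ae0_of_moments R g lam lam0 mg.
have {}hg : {ae leb, forall x, g x = 0}.
  apply: hg.
  - by move=> x x0; rewrite /g /pos ltNge x0 mulr0.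
  - apply: (integrable_dominated (T := mR R)
      (g := fun x : R => `|f x * expR (lam * `|x|) * nu x|)) => //.
    + by apply: measurable_funM => //; exact: measurable_expRMl.
    + move=> x _; rewrite /g; case: (gpos x) => [->|[-> x0]].
        by rewrite mulr0 mul0r normr0.
      by rewrite mulr1 (gtr0_norm x0) mulrAC.
    + exact: integrable_norm ig.
  - move=> k; have lk := l2_Xn k.
    have [ik Ek] := integral_density (ip_integrable lf lk).
    have : ip mu f (horner 'X^k) = 0 by [].
    have -> : ip mu f (horner 'X^k) = \int[mu]_x (f x * x ^+ k) by apply: eq_Rintegral => x _; rewrite hornerXn.
    rewrite Ek => <-; rewrite /Rintegral; congr fine; apply: ae_eq_integral => //.
    + by apply/measurable_EFinP; apply: measurable_funM => //; exact: measurable_funX.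
    + by case/integrableP : ik.
    exists [set 0]; split => //; first exact: lebesgue_measure_set1.
    move=> x /= hx; case: (ltgtP x 0) => // x0; exfalso; apply: hx => _.
      by rewrite (nu_supp Hnu (or_introl x0)) !mulr0 /g (nu_supp Hnu (or_introl x0)) mulr0 !mul0r.
    by rewrite /g /pos x0 mulr1 mulrAC.
have h1 : {ae mu, forall x, 0 < x -> f x = 0}.
  apply: ae_transfer; apply: ae_mono hg => x gx n0 x0; move: gx.
  rewrite /g /pos x0 mulr1 => /eqP; rewrite mulf_eq0 (negPf n0) orbF => /eqP.
  by [].
have h2 := mu_pos.
have := ae_mono2 (fun x a b => a b) h1 h2.
by apply: ae_mono => x fx _.
Qed.

Lemma dense_poly f : l2 mu f -> forall d, 0 < d ->
  exists q, nrm mu (fun x => f x - q.[x]) <= d.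
Proof.
apply: (dense_of_orthogonal (e := horner)) => [|r a q x|].
- exact: l2_poly.
- by rewrite hornerD hornerZ.
- exact: orth_poly.
Qed.

End InvariantDensity.

(** * Functions in [C_0] and Feller semigroups *)

Section C0Functions.
Context {R : realType}.
Implicit Types (f g : R -> R) (a b c : R).

Lemma C0_lin f g a : C0 f -> C0 g -> C0 (fun x => a * f x + g x).
Proof.
move=> [cf lf nf] [cg lg ng]; split.
- move=> x; apply: cvgD; last exact: cg.
  by apply: cvgM; [exact: cvg_cst|exact: cf].
- by rewrite -(addr0 0) -{1}(mulr0 a); apply: cvgD => //; apply: cvgM => //; exact: cvg_cst.
- by move=> x x0; rewrite nf// ng// mulr0 addr0.
Qed.

Lemma C0M f g : C0 f -> C0 g -> C0 (fun x => f x * g x).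
Proof.
move=> [cf lf nf] [cg lg ng]; split.
- by move=> x; apply: cvgM; [exact: cf|exact: cg].
- by rewrite -(mulr0 0); apply: cvgM.
- by move=> x x0; rewrite nf// mul0r.
Qed.

Lemma C0_norm f : C0 f -> C0 (fun x => `|f x|).
Proof.
move=> [cf lf nf]; split.
- by move=> x; apply: cvg_norm; exact: cf.
- by rewrite -(@normr0 R R); apply: cvg_norm.
- by move=> x x0; rewrite nf// normr0.
Qed.

Lemma C0_0 : C0 (fun=> 0 : R).
Proof. by split => // [x|]; exact: cvg_cst. Qed.

Lemma C0Z f a : C0 f -> C0 (fun x => a * f x).
Proof.
by move=> Cf; have := C0_lin a Cf C0_0; congr C0; apply/funext => x; rewrite addr0.
Qed.

Lemma C0_tail f e : C0 f -> 0 < e -> exists2 M, 0 < M & forall x, M <= x -> `|f x| <= e.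
Proof.
move=> [_ lf _] e0; have /cvgr0_norm_lt /(_ _ e0) [M [_ hM]] := lf.
exists (Num.max M 0 + 1); first by rewrite ltr_wpDl// le_max lexx orbT.
move=> x hx; apply/ltW/hM; apply: lt_le_trans hx.
by rewrite ltr_pwDr// le_max lexx.
Qed.

Lemma C0_bounded f : C0 f -> exists2 c, 0 < c & forall x, `|f x| <= c.
Proof.
move=> Cf; have [M M0 hM] := C0_tail Cf ltr01.
have [cf _ nf] := C0_norm Cf.
have [|z zI hz] := @EVT_max R (fun x => `|f x|) 0 M (ltW M0).
  by apply: continuous_subspaceW cf => x /=; rewrite !in_itv/= andbT => /andP[].
exists (`|f z| + 1); first by rewrite ltr_wpDl.
move=> x; have [x0|x0] := ltP x 0; first by rewrite nf// addr_ge0.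
have [xM|/ltW Mx] := leP x M; last by apply: le_trans (hM _ Mx) _; rewrite lerDr.
by apply: le_trans (hz x _) _; [rewrite in_itv/= x0|rewrite lerDl].
Qed.

Lemma C0_measurable f : C0 f -> measurable_fun [set: mR R] (f : mR R -> R).
Proof.
move=> [cf _ nf]; have mp : measurable (`[0%R, +oo[%classic : set (mR R)) by exact: measurable_itv.
have mn : measurable (`]-oo, 0%R[%classic : set (mR R)) by exact: measurable_itv.
rewrite (_ : setT = `[0%R, +oo[%classic `|` `]-oo, 0%R[%classic); last first.
  apply/seteqP; split => // x _ /=; rewrite !in_itv/= andbT.
  by case: (leP 0 x) => h; [left|right].
apply/measurable_funU => //; split; first exact: subspace_continuous_measurable_fun.
apply: (eq_measurable_fun (fun _ : mR R => 0 : R)) => [x|]; last exact: measurable_cst.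
by rewrite inE/= in_itv/= => x0; rewrite nf.
Qed.

Variable mu : probability (mR R) R.
Local Notation l2 := (l2 mu).
Local Notation nrm := (nrm mu).

Lemma nrm_eq0 f : (forall x, f x = 0) -> nrm f = 0.
Proof.
move=> f0; rewrite /nrm /ip; under eq_Rintegral do rewrite f0 mulr0.
by rewrite Rintegral_cst// mul0r sqrtr0.
Qed.

Lemma l2_bounded f c : measurable_fun [set: mR R] (f : mR R -> R) ->
  (forall x, `|f x| <= c) -> l2 f /\ nrm f <= c.
Proof.
move=> mf fc; have c0 : 0 <= c by apply: le_trans (fc 0).
have fc2 x : f x ^+ 2 <= c ^+ 2.
  by rewrite -(real_normK (num_real (f x))) ler_sqr ?nnegrE.
have lf : l2 f.
  split => //; apply: (integrable_dominated (T := mR R) (g := fun=> c ^+ 2)) => //.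
  - exact: measurable_funX.
  - by move=> x _; rewrite ger0_norm ?sqr_ge0.
  - exact: (finite_measure_integrable_cst mu (c ^+ 2)).
split => //; rewrite -ler_sqr ?nnegrE ?nrm_ge0// nrm_sqr.
apply: (@le_trans _ _ (\int[mu]_x (cst (c ^+ 2) x))).
  apply: le_Rintegral => //.
  - exact: ip_integrable.
  - exact: (finite_measure_integrable_cst mu (c ^+ 2)).
  - by move=> x _; rewrite -expr2.
apply: (@le_trans _ _ (c ^+ 2 * fine (mu setT))); first by rewrite Rintegral_cst.
by rewrite probability_setT mulr1.
Qed.

Lemma l2_C0 f : C0 f -> l2 f.
Proof.
move=> Cf; have [c _ hc] := C0_bounded Cf.
exact: (l2_bounded (C0_measurable Cf) hc).1.
Qed.

Lemma expdecay_C0 (e : R) : 0 < e -> C0 (fun x : R => if x < 0 then 0 else expR (- (e * x)) : R).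
Proof.
move=> e0; split.
- apply: (@subspace_eq_continuous _ _ _ (fun x => expR (- (e * x)))).
    by move=> x; rewrite inE/= in_itv/= andbT => x0; rewrite /from_subspace ltNge x0.
  by apply: continuous_subspaceT => x; exact: continuous_expRM.
- apply/cvgr0Pnorm_le => d d0.
  exists ((e * d)^-1); split; first exact: num_real.
  move=> x hx; have x0 : 0 < x by apply: lt_trans hx; rewrite invr_gt0 mulr_gt0.
  rewrite ltNge (ltW x0)/= ger0_norm ?expR_ge0// expRN.
  have ex : 0 < e * x by rewrite mulr_gt0.
  apply: (@le_trans _ _ (e * x)^-1).
    rewrite lef_pV2 ?posrE ?expR_gt0//; apply: le_trans (expR_ge1Dx _); by rewrite lerDr.
  rewrite -(invrK d) lef_pV2 ?posrE ?invr_gt0// ltW// mulrC -ltr_pdivrMr//.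
  by move: hx; rewrite invfM mulrC.
- by move=> x ->.
Qed.

Section Feller.
Variable P : R -> (R -> R) -> R -> R.
Hypothesis HF : feller_semigroup P.
Implicit Types (s t h : R).

Lemma P_0 t x : 0 <= t -> P t (fun=> 0) x = 0.
Proof.
move=> t0; have := feller_linear HF 1 t0 C0_0 C0_0 x.
have -> : (fun y : R => 1 * 0 + 0) = (fun=> 0 : R) by apply/funext => y; rewrite mulr0 addr0.
by rewrite mul1r => /eqP; rewrite -subr_eq0 opprD addNKr oppr_eq0 => /eqP.
Qed.

Lemma PZ t f a x : 0 <= t -> C0 f -> P t (fun y => a * f y) x = a * P t f x.
Proof.
move=> t0 Cf; have := feller_linear HF a t0 Cf C0_0 x; rewrite P_0// addr0 => <-.
by congr (P t _ x); apply/funext => y; rewrite addr0.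
Qed.

Lemma P_lin t f g a b x : 0 <= t -> C0 f -> C0 g ->
  P t (fun y => a * f y + b * g y) x = a * P t f x + b * P t g x.
Proof. by move=> t0 Cf Cg; rewrite feller_linear ?PZ//; exact: C0Z. Qed.

Lemma P_itv t f c x : 0 <= t -> C0 f -> 0 < c -> (forall y, 0 <= f y <= c) -> 0 <= P t f x <= c.
Proof.
move=> t0 Cf c0 hf.
have := @feller_contr _ _ HF t (fun y => c^-1 * f y) t0 (C0Z c^-1 Cf).
have h y : 0 <= c^-1 * f y <= 1.
  by have /andP[h1 h2] := hf y; rewrite mulr_ge0 ?invr_ge0 ?(ltW c0)//= mulrC ler_pdivrMr// mul1r.
by move=> /(_ h x); rewrite PZ// pmulr_rge0 ?invr_gt0// mulrC ler_pdivrMr// mul1r.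
Qed.

Lemma P_ge0 t f x : 0 <= t -> C0 f -> (forall y, 0 <= f y) -> 0 <= P t f x.
Proof.
move=> t0 Cf f0; have [c c0 hc] := C0_bounded Cf.
have h y : 0 <= f y <= c by rewrite f0/=; have := hc y; rewrite ger0_norm.
by have /andP[] := P_itv x t0 Cf c0 h.
Qed.

Lemma P_bound t f c x : 0 <= t -> C0 f -> 0 < c -> (forall y, `|f y| <= c) -> `|P t f x| <= c.
Proof.
move=> t0 Cf c0 hf.
pose fp y := 2^-1 * `|f y| + 2^-1 * f y.
pose fm y := 2^-1 * `|f y| + (- 2^-1) * f y.
have Cp : C0 fp by apply: C0_lin; [exact: C0_norm|exact: C0Z].
have Cm : C0 fm by apply: C0_lin; [exact: C0_norm|exact: C0Z].
have hp y : 0 <= fp y <= c.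
  have := hf y; have := ler_norm (f y); have := ler_norm (- f y); rewrite normrN /fp; lra.
have hm y : 0 <= fm y <= c.
  have := hf y; have := ler_norm (f y); have := ler_norm (- f y); rewrite normrN /fm; lra.
have E : P t f x = P t fp x - P t fm x.
  have := P_lin 1 (-1) x t0 Cp Cm; rewrite mul1r mulN1r => <-.
  by congr (P t _ x); apply/funext => y; rewrite /fp /fm; field.
have /andP[p0 pc] := P_itv x t0 Cp c0 hp; have /andP[m0 mc] := P_itv x t0 Cm c0 hm.
by rewrite E ler_norml; lra.
Qed.

(** Cauchy-Schwarz for the positive functional [f |-> P t f x]. As constants are not in [C_0], a
    slowly decaying exponential [g] replaces 1 in the expansion of [P t ((f - l g) ^ 2) >= 0]. *)
Lemma P_sqr t f x : 0 <= t -> C0 f -> P t f x ^+ 2 <= P t (fun y => f y * f y) x.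
Proof.
move=> t0 Cf; have [c c0 hc] := C0_bounded Cf.
set l := P t f x; apply/ler_addgt0Pl => e e0.
pose d := e / (2 * (`|l| + 1)).
have l1 : 0 < `|l| + 1 by rewrite ltr_wpDl.
have d0 : 0 < d by rewrite divr_gt0// mulr_gt0.
have [M M0 hM] := C0_tail Cf d0.
(* Makes [1 - g <= d / c] on [[0, M]]; beyond [M] the function [f] itself is at most [d]. *)
pose n := d / (c * M).
have n0 : 0 < n by rewrite divr_gt0// mulr_gt0.
pose g (y : R) := if y < 0 then 0 else expR (- (n * y)).
have Cg : C0 g := expdecay_C0 n0.
have g01 y : 0 <= g y <= 1.
  rewrite /g; case: ltP => y0; first by rewrite lexx ler01.
  by rewrite expR_ge0 expRN_le1// mulr_ge0// ltW.
have fg y : `|f y * g y - f y| <= d.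
  have -> : f y * g y - f y = - (f y * (1 - g y)) by ring.
  have /andP[g0 g1] := g01 y.
  have g1' : 0 <= 1 - g y by rewrite subr_ge0.
  rewrite normrN normrM (ger0_norm g1').
  have [y0|y0] := ltP y 0; first by have [_ _ ->] := Cf => //; rewrite normr0 mul0r ltW.
  have [yM|/ltW My] := leP y M; last first.
    by apply: le_trans (hM _ My); rewrite ler_piMr// gerBl.
  apply: (@le_trans _ _ (c * (n * M))); last first.
    rewrite le_eqVlt; apply/orP; left; apply/eqP; rewrite /n; field.
    by rewrite !gt_eqF.
  apply: ler_pM => //; rewrite /g ltNge y0/=.
  apply: (@le_trans _ _ (n * y)); last by rewrite ler_pM2l.
  by have := expR_ge1Dx (- (n * y)); lra.
have Cfg := C0M Cf Cg; have Cff := C0M Cf Cf; have Cgg := C0M Cg Cg.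
have Pfg : `|P t (fun y => f y * g y) x - l| <= d.
  have := P_lin 1 (-1) x t0 Cfg Cf; rewrite mul1r mulN1r => <-.
  apply: P_bound => // [|y]; last by rewrite mul1r mulN1r.
  apply: C0_lin => //; exact: C0Z.
have Pgg : P t (fun y => g y * g y) x <= 1.
  have h y : 0 <= g y * g y <= 1.
    have /andP[g0 g1] := g01 y; rewrite mulr_ge0//=.
    by apply: (@le_trans _ _ (1 * 1)); [apply: ler_pM|rewrite mulr1].
  by have /andP[] := P_itv x t0 Cgg ltr01 h.
have Q0 : 0 <= P t (fun y => 1 * (f y * f y) + 1 * ((- (2 * l)) * (f y * g y) + l ^+ 2 * (g y * g y))) x.
  apply: P_ge0 => // [|y].
    by apply: C0_lin => //; apply: C0Z; apply: C0_lin => //; exact: C0Z.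
  by rewrite (_ : 1 * _ + _ = (f y - l * g y) ^+ 2) ?sqr_ge0//; ring.
move: Q0; rewrite P_lin//; last by apply: C0_lin => //; exact: C0Z.
rewrite !mul1r P_lin//.
move: Pfg; rewrite ler_norml => /andP[h1 h2] h3.
set A := P t (fun y => f y * f y) x in h3 *.
set B := P t (fun y => f y * g y) x in h1 h2 h3.
set G := P t (fun y => g y * g y) x in Pgg h3.
have h4 : l ^+ 2 * G <= l ^+ 2 by rewrite ler_piMr// sqr_ge0.
have h5 : `|2 * l * (B - l)| <= e.
  rewrite normrM normrM ger0_norm//.
  apply: (@le_trans _ _ (2 * (`|l| + 1) * d)); last by rewrite /d mulrC divfK// gt_eqF// mulr_gt0.
  apply: ler_pM => //.
    by rewrite ler_pM2l// lerDl.
  by rewrite ler_norml h1 h2.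
move: h5; rewrite ler_norml => /andP[h6 h7].
have E1 : 2 * l * (B - l) = 2 * l * B - 2 * l ^+ 2 by ring.
rewrite E1 in h6 h7; rewrite mulNr in h3; lra.
Qed.

Hypothesis inv : forall t f, 0 <= t -> C0 f -> \int[mu]_x P t f x = \int[mu]_x f x.

Lemma P_contraction t f : 0 <= t -> C0 f -> nrm (P t f) <= nrm f.
Proof.
move=> t0 Cf; have Cff := C0M Cf Cf.
rewrite -ler_sqr ?nnegrE ?nrm_ge0// !nrm_sqr -[leRHS](inv t0 Cff).
apply: le_Rintegral => //.
- by apply: ip_integrable; apply: l2_C0; exact: (feller_C0 HF).
- have lP : l2 (P t (fun y => f y * f y)) by apply: l2_C0; exact: (feller_C0 HF).
  have := ip_integrable lP (l2_cst mu 1); congr (mu.-integrable _ _).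
  by apply/funext => x; rewrite /= mulr1.
- by move=> x _; rewrite -expr2; exact: P_sqr.
Qed.

(** Cut [[0, t]] into [N + 1] steps of length [h]. Over one step [P h f - exp (- n h) f] is
    [h (g + n f)] up to [o(h)], and contractivity lets the errors simply add up, to a factor [t]. *)
Lemma generator_bound f g n t : 0 <= t -> generates P f g ->
  nrm (fun x => P t f x - expR (- (n%:R * t)) * f x) <= t * nrm (fun x => g x + n%:R * f x).
Proof.
rewrite le_eqVlt => /predU1P[<- [Cf Cg _]|t0 [Cf Cg Hg]].
  rewrite mul0r nrm_eq0// => x.
  by rewrite (feller_id HF Cf) mulr0 oppr0 expR0 mul1r subrr.
have lf := l2_C0 Cf; have lg := l2_C0 Cg.
have lgf : l2 (fun x => g x + n%:R * f x) by exact: l2_lin.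
apply/ler_addgt0Pr => e e0.
pose e1 := e / (2 * t).
have e10 : 0 < e1 by rewrite divr_gt0// mulr_gt0.
(* [h K <= e1] makes the second-order term [(n h) ^ 2 ||f||] of the exponential at most [h e1]. *)
pose K := n%:R ^+ 2 * nrm f + 1.
have K0 : 0 < K by rewrite ltr_wpDl// mulr_ge0 ?nrm_ge0// exprn_ge0.
have [d /= d0 hd] := Hg e1 e10.
have [N hN] : exists N : nat, t / N.+1%:R < Num.min d (e1 / K).
  have m0 : 0 < Num.min d (e1 / K) by rewrite lt_min d0 divr_gt0.
  have [N _ /(_ N (leqnn N))/= hN] := near_infty_natSinv_lt (PosNum (divr_gt0 m0 t0)).
  by exists N; move: hN; rewrite ltr_pdivlMr// mulrC.
pose h := t / N.+1%:R.
have h0 : 0 < h by rewrite divr_gt0.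
have [hd' hK] : h < d /\ h < e1 / K by move: hN; rewrite lt_min => /andP[].
pose c := expR (- (n%:R * h)).
pose r x := P h f x - c * f x.
have CPh : C0 (P h f) by apply: (feller_C0 HF) => //; exact: ltW.
have Cr : C0 r.
  by have := C0_lin 1 CPh (C0Z (- c) Cf); congr C0; apply/funext => x; rewrite /r mul1r mulNr.
have nr : nrm r <= h * (nrm (fun x => g x + n%:R * f x) + 2 * e1).
  pose u x := (P h f x - f x) / h - g x.
  have u1 x : `|u x| <= e1.
    by apply: hd => //; rewrite /= sub0r normrN gtr0_norm.
  have Cu : C0 u.
    have := C0_lin h^-1 CPh (C0_lin (- h^-1) Cf (C0Z (-1) Cg)); congr C0; apply/funext => x.
    by rewrite /u; ring.
  have [lu nu1] := l2_bounded (C0_measurable Cu) u1.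
  have rE : r = fun x => (h * (g x + n%:R * f x) + h * u x) + (- ecomp (n%:R * h)) * f x.
    apply/funext => x; rewrite /r /u /c /ecomp; field.
    exact: lt0r_neq0.
  rewrite rE; apply: le_trans (nrmD (l2D (l2Z _ lgf) (l2Z _ lu)) (l2Z _ lf)) _.
  apply: le_trans (lerD (nrmD (l2Z _ lgf) (l2Z _ lu)) (lexx _)) _.
  rewrite !nrmZ// normrN (gtr0_norm h0) (ger0_norm (ecomp_ge0 _)).
  have nh : 0 <= n%:R * h by rewrite mulr_ge0// ltW.
  have ec : ecomp (n%:R * h) * nrm f <= h * e1.
    apply: (@le_trans _ _ ((n%:R * h) ^+ 2 * nrm f)).
      apply: ler_wpM2r; first exact: nrm_ge0.
      by apply: le_trans (ecomp_le nh) _; rewrite ge_min lexx.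
    rewrite exprMn expr2 (_ : _ * _ * _ * _ = h * (h * (n%:R ^+ 2 * nrm f))); last by ring.
    rewrite ler_pM2l//; apply: (@le_trans _ _ (h * K)).
      by rewrite ler_pM2l// lerDl.
    by rewrite -ler_pdivlMr// ltW.
  have : h * nrm u <= h * e1 by rewrite ler_pM2l.
  by rewrite mulrDr; lra.
have step j : nrm (fun x => P (j%:R * h) f x - c ^+ j * f x) <= j%:R * nrm r.
  elim: j => [|j IH].
    rewrite !mul0r nrm_eq0// => x.
    by rewrite (feller_id HF Cf) expr0 mul1r subrr.
  have jh : 0 <= j%:R * h by rewrite mulr_ge0// ltW.
  have E x : P (j.+1%:R * h) f x - c ^+ j.+1 * f x =
      P (j%:R * h) r x + c * (P (j%:R * h) f x - c ^+ j * f x).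
    rewrite -(natr1 j) mulrDl mul1r (feller_comp HF jh (ltW h0) Cf).
    have -> : P h f = fun y => 1 * r y + c * f y.
      by apply/funext => y; rewrite /r mul1r subrK.
    by rewrite P_lin// exprS; ring.
  have lPr : l2 (P (j%:R * h) r) by apply: l2_C0; exact: (feller_C0 HF).
  have lPf : l2 (fun x => P (j%:R * h) f x - c ^+ j * f x).
    by apply: l2B; [apply: l2_C0; exact: (feller_C0 HF)|exact: l2Z].
  rewrite (eq_nrm mu E); apply: le_trans (nrmD lPr (l2Z c lPf)) _.
  rewrite nrmZ// (ger0_norm (expR_ge0 _)) -(natr1 j) mulrDl mul1r addrC.
  apply: lerD; last exact: P_contraction.
  by apply: le_trans IH; rewrite ler_piMl ?nrm_ge0// expRN_le1// mulr_ge0// ltW.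
have tE : N.+1%:R * h = t by rewrite mulrC divfK.
have := step N.+1; rewrite tE.
have -> : c ^+ N.+1 = expR (- (n%:R * t)).
  by rewrite /c -expRM_natr; congr expR; rewrite -tE; ring.
move=> /le_trans; apply.
apply: (@le_trans _ _ (N.+1%:R * (h * (nrm (fun x => g x + n%:R * f x) + 2 * e1)))).
  by rewrite ler_pM2l.
rewrite mulrA tE mulrDr lerD2l /e1.
by rewrite le_eqVlt; apply/orP; left; apply/eqP; field; exact: lt0r_neq0.
Qed.

End Feller.
End C0Functions.

(** * Polynomials damped by an exponential *)

Section PolyExp.
Context {R : realType}.
Implicit Types (q r : {poly R}) (e x y z M a : R).

Definition absp q : {poly R} := \poly_(i < size q) `|q`_i|.

Lemma absp_coef_ge0 q i : 0 <= (absp q)`_i.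
Proof. by rewrite coef_poly; case: ifP. Qed.

Lemma horner_mono q x y : (forall i, 0 <= q`_i) -> 0 <= x -> x <= y -> q.[x] <= q.[y].
Proof.
move=> q0 x0 xy; rewrite !horner_coef; apply: ler_sum => i _; apply: ler_wpM2l => //.
by apply: lerXn2r; rewrite ?nnegrE// (le_trans x0).
Qed.

Lemma absp_ge q x : 0 <= x -> `|q.[x]| <= (absp q).[x].
Proof.
move=> x0; rewrite horner_poly horner_coef; apply: le_trans (ler_norm_sum _ _ _) _.
by apply: ler_sum => i _; rewrite normrM (ger0_norm (exprn_ge0 _ x0)).
Qed.

Lemma polyexp_bound q e : 0 < e -> exists2 C, 0 < C &
  forall x, 0 <= x -> (1 + x) * (`|q.[x]| * expR (- (e * x))) <= C.
Proof.
move=> e0; pose r := (1 + 'X) * absp q.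
pose C := \sum_(i < size r) `|r`_i| * (i`!%:R / e ^+ i).
have C0 : 0 <= C.
  by apply: sumr_ge0 => i _; rewrite mulr_ge0// divr_ge0// exprn_ge0// ltW.
exists (C + 1) => [|x x0]; first by rewrite ltr_wpDl.
apply: (@le_trans _ _ C); last by rewrite lerDl.
apply: (@le_trans _ _ (r.[x] * expR (- (e * x)))).
  rewrite mulrA ler_wpM2r ?expR_ge0// /r hornerM !hornerE ler_wpM2l ?addr_ge0//.
  exact: absp_ge.
rewrite expRN ler_pdivrMr ?expR_gt0// horner_coef mulr_suml; apply: ler_sum => i _.
apply: (@le_trans _ _ (`|r`_i| * x ^+ i)).
  by rewrite ler_wpM2r ?exprn_ge0// ler_norm.
by rewrite -mulrA ler_wpM2l//; exact: expr_le_expR.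
Qed.

Lemma is_derive_polyexp q e x : is_derive x (1 : R) (fun x => q.[x] * expR (- (e * x)))
  ((q^`() - e *: q).[x] * expR (- (e * x))).
Proof.
have d1 := is_derive_expRM e x.
have d2 : is_derive x (1 : R) (horner q) q^`().[x].
  exact: is_derive_poly.
apply: is_derive_eq; rewrite /GRing.scale/= hornerD hornerN hornerZ; ring.
Qed.

Lemma is_derive_comp_expR (F f : R -> R) s : (forall x : R, is_derive x (1 : R) F (f x)) ->
  is_derive s (1 : R) (fun s => F (expR s)) (expR s * f (expR s)).
Proof.
move=> dF; have d1 := dF (expR s).
have d2 : is_derive s (1 : R) expR (expR s) by exact: is_derive_expR.
have := @is_derive1_comp R F expR s _ _ d1 d2.
by rewrite mulrC.
Qed.

(** [D] vanishes to first order at 0, so integrating the bound on [D2] twice gives the compensated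
    exponential; this shape is wanted because [ecomp] is integrable against [Pi]. *)
Lemma ecomp_compare (D D1 D2 : R -> R) a M y : 0 < a -> 0 <= y ->
  (forall v : R, is_derive v (1 : R) D (D1 v)) ->
  (forall v : R, is_derive v (1 : R) D1 (D2 v)) ->
  D 0 = 0 -> D1 0 = 0 -> (forall v, 0 <= v -> `|D2 v| <= M * expR (- (a * v))) ->
  `|D y| <= M / a ^+ 2 * ecomp (a * y).
Proof.
move=> a0 y0 dD dD1 D00 D10 hD2.
have an : a != 0 by rewrite gt_eqF.
have key (E E1 E2 : R -> R) : (forall v : R, is_derive v (1 : R) E (E1 v)) ->
    (forall v : R, is_derive v (1 : R) E1 (E2 v)) -> E 0 = 0 -> E1 0 = 0 ->
    (forall v, 0 <= v -> E2 v <= M * expR (- (a * v))) -> E y <= M / a ^+ 2 * ecomp (a * y).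
  move=> dE dE1 E00 E10 hE2.
  have mono (F F1 : R -> R) : (forall v : R, is_derive v (1 : R) F (F1 v)) -> F 0 = 0 ->
      (forall v, 0 <= v -> 0 <= F1 v) -> forall v, 0 <= v -> 0 <= F v.
    move=> dF F0 F10 v v0; rewrite -F0.
    suff : 0 <= F v - F 0 by rewrite F0 subr0.
    have [->|vn0] := eqVneq v 0; first by rewrite subrr.
    have {}v0 : 0 < v by rewrite lt_neqAle eq_sym vn0.
    have [|w] := @MVT R F F1 0 v v0 (fun w _ => dF w).
      by apply: continuous_subspaceT; exact: derive_continuous dF.
    rewrite in_itv/= => /andP[w0 _] ->.
    by rewrite mulr_ge0 ?subr_ge0 ?F10 ?(ltW v0)// ltW.
  have h1 v : 0 <= v -> 0 <= M / a * (1 - expR (- (a * v))) - E1 v.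
    apply: (mono (fun v => M / a * (1 - expR (- (a * v))) - E1 v)
                 (fun v => M * expR (- (a * v)) - E2 v)).
    - move=> w; have d1 := is_derive_expRM a w; have d2 := dE1 w.
      by apply: is_derive_eq; rewrite /GRing.scale/=; field.
    - by rewrite mulr0 oppr0 expR0 subrr mulr0 E10 subrr.
    - by move=> w w0; rewrite subr_ge0 hE2.
  rewrite -subr_ge0.
  apply: (mono (fun v => M / a ^+ 2 * ecomp (a * v) - E v)
               (fun v => M / a * (1 - expR (- (a * v))) - E1 v)) => //.
  - move=> w; have d1 := is_derive_expRM a w; have d2 := dE w.
    by rewrite /ecomp; apply: is_derive_eq; rewrite /GRing.scale/=; field.
  - by rewrite /ecomp mulr0 oppr0 expR0 subrr addr0 mulr0 E00 subrr.
rewrite ler_norml; apply/andP; split; last first.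
  apply: (key D D1 D2) => // v v0; exact: le_trans (ler_norm _) (hD2 v v0).
rewrite lerNl; apply: (key (fun v => - D v) (fun v => - D1 v) (fun v => - D2 v)).
- by rewrite D00 oppr0.
- by rewrite D10 oppr0.
- by move=> v v0; rewrite (le_trans _ (hD2 v v0))// -normrN ler_norm.
Qed.

(** Integrand of the nonlocal part of [lagG], before division by [x]. Its second derivative in [y]
    is [x exp (- y)] times [jker] at [exp (- y) x], where [jker] is the derivative of [z f'(z)]. *)
Definition jump (f f1 : R -> R) x y : R := f (expR (- y) * x) - f x + y * x * f1 x.

Definition jker (f1 f2 : R -> R) z : R := f1 z + z * f2 z.

Lemma jump_derive (f f1 f2 : R -> R) x y :
  (forall z : R, is_derive z (1 : R) f (f1 z)) -> (forall z : R, is_derive z (1 : R) f1 (f2 z)) ->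
  is_derive y (1 : R) (jump f f1 x) (x * f1 x - expR (- y) * x * f1 (expR (- y) * x)) /\
  is_derive y (1 : R) (fun y => x * f1 x - expR (- y) * x * f1 (expR (- y) * x))
    (x * (expR (- y) * jker f1 f2 (expR (- y) * x))).
Proof.
move=> d1 d2.
have e1 : is_derive y (1 : R) (fun y => expR (- y) * x) (- expR (- y) * x).
  have := is_derive_expRM 1 y; under eq_fun do rewrite mul1r.
  by rewrite mul1r => d; apply: is_derive_eq; rewrite /GRing.scale/=; ring.
have c1 := @is_derive1_comp R f (fun y => expR (- y) * x) y _ _ (d1 _) e1.
have c2 := @is_derive1_comp R f1 (fun y => expR (- y) * x) y _ _ (d2 _) e1.
rewrite /comp in c1 c2.
split.
  by rewrite /jump; apply: is_derive_eq; rewrite /GRing.scale/=; ring.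
by apply: is_derive_eq; rewrite /GRing.scale/= /jker; ring.
Qed.

Lemma jump_cmp (f f1 f2 h h1 h2 : R -> R) x x' y a M : 0 < a -> 0 < x -> 0 < x' -> 0 <= y ->
  (forall z : R, is_derive z (1 : R) f (f1 z)) -> (forall z : R, is_derive z (1 : R) f1 (f2 z)) ->
  (forall z : R, is_derive z (1 : R) h (h1 z)) -> (forall z : R, is_derive z (1 : R) h1 (h2 z)) ->
  (forall v, 0 <= v -> `|expR (- v) * (jker f1 f2 (expR (- v) * x) -
     jker h1 h2 (expR (- v) * x'))| <= M * expR (- (a * v))) ->
  `|jump f f1 x y / x - jump h h1 x' y / x'| <= M / a ^+ 2 * ecomp (a * y).
Proof.
move=> a0 x0 x'0 y0 d1 d2 d3 d4 hM.
have Dx v := (jump_derive x v d1 d2).1; have Dx1 v := (jump_derive x v d1 d2).2.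
have Dy v := (jump_derive x' v d3 d4).1; have Dy1 v := (jump_derive x' v d3 d4).2.
pose D y := jump f f1 x y / x - jump h h1 x' y / x'.
pose D1 v := (x * f1 x - expR (- v) * x * f1 (expR (- v) * x)) / x -
  (x' * h1 x' - expR (- v) * x' * h1 (expR (- v) * x')) / x'.
pose D2 v := expR (- v) * (jker f1 f2 (expR (- v) * x) - jker h1 h2 (expR (- v) * x')).
apply: (@ecomp_compare D D1 D2 a M y a0 y0).
- move=> v; have a1 := Dx v; have a2 := Dy v; rewrite /D /D1.
  by apply: is_derive_eq; rewrite /GRing.scale/=; ring.
- move=> v; have a1 := Dx1 v; have a2 := Dy1 v; rewrite /D1.
  apply: is_derive_eq; rewrite /GRing.scale/= /D2.
  by move: (jker f1 f2 _) (jker h1 h2 _) => j1 j2; field; rewrite !gt_eqF.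
- by rewrite /D /jump oppr0 expR0 !mul1r !subrr !mul0r add0r !mul0r subrr.
- by rewrite /D1 oppr0 expR0 !mul1r !subrr !mul0r subrr.
- exact: hM.
Qed.

Lemma jump_cmp1 (f f1 f2 h h1 h2 : R -> R) x x' y M : 0 < x -> 0 < x' -> 0 <= y ->
  (forall z : R, is_derive z (1 : R) f (f1 z)) -> (forall z : R, is_derive z (1 : R) f1 (f2 z)) ->
  (forall z : R, is_derive z (1 : R) h (h1 z)) -> (forall z : R, is_derive z (1 : R) h1 (h2 z)) ->
  (forall s, 0 < s <= 1 -> `|jker f1 f2 (s * x) - jker h1 h2 (s * x')| <= M) ->
  `|jump f f1 x y / x - jump h h1 x' y / x'| <= M * ecomp (1 * y).
Proof.
move=> x0 x'0 y0 d1 d2 d3 d4 hM.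
have := @jump_cmp f f1 f2 h h1 h2 x x' y 1 M ltr01 x0 x'0 y0 d1 d2 d3 d4.
rewrite expr1n divr1; apply=> v v0; rewrite normrM (ger0_norm (expR_ge0 _)) mul1r mulrC.
by apply: ler_wpM2r; [exact: expR_ge0|apply: hM; rewrite expR_gt0 expRN_le1].
Qed.

Lemma is_derive_zero (z : R) : is_derive z (1 : R) (fun=> 0 : R) (0 : R).
Proof. exact: is_derive_cst. Qed.

Lemma polyexp_eps (r0 r1 r2 : {poly R}) e x : 0 < e <= 1 -> 0 <= x ->
  `|(r0 + e *: r1 + e ^+ 2 *: r2).[x] * expR (- (e * x)) - r0.[x]| <=
  e * ('X * absp r0 + absp r1 + absp r2).[x].
Proof.
move=> /andP[e0 e1] x0; rewrite !hornerE.
have ex : 0 <= e * x by rewrite mulr_ge0// ltW.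
have u1 := expRN_le1 ex; have u0 := expR_ge0 (- (e * x)).
have u2 : 1 - expR (- (e * x)) <= e * x by have := expR_ge1Dx (- (e * x)); lra.
have a0 := absp_ge r0 x0; have a1 := absp_ge r1 x0; have a2 := absp_ge r2 x0.
move: (expR _) u0 u1 u2 => u u0 u1 u2.
have -> : (r0.[x] + e * r1.[x] + e ^+ 2 * r2.[x]) * u - r0.[x] =
  - (r0.[x] * (1 - u)) + (u * e) * r1.[x] + (u * e ^+ 2) * r2.[x] by ring.
have ue : 0 <= u * e by rewrite mulr_ge0// ltW.
have ue2 : 0 <= u * e ^+ 2 by rewrite mulr_ge0// sqr_ge0.
have u1' : 0 <= 1 - u by rewrite subr_ge0.
apply: le_trans (ler_normD _ _) _; apply: le_trans (lerD (ler_normD _ _) (lexx _)) _.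
rewrite normrN (normrM r0.[x]) (normrM (u * e)) (normrM (u * e ^+ 2)) (ger0_norm u1') (ger0_norm ue) (ger0_norm ue2).
rewrite !(mulrDr e); apply: lerD; [apply: lerD|].
- by rewrite mulrC [leRHS]mulrA; exact: ler_pM.
- by apply: ler_pM => //; rewrite ler_piMl// ltW.
- apply: ler_pM => //; apply: (@le_trans _ _ (1 * e ^+ 2)); first by rewrite ler_wpM2r// sqr_ge0.
  by rewrite mul1r expr2 ler_piMl// ltW.
Qed.

End PolyExp.

(** * The generator on damped polynomials *)

Section GeneratorPolyExp.
Context {R : realType} (p : laguerre_exponent R).
Implicit Types (q r : {poly R}) (e x y z M a : R).
Local Notation c1 := (pint p (fun y => ecomp (1 * y))).

Lemma pintegrable_jump (f f1 f2 : R -> R) x M : 0 < x ->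
  (forall z : R, is_derive z (1 : R) f (f1 z)) -> (forall z : R, is_derive z (1 : R) f1 (f2 z)) ->
  (forall s, 0 < s <= 1 -> `|jker f1 f2 (s * x)| <= M) ->
  pintegrable p (fun y => jump f f1 x y / x).
Proof.
move=> x0 d1 d2 hM.
apply: (integrable_dominated (T := mR R) (g := fun y : R => M * ecomp (1 * y))) => //.
- apply: measurable_funTS; apply: continuous_measurable_fun => y.
  apply: cvgM; last exact: cvg_cst.
  exact: (derive_continuous (fun v => (jump_derive x v d1 d2).1)).
- move=> y; rewrite pD => y0.
  have := @jump_cmp1 _ f f1 f2 (fun=> 0) (fun=> 0) (fun=> 0) x x y M x0 x0 (ltW y0) d1 d2
    is_derive_zero is_derive_zero.
  rewrite /jump !(mulr0, subrr, addr0, mul0r, subr0); apply => s s01.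
  by rewrite /jker mulr0 addr0 subr0; exact: hM.
- by apply: pintegrableZ; exact: pintegrable_ecomp ler01.
Qed.

Definition Jop (f f1 : R -> R) x : R := pint p (fun y => jump f f1 x y / x).

Lemma Jop_cmp (f f1 f2 h h1 h2 : R -> R) x x' a M : 0 < a -> 0 < x -> 0 < x' ->
  (forall z : R, is_derive z (1 : R) f (f1 z)) -> (forall z : R, is_derive z (1 : R) f1 (f2 z)) ->
  (forall z : R, is_derive z (1 : R) h (h1 z)) -> (forall z : R, is_derive z (1 : R) h1 (h2 z)) ->
  pintegrable p (fun y => jump f f1 x y / x) -> pintegrable p (fun y => jump h h1 x' y / x') ->
  (forall v, 0 <= v -> `|expR (- v) * (jker f1 f2 (expR (- v) * x) -
     jker h1 h2 (expR (- v) * x'))| <= M * expR (- (a * v))) ->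
  `|Jop f f1 x - Jop h h1 x'| <= M / a ^+ 2 * pint p (fun y => ecomp (a * y)).
Proof.
move=> a0 x0 x'0 d1 d2 d3 d4 i1 i2 hM.
have ie := pintegrable_ecomp p (ltW a0).
have b y : 0 < y -> `|jump f f1 x y / x - jump h h1 x' y / x'| <= M / a ^+ 2 * ecomp (a * y).
  by move=> y0; apply: (jump_cmp a0 x0 x'0 (ltW y0) d1 d2 d3 d4 hM).
rewrite -pintB// -pintZ// ler_norml; apply/andP; split.
  rewrite -mulN1r -pintZ; last exact: pintegrableZ.
  apply: le_pint; [by do 2 apply: pintegrableZ|exact: pintegrableB|].
  by move=> y /b; rewrite ler_norml mulN1r => /andP[].
apply: le_pint; [exact: pintegrableB|exact: pintegrableZ|].
by move=> y /b; rewrite ler_norml => /andP[].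
Qed.

Lemma Jop_cmp1 (f f1 f2 h h1 h2 : R -> R) x x' M : 0 < x -> 0 < x' ->
  (forall z : R, is_derive z (1 : R) f (f1 z)) -> (forall z : R, is_derive z (1 : R) f1 (f2 z)) ->
  (forall z : R, is_derive z (1 : R) h (h1 z)) -> (forall z : R, is_derive z (1 : R) h1 (h2 z)) ->
  pintegrable p (fun y => jump f f1 x y / x) -> pintegrable p (fun y => jump h h1 x' y / x') ->
  (forall s, 0 < s <= 1 -> `|jker f1 f2 (s * x) - jker h1 h2 (s * x')| <= M) ->
  `|Jop f f1 x - Jop h h1 x'| <= M * c1.
Proof.
move=> x0 x'0 d1 d2 d3 d4 i1 i2 hM.
have := @Jop_cmp f f1 f2 h h1 h2 x x' 1 M ltr01 x0 x'0 d1 d2 d3 d4 i1 i2.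
rewrite expr1n divr1; apply=> v v0; rewrite normrM (ger0_norm (expR_ge0 _)) mul1r mulrC.
by apply: ler_wpM2r; [exact: expR_ge0|apply: hM; rewrite expR_gt0 expRN_le1].
Qed.

(** Cut to the half-line, these functions are in [C_0], while nonzero polynomials are not. They are
    stable under derivation: [dq] and [kq] give the polynomial factors of the derivative and of
    [jker]. *)
Definition pe e q x : R := q.[x] * expR (- (e * x)).
Definition dq e q : {poly R} := q^`() - e *: q.
Definition kq e q : {poly R} := dq e q + 'X * dq e (dq e q).

Lemma is_derive_pe e q x : is_derive x (1 : R) (pe e q) (pe e (dq e q) x).
Proof. exact: is_derive_polyexp. Qed.

Lemma jker_pe e q z : jker (pe e (dq e q)) (pe e (dq e (dq e q))) z = pe e (kq e q) z.
Proof. by rewrite /jker /pe /kq hornerD hornerM hornerX; ring. Qed.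

Lemma pe_bound e q : 0 < e -> exists2 C, 0 < C & forall x, 0 <= x -> (1 + x) * `|pe e q x| <= C.
Proof.
move=> e0; have [C C0 hC] := polyexp_bound q e0; exists C => // x x0.
by rewrite /pe normrM (ger0_norm (expR_ge0 _)) hC.
Qed.

Lemma pe_bound1 e q : 0 < e -> exists2 C, 0 < C & forall x, 0 <= x -> `|pe e q x| <= C.
Proof.
move=> e0; have [C C0 hC] := pe_bound q e0; exists C => // x x0.
by apply: le_trans (hC x x0); rewrite ler_peMl// lerDl.
Qed.

Lemma pe_lip e q : 0 < e -> exists2 C, 0 < C & forall x z, 0 <= x -> 0 <= z ->
  `|pe e q x - pe e q z| <= C * `|x - z|.
Proof.
move=> e0; have [C C0 hC] := pe_bound1 (dq e q) e0; exists C => // x z x0 z0.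
wlog xz : x z x0 z0 / x < z.
  move=> h; have [xz|zx|->] := ltgtP x z; first exact: h.
    by rewrite distrC (distrC x); exact: h.
  by rewrite !subrr !normr0 mulr0.
rewrite distrC (distrC x).
have [|w] := @MVT R (pe e q) (pe e (dq e q)) x z xz (fun w _ => is_derive_pe e q w).
  by apply: continuous_subspaceT; exact: derive_continuous (is_derive_pe e q).
rewrite in_itv/= => /andP[xw _] ->; rewrite normrM ler_wpM2r// hC//.
by rewrite (le_trans x0)// ltW.
Qed.

Lemma cvg_pe e q : 0 < e -> pe e q x @[x --> +oo] --> 0.
Proof.
move=> e0; have [C C0 hC] := pe_bound q e0.
apply/cvgr0Pnorm_le => d d0; exists (C / d); split; first exact: num_real.
move=> x hx; have x0 : 0 < x by apply: lt_trans hx; rewrite divr_gt0.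
have x1 : 0 < 1 + x by rewrite addr_gt0.
rewrite -(ler_pM2l x1); apply: le_trans (hC x (ltW x0)) _.
rewrite -ler_pdivrMr// (le_trans (ltW hx))// lerDr//.
Qed.

Definition pos_ext (f : R -> R) x : R := if x < 0 then 0 else f x.

Lemma C0_pos_ext f : continuous f -> f x @[x --> +oo] --> (0 : R) -> C0 (pos_ext f).
Proof.
move=> cf lf; split.
- apply: (@subspace_eq_continuous _ _ _ f).
    by move=> x; rewrite inE/= in_itv/= andbT => x0; rewrite /from_subspace /pos_ext ltNge x0.
  exact: continuous_subspaceT.
- apply: cvg_trans lf; apply: near_eq_cvg; near=> x.
  by rewrite /pos_ext ltNge (_ : 0 <= x)//; near: x; exact: nbhs_pinfty_ge.
- by rewrite /pos_ext => x ->.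
Unshelve. all: by end_near. Qed.

Lemma C0_pe e q : 0 < e -> C0 (pos_ext (pe e q)).
Proof.
move=> e0; apply: C0_pos_ext; last exact: cvg_pe.
exact: derive_continuous (is_derive_pe e q).
Qed.

Lemma derive1_of (f g : R -> R) : (forall x : R, is_derive x (1 : R) f (g x)) -> derive1 f = g.
Proof. by move=> d; apply/funext => x; rewrite derive1E; have [_ ->] := d x. Qed.

Lemma cvg_expR_pinfty : @expR R x @[x --> +oo] --> +oo.
Proof.
apply/cvgryPge => A; near=> x; apply: (@le_trans _ _ x).
  by near: x; apply: nbhs_pinfty_ge; exact: num_real.
by apply: le_trans (expR_ge1Dx x); rewrite lerDr.
Unshelve. all: by end_near. Qed.

Lemma C2_ext_pe e q : 0 < e -> C2_ext (fun s => pos_ext (pe e q) (expR s)).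
Proof.
move=> e0; pose H r s := pe e r (expR s).
pose nx r : {poly R} := 'X * dq e r.
have dH r s : is_derive s (1 : R) (H r) (H (nx r) s).
  have := is_derive_comp_expR s (is_derive_pe e r).
  by rewrite /H /nx /pe hornerM hornerX mulrA.
have -> : (fun s => pos_ext (pe e q) (expR s)) = H q.
  by apply/funext => s; rewrite /pos_ext ltNge expR_ge0.
have h1 r : derive1 (H r) = H (nx r) by exact: derive1_of (dH r).
have hlim r : cvg (H r x @[x --> +oo]) /\ cvg (H r x @[x --> -oo]).
  split; apply/cvg_ex.
    exists 0; apply: (@cvg_comp _ _ _ expR (pe e r) _ _ _ _ (cvg_pe r e0)).
    exact: cvg_expR_pinfty.
  exists (pe e r 0); apply: (@cvg_comp _ _ _ expR (pe e r) _ (nbhs (0 : R))).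
    exact/cvgNy_compNP/cvgr_expR.
  exact: (derive_continuous (is_derive_pe e r)).
split.
- by move=> x; rewrite h1; split; [have [] := dH q x|have [] := dH (nx q) x].
- by rewrite /= !h1; exact: derive_continuous (dH _).
- by move=> [|[|[|k]]]//= _; rewrite ?h1; exact: hlim.
Qed.

Lemma derive1_pos (f g g1 : R -> R) x : (forall y, 0 < y -> f y = g y) ->
  (forall y : R, is_derive y (1 : R) g (g1 y)) -> 0 < x -> derive1 f x = g1 x.
Proof.
move=> fg dg x0; rewrite derive1E (@near_eq_derive _ _ _ f g)//.
  by have [_ ->] := dg x.
by near=> y; apply: fg; near: y; exact: lt_nbhsr.
Unshelve. all: by end_near. Qed.

Lemma pint_pe e q x : 0 < e -> 0 < x -> pintegrable p (fun y => jump (pe e q) (pe e (dq e q)) x y / x).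
Proof.
move=> e0 x0; have [C C0 hC] := pe_bound1 (kq e q) e0.
have hM s : 0 < s <= 1 -> `|jker (pe e (dq e q)) (pe e (dq e (dq e q))) (s * x)| <= C.
  by move=> /andP[s0 _]; rewrite jker_pe hC// mulr_ge0// ltW.
exact: (pintegrable_jump x0 (is_derive_pe e q) (is_derive_pe e (dq e q)) hM).
Qed.

Lemma lagG_pe e q x : 0 < e -> 0 < x -> lagG p (pos_ext (pe e q)) x =
  lsigma p ^+ 2 * x * pe e (dq e (dq e q)) x +
  (ldrift p + lsigma p ^+ 2 - x) * pe e (dq e q) x + Jop (pe e q) (pe e (dq e q)) x.
Proof.
move=> e0 x0; rewrite /lagG.
have E y : 0 < y -> pos_ext (pe e q) y = pe e q y by move=> y0; rewrite /pos_ext ltNge ltW.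
have E1 y : 0 < y -> derive1 (pos_ext (pe e q)) y = pe e (dq e q) y.
  by move=> y0; apply: (derive1_pos E (is_derive_pe e q)).
rewrite [derive1n 2 _ x]/= (derive1_pos E1 (is_derive_pe e _) x0) E1//.
congr (_ + _).
rewrite -/(pint p _) (@eq_pint _ p _ (fun y => x * (jump (pe e q) (pe e (dq e q)) x y / x))); last first.
  move=> y y0; by rewrite !E ?mulr_gt0 ?expR_gt0// [RHS]mulrCA mulfV ?mulr1// lt0r_neq0.
rewrite pintZ; first by rewrite mulrAC divff ?mul1r//; exact: lt0r_neq0.
exact: pint_pe.
Qed.

(** The value at 0 is the limit: near 0 the quotient [jump / x] is close to that of a linear
    function with slope [jker] at 0, for which it is exactly a multiple of [ecomp]. *)
Definition Jop0 e q x : R :=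
  if x <= 0 then pe e (kq e q) 0 * c1 else Jop (pe e q) (pe e (dq e q)) x.

Lemma c1_ge0 : 0 <= c1.
Proof. by apply: pint_ge0 => y _; exact: ecomp_ge0. Qed.

Lemma Jop0_lip e q : 0 < e -> exists2 C, 0 < C & forall x z,
  `|Jop0 e q x - Jop0 e q z| <= C * `|x - z|.
Proof.
move=> e0; have [C C0 hC] := pe_lip (kq e q) e0.
have C1 : 0 < C * (c1 + 1) by rewrite mulr_gt0// ltr_wpDl ?c1_ge0.
exists (C * (c1 + 1)) => // x z.
have pd := is_derive_pe e q; have pdd := is_derive_pe e (dq e q).
have key x' z' : 0 < x' -> 0 < z' ->
    `|Jop (pe e q) (pe e (dq e q)) x' - Jop (pe e q) (pe e (dq e q)) z'| <= C * `|x' - z'| * c1.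
  move=> x0 z0; apply: (@Jop_cmp1 _ _ (pe e (dq e (dq e q))) _ _ (pe e (dq e (dq e q)))) => //; try exact: pint_pe.
  move=> s /andP[s0 s1]; rewrite !jker_pe; apply: le_trans (hC _ _ (mulr_ge0 (ltW s0) (ltW x0)) (mulr_ge0 (ltW s0) (ltW z0))) _.
  by rewrite ler_wpM2l ?(ltW C0)// -mulrBr normrM (gtr0_norm s0) ler_piMl.
pose k0 := pe e (kq e q) 0.
have key0 x' : 0 < x' -> `|Jop (pe e q) (pe e (dq e q)) x' - k0 * c1| <= C * `|x'| * c1.
  move=> x0; pose h y : R := k0 * y.
  have dh y : is_derive y (1 : R) h (cst k0 y).
    by apply: is_derive_eq; rewrite /GRing.scale/=; ring.
  have dh1 y : is_derive y (1 : R) (cst k0) (0 : R) by exact: is_derive_cst.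
  have jE y : jump h (cst k0) x' y / x' = k0 * ecomp (1 * y).
    by rewrite /jump /h /ecomp mul1r /=; field; rewrite gt_eqF.
  have ik : pintegrable p (fun y => jump h (cst k0) x' y / x').
    by under eq_fun do rewrite jE; apply: pintegrableZ; exact: pintegrable_ecomp ler01.
  have <- : Jop h (cst k0) x' = k0 * c1.
    by rewrite /Jop (@eq_pint _ p _ (fun y => k0 * ecomp (1 * y)))// pintZ//; exact: pintegrable_ecomp ler01.
  apply: (Jop_cmp1 x0 x0 pd pdd dh dh1 (pint_pe q e0 x0) ik).
  move=> s /andP[s0 s1]; rewrite jker_pe /jker mulr0 addr0.
  apply: le_trans (hC _ 0 (mulr_ge0 (ltW s0) (ltW x0)) (lexx _)) _.
  by rewrite subr0 ler_wpM2l ?(ltW C0)// normrM (gtr0_norm s0) ler_piMl.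
have cc (d : R) : C * `|d| * c1 <= C * (c1 + 1) * `|d|.
  by rewrite mulrAC ler_wpM2r// ler_wpM2l ?(ltW C0)// lerDl.
rewrite /Jop0; case: (leP x 0) => x0; case: (leP z 0) => z0.
- by rewrite subrr normr0 mulr_ge0// ltW.
- rewrite distrC; apply: le_trans (key0 z z0) _; apply: le_trans (cc z) _.
  rewrite ler_wpM2l ?(ltW C1)// (distrC x) !ger0_norm ?(ltW z0)//; last by lra.
  by rewrite lerDl oppr_ge0.
- apply: le_trans (key0 x x0) _; apply: le_trans (cc x) _.
  rewrite ler_wpM2l ?(ltW C1)// !ger0_norm ?(ltW x0)//; last by lra.
  by rewrite lerDl oppr_ge0.
- by apply: le_trans (key x z x0 z0) _; exact: cc.
Qed.

(** Half of the decay [exp (- v)] is kept for the comparison with [ecomp]; the other half is traded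
    for decay in [x] through [sqrt x * s <= 1 + s ^ 2 x] with [s = exp (- v / 2)]. The rate is
    [1 / sqrt x]. *)
Lemma cvg_Jop0 e q : 0 < e -> Jop0 e q x @[x --> +oo] --> (0 : R).
Proof.
move=> e0; have [C C0 hC] := pe_bound (kq e q) e0.
pose K := 4 * pint p (fun y => ecomp (2^-1 * y)).
have K0 : 0 <= K by rewrite mulr_ge0//; apply: pint_ge0 => y _; exact: ecomp_ge0.
have hJ x : 0 < x -> `|Jop0 e q x| <= C * K / Num.sqrt x.
  move=> x0; rewrite /Jop0 (lt_geF x0).
  have sx : 0 < Num.sqrt x by rewrite sqrtr_gt0.
  have h0 : 0 < 2^-1 :> R by rewrite invr_gt0.
  have j0 y : jump (fun=> 0) (fun=> 0) x y / x = 0 :> R by rewrite /jump mulr0 subrr addr0 mul0r.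
  have i0 : pintegrable p (fun y => jump (fun=> 0) (fun=> 0) x y / x).
    under eq_fun do rewrite j0.
    have := pintegrableZ 0 (pintegrable_ecomp p ler01).
    by under eq_fun do rewrite mul0r.
  have := @Jop_cmp (pe e q) (pe e (dq e q)) (pe e (dq e (dq e q))) (fun=> 0) (fun=> 0) (fun=> 0) x x
    2^-1 (C / Num.sqrt x) h0 x0 x0 (is_derive_pe e q) (is_derive_pe e _) is_derive_zero is_derive_zero (pint_pe q e0 x0) i0.
  rewrite {2}/Jop (@eq_pint _ p _ (fun y => 0 * ecomp (1 * y))); last by move=> y _; rewrite j0 mul0r.
  rewrite pintZ ?mul0r ?subr0; last exact: pintegrable_ecomp ler01.
  move=> h; apply: le_trans (h _) _; last first.
    rewrite /K le_eqVlt; apply/orP; left; apply/eqP; field.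
    exact: lt0r_neq0.
  move=> v v0; rewrite jker_pe /jker mulr0 addr0 subr0 normrM (ger0_norm (expR_ge0 _)).
  pose s := expR (- (2^-1 * v)).
  have s0 : 0 < s by exact: expR_gt0.
  have sE : expR (- v) = s * s by rewrite /s -expRD; congr expR; field.
  rewrite sE -/s; have xE : x = Num.sqrt x * Num.sqrt x by rewrite -expr2 sqr_sqrtr// ltW.
  have z0 : 0 <= s * s * x by rewrite !mulr_ge0 ?(ltW s0) ?(ltW x0).
  have h1 := hC _ z0; set w := `|pe e _ _| in h1 *.
  have w0 : 0 <= w by exact: normr_ge0.
  rewrite -mulrA [C / _ * s]mulrAC ler_pdivlMr//.
  apply: (@le_trans _ _ (s * ((1 + s * s * x) * w))); last by rewrite mulrC ler_wpM2r// ltW.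
  rewrite -!mulrA ler_pM2l// mulrCA mulrC.
  suff hs : Num.sqrt x * s <= 1 + s * (s * x).
    by have := ler_wpM2r w0 hs; congr (_ <= _); ring.
  rewrite [in leRHS]xE.
  move: (Num.sqrt x) sx => g g0; have := sqr_ge0 (1 - s * g); have := mulr_gt0 s0 g0.
  rewrite sqrrB expr1n mul1r expr2 => h2 h3.
  rewrite (_ : s * (s * (g * g)) = s * g * (s * g)); last by ring.
  lra.
apply/cvgr0Pnorm_le => d d0; exists ((C * K / d) ^+ 2); split; first exact: num_real.
move=> x hx; have x0 : 0 < x by apply: le_lt_trans hx; exact: sqr_ge0.
have sx : 0 < Num.sqrt x by rewrite sqrtr_gt0.
apply: le_trans (hJ x x0) _; rewrite ler_pdivrMr// [d * _]mulrC -ler_pdivrMr//.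
have : Num.sqrt ((C * K / d) ^+ 2) <= Num.sqrt x by apply: ler_wsqrtr; exact: ltW.
have h0 : 0 <= C * K / d by apply: divr_ge0; [apply: mulr_ge0 => //; exact: ltW|exact: ltW].
by rewrite sqrtr_sqr ger0_norm.
Qed.

Definition genpoly e q : {poly R} :=
  (lsigma p ^+ 2 *: 'X) * dq e (dq e q) + ((ldrift p + lsigma p ^+ 2)%:P - 'X) * dq e q.

Definition gpe e q : R -> R := pos_ext (fun x => pe e (genpoly e q) x + Jop0 e q x).

Lemma C0_gpe e q : 0 < e -> C0 (gpe e q).
Proof.
move=> e0; apply: C0_pos_ext.
  have [C C0 hC] := Jop0_lip q e0.
  move=> x; apply: cvgD; first exact: (derive_continuous (is_derive_pe e _)).
  apply/cvgrPdist_le => d d0; near=> z.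
  apply: le_trans (hC _ _) _; rewrite mulrC -ler_pdivlMr//.
  by near: z; move: (@cvg_id _ (nbhs x)) => /cvgrPdist_le; apply; rewrite divr_gt0.
rewrite -(addr0 0); apply: cvgD; [exact: cvg_pe|exact: cvg_Jop0].
Unshelve. all: by end_near. Qed.

Lemma gpe_lagG e q x : 0 < e -> 0 < x -> gpe e q x = lagG p (pos_ext (pe e q)) x.
Proof.
move=> e0 x0; rewrite lagG_pe// /gpe /pos_ext (le_gtF (ltW x0)) /Jop0 (lt_geF x0).
congr (_ + _); rewrite /pe /genpoly !(hornerD, hornerN, hornerM, hornerZ, hornerX, hornerC, hornerMn, hornerXn); ring.
Qed.

Lemma pint_poly q x : 0 < x -> pintegrable p (fun y => jump (horner q) (horner q^`()) x y / x).
Proof.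
move=> x0; apply: (@pintegrable_jump _ _ (horner q^`()^`()) x (absp (q^`() + 'X * q^`()^`())).[x]) => //.
move=> s /andP[s0 s1].
have -> : jker (horner q^`()) (horner q^`()^`()) (s * x) = (q^`() + 'X * q^`()^`()).[s * x].
  by rewrite /jker hornerD hornerM hornerX.
have sx0 : 0 <= s * x by rewrite mulr_ge0 ?(ltW s0)// ltW.
apply: le_trans (absp_ge _ sx0) _; apply: horner_mono => //; first exact: absp_coef_ge0.
by rewrite ler_piMl// ltW.
Qed.

(** The generator sends ['X^k] to [k phi(k) 'X^(k - 1) - k 'X^k]; the factor [x] avoids the
    truncated exponent [k - 1]. *)
Lemma genpoly_mom (n : nat) q x : 0 < x ->
  x * ((genpoly 0 q + n%:R *: q).[x] + Jop (horner q) (horner q^`()) x) =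
  mom (fun k => k%:R * phir p k%:R * x ^+ k + (n%:R - k%:R) * x ^+ k.+1) q.
Proof.
move=> x0; have xn : x != 0 by rewrite gt_eqF.
pose L q := x * ((genpoly 0 q + n%:R *: q).[x] + Jop (horner q) (horner q^`()) x).
have d0 r : dq 0 r = r^`() by rewrite /dq scale0r subr0.
apply: (mom_ext (f := L)) => [q1 q2|r q1|k]; rewrite /L /genpoly !d0.
- have -> : Jop (horner (q1 + q2)) (horner (q1 + q2)^`()) x =
      Jop (horner q1) (horner q1^`()) x + Jop (horner q2) (horner q2^`()) x.
    rewrite /Jop -pintD; [|exact: pint_poly|exact: pint_poly].
    by apply: eq_pint => y _; rewrite /jump derivD !hornerD; ring.
  by rewrite !derivD !(hornerD, hornerN, hornerM, hornerZ, hornerX, hornerC, hornerMn, hornerXn); ring.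
- have -> : Jop (horner (r *: q1)) (horner (r *: q1)^`()) x = r * Jop (horner q1) (horner q1^`()) x.
    rewrite /Jop -pintZ; last exact: pint_poly.
    by apply: eq_pint => y _; rewrite /jump derivZ !hornerZ; ring.
  by rewrite !derivZ !(hornerD, hornerN, hornerM, hornerZ, hornerX, hornerC, hornerMn, hornerXn); ring.
have JE : x * Jop (horner 'X^k) (horner ('X^k)^`()) x = x ^+ k * pint p (fun y => ecomp (k%:R * y)).
  rewrite /Jop -pintZ; last exact: pint_poly.
  rewrite -pintZ; last exact: pintegrable_ecomp.
  apply: eq_pint => y _; rewrite mulrCA divff// mulr1 /jump derivXn !(hornerD, hornerN, hornerM, hornerZ, hornerX, hornerC, hornerMn, hornerXn) /ecomp.
  rewrite exprMn -expRM_natr (_ : - y * k%:R = - (k%:R * y)); last by ring.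
  case: k => [|k]; first by rewrite !mulr0n !expr0 !mul0r oppr0 expR0 mulr0; ring.
  by rewrite -[_ *+ k.+1]mulr_natr exprS; ring.
rewrite mulrDr JE; case: k {JE} => [|[|k]].
- rewrite derivXn derivMn !mulr0n !(hornerD, hornerN, hornerM, hornerZ, hornerX, hornerC, hornerMn, hornerXn) !mul0r subr0.
  have -> : pint p (fun y => ecomp (0 * y)) = 0.
    rewrite (@eq_pint _ p _ (fun y => 0 * ecomp (1 * y))); last first.
      by move=> y _; rewrite !mul0r /ecomp oppr0 expR0 subrr addr0.
    by rewrite pintZ ?mul0r//; exact: pintegrable_ecomp ler01.
  by rewrite ?mulr0n !(expr0, expr1); ring.
- rewrite derivXn/= expr0 mulr1n derivC !(hornerD, hornerN, hornerM, hornerZ, hornerX, hornerC, hornerMn, hornerXn) /phir; field.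
  by [].
have e1 : ('X^(k.+2))^`() = k.+2%:R *: 'X^(k.+1) :> {poly R} by rewrite derivXn scaler_nat.
have e2 : (k.+2%:R *: 'X^(k.+1))^`() = (k.+2%:R * k.+1%:R) *: 'X^k :> {poly R}.
  by rewrite derivZ derivXn -[X in _ *: X = _]scaler_nat scalerA.
rewrite e1 e2 !(hornerD, hornerN, hornerM, hornerZ, hornerX, hornerC, hornerXn) /phir !exprS.
move: (pint _ _) => J; have k2 : k.+2%:R != 0 :> R by rewrite pnatr_eq0.
have -> : k.+1%:R = k.+2%:R - 1 :> R by rewrite -(natr1 k.+1) addrK.
by move: k.+2%:R k2 => c c0; field.
Qed.

Hypothesis phi1 : 0 < phir p 1.

Lemma gen_lpoly n x : 0 < x ->
  (genpoly 0 (lpoly (W p) n) + n%:R *: lpoly (W p) n).[x] +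
  Jop (horner (lpoly (W p) n)) (horner (lpoly (W p) n)^`()) x = 0.
Proof.
move=> x0; apply: (mulfI (lt0r_neq0 x0)); rewrite genpoly_mom// mulr0.
rewrite (mom_lpoly _ _ (ltnSn n)).
pose s k : R := (-1) ^+ k * 'C(n, k)%:R / W p k.
have Wn k : W p k != 0 by rewrite gt_eqF// W_gt0.
rewrite (eq_bigr (fun k : 'I_n.+1 => s k * (k%:R * phir p k%:R) * x ^+ k + s k * (n%:R - k%:R) * x ^+ k.+1)); last first.
  by move=> k _; rewrite /s; field.
rewrite big_split/= big_ord_recl/= !mul0r mulr0 mul0r add0r [X in _ + X]big_ord_recr/= subrr mulr0 mul0r addr0.
rewrite -big_split/= big1// => k _; rewrite /bump leq0n add1n -mulrDl.
suff -> : s k.+1 * (k.+1%:R * phir p k.+1%:R) + s k * (n%:R - k%:R) = 0 by rewrite mul0r.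
rewrite /s WS exprS.
have := mul_bin_left n k => /(congr1 (fun z : nat => z%:R : R)); rewrite !natrM natrB; last by rewrite ltnW.
move=> h; have pk := lt0r_neq0 (phir_gt0 phi1 k).
transitivity ((-1) ^+ k / W p k * ('C(n, k)%:R * (n%:R - k%:R) - k.+1%:R * 'C(n, k.+1)%:R)).
  have := Wn k; set f := phir p _ in pk *; set w := W p k; set k1 := k.+1%:R; move=> w0; field; by rewrite pk w0.
by rewrite h ['C(n, k)%:R * _]mulrC subrr mulr0.
Qed.

(** The undamped expression vanishes by [gen_lpoly], so only the effect of the damping is left. It
    is expanded in powers of [e], and [A] collects the bounds. *)
Lemma gen_error n : exists2 A : {poly R}, (forall i, 0 <= A`_i) &
  forall e x, 0 < e <= 1 -> 0 < x ->
   `|gpe e (lpoly (W p) n) x + n%:R * pe e (lpoly (W p) n) x| <= e * A.[x].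
Proof.
set q := lpoly (W p) n.
pose B r0 r1 r2 : {poly R} := 'X * absp r0 + absp r1 + absp r2.
have Bpos r0 r1 r2 i : 0 <= (B r0 r1 r2)`_i.
  rewrite /B !coefD coefXM; case: (i == 0%N); rewrite ?add0r ?addr_ge0//; exact: absp_coef_ge0.
pose s2 := lsigma p ^+ 2; pose ms := ldrift p + s2.
(* [a0], [a1], [a2] are the coefficients in [e] of the local part, and [k0], [k1], [k2] those of
   [kq e q]. *)
pose a0 := genpoly 0 q + n%:R *: q.
pose a1 := - (s2 *: 'X) * (2 *: q^`()) - (ms%:P - 'X) * q.
pose a2 := (s2 *: 'X) * q.
pose k0 := q^`() + 'X * q^`()^`().
pose k1 := - q - 'X * (2 *: q^`()).
pose k2 := 'X * q.
have d0 r : dq 0 r = r^`() by rewrite /dq scale0r subr0.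
have ddE e : dq e (dq e q) = q^`()^`() - e *: (2 *: q^`()) + e ^+ 2 *: q.
  rewrite /dq derivB derivZ scalerBr scalerA expr2 scaler_nat mulr2n scalerDr.
  by rewrite opprB opprD !addrA; ring.
exists (B a0 a1 a2 + c1 *: B k0 k1 k2).
  by move=> i; rewrite coefD coefZ addr_ge0// mulr_ge0 ?c1_ge0.
move=> e x e01 x0; have /andP[e0 e1] := e01.
have g0 := gen_lpoly n x0; rewrite -/q in g0.
rewrite -[X in `|X|]subr0 -g0 /gpe /pos_ext (le_gtF (ltW x0)) /Jop0 (lt_geF x0).
set J := Jop (pe e q) _ x; set J' := Jop (horner q) _ x.
have -> : pe e (genpoly e q) x + J + n%:R * pe e q x - (a0.[x] + J') =
    ((a0 + e *: a1 + e ^+ 2 *: a2).[x] * expR (- (e * x)) - a0.[x]) + (J - J').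
  rewrite /pe /a0 /a1 /a2 /genpoly ddE !d0 /dq -/s2 -/ms !(hornerD, hornerN, hornerM, hornerZ, hornerX, hornerC, hornerMn, hornerXn); ring.
apply: le_trans (ler_normD _ _) _; rewrite [X in _ <= _ * X]hornerD [leRHS]mulrDr; apply: lerD.
  exact: polyexp_eps (ltW x0).
rewrite hornerZ mulrCA mulrC.
have pd := is_derive_pe e q; have pdd := is_derive_pe e (dq e q).
apply: (Jop_cmp1 x0 x0 pd pdd (is_derive_poly q) (is_derive_poly q^`()) (pint_pe q e0 x0) (pint_poly q x0)).
move=> s /andP[s0 s1]; rewrite jker_pe.
have -> : jker (horner q^`()) (horner q^`()^`()) (s * x) = k0.[s * x].
  by rewrite /jker /k0 hornerD hornerM hornerX.
have -> : pe e (kq e q) (s * x) = (k0 + e *: k1 + e ^+ 2 *: k2).[s * x] * expR (- (e * (s * x))).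
  rewrite /pe /kq ddE /dq /k0 /k1 /k2 !(hornerD, hornerN, hornerM, hornerZ, hornerX, hornerC, hornerMn, hornerXn); ring.
have sx0 : 0 <= s * x by rewrite mulr_ge0 ?(ltW s0)// ltW.
apply: le_trans (polyexp_eps _ _ _ e01 sx0) _; rewrite ler_pM2l//.
apply: (horner_mono (q := B k0 k1 k2)) => //; by rewrite ler_piMl// ltW.
Qed.

End GeneratorPolyExp.

(** * The semigroup on polynomials *)

Section PolynomialSemigroup.
Context {R : realType} (p : laguerre_exponent R) (P : R -> (R -> R) -> R -> R)
  (mu : probability (mR R) R) (nu : R -> R).
Hypotheses (HP : generalized_laguerre p P) (Hnu : invariant_density p P mu nu).
Implicit Types (q : {poly R}) (t e d : R).
Local Notation l2 := (l2 mu).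
Local Notation nrm := (nrm mu).

Lemma nrm_le_pos f g : l2 f -> l2 g -> (forall x, 0 < x -> `|f x| <= g x) -> nrm f <= nrm g.
Proof.
move=> [mf jf] [mg jg] fg; rewrite /nrm; apply: ler_wsqrtr; rewrite /ip /Rintegral.
have ff : (fun x => f x * f x) = fun x => f x ^+ 2 by apply/funext => x; rewrite expr2.
have gg : (fun x => g x * g x) = fun x => g x ^+ 2 by apply/funext => x; rewrite expr2.
apply: fine_le.
- by apply: integrable_fin_num => //; rewrite ff.
- by apply: integrable_fin_num => //; rewrite gg.
apply: ae_ge0_le_integral => //.
- by move=> x _; rewrite lee_fin -expr2 sqr_ge0.
- by apply/measurable_EFinP; apply: measurable_funM.
- by move=> x _; rewrite lee_fin -expr2 sqr_ge0.
- by apply/measurable_EFinP; apply: measurable_funM.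
apply: ae_mono (mu_pos Hnu) => x x0 _.
rewrite lee_fin -!expr2 -(real_normK (num_real (f x))).
by apply: lerXn2r; rewrite ?nnegrE ?fg// (le_trans _ (fg x x0)).
Qed.

(** [P] acts on [C_0], which excludes polynomials. A weakly damped [lpoly n] serves as a substitute:
    it is close in norm and is an approximate eigenvector. *)
Lemma lpoly_core n e : 0 < e -> exists f, [/\ C0 f, nrm (fun x => f x - (lpoly (W p) n).[x]) <= e &
  forall t, 0 <= t -> nrm (fun x => P t f x - expR (- (n%:R * t)) * f x) <= t * e].
Proof.
move=> e0; have phi1 := phir1_gt0 Hnu; set q := lpoly (W p) n.
have [A Apos hA] := gen_error phi1 n; rewrite -/q in hA.
pose B := 'X * absp q + absp 0 + absp 0 : {poly R}.
pose K := nrm (horner A) + nrm (horner B).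
have K0 : 0 <= K by rewrite addr_ge0 ?nrm_ge0.
have K1 : 0 < K + 1 by rewrite ltr_wpDl.
pose d := Num.min 1 (e / (K + 1)).
have d0 : 0 < d by rewrite lt_min ltr01 divr_gt0.
have d1 : 0 < d <= 1 by rewrite d0 ge_min lexx.
have dK x : x <= K -> d * x <= e.
  move=> xK; apply: (@le_trans _ _ (d * K)); first by rewrite ler_pM2l.
  apply: (@le_trans _ _ (e / (K + 1) * K)).
    by apply: ler_wpM2r => //; rewrite ge_min lexx orbT.
  by rewrite -mulrA ler_piMr ?(ltW e0)// mulrC ler_pdivrMr// mul1r lerDl.
pose f : R -> R := pos_ext (pe d q).
have cf : C0 f by apply: C0_pe.
have cg : C0 (gpe p d q) by apply: C0_gpe.
have lf := l2_C0 mu cf; have lg := l2_C0 mu cg; have lq := l2_poly Hnu q.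
have fE x : 0 < x -> f x = pe d q x by move=> x0; rewrite /f /pos_ext (le_gtF (ltW x0)).
exists f; split => //.
  apply: (@le_trans _ _ (nrm (fun x => d * B.[x]))).
    apply: nrm_le_pos => [||x x0]; [exact: l2B|exact: l2Z (l2_poly Hnu B)|].
    have := polyexp_eps q 0 0 d1 (ltW x0); rewrite !scaler0 !addr0.
    by rewrite fE.
  rewrite (nrmZ _ (l2_poly Hnu B)) (gtr0_norm d0); apply: dK.
  by rewrite lerDr nrm_ge0.
move=> t t0.
have gen : generates P f (gpe p d q).
  by apply: HP.2 => //; [exact: C2_ext_pe|move=> x x0; exact: gpe_lagG].
apply: le_trans (generator_bound HP.1 (inv_mu Hnu) n t0 gen) _.
apply: ler_wpM2l => //.
apply: (@le_trans _ _ (nrm (fun x => d * A.[x]))).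
  apply: nrm_le_pos => [||x x0]; [exact: l2_lin|exact: l2Z (l2_poly Hnu A)|].
  by have := hA d x d1 x0; rewrite fE.
rewrite (nrmZ _ (l2_poly Hnu A)) (gtr0_norm d0); apply: dK.
by rewrite lerDl nrm_ge0.
Qed.

Lemma P_sum t n (c : nat -> R) (f : nat -> R -> R) : 0 <= t -> (forall k, C0 (f k)) ->
  C0 (fun x => \sum_(k < n) c k * f k x) /\
  P t (fun x => \sum_(k < n) c k * f k x) = fun x => \sum_(k < n) c k * P t (f k) x.
Proof.
move=> t0 cf; elim: n => [|n [IH1 IH2]].
  have -> : (fun x => \sum_(k < 0) c k * f k x) = fun=> 0.
    by apply/funext => x; rewrite big_ord0.
  split; first exact: C0_0.
  by apply/funext => x; rewrite big_ord0 (P_0 HP.1).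
have -> : (fun x => \sum_(k < n.+1) c k * f k x) =
    fun x => c n * f n x + \sum_(k < n) c k * f k x.
  by apply/funext => x; rewrite big_ord_recr/= addrC.
split; first exact: C0_lin.
apply/funext => x; rewrite (feller_linear HP.1)// IH2 big_ord_recr/=.
by rewrite addrC.
Qed.

(** Up to any error, [lag_sg] at [exp (- t)] is [P t] applied to a combination of damped
    polynomials, and [P t] is a contraction by invariance of [mu]. *)
Lemma lag_sg_contraction t q : 0 <= t ->
  nrm (horner (lag_sg (W p) (expR (- t)) q)) <= nrm (horner q).
Proof.
move=> t0; have phi1 := phir1_gt0 Hnu; have W0 n := W_gt0 phi1 n.
pose L n := lpoly (W p) n; pose c k := (-1) ^+ k * mom (binw (W p) k) q.
pose N := size q; pose S := \sum_(k < N) `|c k|.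
have S0 : 0 <= S by rewrite sumr_ge0.
have E := poly_lpoly W0 (leqnn (size q)); rewrite -/N in E.
have lL n := l2_poly Hnu (L n).
apply/ler_addgt0Pr => e e0; pose d := e / (S * (2 + t) + 1).
have D0 : 0 < S * (2 + t) + 1 by rewrite ltr_wpDl// mulr_ge0// addr_ge0.
have d0 : 0 < d by rewrite divr_gt0.
have [f hf] := choice (fun n => lpoly_core n d0).
have cf n : C0 (f n) by have [] := hf n.
have [cF PF] := P_sum N c t0 cf.
set F := (fun x => _) in cF PF.
have lF := l2_C0 mu cF; have lf n := l2_C0 mu (cf n).
have lPf n : l2 (P t (f n)) := l2_C0 mu (feller_C0 HP.1 t0 (cf n)).
have lPF : l2 (P t F) := l2_C0 mu (feller_C0 HP.1 t0 cF).
have lq := l2_poly Hnu q.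
set Lq := lag_sg _ _ q; have lLq := l2_poly Hnu Lq.
have qE x : q.[x] = \sum_(k < N) c k * (L k).[x].
  rewrite [in LHS]E horner_sum; apply: eq_bigr => k _.
  by rewrite hornerZ.
have LqE x : Lq.[x] = \sum_(k < N) c k * (expR (- t) ^+ k * (L k).[x]).
  rewrite (_ : Lq = lag_sg (W p) (expR (- t)) (\sum_(k < N) c k *: L k)); last by congr (lag_sg _ _ _); exact: E.
  rewrite lag_sg_sum horner_sum; apply: eq_bigr => k _.
  by rewrite lag_sg_lpoly// !hornerZ.
have b1 : nrm (fun x => F x - q.[x]) <= S * d.
  have l1 k : l2 (fun x => c k * (f k x - (L k).[x])) by apply: l2Z; exact: l2B.
  have [_] := nrm_sum N l1.
  rewrite (@eq_nrm _ _ (fun x => \sum_(k < N) c k * (f k x - (L k).[x])) (fun x => F x - q.[x])); last first.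
    by move=> x; rewrite qE /F -sumrB; apply: eq_bigr => k _; rewrite mulrBr.
  move=> /le_trans; apply; rewrite /S mulr_suml; apply: ler_sum => k _.
  rewrite nrmZ; last exact: l2B.
  by apply: ler_wpM2l => //; have [] := hf k.
have b2 : nrm (fun x => Lq.[x] - P t F x) <= S * ((1 + t) * d).
  pose h k x := expR (- t) ^+ k * ((L k).[x] - f k x) + (expR (- t) ^+ k * f k x - P t (f k) x).
  have l0 k : l2 (fun x => expR (- t) ^+ k * ((L k).[x] - f k x)) by apply: l2Z; exact: l2B.
  have l2' k : l2 (fun x => expR (- t) ^+ k * f k x - P t (f k) x) by apply: l2B => //; exact: l2Z.
  have l1 k : l2 (fun x => c k * h k x) by apply: l2Z; exact: l2D.
  have [_] := nrm_sum N l1.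
  rewrite (@eq_nrm _ _ (fun x => \sum_(k < N) c k * h k x) (fun x => Lq.[x] - P t F x)); last first.
    move=> x; rewrite PF LqE -sumrB; apply: eq_bigr => k _; rewrite /h; ring.
  move=> /le_trans; apply; rewrite /S mulr_suml; apply: ler_sum => k _.
  rewrite nrmZ; last exact: l2D.
  apply: ler_wpM2l => //; have [_ h1 h2] := hf k.
  apply: le_trans (nrmD (l0 k) (l2' k)) _; rewrite mulrDl mul1r; apply: lerD.
    rewrite nrmZ; last exact: l2B.
    rewrite (nrmB_sym (lL k) (lf k)); apply: le_trans h1.
    by rewrite ler_piMl ?nrm_ge0// normrX exprn_ile1// ger0_norm ?expR_ge0// expRN_le1.
  rewrite nrmB_sym//; last exact: l2Z.
  have := h2 t t0; rewrite (_ : expR (- (k%:R * t)) = expR (- t) ^+ k)//.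
  by rewrite -expRM_natl; congr expR; ring.
have b3 : nrm (horner Lq) <= nrm (fun x => Lq.[x] - P t F x) + nrm (P t F).
  have := nrmD (l2B lLq lPF) lPF.
  by rewrite (@eq_nrm _ _ (fun x => Lq.[x] - P t F x + P t F x) (horner Lq))// => x; rewrite subrK.
have b4 : nrm F <= nrm (fun x => F x - q.[x]) + nrm (horner q).
  have := nrmD (l2B lF lq) lq.
  by rewrite (@eq_nrm _ _ (fun x => F x - q.[x] + q.[x]) F)// => x; rewrite subrK.
have b5 := P_contraction HP.1 (inv_mu Hnu) t0 cF.
have b6 : S * ((1 + t) * d) + S * d <= e.
  rewrite (_ : _ + _ = S * (2 + t) * d); last by ring.
  by rewrite /d mulrA ler_pdivrMr// mulrC ler_pM2l// lerDl.
move: b1 b2 b3 b4 b5 b6; lra.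
Qed.

End PolynomialSemigroup.

(** * Completely monotone functions at the integers *)

Section CompletelyMonotone.
Context {R : realType}.
Implicit Types (f : R -> R) (u : R).

(** [F n] stands for [(-1) ^ n f^(n)]. Carrying the whole sequence makes stability under differences
    immediate, and only values on [(0, oo)] are constrained. *)
Definition cmf f := exists F : nat -> R -> R, F 0%N = f /\
  forall n u, 0 < u -> 0 <= F n u /\ is_derive u (1 : R) (F n) (- F n.+1 u).

Lemma cmf_of_cm f : completely_monotone f -> cmf f.
Proof.
move=> h; exists (fun n u => (-1) ^+ n * derive1n n f u); split.
  by apply/funext => u; rewrite expr0 mul1r.
move=> n u u0; have [d h0] := h n u u0; split => //.
have di : is_derive u (1 : R) (derive1n n f) (derive1n n.+1 f u).
  by rewrite derive1nS derive1E; split.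
apply: is_derive_eq; rewrite /GRing.scale/= exprS; ring.
Qed.

Lemma cmf_ge0 f u : cmf f -> 0 < u -> 0 <= f u.
Proof. by move=> [F [<- h]] u0; have [] := h 0%N u u0. Qed.

Lemma cmf_diff f : cmf f -> cmf (fun u => f u - f (u + 1)).
Proof.
move=> [F [F0 h]]; exists (fun n u => F n u - F n (u + 1)); split; first by rewrite F0.
move=> n u u0; have u1 : 0 < u + 1 by rewrite addr_gt0.
have [_ d0] := h n u u0; have [_ d1] := h n (u + 1) u1.
split.
  have uu : u < u + 1 by rewrite ltrDl.
  have [||w] := @MVT R (F n) (fun w => - F n.+1 w) u (u + 1) uu _ _.
  - by move=> w; rewrite in_itv/= => /andP[uw _]; have [] := h n w (lt_trans u0 uw).
  - apply: derivable_within_continuous => w; rewrite in_itv/= => /andP[uw _].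
    by have [_ d] := h n w (lt_le_trans u0 uw); have [] := d.
  move=> wi E; have := wi; rewrite in_itv/= => /andP[uw _]; rewrite -opprB E oppr_ge0.
  rewrite [u + 1 - u]addrAC subrr add0r mulr1 oppr_le0.
  by have [] := h n.+1 w (lt_trans u0 uw).
have ds : is_derive u (1 : R) (fun u : R => u + 1) (1 : R).
  by apply: is_derive_eq; rewrite addr0.
have dc := @is_derive1_comp R (F n) (fun u : R => u + 1) u _ _ d1 ds.
rewrite /comp in dc.
by apply: is_derive_eq; rewrite /GRing.scale/=; ring.
Qed.

Lemma mom_1subX_diff y (p : {poly R}) :
  mom y ((1 - 'X) * p) = mom (fun n => y n - y n.+1) p.
Proof.
rewrite mulrBl mul1r momB -['X]/('X^1) mom_mulXn.
rewrite (_ : (fun n => y n - y n.+1) = fun n => y n + (-1) * y n.+1); last first.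
  by apply/funext => n; rewrite mulN1r.
rewrite mom_addseq mom_scaleseq mulN1r; congr (_ - _); apply: eq_mom => n.
by rewrite addn1.
Qed.

(** Multiplying the polynomial by [1 - 'X] is a finite difference of the sequence, and differences
    preserve complete monotonicity. *)
Lemma cmf_mom_ge0 f (j : nat) l i : cmf f -> (0 < j)%N ->
  0 <= mom (fun n => f (n + j)%:R) ((1 - 'X) ^+ l * 'X^i).
Proof.
elim: l f => [|l IH] f cf j0.
  by rewrite expr0 mul1r momXn (cmf_ge0 cf)// ltr0n addn_gt0 j0 orbT.
rewrite exprS -mulrA mom_1subX_diff.
have -> : (fun n => f (n + j)%:R - f (n.+1 + j)%:R) = fun n => (fun u => f u - f (u + 1)) (n + j)%:R.
  by apply/funext => n; rewrite addSn natr1.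
exact: (IH (fun u => f u - f (u + 1)) (cmf_diff cf) j0).
Qed.

(* Hausdorff: a functional that is nonnegative on the Bernstein polynomials is
   nonnegative on the polynomials that are nonnegative on [0, 1]. In the
   expansion of ['X^m] the Bernstein coefficients are exactly the quotients of
   falling factorials [i ^_ m / N ^_ m], which are within [O(1/N)] of [(i/N)^m]. *)
Lemma bernstein_Xm N m : (m <= N)%N ->
  'X^m = \sum_(i < N.+1) ((i ^_ m)%:R / (N ^_ m)%:R * 'C(N, i)%:R) *:
     ((1 - 'X) ^+ (N - i) * 'X^i) :> {poly R}.
Proof.
move=> mN; have NM0 : (N ^_ m)%:R != 0 :> R by rewrite pnatr_eq0 -lt0n ffact_gt0.
have E i : (i <= N)%N -> (i ^_ m)%:R / (N ^_ m)%:R * 'C(N, i)%:R = 'C(N - m, i - m)%:R * (m <= i)%N%:R :> R.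
  move=> iN; case: (leqP m i) => mi; last by rewrite ffact_small// !mul0r mulr0.
  rewrite mulr1; apply: (mulIf NM0); rewrite mulrAC divfK// -!natrM; congr (_%:R).
  have h1 := bin_fact iN; have mi' : (i - m <= N - m)%N by rewrite leq_sub2r.
  have h2 := bin_fact mi'; have h3 := ffact_fact mi; have h4 := ffact_fact mN.
  have e1 : (N - m - (i - m) = N - i)%N by rewrite subnBA// subnK.
  rewrite e1 in h2.
  apply/eqP; rewrite -(eqn_pmul2r (fact_gt0 (i - m))) -(eqn_pmul2r (fact_gt0 (N - i))); apply/eqP.
  transitivity N`!; first by rewrite -h1 -h3; ring.
  by rewrite -h4 -h2; ring.
under eq_bigr => i _ do rewrite (E _ (leq_ord i)).
have -> : 'X^m = 'X^m * (1 - 'X + 'X) ^+ (N - m) :> {poly R} by rewrite subrK expr1n mulr1.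
rewrite exprDn.
rewrite mulr_sumr -(big_mkord xpredT (fun i => ('C(N - m, i - m)%:R * (m <= i)%N%:R) *: ((1 - 'X) ^+ (N - i) * 'X^i))).
rewrite (big_cat_nat (n := m))//=; last by rewrite ltnW// ltnS.
rewrite [X in _ = X + _]big_nat_cond [X in _ = X + _]big1 ?add0r; last first.
  by move=> i /andP[/andP[_ im] _]; rewrite leqNgt im mulr0 scale0r.
have shift (G : nat -> {poly R}) : \sum_(m <= i < N.+1) G i = \sum_(i < (N - m).+1) G (i + m)%N.
  by rewrite -[LHS]/(\sum_(0 + m <= i < N.+1) G i) big_addn subSn// big_mkord.
rewrite shift; apply: eq_bigr => i _.
rewrite addnK leq_addl mulr1 -scaler_nat -scalerAr; congr (_ *: _).
by rewrite mulrCA -exprD [(m + i)%N]addnC subnDA subnAC.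
Qed.

Lemma ffact_le_pow i m : (i ^_ m <= i ^ m)%N.
Proof.
rewrite ffact_prod -[X in (_ <= _ ^ X)%N]card_ord -prod_nat_const.
by apply: leq_prod => k _; exact: leq_subr.
Qed.

Lemma ffact_ge_pow i m : (i ^ m.+1 <= i ^_ m.+1 + m * m.+1 * i ^ m)%N.
Proof.
elim: m => [|m IH]; first by rewrite ffactn1 mul0n addn0.
rewrite ffactnSr expnSr.
have h1 : (i ^ m.+1 * i <= (i ^_ m.+1 + m * m.+1 * i ^ m) * i)%N by rewrite leq_mul2r IH orbT.
apply: leq_trans h1 _; rewrite mulnDl.
have h2 : (i ^_ m.+1 * i <= i ^_ m.+1 * (i - m.+1) + i ^ m.+1 * m.+1)%N.
  apply: (@leq_trans (i ^_ m.+1 * (i - m.+1) + i ^_ m.+1 * m.+1)).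
    by rewrite -mulnDr leq_mul2l addnC -leq_subLR leqnn orbT.
  by rewrite leq_add2l leq_mul2r ffact_le_pow orbT.
have h3 : (m * m.+1 * i ^ m * i = m * m.+1 * i ^ m.+1)%N by rewrite -mulnA -expnSr.
rewrite h3; apply: leq_trans (leq_add h2 (leqnn _)) _.
rewrite -addnA leq_add2l mulnC -mulnDl leq_mul2r; apply/orP; right.
nia.
Qed.

Lemma ffact_ratio i N m : (m <= N)%N -> (0 < N)%N -> (i <= N)%N ->
  `|(i ^_ m)%:R / (N ^_ m)%:R - (i%:R / N%:R) ^+ m| <= (m * m)%:R / N%:R :> R.
Proof.
case: m => [|m] mN N0 iN.
  by rewrite !ffactn0 divr1 expr0 subrr normr0 divr_ge0.
have Np : 0 < N%:R :> R by rewrite ltr0n.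
have NM : 0 < (N ^_ m.+1)%:R :> R by rewrite ltr0n ffact_gt0.
have ui : (i ^_ m.+1 * N ^ m.+1 <= i ^ m.+1 * N ^_ m.+1 + 0)%N.
  rewrite addn0 !ffact_prod.
  rewrite -[X in (_ * _ ^ X)%N]card_ord -[X in (_ ^ X * _)%N]card_ord -!prod_nat_const -!big_split/=.
  by apply: leq_prod => k _; rewrite mulnBl mulnBr leq_sub2l// mulnC leq_mul2l iN orbT.
have Np1 : 0 < N%:R ^+ m.+1 :> R by rewrite exprn_gt0.
have up : (i ^_ m.+1)%:R / (N ^_ m.+1)%:R <= (i%:R / N%:R) ^+ m.+1 :> R.
  rewrite expr_div_n ler_pdivrMr// mulrAC ler_pdivlMr// -!natrX -!natrM ler_nat.
  by move: ui; rewrite addn0.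
rewrite distrC ger0_norm ?subr_ge0// lerBlDr.
have lo : (i%:R / N%:R) ^+ m.+1 <= (i ^_ m.+1)%:R / N%:R ^+ m.+1 + (m * m.+1)%:R / N%:R :> R.
  have := ffact_ge_pow i m; rewrite -(ler_nat R) natrD => h.
  rewrite expr_div_n; apply: (@le_trans _ _ (((i ^_ m.+1)%:R + (m * m.+1 * i ^ m)%:R) / N%:R ^+ m.+1)).
    by rewrite ler_pM2r ?invr_gt0// -natrX.
  rewrite mulrDl lerD2l natrM natrX exprS invfM.
  rewrite [leLHS]mulrACA -[leRHS]mulr1; apply: ler_wpM2l; first by rewrite divr_ge0.
  rewrite ler_pdivrMr ?exprn_gt0// mul1r.
  by apply: lerXn2r; rewrite ?nnegrE ?ler_nat.
apply: le_trans lo _; rewrite addrC; apply: lerD.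
  by rewrite ler_pM2r ?invr_gt0// ler_nat leq_mul2r leqnSn orbT.
rewrite ler_wpM2l// lef_pV2 ?posrE// -natrX ler_nat; exact: ffact_le_pow.
Qed.

Lemma hausdorff (y : nat -> R) (p : {poly R}) :
  (forall l i, 0 <= mom y ((1 - 'X) ^+ l * 'X^i)) ->
  (forall t, 0 <= t <= 1 -> 0 <= p.[t]) -> 0 <= mom y p.
Proof.
move=> hy hp; pose d := size p.
(* [C / N] bounds the total error made by replacing the Bernstein coefficients of [p] in degree [N]
   by its values at the points [i / N]. *)
pose C := (\sum_(m < d) `|p`_m| * (m * m)%:R) * y 0%N.
have y0 : 0 <= y 0%N by have := hy 0%N 0%N; rewrite expr0 mul1r momXn.
suff h N : (d <= N)%N -> (0 < N)%N -> - (C / N%:R) <= mom y p.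
  rewrite -oppr_le0; apply/ler_addgt0Pr => e e0; rewrite add0r.
  pose N := (d + (Num.truncn (`|C| / e)).+1)%N.
  have N0 : (0 < N)%N by rewrite /N addnS.
  have := h N (leq_addr _ _) N0; rewrite lerNl => /le_trans; apply.
  have Np : 0 < N%:R :> R by rewrite ltr0n.
  rewrite ler_pdivrMr// mulrC -ler_pdivrMr//.
  apply: (@le_trans _ _ (`|C| / e)); first by rewrite ler_pM2r ?invr_gt0// ler_norm.
  by apply/ltW/(lt_le_trans (truncnS_gt _)); rewrite ler_nat leq_addl.
move=> dN N0; pose b i := mom y ((1 - 'X) ^+ (N - i) * 'X^i) * 'C(N, i)%:R.
have b0 i : 0 <= b i by rewrite mulr_ge0.
have momX m : (m <= N)%N -> y m = \sum_(i < N.+1) (i ^_ m)%:R / (N ^_ m)%:R * b i.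
  move=> mN; rewrite -momXn (bernstein_Xm mN) mom_sum; apply: eq_bigr => i _.
  by rewrite momZ /b; ring.
have sb : \sum_(i < N.+1) b i = y 0%N.
  by rewrite momX//; apply: eq_bigr => i _; rewrite !ffactn0 divr1 mul1r.
have E : mom y p = \sum_(i < N.+1) (\sum_(m < d) p`_m * ((i ^_ m)%:R / (N ^_ m)%:R)) * b i.
  under [RHS]eq_bigr do rewrite mulr_suml.
  rewrite exchange_big/= /mom; apply: eq_bigr => m _.
  rewrite momX; last by rewrite (leq_trans _ dN)// ltnW.
  by rewrite mulr_sumr; apply: eq_bigr => i _; rewrite mulrA.
have hi i : (i <= N)%N -> - ((\sum_(m < d) `|p`_m| * (m * m)%:R) / N%:R) <=
   \sum_(m < d) p`_m * ((i ^_ m)%:R / (N ^_ m)%:R).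
  move=> iN; have Np : 0 < N%:R :> R by rewrite ltr0n.
  have t01 : 0 <= (i%:R / N%:R : R) <= 1.
    by rewrite divr_ge0//= ler_pdivrMr// mul1r ler_nat.
  have := hp _ t01; rewrite horner_coef -/d => h.
  rewrite -subr_ge0 opprK; apply: le_trans h _; rewrite mulr_suml -lerBlDl -sumrB.
  apply: ler_sum => m _; rewrite -mulrBr; apply: le_trans (ler_norm _) _.
  rewrite normrM -mulrA ler_wpM2l// distrC; apply: ffact_ratio => //.
  by rewrite (leq_trans _ dN)// ltnW.
rewrite E /C -sb mulrAC mulr_sumr -sumrN; apply: ler_sum => i _.
by rewrite -mulNr; apply: ler_wpM2r => //; apply: hi; rewrite -ltnS.
Qed.

Lemma cmf_hpsd f j : cmf f -> (0 < j)%N -> hpsd (fun n => f (n + j)%:R).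
Proof.
move=> cf j0; apply: hpsd_mom => p; apply: hausdorff => [l i|t _].
  exact: cmf_mom_ge0.
by rewrite horner_exp sqr_ge0.
Qed.

Lemma cmf_nonincr f j : cmf f -> (0 < j)%N -> f j.+1%:R <= f j%:R.
Proof.
move=> cf j0; have := cmf_ge0 (cmf_diff cf) (_ : 0 < j%:R).
by rewrite ltr0n => /(_ j0); rewrite subr_ge0 natr1.
Qed.

End CompletelyMonotone.

(** * The Gamma function *)

Section GammaIntegral.
Context {R : realType}.
Local Notation leb := (@lebesgue_measure R).
Local Notation D := (`]0%R, +oo[%classic : set (mR R)).
Implicit Types (s t a b c : R).

Definition gam s t : R := t `^ (s - 1) * expR (- t).

Lemma gam_ge0 s t : 0 <= gam s t.
Proof. by rewrite mulr_ge0 ?powR_ge0 ?expR_ge0. Qed.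

Lemma measurable_gam s : measurable_fun [set: mR R] (gam s : mR R -> R).
Proof.
apply: measurable_funM; first exact: measurable_powR.
have := measurable_expRMl (- 1 : R); congr measurable_fun; apply/funext => t.
by rewrite mulN1r.
Qed.

Lemma is_derive_gam s t : 0 < t -> is_derive t (1 : R) (gam s) ((s - 1) * gam (s - 1) t - gam s t).
Proof.
move=> t0; have d1 := is_derive1_powR (s - 1) t0.
have d2 := is_derive_expRM 1 t.
have E : gam s = fun t => t `^ (s - 1) * expR (- (1 * t)) by apply/funext => w; rewrite mul1r.
rewrite E; apply: is_derive_eq; rewrite /GRing.scale/= /gam mul1r; ring.
Qed.

Lemma continuous_of_derive (f f1 : R -> R) t : is_derive t (1 : R) f (f1 t) -> {for t, continuous f}.
Proof. by move=> [d _]; apply/differentiable_continuous/derivable1_diffP. Qed.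

Lemma FTC2_pos (F f f1 : R -> R) a b : 0 < a -> a < b ->
  (forall t, 0 < t -> is_derive t (1 : R) F (f t)) ->
  (forall t, 0 < t -> is_derive t (1 : R) f (f1 t)) ->
  \int[leb]_(t in `[a, b]) f t = F b - F a.
Proof.
move=> a0 ab dF df; have b0 := lt_trans a0 ab.
rewrite /Rintegral (@continuous_FTC2 _ f F a b)//.
- apply: continuous_in_subspaceT => t; rewrite inE/= in_itv/= => /andP[at_ _].
  exact: continuous_of_derive (df t (lt_le_trans a0 at_)).
- split.
  + by move=> t; rewrite in_itv/= => /andP[at_ _]; have [] := dF t (lt_trans a0 at_).
  + apply: cvg_at_right_filter; exact: continuous_of_derive (dF a a0).
  + apply: cvg_at_left_filter; exact: continuous_of_derive (dF b b0).
- move=> t; rewrite in_itv/= => /andP[at_ _]; rewrite derive1E.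
  by have [_ ->] := dF t (lt_trans a0 at_).
Qed.

Lemma continuous_gam s t : 0 < t -> {for t, continuous (gam s)}.
Proof.
move=> t0; have d := is_derive_gam s t0.
exact: (@continuous_of_derive _ (fun t => (s - 1) * gam (s - 1) t - gam s t)).
Qed.

Lemma gam_compact_integrable s a b : 0 < a -> leb.-integrable `[a, b] (EFin \o gam s).
Proof.
move=> a0; apply: continuous_compact_integrable; first exact: segment_compact.
apply: continuous_in_subspaceT => t; rewrite inE/= in_itv/= => /andP[at_ _].
exact: continuous_gam (lt_le_trans a0 at_).
Qed.

Lemma gam_parts s a b : 0 < a -> a < b ->
  s * \int[leb]_(t in `[a, b]) gam s t - \int[leb]_(t in `[a, b]) gam (s + 1) t =
  gam (s + 1) b - gam (s + 1) a.
Proof.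
move=> a0 ab; have i1 := gam_compact_integrable s b a0; have i2 := gam_compact_integrable (s + 1) b a0.
have dF t : 0 < t -> is_derive t (1 : R) (gam (s + 1)) (s * gam s t - gam (s + 1) t).
  by move=> t0; have := is_derive_gam (s + 1) t0; rewrite addrK.
pose f1 t := s * ((s - 1) * gam (s - 1) t - gam s t) - (s * gam s t - gam (s + 1) t).
have df t : 0 < t -> is_derive t (1 : R) (fun t => s * gam s t - gam (s + 1) t) (f1 t).
  move=> t0; have d1 := is_derive_gam s t0; have d2 := dF t t0.
  by apply: is_derive_eq; rewrite /f1 /GRing.scale/=; ring.
rewrite -(FTC2_pos a0 ab dF df).
by rewrite RintegralB//; [rewrite RintegralZl|exact: integrableZlr].
Qed.

Lemma powR_le_exp s : 0 <= s -> exists2 C, 0 < C & forall t, 0 < t -> t `^ s <= C * expR (2^-1 * t).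
Proof.
move=> s0; pose N := (Num.truncn s).+1.
have sN : s <= N%:R by apply: ltW; exact: truncnS_gt.
have h0 : 0 < 2^-1 :> R by rewrite invr_gt0.
exists (1 + N`!%:R / 2^-1 ^+ N); first by rewrite ltr_pwDl// divr_ge0// exprn_ge0.
move=> t t0; rewrite mulrDl mul1r.
have h1 := expr_le_expR N h0 (ltW t0).
have e1 : 1 <= expR (2^-1 * t) by rewrite -expR0 ler_expR mulr_ge0// ltW.
have [t1|/ltW t1] := leP t 1.
  apply: (@le_trans _ _ 1); last by rewrite (le_trans e1)// lerDl mulr_ge0 ?expR_ge0// divr_ge0// exprn_ge0.
  have t01 : 0 < t <= 1 by rewrite t0.
  by rewrite -(powRr0 t); apply: (ger_powR t01).
apply: (@le_trans _ _ (t ^+ N)); last by rewrite (le_trans h1)// lerDr expR_ge0.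
by rewrite -powR_mulrn ?(ltW t0)//; exact: ler_powR.
Qed.

Definition segm n : set (mR R) := `[n.+1%:R^-1, n.+1%:R].

Lemma segm_bigcup : \bigcup_n segm n = D.
Proof.
apply/seteqP; split => [t [n _]|t]; rewrite /segm /= !in_itv/= andbT.
  by move=> /andP[h _]; apply: lt_le_trans h; rewrite invr_gt0.
move=> t0; have := near_infty_natSinv_lt (PosNum t0) => -[n1 _ /(_ n1 (leqnn n1))/= h1].
pose n2 := Num.truncn t.
have h2 : t <= n2.+1%:R by apply: ltW; exact: truncnS_gt.
exists (maxn n1 n2) => //=; rewrite in_itv/=; apply/andP; split.
  by apply: le_trans (ltW h1); rewrite lef_pV2 ?posrE// ler_nat ltnS leq_maxl.
by apply: le_trans h2 _; rewrite ler_nat ltnS leq_maxr.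
Qed.

Lemma cvg_int_segm (f : R -> R) : measurable_fun [set: mR R] (f : mR R -> R) ->
  (forall t, 0 <= f t) ->
  (\int[leb]_(t in segm n) (f t)%:E)%E @[n --> \oo] --> (\int[leb]_(t in D) (f t)%:E)%E.
Proof.
move=> mf f0; rewrite -segm_bigcup.
apply: ge0_nondecreasing_set_cvg_integral => //.
- move=> n m nm; apply/subsetPset => t; rewrite /segm /= !in_itv/= => /andP[h1 h2].
  rewrite (le_trans _ h1) ?(le_trans h2)// ?ler_nat// lef_pV2 ?posrE// ler_nat//.
- by move=> n; exact: measurable_itv.
- by move=> n; apply/measurable_EFinP; exact: measurable_funTS.
- by move=> i t _; rewrite lee_fin.
Qed.

Lemma segm_lt n : 0 < n.+2%:R^-1 :> R /\ n.+2%:R^-1 < n.+2%:R :> R.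
Proof.
split; first by rewrite invr_gt0.
by apply: (@lt_le_trans _ _ 1); [rewrite invf_lt1// ltr1n|rewrite ler1n].
Qed.

Lemma gam_tail s : 0 <= s -> exists2 C, 0 < C & forall t, 0 < t -> gam (s + 1) t <= C * expR (- (2^-1 * t)).
Proof.
move=> s0; have [C C0 hC] := powR_le_exp s0; exists C => // t t0.
rewrite /gam addrK; apply: le_trans (ler_wpM2r (expR_ge0 _) (hC t t0)) _.
by rewrite -mulrA -expRD (_ : 2^-1 * t + - t = - (2^-1 * t))//; field.
Qed.

(** The singularity at 0 for [s < 1] is handled by integration by parts on compact segments, which
    bounds the integral of [gam s] through that of [gam (s + 1)], itself below a decaying
    exponential. *)
Lemma gam_integrable s : 0 < s -> leb.-integrable D (EFin \o gam s).
Proof.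
move=> s0; have [C C0 hC] := gam_tail (ltW s0).
have int1 n : \int[leb]_(t in segm n.+1) gam (s + 1) t <= C * 2.
  have [a0 ab] := segm_lt n.
  have ie : leb.-integrable (segm n.+1) (EFin \o (fun t => C * expR (- (2^-1 * t)))).
    by apply: continuous_integrable_itv => t; apply: cvgM; [exact: cvg_cst|exact: continuous_expRM].
  apply: (@le_trans _ _ (\int[leb]_(t in segm n.+1) (C * expR (- (2^-1 * t))))).
    apply: le_Rintegral => //; [exact: measurable_itv|exact: gam_compact_integrable|].
    by move=> t; rewrite /segm/= in_itv/= => /andP[h _]; apply: hC; exact: lt_le_trans h.
  have dF (t : R) : is_derive t (1 : R) (fun t => - (C * 2) * expR (- (2^-1 * t))) (C * expR (- (2^-1 * t))).
    by have d := is_derive_expRM 2^-1 t; apply: is_derive_eq; rewrite /GRing.scale/=; field.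
  rewrite (FTC2_derive (ltW ab) dF).
    have C2 : 0 <= C * 2 by rewrite mulr_ge0// ltW.
    have := mulr_ge0 C2 (expR_ge0 (- (2^-1 * n.+2%:R))).
    have := ler_wpM2l C2 (expRN_le1 (_ : 0 <= 2^-1 * n.+2%:R^-1)).
    have -> : 0 <= 2^-1 * n.+2%:R^-1 :> R by rewrite mulr_ge0// invr_ge0.
    by move=> /(_ isT); lra.
  by move=> t; apply: cvgM; [exact: cvg_cst|exact: continuous_expRM].
have bd n : \int[leb]_(t in segm n.+1) gam s t <= (C * 2 + C) / s.
  have [a0 ab] := segm_lt n.
  have b0 := lt_trans a0 ab.
  rewrite ler_pdivlMr// mulrC; have := gam_parts s a0 ab; rewrite -/(segm n.+1).
  have := int1 n; have := gam_ge0 (s + 1) (n.+2%:R^-1).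
  have : gam (s + 1) n.+2%:R <= C.
    apply: le_trans (hC _ b0) _; rewrite ler_piMr ?(ltW C0)// expRN_le1// mulr_ge0// ltW//.
  rewrite /segm; lra.
apply/integrableP; split.
  by apply/measurable_EFinP; apply: measurable_funTS; exact: measurable_gam.
under eq_integral => t _ do rewrite /= ger0_norm ?gam_ge0//.
apply: (@le_lt_trans _ _ ((C * 2 + C) / s)%:E); last by rewrite ltry.
apply: (cvge_to_le (cvg_int_segm (measurable_gam s) (gam_ge0 s))).
exists 1%N => // -[//|n] /= _; rewrite -[leLHS]fineK ?lee_fin ?bd//.
have [a0 _] := segm_lt n.
by apply: integrable_fin_num; [exact: measurable_itv|exact: gam_compact_integrable].
Qed.

Lemma Gamma_gam s : Gamma s = \int[leb]_(t in D) gam s t.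
Proof. by []. Qed.

Lemma cvg_Gamma_segm s : 0 < s -> \int[leb]_(t in segm n) gam s t @[n --> \oo] --> Gamma s.
Proof.
move=> s0; apply: fine_cvg; rewrite fineK.
  exact: cvg_int_segm (measurable_gam s) (gam_ge0 s).
by apply: integrable_fin_num => //; exact: gam_integrable.
Qed.

Lemma GammaS s : 0 < s -> Gamma (s + 1) = s * Gamma s.
Proof.
move=> s0; have s1 : 0 < s + 1 by rewrite addr_gt0.
have c1 : s * (\int[leb]_(t in segm n) gam s t) - \int[leb]_(t in segm n) gam (s + 1) t @[n --> \oo] -->
    s * Gamma s - Gamma (s + 1).
  apply: cvgB; last exact: cvg_Gamma_segm.
  by apply: cvgM; [exact: cvg_cst|exact: cvg_Gamma_segm].
have [C C0 hC] := gam_tail (ltW s0).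
have harm : n.+1%:R^-1 @[n --> \oo] --> (0 : R) := @cvg_harmonic R.
have c2 : gam (s + 1) n.+1%:R - gam (s + 1) n.+1%:R^-1 @[n --> \oo] --> (0 : R).
  rewrite -(subrr 0); apply: cvgB.
    apply: (@squeeze_cvgr _ _ _ _ (fun=> 0) (fun n => 2 * C * n.+1%:R^-1)).
    - apply: nearW => n; rewrite gam_ge0/=; apply: le_trans (hC _ (ltr0Sn _ _)) _.
      have np : 0 < n.+1%:R :> R by [].
      rewrite ler_pdivlMr// expRN.
      have h := expR_ge1Dx (2^-1 * n.+1%:R : R).
      have E0 := expR_gt0 (2^-1 * n.+1%:R : R).
      rewrite [2 * C]mulrC -mulrA ler_pM2l// mulrC ler_pdivrMr//; lra.
    - exact: cvg_cst.
    - by rewrite -(mulr0 (2 * C)); apply: cvgM; [exact: cvg_cst|exact: harm].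
  apply: (@squeeze_cvgr _ _ _ _ (fun=> 0) (fun n => n.+1%:R^-1 `^ s)).
  - apply: nearW => n; rewrite gam_ge0/= /gam addrK ler_piMr ?powR_ge0// expRN_le1//.
  - exact: cvg_cst.
  - have pc : t `^ s @[t --> (0 : R)^'+] --> (0 : R) by exact: powR_cvg0.
    by move/cvg_at_rightP: pc; apply; split => // n; rewrite invr_gt0.
have c3 : s * (\int[leb]_(t in segm n) gam s t) - \int[leb]_(t in segm n) gam (s + 1) t @[n --> \oo] --> (0 : R).
  apply: cvg_trans c2; apply: near_eq_cvg; exists 1%N => // -[//|n] /= _.
  by have [a0 ab] := segm_lt n; rewrite /segm gam_parts.
have e : s * Gamma s - Gamma (s + 1) = 0.
  by apply: etrans (esym (cvg_lim _ c1)) (cvg_lim _ c3); exact: norm_hausdorff.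
by apply/esym/eqP; rewrite -subr_eq0; apply/eqP.
Qed.

(** Restrict the integral to [[T, T + 1]]; for [al > 0], as [T] is free, this gives growth faster
    than any geometric sequence. *)
Lemma Gamma_lb (al c T : R) n : 0 <= al -> 0 < c -> 1 <= T ->
  (T `^ al) ^+ n * (expR (- (T + 1)) / (T + 1)) <= Gamma (al * n%:R + c).
Proof.
move=> al0 c0 T1; have T0 : 0 < T by apply: lt_le_trans T1.
have TT : 0 < T + 1 by rewrite addr_gt0.
have s0 : 0 < al * n%:R + c by rewrite ltr_wpDl// mulr_ge0.
have ig := gam_integrable s0.
have sub : `[T, T + 1] `<=` D.
  by move=> t /=; rewrite !in_itv/= andbT => /andP[h _]; exact: lt_le_trans h.
apply: (@le_trans _ _ (\int[leb]_(t in `[T, T + 1]) gam (al * n%:R + c) t)); last first.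
  rewrite Gamma_gam /Rintegral fine_le//.
  - by apply: integrable_fin_num => //; exact: gam_compact_integrable.
  - by apply: integrable_fin_num.
  apply: ge0_subset_integral => //.
  - by apply/measurable_EFinP; apply: measurable_funTS; exact: measurable_gam.
  - by move=> t _; rewrite lee_fin gam_ge0.
set L := _ * _.
have -> : L = \int[leb]_(t in `[T, T + 1]) (cst L t).
  have m1 : leb `[T, T + 1] = 1%:E.
    by rewrite lebesgue_measure_itv/= lte_fin ltrDl ltr01 -EFinB addrAC subrr add0r.
  transitivity (L * fine (leb `[T, T + 1])); first by rewrite m1 mulr1.
  by rewrite Rintegral_cst.
apply: le_Rintegral => //.
- by apply: continuous_integrable_itv => t; exact: cvg_cst.
- exact: gam_compact_integrable.
move=> t /=; rewrite in_itv/= => /andP[Tt tT]; have t0 := lt_le_trans T0 Tt.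
have t1 : 1 <= t := le_trans T1 Tt.
rewrite /L /gam -addrA powRD; last by rewrite (gt_eqF t0) implybT.
rewrite -mulrA; apply: ler_pM.
- by rewrite exprn_ge0// powR_ge0.
- by rewrite divr_ge0 ?expR_ge0// ltW.
- rewrite powRrM powR_mulrn ?powR_ge0//; apply: lerXn2r; rewrite ?nnegrE ?powR_ge0//.
  by apply: ge0_ler_powR => //; rewrite ?nnegrE ltW.
rewrite mulrC; apply: ler_pM; rewrite ?invr_ge0 ?expR_ge0 ?(ltW TT)//.
  apply: (@le_trans _ _ (t `^ (-1))).
    by rewrite powR_inv1 ?(ltW t0)// lef_pV2 ?posrE.
  by apply: ler_powR => //; lra.
by rewrite ler_expR lerN2.
Qed.

Lemma Gamma_gt0 c : 0 < c -> 0 < Gamma c.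
Proof.
move=> c0; have := @Gamma_lb 0 c 1 0 (lexx 0) c0 (lexx 1).
rewrite mul0r add0r; apply: lt_le_trans.
by rewrite expr0 mul1r divr_gt0 ?expR_gt0.
Qed.

End GammaIntegral.

Opaque Gamma.

(** * Gamma moment sequences *)

Section GammaMoments.
Context {R : realType} (al c : R).
Hypotheses (al0 : 0 < al) (c0 : 0 < c).
Local Notation leb := (@lebesgue_measure R).
Local Notation D := (`]0%R, +oo[%classic : set (mR R)).
Implicit Types (q : {poly R}) (n j : nat) (t : R).

(** Integral of [(t ^ al) ^ n t ^ j] against the Gamma law of parameter [c], so [gx] is the moment
    sequence of [t ^ al]. The index [j] plays the same part as in [bmu]: by [gmuS], a factor [n]
    costs one increment of [j]. *)
Definition gmu n j : R := Gamma (al * n%:R + j%:R + c) / Gamma c.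
Definition gx n : R := gmu n 0.
Definition gker j n t : R := t `^ al ^+ n * (t ^+ j * (gam c t / Gamma c)).

Let Gc : 0 < Gamma c := Gamma_gt0 c0.
Let e0 n j : 0 < al * n%:R + j%:R + c.
Proof. by rewrite ltr_wpDl// addr_ge0// mulr_ge0// ltW. Qed.

Lemma gkerE n j t : 0 < t -> gker j n t = (Gamma c)^-1 * gam (al * n%:R + j%:R + c) t.
Proof.
move=> t0; rewrite /gker /gam.
have -> : al * n%:R + j%:R + c - 1 = al * n%:R + (j%:R + (c - 1)) by ring.
have tn : forall b, (t == 0) ==> b by move=> b; rewrite (gt_eqF t0).
rewrite !powRD ?(gt_eqF t0) ?implybT// powRrM !powR_mulrn ?powR_ge0 ?(ltW t0)//.
by field; rewrite gt_eqF.
Qed.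

Lemma gker_integrable n j : leb.-integrable D (EFin \o gker j n).
Proof.
have h : leb.-integrable D (EFin \o (fun t => (Gamma c)^-1 * gam (al * n%:R + j%:R + c) t)).
  by apply: integrableZlr => //; exact: gam_integrable.
apply: eq_integrable h => // t; rewrite inE/= in_itv/= andbT => t0.
by rewrite gkerE.
Qed.

Lemma gker_int n j : \int[leb]_(t in D) gker j n t = gmu n j.
Proof.
rewrite /gmu Gamma_gam mulrC -RintegralZl//; last exact: gam_integrable.
apply: eq_Rintegral => t; rewrite inE/= in_itv/= andbT => t0.
by rewrite gkerE.
Qed.

Lemma gpoly_int q j :
  leb.-integrable D (EFin \o (fun t => q.[t `^ al] * (t ^+ j * (gam c t / Gamma c)))) /\
  \int[leb]_(t in D) (q.[t `^ al] * (t ^+ j * (gam c t / Gamma c))) = mom (gmu^~ j) q.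
Proof.
have -> : (fun t => q.[t `^ al] * (t ^+ j * (gam c t / Gamma c))) =
    fun t => \sum_(i < size q) q`_i * gker j i t.
  apply/funext => t; rewrite horner_coef mulr_suml; apply: eq_bigr => i _.
  by rewrite /gker -mulrA.
have h i : leb.-integrable D (EFin \o (fun t => q`_i * gker j i t)).
  by apply: integrableZlr => //; exact: gker_integrable.
split; first by apply: (@integrable_sumr _ _ _ leb D (size q) (fun i t => q`_i * gker j i t)).
rewrite (@Rintegral_sumr _ _ _ leb D (size q) (fun i t => q`_i * gker j i t))//.
rewrite /mom; apply: eq_bigr => i _; rewrite RintegralZl ?gker_int//.
exact: gker_integrable.
Qed.

Lemma hpsd_gmu j : hpsd (gmu^~ j).
Proof.
apply: (eq_hpsd (a := fun n => \int[leb]_(t in D) gker j n t)) => [n|]; first exact: gker_int.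
apply: hpsd_Rintegral => // [n|t]; first exact: gker_integrable.
rewrite /= in_itv/= andbT => t0.
apply: (eq_hpsd (a := fun n => (t ^+ j * (gam c t / Gamma c)) * t `^ al ^+ n)).
  by move=> n; rewrite /gker mulrC.
apply: hpsdZ; last exact: hpsd_exp.
by rewrite mulr_ge0 ?exprn_ge0 ?divr_ge0 ?gam_ge0// ltW.
Qed.

(** Cauchy-Schwarz with [t ^ j] in [L^2] of the Gamma law; it goes through the discriminant, because
    [t ^ j] need not be a polynomial in [t ^ al]. *)
Lemma bfun_gmu j : bfun gx (gmu^~ j) (Num.sqrt (gmu 0 j.*2)).
Proof.
have m0 n i : 0 <= gmu n i.
  by apply: divr_ge0; apply: ltW; [exact: Gamma_gt0 (e0 n i)|exact: Gc].
apply: bfunP; [exact: hpsd_gmu|exact: sqrtr_ge0|move=> q].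
rewrite sqr_sqrtr// mulrC; apply: disc_le => // a.
have [i1 e1] := gpoly_int (q ^+ 2) 0; have [i2 e2] := gpoly_int q j.
have [i3 e3] := gpoly_int 1 j.*2.
have -> : gmu 0 j.*2 = mom (gmu^~ j.*2) 1 by rewrite -(expr0 'X) momXn.
have mD : measurable D by exact: measurable_itv.
have z1 := integrableZlr (2 * a) mD i2; have z2 := integrableZlr (a ^+ 2) mD i3.
rewrite -e1 -e2 -e3 -(RintegralZl (2 * a) mD i2) -(RintegralZl (a ^+ 2) mD i3).
rewrite -(RintegralD mD i1 z1) -(RintegralD mD (integrableDr mD i1 z1) z2).
apply: Rintegral_ge0 => t; rewrite /= in_itv/= andbT => t0.
have h1 : (1 : {poly R}).[t `^ al] = 1 by rewrite -polyC1 hornerC.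
rewrite h1 horner_exp expr0.
have -> : t ^+ j.*2 = (t ^+ j) ^+ 2 by rewrite -exprM muln2.
set u := q.[_]; set v := t ^+ j; set g := _ / _.
have g0 : 0 <= g by rewrite divr_ge0 ?gam_ge0// ltW.
rewrite (_ : _ + _ = (u + a * v) ^+ 2 * g); last by ring.
by rewrite mulr_ge0// sqr_ge0.
Qed.

Lemma gmuS n j : gmu n j.+1 = (al * n%:R + j%:R + c) * gmu n j.
Proof.
rewrite /gmu mulrA -(GammaS (e0 n j)).
by rewrite (_ : al * n%:R + j.+1%:R + c = al * n%:R + j%:R + c + 1)// -natr1; ring.
Qed.

Lemma gx0 : gx 0 = 1.
Proof. by rewrite /gx /gmu mulr0 !add0r divff// gt_eqF. Qed.

Lemma gx_gt0 n : 0 < gx n.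
Proof. by rewrite divr_gt0// Gamma_gt0. Qed.

Lemma hpsd_addn_gx : hpsd (fun n => (n%:R + c / al) * gx n).
Proof.
apply: (eq_hpsd (a := fun n => al^-1 * gmu n 1)) => [n|].
  by rewrite gmuS /gx; field; rewrite gt_eqF.
by apply: hpsdZ; [rewrite invr_ge0 ltW|exact: hpsd_gmu].
Qed.

Lemma bfun_gx K : bfun gx (fun n => 'C(n, K)%:R * gx n)
  ((((4 + 2 * c) / al + 1) * (K%:R + 1)) ^+ K / K`!%:R).
Proof.
set A := _ / al + 1; have ai : 0 < al^-1 by rewrite invr_gt0.
have A0 : 0 <= A by rewrite addr_ge0// divr_ge0 ?(ltW al0)// addr_ge0// mulr_ge0// ltW.
have b0 : Num.sqrt (gmu 0 0.*2) = 1 by rewrite double0 -/(gx 0) gx0 sqrtr1.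
have T0 : 0 <= A * (K%:R + 1) by rewrite mulr_ge0// addr_ge0.
have := @binom_bfun R gx gmu (fun=> al^-1) (fun j => (j%:R + c) / al)
  (fun j => Num.sqrt (gmu 0 j.*2)) _ K T0 (fun=> erefl).
rewrite b0 mulr1 => main.
have rec n j : (j < K)%N -> n%:R * gmu n j = al^-1 * gmu n j.+1 - (j%:R + c) / al * gmu n j.
  by move=> _; rewrite gmuS; move: (gmu n j) => g; field; rewrite gt_eqF.
apply: (main rec (fun j _ => bfun_gmu j)) => j jK; clear main rec; set s := Num.sqrt (gmu 0 j.*2).
have s0 : 0 <= s by exact: sqrtr_ge0.
have jc : 0 < j.*2%:R + c by rewrite ltr_wpDl.
have jK' : j%:R + 1 <= K%:R :> R by rewrite natr1 ler_nat.
have hs : Num.sqrt (gmu 0 j.+1.*2) <= (j.*2%:R + c + 1) * s.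
  rewrite doubleS !gmuS mulr0 !add0r mulrA sqrtrM; last first.
    by apply: mulr_ge0; apply: ltW => //; exact: ltr_wpDl.
  apply: ler_wpM2r => //.
  have z0 : 0 <= j.*2%:R + c + 1 by rewrite addr_ge0 ?(ltW jc).
  rewrite -[leRHS]ger0_norm// -sqrtr_sqr; apply: ler_wsqrtr.
  rewrite (_ : j.*2.+1%:R + c = j.*2%:R + c + 1); last by rewrite -natr1; ring.
  by rewrite expr2; apply: ler_wpM2l => //; rewrite lerDl.
rewrite (gtr0_norm ai) (gtr0_norm (divr_gt0 _ al0)); last by rewrite ltr_wpDl.
apply: (@le_trans _ _ ((al^-1 * (j.*2%:R + c + 1) + ((j%:R + c) / al + K%:R)) * s)).
  by rewrite [leRHS]mulrDl; apply: lerD => //; rewrite -mulrA; apply: ler_wpM2l => //; exact: ltW.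
apply: ler_wpM2r => //.
rewrite -muln2 natrM /A.
have K0 : 0 <= K%:R :> R by [].
have j0 : 0 <= j%:R :> R by [].
have -> : ((4 + 2 * c) / al + 1) * (K%:R + 1) = al^-1 * ((4 + 2 * c) * (K%:R + 1)) + (K%:R + 1) by ring.
have -> : al^-1 * (j%:R * 2 + c + 1) + ((j%:R + c) / al + K%:R) =
  al^-1 * (3 * j%:R + 2 * c + 1) + K%:R by ring.
apply: lerD; last by rewrite lerDl.
rewrite ler_pM2l// mulrDr mulr1.
have : 0 <= c * K%:R by rewrite mulr_ge0// ltW.
move: jK' j0; nra.
Qed.

Lemma gx_growth L : 0 < L -> exists2 d, 0 < d & forall k, d * L ^+ k <= gx k.
Proof.
move=> L0; pose T := Num.max 1 (L `^ al^-1).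
have T1 : 1 <= T by rewrite le_max lexx.
have T0 : 0 < T by apply: lt_le_trans T1.
have LT : L <= T `^ al.
  apply: (@le_trans _ _ (L `^ al^-1 `^ al)).
    by rewrite -powRrM mulVf ?gt_eqF// powRr1// ltW.
  by apply: ge0_ler_powR; rewrite ?nnegrE ?powR_ge0 ?(ltW al0) ?(ltW T0)// le_max lexx orbT.
exists (expR (- (T + 1)) / (T + 1) / Gamma c).
  by rewrite !divr_gt0 ?expR_gt0// addr_gt0.
move=> k; have := Gamma_lb k (ltW al0) c0 T1 => h.
rewrite /gx /gmu addr0 mulrAC; apply: ler_wpM2r; first by rewrite invr_ge0 ltW.
apply: le_trans h; rewrite mulrC; apply: ler_wpM2r.
  by rewrite divr_ge0 ?expR_ge0// ltW// addr_gt0.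
by apply: lerXn2r; rewrite ?nnegrE ?powR_ge0 ?(ltW L0).
Qed.

End GammaMoments.

(** * Hypotheses of the dilation argument *)

Section ChainHypotheses.
Context {R : realType} (p : laguerre_exponent R).
Hypothesis phi1 : 0 < phir p 1.
Implicit Types (al mm A C L : R).

(** What the dilation argument asks of [W]: control of dilations, dual functionals with at most
    geometric bounds, and moments growing faster than any geometric sequence. *)
Definition chain_hyp := exists kap B C M,
  [/\ hpsd (fun n => (n + kap.+1)%:R * W p n),
      forall k, bfun (W p) (binw (W p) k) (B k),
      1 <= M, forall k, B k <= C * M ^+ k &
      forall L, 0 < L -> exists2 c, 0 < c & forall k, c * L ^+ k <= W p k].

(** [(K + 1) ^ K <= K! exp (K + 1)], one term of the exponential series. *)
Lemma exp_growth A K : 0 <= A -> (A * (K%:R + 1)) ^+ K / K`!%:R <= expR 1 * (A * expR 1) ^+ K.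
Proof.
move=> A0; have K1 : 0 <= K%:R + 1 :> R by rewrite addr_ge0.
have Kf : 0 < K`!%:R :> R by rewrite ltr0n fact_gt0.
have := expr_le_expR K ltr01 K1; rewrite expr1n divr1 mul1r => h.
rewrite ler_pdivrMr// !exprMn.
have -> : expR 1 * (A ^+ K * expR 1 ^+ K) * K`!%:R = A ^+ K * (K`!%:R * expR (K%:R + 1)).
  by rewrite expRD -[in RHS](mulr1 K%:R) expRM_natl; ring.
by apply: ler_wpM2l => //; exact: exprn_ge0.
Qed.

Lemma hpsd_nat_shift (x : nat -> R) (r : R) : hpsd x -> hpsd (fun n => (n%:R + r) * x n) ->
  exists kap, hpsd (fun n => (n + kap.+1)%:R * x n).
Proof.
move=> hx hr; exists (Num.truncn `|r|); set k := (Num.truncn _).+1.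
apply: (eq_hpsd (a := fun n => (n%:R + r) * x n + (k%:R - r) * x n)) => [n|].
  by rewrite natrD; ring.
apply: hpsdD => //; apply: hpsdZ => //; rewrite subr_ge0.
exact: le_trans (ler_norm _) (ltW (truncnS_gt _)).
Qed.

Lemma chain_hyp_NP : hpsd (W p) -> classNP p -> chain_hyp.
Proof.
move=> hW sp; have [C C0 hC] := density_sigma sp.
have [b [b0 _ db]] := hC 1 ltr01.
have [kap hkap] := hpsd_nat_shift hW (hpsd_addn_W phi1 b0 db).
(* With [b <= C (4 K + 5)], the rate [3 b + 6 K + 5] of [bfun_bet_growth] is at most
   [(15 C + 6) (K + 1)]. *)
pose A := 15 * C + 6.
have A0 : 0 <= A by rewrite addr_ge0// mulr_ge0.
pose B k : R := (A * (k%:R + 1)) ^+ k / k`!%:R.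
exists kap, B, (expR 1), (Num.max 1 (A * expR 1)); split => //.
- move=> K; have K0 : 0 <= K%:R :> R by [].
  have A4 : 0 < (4 * K + 4)%:R :> R by rewrite ltr0n addn_gt0 orbT.
  have [d [d0 dC dd]] := hC _ A4.
  have h := bfun_W phi1 A4 d0 dd (bfun_bet_growth (K := K) (ltW d0) (lexx _)).
  apply: bfun_le h; rewrite /B; apply: ler_wpM2r; first by rewrite invr_ge0.
  apply: lerXn2r; rewrite ?nnegrE.
  + by rewrite !addr_ge0// mulr_ge0// ltW.
  + by rewrite mulr_ge0// addr_ge0.
  move: dC; rewrite natrD natrM /A; have : 0 <= C * K%:R by rewrite mulr_ge0.
  nra.
- by rewrite le_max lexx.
- move=> k; apply: le_trans (exp_growth k A0) _; rewrite ler_pM2l ?expR_gt0//.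
  apply: lerXn2r; rewrite ?nnegrE ?mulr_ge0 ?expR_ge0//.
    by rewrite le_max ler01.
  by rewrite le_max lexx orbT.
move=> L L0.
have [s s0 sE] : exists2 s, 0 < s & s = lsigma p ^+ 2 by exists (lsigma p ^+ 2).
exists (expR (- (L / s))); first exact: expR_gt0.
move=> k; have Ls : 0 <= L / s by rewrite divr_ge0// ltW.
have := expr_le_expR k ltr01 Ls; rewrite expr1n divr1 mul1r => h.
have h1 : L ^+ k <= s ^+ k * (k`!%:R * expR (L / s)).
  have sk : 0 < s ^+ k by exact: exprn_gt0.
  by move: h; rewrite expr_div_n (ler_pdivrMr _ _ sk) mulrC.
have h2 : s ^+ k * k`!%:R <= W p k.
  elim: k {h h1} => [|k IH]; first by rewrite W0 expr0 fact0 mulr1.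
  rewrite WS exprS factS natrM.
  have -> : s * s ^+ k * (k.+1%:R * k`!%:R) = (s ^+ k * k`!%:R) * (s * k.+1%:R) by ring.
  apply: ler_pM => //; rewrite ?mulr_ge0 ?exprn_ge0 ?(ltW s0)//.
  rewrite /phir -sE addrAC lerDr addr_ge0 ?ldrift_ge0// mulr_ge0 ?invr_ge0//.
  by apply: pint_ge0 => y _; exact: ecomp_ge0.
rewrite mulrC expRN ler_pdivrMr ?expR_gt0//; apply: le_trans h1 _.
by rewrite mulrA; apply: ler_wpM2r => //; exact: expR_ge0.
Qed.

(** The partial products of [phiR] form the Gamma sequence, so [W] is [gx] times the products of
    [1 / f], where [f = phiR / phi] is completely monotone. Berg-Duran applies to [f], and the
    bounds are inherited from [gx]. The condition on [mm] gives [al <= c], hence [0 < c]. *)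
Lemma chain_hyp_Nam al mm : 0 < al <= 1 -> 1 - al^-1 <= mm -> hpsd (W p) -> classNam al mm p -> chain_hyp.
Proof.
move=> /andP[al0 al1] hmm hW cm; pose c := al * mm + 1.
have c0 : 0 < c.
  apply: (lt_le_trans al0); rewrite /c; have := ler_wpM2l (ltW al0) hmm.
  by rewrite mulrBr mulr1 divff ?gt_eqF//; lra.
have cf := cmf_of_cm cm; set f := (fun u => _) in cf.
have Gp n : 0 < Gamma (al * n%:R + c) by apply: Gamma_gt0; rewrite ltr_wpDl// mulr_ge0// ltW.
have fE n : f n.+1%:R = (gx al c n.+1 / gx al c n) / phir p n.+1%:R.
  rewrite /f phir_nat; congr (_ / _); rewrite /phiR /gx /gmu !addr0.
  rewrite -addrA -/c (_ : al * n.+1%:R + c - al = al * n%:R + c); last by rewrite -natr1; ring.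
  have := Gp n; have := Gp n.+1; have := Gamma_gt0 c0.
  move: (Gamma _) (Gamma _) (Gamma _) => x y z x0 y0 z0; field.
  by rewrite !gt_eqF.
have gp n := gx_gt0 al0 c0 n.
have pp n := phir_gt0 phi1 n.
have fp k : (0 < k)%N -> 0 < f k%:R.
  by case: k => // k _; rewrite fE; apply: divr_gt0; [exact: divr_gt0|exact: pp].
have fd k : (0 < k)%N -> f k.+1%:R <= f k%:R by exact: cmf_nonincr.
pose s n := \prod_(k < n) (f k.+1%:R)^-1.
have hs : hpsd s by apply: (hpsd_inv_prod (a := fun k => f k%:R)) => // j j0; exact: cmf_hpsd.
have s0 : s 0%N = 1 by rewrite /s big_ord0.
have WE n : W p n = gx al c n * s n.
  elim: n => [|n IH]; first by rewrite W0 gx0// s0 mulr1.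
  rewrite WS IH /s big_ord_recr/= -/(s n) fE; have := pp n; have := gp n; have := gp n.+1.
  move: (phir p _) (gx _ _ _) (gx _ _ _) (s n) => u v w r v0 w0 u0; field.
  by rewrite !gt_eqF.
have hx : hpsd (gx al c) by exact: hpsd_gmu.
have [kap hk] := hpsd_nat_shift hx (hpsd_addn_gx al0 c0).
pose A := (4 + 2 * c) / al + 1.
have A0 : 0 <= A by rewrite addr_ge0// divr_ge0 ?(ltW al0)// addr_ge0// mulr_ge0// ltW.
pose B k : R := (A * (k%:R + 1)) ^+ k / k`!%:R.
exists kap, B, (expR 1), (Num.max 1 (A * expR 1)); split => //.
- apply: eq_hpsd (hpsd_mul hk hs) => n; by rewrite WE mulrA.
- move=> K; have h := bfun_mul hx hs s0 (bfun_gx al0 c0 K).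
  apply: (eq_bfunl _ (eq_bfun _ h)) => n; first by rewrite WE.
  by rewrite /binw WE mulrA.
- by rewrite le_max lexx.
- move=> k; apply: le_trans (exp_growth k A0) _; rewrite ler_pM2l ?expR_gt0//.
  apply: lerXn2r; rewrite ?nnegrE ?mulr_ge0 ?expR_ge0//.
    by rewrite le_max ler01.
  by rewrite le_max lexx orbT.
move=> L L0; have f1 : 0 < f 1 by exact: (fp 1%N).
have f1le k : (0 < k)%N -> f k%:R <= f 1.
  case: k => // k _; elim: k => [|k IH]; first by [].
  by apply: le_trans IH; exact: fd.
have [d d0 hd] := gx_growth al0 c0 (mulr_gt0 L0 f1).
exists d => // k; rewrite WE.
have sk : (f 1)^-1 ^+ k <= s k.
  rewrite /s -[X in _ ^+ X]card_ord -prodr_const; apply: ler_prod => i _.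
  have := f1le i.+1 isT; have := fp i.+1 isT.
  move: (f i.+1%:R) (f 1) f1 => y z z0 y0 yz.
  by rewrite invr_ge0 (ltW z0)/= lef_pV2 ?posrE.
have := hd k; rewrite exprMn mulrA => h.
apply: (@le_trans _ _ (d * L ^+ k * f 1 ^+ k * (f 1)^-1 ^+ k)).
  by rewrite -mulrA -exprMn divff ?expr1n ?mulr1// gt_eqF.
by apply: ler_pM => //; rewrite ?mulr_ge0 ?exprn_ge0 ?invr_ge0 ?(ltW d0) ?(ltW L0) ?(ltW f1).
Qed.

End ChainHypotheses.

(** * Iterated primitives and their moments *)

Section IteratedPrimitive.
Context {R : realType}.
Local Notation leb := (@lebesgue_measure R).
Implicit Types (g : R -> R) (lam s : R).

Lemma in_set_itv (i : interval R) s : (s \in [set` i]) = (s \in i).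
Proof. by apply/idP/idP => [/set_mem|h]; [|exact: mem_set]. Qed.

(** [prim] preserves this class on functions of integral 0, which is what allows iteration. *)
Definition expint g := [/\ measurable_fun [set: mR R] (g : mR R -> R),
  forall x, x <= 0 -> g x = 0 &
  exists2 lam, 0 < lam & leb.-integrable setT (EFin \o (fun x => g x * expR (lam * x)))].

Definition prim g s : R := \int[leb]_(t in `]-oo, s]) g t.
Definition lmoment g k : R := \int[leb]_x (g x * x ^+ k).

Lemma expint_integrable_X g k : expint g -> leb.-integrable setT (EFin \o (fun x => g x * x ^+ k)).
Proof.
move=> [mg g0 [lam lam0 ig]].
apply: (integrable_dominated (T := mR R)
  (g := fun x => (k`!%:R / lam ^+ k) * `|g x * expR (lam * x)|)) => //.
- by apply: measurable_funM => //; exact: measurable_exprX.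
- move=> x _; rewrite !normrM (ger0_norm (expR_ge0 _)).
  have [x0|x0] := leP x 0; first by rewrite g0// normr0 !mul0r mulr0.
  rewrite mulrCA; apply: ler_wpM2l => //.
  by rewrite ger0_norm ?exprn_ge0 ?(ltW x0)//; apply: expr_le_expR => //; exact: ltW.
- by apply: integrableZlr => //; exact: integrable_norm ig.
Qed.

Lemma expint_integrable g : expint g -> leb.-integrable setT (EFin \o g).
Proof.
by move=> /(expint_integrable_X 0); congr (leb.-integrable _ _); apply/funext => x /=; rewrite expr0 mulr1.
Qed.

Lemma prim_compl g s : leb.-integrable setT (EFin \o g) -> \int[leb]_x g x = 0 ->
  prim g s = - \int[leb]_(t in `]s, +oo[) g t.
Proof.
move=> ig g0; have e : setT = `]-oo, s] `|` `]s, +oo[ :> set (mR R).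
  by apply/seteqP; split => // t _ /=; rewrite !in_itv/= andbT; case: (leP t s); [left|right].
have := g0; rewrite e /prim Rintegral_setU//.
- by move/eqP; rewrite addr_eq0 => /eqP.
- by rewrite -e.
- by apply/disj_setPS => t /= []; rewrite !in_itv/= andbT => ts /(le_lt_trans ts); rewrite ltxx.
Qed.

Lemma prim_continuous g s : expint g -> {for s, continuous (prim g)}.
Proof.
move=> eg; have [_ g0 _] := eg; pose a := Num.min s 0 - 1; pose b := s + 1.
have as_ : a < s by rewrite /a ltrBlDr (@le_lt_trans _ _ s) ?ltrDl// ge_min lexx.
have a0 : a <= 0 by rewrite /a lerBlDr (@le_trans _ _ 0) ?add0r// ge_min lexx orbT.
have sb : s < b by rewrite ltrDl.
have -> : prim g = fun x => parameterized_integral leb a x g.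
  apply/funext => x; rewrite /prim /parameterized_integral [LHS]Rintegral_mkcond [RHS]Rintegral_mkcond.
  congr Rintegral; apply/funext => t; rewrite !patchE !in_set_itv !in_itv/=.
  have [ta|ta] := leP a t; first by [].
  by case: ifP => //= _; rewrite g0// ltW// (lt_le_trans ta).
apply: (@within_continuous_continuous _ _ _ a b) => //; first exact: lt_trans sb.
  apply: parameterized_integral_continuous; first exact: ltW (lt_trans as_ sb).
  by apply: integrableS (expint_integrable eg).
by rewrite in_itv/= as_.
Qed.

Lemma prim_le0 g s : expint g -> s <= 0 -> prim g s = 0.
Proof.
move=> [_ g0 _] s0; rewrite /prim (@eq_Rintegral _ _ _ leb _ (cst 0)) ?Rintegral_cst ?mul0r// => t.
by rewrite inE/= in_itv/= => ts; rewrite g0// (le_trans ts).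
Qed.

Lemma prim_bound g : expint g -> \int[leb]_x g x = 0 ->
  exists M lam, [/\ 0 <= M, 0 < lam & forall s, `|prim g s| <= M * expR (- (lam * s))].
Proof.
move=> eg z; have [mg g0 [lam lam0 ig]] := eg; have i0 := expint_integrable eg.
exists (\int[leb]_x `|g x * expR (lam * x)|), lam; split => //.
  by apply: Rintegral_ge0.
move=> s; rewrite prim_compl// normrN.
have sub : `]s, +oo[ `<=` [set: mR R] by [].
have i1 : leb.-integrable `]s, +oo[ (EFin \o g) by apply: integrableS i0.
apply: le_trans (le_normr_Rintegral _ i1) _; first exact: measurable_itv.
rewrite mulrC -RintegralZl//; last exact: integrable_norm ig.
rewrite [leLHS]Rintegral_mkcond; apply: le_Rintegral => //.
- apply: (integrable_dominated (T := mR R) (g := fun x => `|g x|)) => //; last exact: integrable_norm i0.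
    apply/(measurable_restrictT _ _).1 => //; apply: measurableT_comp => //; exact: measurable_funTS.
  by move=> x _; rewrite patchE; case: ifP; rewrite ?normr_id// normr0.
- by apply: integrableZlr => //; exact: integrable_norm ig.
move=> x _; rewrite patchE; case: ifPn => [|_]; last by rewrite mulr_ge0 ?expR_ge0.
rewrite inE/= in_itv/= andbT => sx; rewrite normrM (ger0_norm (expR_ge0 _)) mulrCA.
by rewrite ler_peMr// -expRD -expR0 ler_expR addrC -mulrBr mulr_ge0// ?(ltW lam0)// subr_ge0 ltW.
Qed.

Lemma expint_prim g : expint g -> \int[leb]_x g x = 0 -> expint (prim g).
Proof.
move=> eg z; have [M [lam [M0 lam0 hM]]] := prim_bound eg z.
have i0 := expint_integrable eg.
have mp : measurable_fun [set: mR R] (prim g : mR R -> R).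
  by apply: continuous_measurable_fun => s; exact: prim_continuous eg.
split => //; first by move=> x x0; exact: prim_le0.
have l20 : 0 < lam / 2 by rewrite divr_gt0.
exists (lam / 2) => //.
pose f (t : R) := M * expR (- (lam / 2 * t)).
have jf : leb.-integrable setT (EFin \o (f \_ `]0%R, +oo[)).
  rewrite -restrict_EFin; apply/(integrable_mkcond _ _).1 => //.
  by apply: integrableZlr => //; exact: lintegrable_exp.
apply: (integrable_dominated (T := mR R) (g := f \_ `]0%R, +oo[)) => //.
  by apply: measurable_funM => //; exact: measurable_expRMl.
move=> x _; rewrite patchE in_set_itv in_itv/= andbT normrM (ger0_norm (expR_ge0 _)).
have [x0|x0] := leP x 0; first by rewrite prim_le0// normr0 mul0r.
apply: le_trans (ler_wpM2r (expR_ge0 _) (hM x)) _.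
rewrite -mulrA -expRD /f (_ : - (lam * x) + lam / 2 * x = - (lam / 2 * x))//; by field.
Qed.

Lemma Rintegral_zero : \int[leb]_x (cst 0 x : R) = 0.
Proof. by rewrite Rintegral_cst ?mul0r. Qed.

(** Integration by parts for an integrable [g]: since [g] has integral 0, its primitive at [s] is
    minus the integral over [(s, oo)], and Fubini exchanges the integrals of [F]. *)
Lemma prim_moment g k : expint g -> \int[leb]_x g x = 0 ->
  k.+1%:R * lmoment (prim g) k = - lmoment g k.+1.
Proof.
move=> eg z; have [mg g0 _] := eg; have i0 := expint_integrable eg.
pose F (y : mR R * mR R) : R :=
  if (0 < y.1) && (y.1 < y.2) then g y.2 * y.1 ^+ k else 0.
have mF : measurable_fun setT (EFin \o F).
  apply/measurable_EFinP; apply: measurable_fun_ifT => //.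
    by apply: measurable_and; apply: measurable_fun_ltr.
  apply: measurable_funM; first exact: measurableT_comp.
  exact: (measurableT_comp (measurable_exprX k)).
have cint x (h : R) : leb.-integrable `[0, x] (EFin \o (fun s => h * s ^+ k)).
  by apply: continuous_integrable_itv => s; apply: cvgM; [exact: cvg_cst|exact: exprn_continuous].
have bumpi x (h : R) : leb.-integrable `]0, x[ (EFin \o (fun s => h * s ^+ k)).
  by apply: integrableS (cint x h) => //; apply: subset_itv; rewrite bnd_simp.
have bumpE x (h : R) : (fun s => if 0 < s < x then h * s ^+ k else 0) = (fun s => h * s ^+ k) \_ `]0, x[.
  by apply/funext => s; rewrite patchE in_set_itv in_itv.
have bint x (h : R) : leb.-integrable setT (EFin \o (fun s => if 0 < s < x then h * s ^+ k else 0)).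
  by rewrite (bumpE x h) -restrict_EFin; apply/(integrable_mkcond _ _).1.
have inner x (h : R) : \int[leb]_s (if (0 < s) && (s < x) then h * s ^+ k else 0) =
    if 0 < x then h * x ^+ k.+1 / k.+1%:R else 0.
  have [x0|x0] := leP x 0.
    rewrite (_ : (fun s => _) = cst 0); first exact: Rintegral_zero.
    by apply/funext => s; case: ifPn => // /andP[s0 sx]; have := lt_trans s0 sx; rewrite ltNge x0.
  rewrite (bumpE x h) -Rintegral_mkcond (Rintegral_itv_obnd_cbnd (bumpi x h)) Rintegral_itv_bndo_bndc; last first.
    by apply: integrableS (cint x h) => //; apply: subset_itv; rewrite bnd_simp.
  have dF (s : R) : is_derive s (1 : R) (fun s => h / k.+1%:R * s ^+ k.+1) (h * s ^+ k).
    have -> : (fun s => h / k.+1%:R * s ^+ k.+1) = horner ((h / k.+1%:R) *: 'X^(k.+1)).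
      by apply/funext => w; rewrite hornerZ hornerXn.
    have dp := is_derive_poly ((h / k.+1%:R) *: 'X^(k.+1)) s; apply: is_derive_eq.
    by rewrite derivZ derivXn hornerZ hornerMn hornerXn/= -[s ^+ k *+ _]mulr_natr; field.
  rewrite (FTC2_derive (ltW x0) dF); last first.
    by move=> s; apply: cvgM; [exact: cvg_cst|exact: exprn_continuous].
  by rewrite expr0n/= mulr0 subr0 mulrAC.
have fub : \int[leb]_s \int[leb]_x F (s, x) = \int[leb]_x \int[leb]_s F (s, x).
  have iF : (leb \x leb)%E.-integrable setT (EFin \o F).
    have [_ H] := @integrable21ltyP _ _ _ _ R leb leb (EFin \o F) mF; apply: H.
    have ik := integrableZlr k.+1%:R^-1 measurableT (integrable_norm (expint_integrable_X k.+1 eg)).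
    move/integrableP: ik => [_]; congr (_ < _)%E.
    apply: eq_integral => x _; apply/esym; rewrite /= ger0_norm ?mulr_ge0 ?invr_ge0//.
    transitivity (\int[leb]_s (if 0 < s < x then `|g x| * s ^+ k else 0)%:E)%E.
      apply: eq_integral => s _; rewrite /F /=; congr EFin; case: ifPn; last by rewrite normr0.
      by move=> /andP[s0 _]; rewrite normrM (ger0_norm (exprn_ge0 _ (ltW s0))).
    rewrite -[LHS]fineK; last by apply: integrable_fin_num => //; exact: bint.
    rewrite -[fine _]/(Rintegral _ _ _) inner /=; congr EFin; have [x0|x0] := leP x 0.
      by rewrite g0// mul0r normr0 mulr0.
    by rewrite normrM (ger0_norm (exprn_ge0 _ (ltW x0))) mulrC.
  have E : (\int[leb]_s \int[leb]_x (F (s, x))%:E = \int[leb]_x \int[leb]_s (F (s, x))%:E)%E.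
    exact: (@Fubini _ _ _ _ R leb leb (EFin \o F) iF).
  have isx s : leb.-integrable setT (EFin \o (fun x => F (s, x))).
    have [s0|s0] := leP s 0.
      rewrite (_ : _ \o _ = cst 0%E); first exact: integrable0.
      by apply/funext => x; rewrite /F /= (le_gtF s0).
    apply: (integrable_dominated (T := mR R) (g := fun x => s ^+ k * `|g x|)); first exact: measurableT.
    - rewrite (_ : (fun x => F (s, x)) = fun x => if s < x then g x * s ^+ k else 0).
        by apply: measurable_fun_ifT; [exact: measurable_fun_ltr|exact: measurable_funM|exact: measurable_cst].
      by apply/funext => x; rewrite /F /= s0.
    - move=> x _; rewrite /F /= s0 /=; case: ltP => _.
        by rewrite normrM mulrC (ger0_norm (exprn_ge0 _ (ltW s0))).
      rewrite normr0; apply: mulr_ge0; [exact: exprn_ge0 (ltW s0)|exact: normr_ge0].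
    - have hh := integrable_norm i0.
      by apply: (@integrableZlr _ _ _ leb setT (s ^+ k) (fun x => `|g x|) measurableT); exact: hh.
  have a1 : (\int[leb]_s (\int[leb]_x F (s, x))%:E = \int[leb]_s \int[leb]_x (F (s, x))%:E)%E.
    by apply: eq_integral => s _; exact: (fineK (integrable_fin_num measurableT (isx s))).
  have a2 : (\int[leb]_x (\int[leb]_s F (s, x))%:E = \int[leb]_x \int[leb]_s (F (s, x))%:E)%E.
    by apply: eq_integral => x _; exact: (fineK (integrable_fin_num measurableT (bint x (g x)))).
  exact: (congr1 fine (etrans a1 (etrans E (esym a2)))).
have e1 : \int[leb]_s \int[leb]_x F (s, x) = - lmoment (prim g) k.
  rewrite /lmoment -mulN1r -RintegralZl; [|exact: measurableT|exact: expint_integrable_X (expint_prim eg z)].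
  apply: eq_Rintegral => s _; have [s0|s0] := leP s 0.
    have E0 : (fun x => F (s, x)) = cst 0 by apply/funext => x; rewrite /F /= (le_gtF s0).
    by rewrite (prim_le0 eg s0) mul0r mulr0 E0; exact: Rintegral_zero.
  have ii : leb.-integrable `]s, +oo[ (EFin \o g) by apply: integrableS i0.
  rewrite (prim_compl s i0 z).
  have -> : forall I : R, -1 * (- I * s ^+ k) = s ^+ k * I by move=> I; ring.
  rewrite -RintegralZl; [|exact: measurable_itv|exact: ii].
  rewrite [RHS]Rintegral_mkcond; apply: eq_Rintegral => x _; rewrite patchE /F /= s0/=.
  rewrite in_set_itv in_itv/= andbT; case: ltP => // _; exact: mulrC.
have e2 : \int[leb]_x \int[leb]_s F (s, x) = k.+1%:R^-1 * lmoment g k.+1.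
  rewrite /lmoment -RintegralZl; [|exact: measurableT|exact: expint_integrable_X].
  apply: eq_Rintegral => x _; rewrite /F /= inner.
  case: ifPn => [_|]; first by rewrite mulrC.
  by rewrite -leNgt => x0; rewrite g0// mul0r mulr0.
have k0 : k.+1%:R != 0 :> R by [].
apply: (mulfI (invr_neq0 k0)); rewrite mulKf// mulrN -e2 -fub e1 opprK.
by [].
Qed.

Definition nprim n g := iter n prim g.

(** Vanishing of the first [n] moments is what gives integral 0 to each of the functions to be
    integrated in turn. *)
Lemma nprim_moment n g k : expint g -> (forall j, (j < n)%N -> lmoment g j = 0) ->
  expint (nprim n g) /\
  (k + n)`!%:R * lmoment (nprim n g) k = (-1) ^+ n * k`!%:R * lmoment g (k + n).
Proof.
move=> eg; elim: n k => [|n IH] k h; first by rewrite addn0 expr0 mul1r.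
have hn j : (j < n)%N -> lmoment g j = 0 by move=> jn; apply: h; rewrite ltnW// ltnS.
have z : \int[leb]_x nprim n g x = 0.
  have [_] := IH 0%N hn; rewrite add0n h ?ltnSn// mulr0 => /eqP.
  rewrite mulf_eq0 pnatr_eq0 gtn_eqF ?fact_gt0//= => /eqP <-.
  by apply: eq_Rintegral => x _; rewrite expr0 mulr1.
have [en _] := IH 0%N hn; split; first exact: expint_prim.
have [_] := IH k.+1 hn; have := prim_moment k en z; rewrite -/(nprim n.+1 g) => E1.
rewrite addSnnS exprS => E2; apply: (mulfI (_ : k.+1%:R != 0 :> R)) => //.
rewrite mulrCA E1 mulrN E2 factS natrM; ring.
Qed.

End IteratedPrimitive.

(** * Measurability of derivatives *)

Section MeasurableDerivative.
Context {R : realType}.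
Variable G : R -> R.
Hypothesis cG : continuous G.
Local Notation T := (mR R).
Implicit Types (x h : R).

Definition dquot h x : R := h^-1 * (G (h + x) - G x).

(** Open by continuity of [G], so the set where the difference quotients are Cauchy is a countable
    combination of closed sets. The last derivative in [rodV] is identified only almost everywhere,
    whereas membership in [L^2] requires measurability. *)
Definition osc (k m : nat) : set R := [set x | exists h h' : R,
  [/\ h != 0, h' != 0, `|h| < m.+1%:R^-1, `|h'| < m.+1%:R^-1 &
      k.+1%:R^-1 < `|dquot h x - dquot h' x|]].

Lemma continuous_dquot h : continuous (dquot h).
Proof.
move=> x; apply: cvgM; first exact: cvg_cst.
apply: cvgB; last exact: cG.
apply: (@continuous_comp _ _ _ (fun x => h + x) G); last exact: cG.
by apply: cvgD; [exact: cvg_cst|exact: cvg_id].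
Qed.

Lemma open_osc k m : open (osc k m).
Proof.
have -> : osc k m = \bigcup_(z in [set z : R * R | [/\ z.1 != 0, z.2 != 0, `|z.1| < m.+1%:R^-1 & `|z.2| < m.+1%:R^-1]])
    [set x | k.+1%:R^-1 < `|dquot z.1 x - dquot z.2 x|].
  apply/seteqP; split => [x [h [h' [a b c d e]]]|x [[h h'] [a b c d] e]].
    by exists (h, h').
  by exists h, h'.
apply: bigcup_open => -[h h'] _ /=.
rewrite (_ : [set x | _] = (fun x => `|dquot h x - dquot h' x|) @^-1` [set y | k.+1%:R^-1 < y]) //.
apply: open_comp; last exact: open_gt.
move=> x _; apply: (@continuous_comp _ _ _ (fun x => dquot h x - dquot h' x) (fun y => `|y|)).
  by apply: cvgB; exact: continuous_dquot.
exact: norm_continuous.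
Qed.

Lemma not_osc_derivable x : (forall k, exists m, ~ osc k m x) <-> cvg (dquot h x @[h --> 0^']).
Proof.
split => [hk|].
  apply: cauchy_cvg; apply: cauchy_exP => e e0.
  have [k hk'] : exists k : nat, k.+1%:R^-1 < e.
    by have := near_infty_natSinv_lt (PosNum e0) => -[k _ /(_ k (leqnn k))/= h]; exists k.
  have [m hm] := hk k.
  have m0 : 0 < m.+1%:R^-1 :> R by rewrite invr_gt0.
  have h00 : 0 < m.+1%:R^-1 / 2 :> R by rewrite divr_gt0.
  exists (dquot (m.+1%:R^-1 / 2) x).
  suff : \forall h \near 0^', ball (dquot (m.+1%:R^-1 / 2) x) e (dquot h x) by [].
  near=> h.
  rewrite -ball_normE /=; apply: le_lt_trans hk'; rewrite leNgt; apply/negP => c; apply: hm.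
  exists (m.+1%:R^-1 / 2), h; split => //.
  - by near: h; exact: nbhs_dnbhs_neq.
  - by rewrite gtr0_norm// ltr_pdivrMr// ltr_pMr// ltr1n.
  - by near: h; exact: dnbhs0_lt.
move=> /cvg_ex[l hl] k.
have k0 : 0 < k.+1%:R^-1 / 2 :> R by rewrite divr_gt0// invr_gt0.
move/cvgrPdist_lt : hl => /(_ _ k0) [d /= d0 hd].
have := near_infty_natSinv_lt (PosNum d0) => -[m _ /(_ m (leqnn m))/= md].
exists m => -[h [h' [h0 h'0 hm h'm]]].
have a : `|l - dquot h x| < k.+1%:R^-1 / 2.
  by apply: hd => //; rewrite /ball_ /= sub0r normrN (lt_trans hm).
have b : `|l - dquot h' x| < k.+1%:R^-1 / 2.
  by apply: hd => //; rewrite /ball_ /= sub0r normrN (lt_trans h'm).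
apply/negP; rewrite -leNgt.
have -> : dquot h x - dquot h' x = (l - dquot h' x) - (l - dquot h x) by ring.
apply: le_trans (ler_normB _ _) _; rewrite [leRHS]splitr.
by apply: lerD; exact: ltW.
Unshelve. all: by end_near. Qed.

Definition dset : set T := [set x | cvg (dquot h x @[h --> 0^'])].

Lemma measurable_dset : measurable dset.
Proof.
have -> : dset = \bigcap_k \bigcup_m ~` (osc k m : set T).
  apply/seteqP; split => x.
    by move=> /not_osc_derivable h k _; have [m hm] := h k; exists m.
  move=> h; apply/not_osc_derivable => k; have [m _ hm] := h k I; by exists m.
apply: bigcapT_measurable => k; apply: bigcupT_measurable => m.
by apply: measurableC; apply: open_measurable; exact: open_osc.
Qed.

Lemma measurable_derive1 : measurable_fun [set: T] (derive1 G : T -> R).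
Proof.
(* [point] is the value that [derive1] takes where the limit does not exist. *)
pose f (n : nat) (x : T) : R := if x \in dset then dquot n.+1%:R^-1 x else point.
apply/measurable_EFinP; apply: (emeasurable_fun_cvg (fun n x => (f n x)%:E)) => [n|x _].
  apply/measurable_EFinP; apply: measurable_fun_ifT => //.
  - apply: (measurable_fun_bool true); rewrite setTI.
    rewrite (_ : _ @^-1` _ = dset); first exact: measurable_dset.
    by apply/seteqP; split => x /=; [move/set_mem|move/mem_set].
  - by apply: continuous_measurable_fun; exact: continuous_dquot.
apply: cvg_EFin; first exact: nearW.
rewrite (_ : fine \o _ = f ^~ x)//.
have [xD|xD] := boolP (x \in dset); last first.
  have -> : derive1 G x = point.
    by rewrite /derive1; apply: dvgP => h; move/negP: xD; apply; exact: mem_set.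
  by rewrite /f (negbTE xD); exact: cvg_cst.
have xD' : cvg (dquot h x @[h --> 0^']) := set_mem xD.
have hl : dquot h x @[h --> 0^'] --> derive1 G x by exact: xD'.
apply/cvgrPdist_lt => e e0; move/cvgrPdist_lt : hl => /(_ e e0) [d /= d0 hd].
have := near_infty_natSinv_lt (PosNum d0) => -[m _ md]; exists m => // n mn.
rewrite /f xD; apply: hd => //=.
by rewrite sub0r normrN ger0_norm ?invr_ge0//; exact: md.
Qed.

End MeasurableDerivative.

(** * The Rodrigues expression as Riesz representative *)

Section RodriguesDual.
Context {R : realType} (p : laguerre_exponent R) (P : R -> (R -> R) -> R -> R)
  (mu : probability (mR R) R) (nu : R -> R).
Hypothesis Hnu : invariant_density p P mu nu.
Local Notation leb := (@lebesgue_measure R).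
Local Notation l2 := (l2 mu).
Local Notation ip := (ip mu).
Implicit Types (f g v : R -> R) (x s : R).

(** Lebesgue density of [f mu], cut at 0, where the value of [nu] is unconstrained. *)
Definition dens f x : R := if 0 < x then f x * nu x else 0.

Lemma leb_neq (a : R) : {ae leb, forall x : mR R, x != a}.
Proof.
exists [set a]; split; [exact: measurable_set1|exact: lebesgue_measure_set1|].
by move=> x /= /negP; rewrite negbK => /eqP.
Qed.

Lemma measurable_dens f : measurable_fun [set: mR R] (f : mR R -> R) ->
  measurable_fun [set: mR R] (dens f : mR R -> R).
Proof.
move=> mf; apply: measurable_fun_ifT => //.
  by apply: measurable_fun_ltr.
by apply: measurable_funM => //; exact: nu_meas Hnu.
Qed.

Lemma dens_pos f : mu.-integrable setT (EFin \o f) ->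
  leb.-integrable setT (EFin \o dens f) /\ \int[mu]_x f x = \int[leb]_x dens f x.
Proof.
move=> jf; have [i1 ->] := integral_density Hnu jf.
have mf : measurable_fun [set: mR R] (f : mR R -> R).
  by have /measurable_int/measurable_EFinP := jf.
split.
  apply: (integrable_dominated (T := mR R) (g := fun x => `|f x * nu x|)) => //.
  - exact: measurable_dens.
  - by move=> x _; rewrite /dens; case: ifP => // _; rewrite normr0.
  - exact: integrable_norm i1.
rewrite /Rintegral; congr fine; apply: ae_eq_integral => //.
- by apply/measurable_EFinP; apply: measurable_funM => //; exact: nu_meas Hnu.
- by apply/measurable_EFinP; exact: measurable_dens.
apply: ae_mono (leb_neq 0) => x x0 _; rewrite /dens; congr EFin.
case: ltP => // xle; rewrite (nu_supp Hnu) ?mulr0//.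
by left; rewrite lt_neqAle x0.
Qed.

Lemma expint_dens f : l2 f -> expint (dens f).
Proof.
move=> lf; have [mf _] := lf; split; first exact: measurable_dens.
  by move=> x x0; rewrite /dens (le_gtF x0).
have [lam lam0 lE] := exp_moment Hnu; exists lam => //.
have [i1 _] := dens_pos (ip_integrable lf lE).
congr (leb.-integrable _ _) : i1; apply/funext => x /=; rewrite /dens.
case: ifP => [x0|]; last by rewrite mul0r.
by rewrite (gtr0_norm x0) mulrAC.
Qed.

Lemma lmoment_dens f k : l2 f -> lmoment (dens f) k = ip f (horner 'X^k).
Proof.
move=> lf; have [_ E1] := dens_pos (ip_integrable lf (l2_poly Hnu 'X^k)).
have E : ip f (horner 'X^k) = \int[mu]_x (f x * 'X^k.[x]) by [].
rewrite E E1; apply: eq_Rintegral => x _; rewrite /dens hornerXn.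
by case: ifP => _; rewrite ?mul0r// mulrAC.
Qed.

Lemma expintB f g : expint f -> expint g -> expint (fun x => f x - g x).
Proof.
move=> [mf f0 [l1 l10 i1]] [mg g0 [l2 l20 i2]]; split; first exact: measurable_funB.
  by move=> x x0; rewrite f0// g0// subrr.
have l0 : 0 < Num.min l1 l2 by rewrite lt_min l10.
exists (Num.min l1 l2) => //.
apply: (integrable_dominated (T := mR R)
  (g := fun x => `|f x * expR (l1 * x)| + `|g x * expR (l2 * x)|)) => //.
- by apply: measurable_funM; [exact: measurable_funB|exact: measurable_expRMl].
- move=> x _; rewrite !normrM !(ger0_norm (expR_ge0 _)).
  have [x0|x0] := leP x 0; first by rewrite f0// g0// subrr normr0 !mul0r addr0.
  apply: le_trans (ler_wpM2r (expR_ge0 _) (ler_normB _ _)) _; rewrite mulrDl; apply: lerD.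
    by apply: ler_wpM2l => //; rewrite ler_expR ler_pM2r// ge_min lexx.
  by apply: ler_wpM2l => //; rewrite ler_expR ler_pM2r// ge_min lexx orbT.
- by apply: integrableDr => //; exact: integrable_norm.
Qed.

Lemma continuous_ae0 f s : {ae leb, forall x, f x = 0} -> {for s, continuous f} -> f s = 0.
Proof.
move=> [N [mN N0 sN]] cf; apply/eqP; apply: contraT => fs.
have f0 : 0 < `|f s| by rewrite normr_gt0.
move/cvgrPdist_lt : cf => /(_ _ f0) [d /= d0 hd].
pose I0 : set (mR R) := `]s - d, s + d[%classic.
have sub : I0 `<=` N.
  move=> x; rewrite /I0 /= in_itv/= => /andP[x1 x2]; apply: sN => /= fx.
  have := hd x; rewrite /ball_ /= fx subr0 ltxx => /(_ _)/negP; apply => //.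
  by rewrite ltr_distl; apply/andP; split; lra.
have : (leb I0 <= 0)%E.
  by rewrite -[X in (_ <= X)%E]N0; apply: le_measure; rewrite ?inE//; exact: measurable_itv.
rewrite /I0.
rewrite lebesgue_measure_itv/= lte_fin ifT; last by lra.
by rewrite -EFinB lee_fin => h; exfalso; move: h d0; lra.
Qed.

Variables (n : nat) (v : R -> R).
Hypotheses (lv : l2 v)
  (hv : forall q, ip v (horner q) = (-1) ^+ n * mom (binw (W p) n) q).

Let h : R -> R := dens (fun x => n`!%:R * v x).
Let lh : l2 (fun x => n`!%:R * v x) := l2Z _ lv.

Lemma lmoment_h k : lmoment h k = n`!%:R * ((-1) ^+ n * ('C(k, n)%:R * W p k)).
Proof. by rewrite lmoment_dens// ipZl ?hv ?momXn//; exact: l2_poly Hnu _. Qed.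

Lemma nprim_expint k : (k <= n)%N -> expint (nprim k h).
Proof.
move=> kn; have eh : expint h by exact: expint_dens.
have z j : (j < k)%N -> lmoment h j = 0.
  by move=> jk; rewrite lmoment_h bin_small ?mul0r ?mulr0// (leq_trans jk).
by have [] := nprim_moment 0 eh z.
Qed.

(** [h] is [n! v nu]; its first [n] moments vanish by [hv], and its [n]-fold primitive has the
    moments of [x ^ n nu]. Both functions have an exponential moment, so determinacy identifies
    them. *)
Lemma nprim_h : expint (nprim n h) /\
  {ae leb, forall x, nprim n h x = dens (fun x => x ^+ n) x}.
Proof.
have z j : (j < n)%N -> lmoment h j = 0.
  by move=> jn; rewrite lmoment_h bin_small// mul0r !mulr0.
have eh : expint h by exact: expint_dens.
have en := nprim_expint (leqnn n); split => //.
have lX : l2 (fun x => x ^+ n) by exact: l2_Xn Hnu n.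
have eX := expint_dens lX.
have [mg g0 [lam lam0 ig]] := expintB en eX.
have m0 k : \int[leb]_x ((nprim n h x - dens (fun x => x ^+ n) x) * x ^+ k) = 0.
  have -> : \int[leb]_x ((nprim n h x - dens (fun x => x ^+ n) x) * x ^+ k) =
     lmoment (nprim n h) k - lmoment (dens (fun x => x ^+ n)) k.
    rewrite /lmoment -RintegralB//; try exact: expint_integrable_X.
    by apply: eq_Rintegral => x _; rewrite mulrBl.
  rewrite lmoment_dens//.
  have -> : ip (fun x => x ^+ n) (horner 'X^k) = W p (n + k).
    rewrite -momXn exprD -(ip_poly Hnu).
    by apply: eq_Rintegral => x _; rewrite !hornerXn.
  have [_] := nprim_moment k eh z; rewrite lmoment_h => E.
  have kn : (k + n)`!%:R != 0 :> R by rewrite pnatr_eq0 -lt0n fact_gt0.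
  apply/eqP; rewrite subr_eq0; apply/eqP; apply: (mulfI kn); rewrite E addnC.
  have := bin_fact (leq_addr k n); rewrite addnC addnK addnC => <-.
  rewrite !natrM.
  transitivity (((-1) ^+ n * (-1) ^+ n) * (k`!%:R * n`!%:R * 'C(n + k, n)%:R * W p (n + k))).
    by ring.
  by rewrite -exprMn mulrNN mulr1 expr1n; ring.
have := @ae0_of_moments R _ lam lam0 mg g0 ig m0.
by apply: ae_mono => x /eqP; rewrite subr_eq0 => /eqP.
Qed.

Let inr x := 0 < x /\ (x%:E < phi_infty p)%E.

Lemma inr_near x : inr x -> \forall y \near x, inr y.
Proof.
move=> [x0 xr]; case E : (phi_infty p) xr => [r| |]//; rewrite /inr E.
- rewrite lte_fin => xr; near=> y; split; first by near: y; exact: lt_nbhsr.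
  by rewrite lte_fin; near: y; exact: lt_nbhsl.
- by move=> _; near=> y; split; [near: y; exact: lt_nbhsr|exact: ltry].
Unshelve. all: by end_near. Qed.

(** For [0 < n] both sides are continuous on [(0, r)], so equality almost everywhere becomes
    equality everywhere there, as differentiation requires. *)
Lemma nprim_eq x : (0 < n)%N -> inr x -> x ^+ n * nu x = nprim n h x.
Proof.
move=> n0 [x0 xr]; have [en aen] := nprim_h.
have cn : {for x, continuous (nprim n h)}.
  rewrite -(prednK n0); apply: prim_continuous; apply: nprim_expint.
  exact: leq_pred.
have cF : {for x, continuous (fun x => x ^+ n * nu x)}.
  by apply: cvgM; [exact: exprn_continuous|exact: nu_cont Hnu _ x0 xr].
have dE y : 0 < y -> dens (fun x => x ^+ n) y = y ^+ n * nu y by rewrite /dens => ->.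
have cd : {for x, continuous (dens (fun x => x ^+ n))}.
  rewrite /prop_for /continuous_at dE//; apply: cvg_trans cF; apply: near_eq_cvg.
  by near=> y; rewrite dE//; near: y; exact: lt_nbhsr.
apply/esym/eqP; rewrite -subr_eq0 -dE//; apply/eqP.
apply: (@continuous_ae0 (fun y => nprim n h y - dens (fun x => x ^+ n) y)).
  by apply: ae_mono aen => y ->; rewrite subrr.
by apply: cvgB.
Unshelve. all: by end_near. Qed.

Let F : R -> R := fun y => y ^+ n * nu y.

Lemma derive1n_prim k x : (k < n)%N -> inr x -> derive1n k F x = nprim (n - k) h x.
Proof.
elim: k x => [|k IH] x kn ix; first by rewrite subn0; exact: nprim_eq.
rewrite derive1nS derive1E (@near_eq_derive _ _ _ (derive1n k F) (nprim (n - k) h))//; last first.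
  by apply: filterS (inr_near ix) => y; apply: IH; exact: ltnW.
rewrite -derive1E -(subnSK (ltnW kn)).
have e1 : expint (nprim (n - k.+1) h) by apply: nprim_expint; exact: leq_subr.
have cx : {for x, continuous (nprim (n - k.+1) h)}.
  rewrite -(prednK (_ : 0 < n - k.+1)%N) ?subn_gt0//; apply: prim_continuous; apply: nprim_expint.
  by rewrite (leq_trans (leq_pred _))// leq_subr.
have xx : x < x + 1 by rewrite ltrDl.
have iu : leb.-integrable `]-oo, x + 1] (EFin \o nprim (n - k.+1) h).
  by apply: integrableS (expint_integrable e1).
by have [] := @continuous_FTC1 R (nprim (n - k.+1) h) -oo%O x (x + 1) xx iu (ltNyr _) cx.
Qed.

(** Derivatives of order below [n] are computed everywhere on [(0, r)], the primitives being
    continuous; the last one is Lebesgue differentiation of the integrable [h]. *)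
Lemma derive1n_ae : {ae leb, forall x, inr x -> derive1n n F x = h x}.
Proof.
have [n0|n0] := posnP n.
  have D0 m (G : R -> R) : m = 0%N -> derive1n m G = G by move=> ->.
  have P0 m (G : R -> R) : m = 0%N -> nprim m G = G by move=> ->.
  have [_] := nprim_h; rewrite (P0 n)//; apply: ae_mono => x -> [x0 _].
  by rewrite (D0 n)// /dens x0.
have eh := nprim_expint (leq0n n); have ih := expint_integrable eh.
have lh' : locally_integrable [set: R] h by apply: open_integrable_locally => //; exact: openT.
have iy (y : R) : leb.-integrable `]-oo, y] (EFin \o h) by apply: integrableS ih.
apply: ae_mono (FTC1Ny iy lh') => x [_ dx] ix.
have D1 m (G : R -> R) : (0 < m)%N -> derive1n m G = derive1 (derive1n m.-1 G).
  by case: m => // m _; rewrite derive1nS.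
rewrite (D1 n)// derive1E (@near_eq_derive _ _ _ (derive1n n.-1 F) (prim h)) -?derive1E//.
apply: filterS (inr_near ix) => y iny; rewrite derive1n_prim ?prednK//.
by rewrite (_ : n - n.-1 = 1)%N//; case: (n) n0 => // m _; rewrite subSnn.
Qed.

Lemma rodV_ae : {ae mu, forall x, rodV nu n x = v x}.
Proof.
apply: (ae_transfer Hnu).
have nr : {ae leb, forall x : mR R, x%:E != phi_infty p}.
  case: (phi_infty p) => [r| |].
  - by apply: ae_mono (leb_neq r) => x; rewrite eqe.
  - exact: aeW.
  - exact: aeW.
have n2 : {ae leb, forall x : mR R, x != 0 /\ x%:E != phi_infty p}.
  by apply: ae_mono2 (leb_neq 0) nr => x.
apply: ae_mono2 derive1n_ae n2 => x dx [x0 xr] nux.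
have ix : inr x.
  split; first by rewrite lt_neqAle eq_sym x0/= leNgt; apply/negP => xlt; move/eqP: nux; apply; apply: (nu_supp Hnu); left.
  rewrite lt_neqAle xr/= leNgt; apply/negP => xlt; move/eqP: nux; apply; apply: (nu_supp Hnu); by right.
rewrite /rodV -/F (dx ix) /h /dens ix.1; field.
by rewrite nux pnatr_eq0 -lt0n fact_gt0.
Qed.

Lemma measurable_finv (f : R -> R) : measurable_fun [set: mR R] (f : mR R -> R) ->
  measurable_fun [set: mR R] (fun x : mR R => (f x)^-1).
Proof.
move=> mf.
have mi : measurable_fun [set: mR R] (fun x : mR R => x^-1 : R).
  rewrite (_ : (fun x => _) = fun x : R => if 0 < x then x `^ (-1) else if x < 0 then - ((- x) `^ (-1)) else 0).
    apply: measurable_fun_ifT; [exact: measurable_fun_ltr|exact: measurable_powR|].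
    apply: measurable_fun_ifT; [exact: measurable_fun_ltr| |exact: measurable_cst].
    apply: measurableT_comp => //.
    exact: (measurableT_comp (measurable_powR (-1))).
  apply/funext => x; case: (ltgtP 0 x) => [x0|x0|<-]; last by rewrite invr0.
    by rewrite powR_inv1// ltW.
  by rewrite powR_inv1 ?invrN ?opprK// oppr_ge0 ltW.
exact: (measurableT_comp mi mf).
Qed.

Lemma measurable_off2 (f g : R -> R) (a : R) (b : \bar R) :
  measurable_fun [set: mR R] (g : mR R -> R) ->
  (forall x, x != a -> x%:E != b -> f x = g x) ->
  measurable_fun [set: mR R] (f : mR R -> R).
Proof.
move=> mg fg.
have -> : f = fun x => if x == a then f a else if x%:E == b then f (fine b) else g x.
  apply/funext => x; have [->//|xa] := eqVneq x a.
  by have [<-//|xb] := eqVneq x%:E b; exact: fg.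
apply: measurable_fun_ifT => //; first exact: measurable_fun_eqr.
apply: measurable_fun_ifT => //.
case: b fg => [r| |] _.
- by rewrite (_ : (fun x => _) = fun x => x == r)//; exact: measurable_fun_eqr.
- exact: measurable_cst.
- exact: measurable_cst.
Qed.

(** Where [nu] vanishes so does [rodV], by the convention on division by 0. Elsewhere, for [0 < n],
    [rodV] is computed from the derivative of the continuous [prim h]. Only 0 and [r] escape, hence
    [measurable_off2]. *)
Lemma measurable_rodV : measurable_fun [set: mR R] (rodV nu n : mR R -> R).
Proof.
have md (G : R -> R) : measurable_fun [set: mR R] (G : mR R -> R) ->
    measurable_fun [set: mR R] (fun x : mR R => G x / (n`!%:R * nu x)).
  move=> mG; apply: measurable_funM => //; apply: measurable_finv.
  by apply: measurable_funM => //; exact: nu_meas Hnu.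
have [n0|n0] := posnP n.
  have D0 m (G : R -> R) : m = 0%N -> derive1n m G = G by move=> ->.
  rewrite /rodV -/F (D0 n F n0); apply: md; apply: measurable_funM; first exact: measurable_exprX.
  exact: nu_meas Hnu.
have eh := nprim_expint (leq0n n).
have mp := md _ (measurable_derive1 (fun s => prim_continuous (s := s) eh)).
apply: (measurable_off2 (a := 0) (b := phi_infty p) mp) => x x0 xr.
have [nux|nux] := eqVneq (nu x) 0; first by rewrite /rodV nux mulr0 invr0 !mulr0.
have ix : inr x.
  split; first by rewrite lt_neqAle eq_sym x0/= leNgt; apply/negP => xlt; move/eqP: nux; apply; apply: (nu_supp Hnu); left.
  rewrite lt_neqAle xr/= leNgt; apply/negP => xlt; move/eqP: nux; apply; apply: (nu_supp Hnu); by right.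
rewrite /rodV -/F; congr (_ / _).
have D1 m (G : R -> R) : (0 < m)%N -> derive1n m G = derive1 (derive1n m.-1 G).
  by case: m => // m _; rewrite derive1nS.
rewrite (D1 n)// derive1E (@near_eq_derive _ _ _ (derive1n n.-1 F) (prim h)) -?derive1E//.
apply: filterS (inr_near ix) => y iny; rewrite derive1n_prim ?prednK//.
by rewrite (_ : n - n.-1 = 1)%N//; case: (n) n0 => // m _; rewrite subSnn.
Qed.

Lemma l2_rodV : l2 (rodV nu n).
Proof.
have [mv iv] := lv; split; first exact: measurable_rodV.
have mr := measurable_rodV.
apply/integrableP; split; first by apply/measurable_EFinP; exact: measurable_funX.
have /integrableP[_] := iv; congr (_ < _)%E; apply: ae_eq_integral => //.
- by apply: measurableT_comp => //; apply/measurable_EFinP; exact: measurable_funX.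
- by apply: measurableT_comp => //; apply/measurable_EFinP; exact: measurable_funX.
by apply: ae_mono rodV_ae => x /= -> _.
Qed.

End RodriguesDual.

(** * Complex [L^2(mu)] from real and imaginary parts *)

Section ComplexL2.
Context {R : realType} (mu : probability (mR R) R).
Local Notation l2 := (l2 mu).
Local Notation ip := (ip mu).
Local Notation nrm := (nrm mu).
Local Notation cplx := (complex R).
Implicit Types (f g h : R -> cplx) (u v w : nat -> R -> cplx) (z : cplx).

Definition re f : R -> R := fun x => complex.Re (f x).
Definition im f : R -> R := fun x => complex.Im (f x).

Lemma L2P f : L2 mu f <-> l2 (re f) /\ l2 (im f).
Proof. by split => -[a b]; split; apply/l2P. Qed.

Lemma L2_ofR (f : R -> R) : l2 f -> L2 mu (ofR f).
Proof. by move=> lf; apply/L2P; split => //; exact: l2_cst mu 0. Qed.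

Lemma re_lin z f g : re (fun x => z * f x + g x) =
  fun x => (complex.Re z * re f x - complex.Im z * im f x) + re g x.
Proof. by apply/funext => x; rewrite /re /im; case: z (f x) (g x) => [a b] [c d] [e k]. Qed.

Lemma im_lin z f g : im (fun x => z * f x + g x) =
  fun x => (complex.Re z * im f x + complex.Im z * re f x) + im g x.
Proof. by apply/funext => x; rewrite /re /im; case: z (f x) (g x) => [a b] [c d] [e k]. Qed.

Lemma L2_lin z f g : L2 mu f -> L2 mu g -> L2 mu (fun x => z * f x + g x).
Proof.
move=> /L2P[a b] /L2P[c d]; apply/L2P; rewrite re_lin im_lin; split.
  by apply: l2D => //; apply: l2B; exact: l2Z.
by apply: l2D => //; apply: l2D; exact: l2Z.
Qed.

Lemma L2_0 : L2 mu (fun=> 0).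
Proof. by apply/L2P; split; exact: l2_cst mu 0. Qed.

Lemma L2Z z f : L2 mu f -> L2 mu (fun x => z * f x).
Proof.
by move=> lf; have := L2_lin z lf L2_0; congr (L2 mu _); apply/funext => x; rewrite addr0.
Qed.

Lemma L2B f g : L2 mu f -> L2 mu g -> L2 mu (fun x => f x - g x).
Proof.
by move=> lf lg; have := L2_lin (-1) lg lf; congr (L2 mu _); apply/funext => x; rewrite mulN1r addrC.
Qed.

Lemma L2_lincomb n c u : (forall k, L2 mu (u k)) -> L2 mu (lincomb n c u).
Proof.
move=> lu; elim: n => [|n IH].
  by rewrite (_ : lincomb _ _ _ = fun=> 0); [exact: L2_0|apply/funext => x; rewrite /lincomb big_ord0].
rewrite (_ : lincomb _ _ _ = fun x => c n * u n x + lincomb n c u x); first exact: L2_lin.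
by apply/funext => x; rewrite /lincomb big_ord_recr/= addrC.
Qed.

Lemma innerE f g : L2 mu f -> L2 mu g -> inner mu f g =
  Complex (ip (re f) (re g) + ip (im f) (im g)) (ip (im f) (re g) - ip (re f) (im g)).
Proof.
move=> /L2P[a b] /L2P[c d]; rewrite /inner; congr Complex.
  rewrite -RintegralD//; try exact: ip_integrable.
  by apply: eq_Rintegral => x _; rewrite /re /im; case: (f x) (g x) => [p q] [r s] /=; ring.
rewrite -RintegralB//; try exact: ip_integrable.
by apply: eq_Rintegral => x _; rewrite /re /im; case: (f x) (g x) => [p q] [r s] /=; ring.
Qed.

Lemma ip0r (h : R -> R) : ip h (fun=> 0) = 0.
Proof. by rewrite /Submission.ip (@eq_Rintegral _ _ _ mu _ (cst 0)) ?Rintegral_cst ?mul0r// => x _; rewrite mulr0. Qed.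

Lemma inner_ofRr f (g : R -> R) : L2 mu f -> l2 g ->
  inner mu f (ofR g) = Complex (ip (re f) g) (ip (im f) g).
Proof.
move=> lf lg; rewrite innerE//; last exact: L2_ofR.
by rewrite !ip0r addr0 subr0.
Qed.

Lemma inner_ofR (f g : R -> R) : l2 f -> l2 g -> inner mu (ofR f) (ofR g) = Complex (ip f g) 0.
Proof.
move=> lf lg; rewrite inner_ofRr//; last exact: L2_ofR.
by congr Complex; rewrite ipC ip0r.
Qed.

Lemma inner_conj f g : L2 mu f -> L2 mu g -> inner mu g f = conjc (inner mu f g).
Proof.
move=> lf lg; rewrite (innerE lf lg) (innerE lg lf) /conjc.
rewrite (ipC mu (re g) (re f)) (ipC mu (im g) (im f)) (ipC mu (re g) (im f)) (ipC mu (im g) (re f)).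
by rewrite opprB.
Qed.

Lemma inner_lin z f g h : L2 mu f -> L2 mu g -> L2 mu h ->
  inner mu (fun x => z * f x + g x) h = z * inner mu f h + inner mu g h.
Proof.
move=> lf lg lh; have lk := L2_lin z lf lg; rewrite !innerE// re_lin im_lin.
move/L2P: lf => [a b]; move/L2P: lg => [c d]; move/L2P: lh => [e k].
have A (p q r s : R) (f1 f2 f3 k1 : R -> R) : l2 f1 -> l2 f2 -> l2 f3 -> l2 k1 ->
    ip (fun x => (p * f1 x + q * f2 x) + f3 x) k1 = p * ip f1 k1 + q * ip f2 k1 + ip f3 k1.
  move=> l1 l2' l3 lk1; have l12 : l2 (fun x => p * f1 x + q * f2 x) by apply: l2D; exact: l2Z.
  have E3 := ip_linl 1 l12 l3 lk1; rewrite mul1r in E3.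
  have E2 := ip_linl q (l2Z p l1) l2' lk1; rewrite ipZl// in E2.
  rewrite -E2 -E3; congr Submission.ip; apply/funext => x; by rewrite mul1r.
case: z {lk} => [p q] /=.
have B (f1 f2 f3 k1 : R -> R) : l2 f1 -> l2 f2 -> l2 f3 -> l2 k1 ->
    ip (fun x => (p * f1 x - q * f2 x) + f3 x) k1 = p * ip f1 k1 - q * ip f2 k1 + ip f3 k1.
  move=> l1 l2' l3 lk1; rewrite -mulNr -(A p (- q) 0 0)//.
  by apply: eq_Rintegral => x _; rewrite mulNr.
rewrite !(B, A p q 0 0)//; apply/eqP; rewrite eq_complex/=; apply/andP; split; apply/eqP; ring.
Qed.

Lemma L2norm_sqr f : L2 mu f -> L2norm mu f ^+ 2 = nrm (re f) ^+ 2 + nrm (im f) ^+ 2.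
Proof.
move=> /L2P[a b]; rewrite /L2norm sqr_sqrtr; last first.
  by apply: Rintegral_ge0 => x _; rewrite addr_ge0 ?sqr_ge0.
rewrite !nrm_sqr /sqabs (RintegralD measurableT a.2 b.2).
by congr (_ + _); apply: eq_Rintegral => x _; rewrite expr2.
Qed.

Lemma L2norm_ge0 f : 0 <= L2norm mu f. Proof. exact: sqrtr_ge0. Qed.

Lemma L2norm_le f : L2 mu f -> L2norm mu f <= nrm (re f) + nrm (im f).
Proof.
move=> lf; rewrite -ler_sqr ?nnegrE ?addr_ge0 ?nrm_ge0 ?L2norm_ge0// L2norm_sqr// sqrrD.
by rewrite lerD2r lerDl mulrn_wge0// mulr_ge0 ?nrm_ge0.
Qed.

Lemma L2norm_ofR (f : R -> R) : l2 f -> L2norm mu (ofR f) = nrm f.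
Proof.
move=> lf; apply/eqP; rewrite -(@eqrXn2 _ 2%N) ?L2norm_ge0 ?nrm_ge0//.
rewrite L2norm_sqr; last exact: L2_ofR.
by rewrite (nrm_eq0 mu (f := im _))// expr0n/= addr0.
Qed.

Lemma aeqP f g : aeq mu f g <-> re f = re g %[ae mu] /\ im f = im g %[ae mu].
Proof.
split => [h|[h1 h2]].
  by split; apply: ae_mono h => x h0 _; rewrite /re /im (h0 I).
apply: ae_mono2 h1 h2 => x h1 h2 _.
by have := h1 I; have := h2 I; rewrite /re /im; case: (f x) (g x) => [a b] [c d] /= -> ->.
Qed.

Lemma aeq_inner f g h : L2 mu f -> L2 mu g -> L2 mu h -> aeq mu f g -> inner mu f h = inner mu g h.
Proof.
move=> lf lg lh /aeqP[e1 e2]; rewrite !innerE//.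
move/L2P: lf => [a b]; move/L2P: lg => [c d]; move/L2P: lh => [e k].
by rewrite (eq_ae_ip a c e e1) (eq_ae_ip b d k e2) (eq_ae_ip b d e e2) (eq_ae_ip a c k e1).
Qed.

Lemma aeq_norm f g : L2 mu f -> L2 mu g -> aeq mu f g -> L2norm mu f = L2norm mu g.
Proof.
move=> lf lg /aeqP[e1 e2]; apply/eqP; rewrite -(@eqrXn2 _ 2%N) ?L2norm_ge0// (L2norm_sqr lf) (L2norm_sqr lg).
move/L2P: lf => [a b]; move/L2P: lg => [c d].
by rewrite (eq_ae_nrm a c e1) (eq_ae_nrm b d e2).
Qed.

Lemma aeq_sub0 f g : aeq mu (fun x => f x - g x) (fun=> 0) -> aeq mu f g.
Proof. by apply: ae_mono => x h _; apply/eqP; rewrite -subr_eq0 (h I). Qed.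

Lemma L2norm0_aeq f : L2 mu f -> L2norm mu f = 0 -> aeq mu f (fun=> 0).
Proof.
move=> lf h; have := L2norm_sqr lf; rewrite h expr0n/= => /esym/eqP.
rewrite paddr_eq0 ?sqr_ge0// !sqrf_eq0 => /andP[/eqP a /eqP b].
by move/L2P: lf => [c d]; apply/aeqP; split; exact: ae_nrm0.
Qed.

Lemma L2norm_tri f g : L2 mu f -> L2 mu g ->
  L2norm mu (fun x => f x + g x) <= L2norm mu f + L2norm mu g.
Proof.
move=> lf lg; have lk : L2 mu (fun x => f x + g x).
  by have := L2_lin 1 lf lg; congr (L2 mu _); apply/funext => x; rewrite mul1r.
rewrite -ler_sqr ?nnegrE ?addr_ge0 ?L2norm_ge0// sqrrD (L2norm_sqr lk) (L2norm_sqr lf) (L2norm_sqr lg).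
move/L2P: (lf) => [a b]; move/L2P: (lg) => [c d].
have e1 : re (fun x => f x + g x) = fun x => re f x + re g x.
  by apply/funext => x; rewrite /re; case: (f x) (g x) => [? ?] [].
have e2 : im (fun x => f x + g x) = fun x => im f x + im g x.
  by apply/funext => x; rewrite /im; case: (f x) (g x) => [? ?] [].
rewrite e1 e2.
have n1 := nrmD a c; have n2 := nrmD b d.
have s1 : nrm (fun x => re f x + re g x) ^+ 2 <= (nrm (re f) + nrm (re g)) ^+ 2.
  by rewrite ler_sqr ?nnegrE ?addr_ge0 ?nrm_ge0.
have s2 : nrm (fun x => im f x + im g x) ^+ 2 <= (nrm (im f) + nrm (im g)) ^+ 2.
  by rewrite ler_sqr ?nnegrE ?addr_ge0 ?nrm_ge0.
have p : nrm (re f) * nrm (re g) + nrm (im f) * nrm (im g) <= L2norm mu f * L2norm mu g.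
  rewrite -ler_sqr ?nnegrE ?addr_ge0 ?mulr_ge0 ?nrm_ge0 ?L2norm_ge0//.
  rewrite exprMn (L2norm_sqr lf) (L2norm_sqr lg).
  move: (nrm _) (nrm _) (nrm _) (nrm _) => x y z t.
  by have := sqr_ge0 (x * t - y * z); nra.
move: s1 s2 p; rewrite !sqrrD ![_ *+ 2]mulr2n; lra.
Qed.

(** Orthogonality to [g] gives [||f - g|| >= ||f||], which contradicts density at distance
    [||f||]. *)
Lemma dense_orth (S : set (R -> cplx)) f : dense_in_L2 mu S -> L2 mu f ->
  (forall g, S g -> L2 mu g) -> (forall g, S g -> inner mu f g = 0) -> aeq mu f (fun=> 0).
Proof.
move=> dS lf lS orth; apply: L2norm0_aeq => //.
apply/eqP; apply: contraT => f0.
have n0 : 0 < L2norm mu f by rewrite lt_neqAle eq_sym f0 L2norm_ge0.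
have [g Sg hg] := dS f lf _ n0; have lg := lS g Sg.
have lk := L2B lf lg.
have := hg; rewrite ltNge => /negP; case.
rewrite -ler_sqr ?nnegrE ?L2norm_ge0// (L2norm_sqr lf) (L2norm_sqr lk).
have := orth g Sg; rewrite (innerE lf lg) => -[E _].
move/L2P: lf => [a b]; move/L2P: lg => [c d].
have -> : re (fun x => f x - g x) = fun x => re f x - re g x.
  by apply/funext => x; rewrite /re; case: (f x) (g x) => [? ?] [].
have -> : im (fun x => f x - g x) = fun x => im f x - im g x.
  by apply/funext => x; rewrite /im; case: (f x) (g x) => [? ?] [].
have K (f1 g1 : R -> R) : l2 f1 -> l2 g1 ->
    nrm (fun x => f1 x - g1 x) ^+ 2 = nrm f1 ^+ 2 - 2 * ip f1 g1 + nrm g1 ^+ 2.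
  move=> l1 l2'; rewrite !nrm_sqr ipBl//; last exact: l2B.
  rewrite (ipC mu f1 (fun x => f1 x - g1 x)) (ipC mu g1 (fun x => f1 x - g1 x)).
  by rewrite (ipBl l1 l2' l1) (ipBl l1 l2' l2') (ipC mu g1 f1); ring.
rewrite !K//; have := sqr_ge0 (nrm (re g)); have := sqr_ge0 (nrm (im g)).
move: E; lra.
Qed.

Lemma lspan_L2 u : (forall n, L2 mu (u n)) -> forall g, lspan u g -> L2 mu g.
Proof. by move=> lu g [n [c ->]]; exact: L2_lincomb. Qed.

Lemma inner0 h : L2 mu h -> inner mu (fun=> 0) h = 0.
Proof.
move=> lh; have := inner_lin (-1) lh lh lh.
have -> : (fun x => -1 * h x + h x) = fun=> 0 by apply/funext => x; rewrite mulN1r addNr.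
by move=> ->; rewrite mulN1r addNr.
Qed.

Lemma inner_lincomb n c u h : (forall k, L2 mu (u k)) -> L2 mu h ->
  inner mu (lincomb n c u) h = \sum_(k < n) c k * inner mu (u k) h.
Proof.
move=> lu lh; elim: n => [|n IH].
  rewrite big_ord0 (_ : lincomb _ _ _ = fun=> 0); first exact: inner0.
  by apply/funext => x; rewrite /lincomb big_ord0.
rewrite (_ : lincomb _ _ _ = fun x => c n * u n x + lincomb n c u x); last first.
  by apply/funext => x; rewrite /lincomb big_ord_recr/= addrC.
rewrite inner_lin//; last exact: L2_lincomb.
by rewrite IH big_ord_recr/= addrC.
Qed.

Lemma dense_orth_seq u f : dense_in_L2 mu (lspan u) -> (forall n, L2 mu (u n)) -> L2 mu f ->
  (forall n, inner mu f (u n) = 0) -> aeq mu f (fun=> 0).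
Proof.
move=> du lu lf orth; apply: (dense_orth du lf); first exact: lspan_L2.
move=> g [n [c ->]]; rewrite inner_conj//; last exact: L2_lincomb.
rewrite inner_lincomb// big1 ?conjc0// => k _.
by rewrite inner_conj// orth conjc0 mulr0.
Qed.

Lemma dense_real (u : nat -> R -> R) : (forall n, l2 (u n)) ->
  (forall f : R -> R, l2 f -> forall d, 0 < d -> exists N (a : nat -> R),
     nrm (fun x => f x - \sum_(k < N) a k * u k x) <= d) ->
  dense_in_L2 mu (lspan (fun n => ofR (u n))).
Proof.
move=> lu hd f lf e e0; move/L2P: (lf) => [a b].
have d0 : 0 < e / 3 by rewrite divr_gt0.
have [N1 [a1 h1]] := hd _ a _ d0; have [N2 [a2 h2]] := hd _ b _ d0.
(* Padding with zeros brings the combinations for the real and imaginary parts to a common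
   length. *)
pose trunc N (c : nat -> R) k : R := if (k < N)%N then c k else 0.
pose N := maxn N1 N2.
have tE M c x : (M <= N)%N -> \sum_(k < N) trunc M c k * u k x = \sum_(k < M) c k * u k x.
  move=> MN; rewrite (sum_ord_widen (n := M) (F := fun k => trunc M c k * u k x))//.
    by apply: eq_bigr => k _; rewrite /trunc ltn_ord.
  by move=> i iM; rewrite /trunc ltnNge iM mul0r.
pose c k := Complex (trunc N1 a1 k) (trunc N2 a2 k).
pose g := lincomb N c (fun n => ofR (u n)).
have lg : L2 mu g by apply: L2_lincomb => k; exact: L2_ofR.
exists g; first by exists N, c.
have rg x : g x = Complex (\sum_(k < N1) a1 k * u k x) (\sum_(k < N2) a2 k * u k x).
  rewrite -(tE _ a1 x (leq_maxl N1 N2)) -(tE _ a2 x (leq_maxr N1 N2)) /g /lincomb.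
  elim: N {tE lg g} => [|n IH]; first by rewrite !big_ord0.
  rewrite !big_ord_recr/= IH /c /ofR; apply/eqP; rewrite eq_complex/=.
  by rewrite !mulr0 subr0 add0r !eqxx.
have lk := L2B lf lg.
apply: le_lt_trans (L2norm_le lk) _.
have -> : re (fun x => f x - g x) = fun x => re f x - \sum_(k < N1) a1 k * u k x.
  by apply/funext => x; rewrite /re rg; case: (f x).
have -> : im (fun x => f x - g x) = fun x => im f x - \sum_(k < N2) a2 k * u k x.
  by apply/funext => x; rewrite /im rg; case: (f x).
by move: h1 h2; lra.
Qed.

End ComplexL2.

(** * Operators diagonal along a complete family of functionals *)

Section DiagonalOperators.
Context {R : realType} (mu : probability (mR R) R).
Local Notation cplx := (complex R).
Variables (A : (R -> cplx) -> R -> cplx) (w : nat -> R -> cplx) (z : nat -> R).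
Hypotheses (bA : bounded_op mu A) (lw : forall n, L2 mu (w n))
  (HE : forall f n, L2 mu f -> inner mu (A f) (w n) = Complex (z n) 0 * inner mu f (w n))
  (HC : forall f, L2 mu f -> (forall n, inner mu f (w n) = 0) -> aeq mu f (fun=> 0)).
Implicit Types (f g u : R -> cplx) (l : cplx).

Let LA f : L2 mu f -> L2 mu (A f). Proof. by have [h _ _] := bA; exact: h. Qed.

Lemma L2_sub_scalar l f : L2 mu f -> L2 mu (sub_scalar A l f).
Proof. by move=> lf; apply: L2B; [exact: LA|exact: L2Z]. Qed.

Lemma inner_sub_scalar l f n : L2 mu f ->
  inner mu (sub_scalar A l f) (w n) = (Complex (z n) 0 - l) * inner mu f (w n).
Proof.
move=> lf; have -> : sub_scalar A l f = fun x => (- l) * f x + A f x.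
  by apply/funext => x; rewrite /sub_scalar mulNr addrC.
by rewrite inner_lin ?HE//; [ring|exact: LA].
Qed.

Lemma iter_sub_scalar l k f n : L2 mu f -> L2 mu (iter k (sub_scalar A l) f) /\
  inner mu (iter k (sub_scalar A l) f) (w n) = (Complex (z n) 0 - l) ^+ k * inner mu f (w n).
Proof.
move=> lf; elim: k => [|k [IH1 IH2]]; first by rewrite expr0 mul1r.
split; first exact: L2_sub_scalar.
by rewrite iterS inner_sub_scalar// IH2 exprS mulrA.
Qed.

Lemma inner0l n : inner mu (fun=> 0) (w n) = 0.
Proof. exact: inner0 (lw n). Qed.

Lemma aeq0_inner f n : L2 mu f -> aeq mu f (fun=> 0) -> inner mu f (w n) = 0.
Proof. by move=> lf f0; rewrite (aeq_inner lf (L2_0 mu) (lw n) f0) inner0l. Qed.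

Lemma inner_neq0 f : L2 mu f -> ~ aeq mu f (fun=> 0) -> exists n, inner mu f (w n) != 0.
Proof.
move=> lf f0; apply: contrapT => h; apply: f0; apply: HC => // n.
by apply/eqP; apply: contrapT => /negP hn; apply: h; exists n.
Qed.

(** An eigenvector pairs nontrivially with some [w n], which fixes the eigenvalue. *)
Lemma point_spectrum_sub l : point_spectrum mu A l -> exists n, l = Complex (z n) 0.
Proof.
move=> [f [lf kf] f0]; have [n hn] := inner_neq0 lf f0; exists n.
have := aeq0_inner n (L2_sub_scalar l lf) kf; rewrite inner_sub_scalar// => /eqP.
by rewrite mulf_eq0 (negbTE hn) orbF subr_eq0 => /eqP ->.
Qed.

Section Eigenvector.
Variables (n : nat) (u : R -> cplx).
Hypotheses (lu : L2 mu u) (hu : forall m, inner mu u (w m) = (n == m)%:R).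

Lemma sub_scalar_eig : aeq mu (sub_scalar A (Complex (z n) 0) u) (fun=> 0).
Proof.
apply: HC => [|m]; first exact: L2_sub_scalar.
rewrite inner_sub_scalar// hu; case: eqVneq => [->|_]; first by rewrite subrr mul0r.
by rewrite mulr0.
Qed.

Lemma eig_neq0 : ~ aeq mu u (fun=> 0).
Proof. by move=> /(aeq0_inner n lu)/eqP; rewrite hu eqxx oner_eq0. Qed.

Lemma point_spectrum_eig : point_spectrum mu A (Complex (z n) 0).
Proof. by exists u; [split => //; exact: sub_scalar_eig|exact: eig_neq0]. Qed.

Hypothesis zinj : injective z.

Lemma eig_multiple f : L2 mu f -> (forall m, m != n -> inner mu f (w m) = 0) ->
  aeq mu f (fun x => inner mu f (w n) * u x).
Proof.
move=> lf h; apply: aeq_sub0; apply: HC => [|m]; first by apply: L2B => //; exact: L2Z.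
rewrite (_ : (fun x => _) = fun x => (- inner mu f (w n)) * u x + f x); last first.
  by apply/funext => x; rewrite mulNr addrC.
rewrite inner_lin// hu; case: eqVneq => [<-|mn]; first by rewrite mulr1 addNr.
by rewrite mulr0 add0r h// eq_sym.
Qed.

(** For [m] different from [n] the pairing with [w m] is multiplied by the nonzero number
    [(z m - z n) ^ k]. Generalized eigenvectors thus pair only with [w n], which excludes a
    nilpotent part. *)
Lemma iter_kernel k f : Ker mu (iter k (sub_scalar A (Complex (z n) 0))) f ->
  forall m, m != n -> inner mu f (w m) = 0.
Proof.
move=> [lf kf] m mn; have [l1 l2] := iter_sub_scalar (Complex (z n) 0) k m lf.
have := aeq0_inner m l1 kf; rewrite l2 => /eqP; rewrite mulf_eq0 => /orP[|/eqP//].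
rewrite expf_eq0 => /andP[_]; rewrite subr_eq0 => /eqP[/zinj e].
by rewrite e eqxx in mn.
Qed.

Lemma has_dim_eig (K : set (R -> cplx)) : K u ->
  (forall f, K f -> L2 mu f /\ forall m, m != n -> inner mu f (w m) = 0) -> has_dim mu K 1.
Proof.
move=> Ku hK; exists (fun=> u).
have E c : lincomb 1 c (fun=> u) = fun x => c 0%N * u x.
  by apply/funext => x; rewrite /lincomb big_ord_recl big_ord0 addr0.
split => //.
  move=> c; rewrite E => c0 [|k]// _; have := aeq0_inner n (L2Z (c 0%N) lu) c0.
  have -> : (fun x => c 0%N * u x) = fun x => c 0%N * u x + 0 by apply/funext => x; rewrite addr0.
  by rewrite inner_lin ?inner0l ?addr0 ?hu ?eqxx ?mulr1//; exact: L2_0.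
move=> f Kf; have [lf hf] := hK f Kf; exists (fun=> inner mu f (w n)); rewrite E.
exact: eig_multiple.
Qed.

Lemma geom_mult_eig : geom_mult mu (Complex (z n) 0) A 1.
Proof.
apply: has_dim_eig; first by split => //; exact: sub_scalar_eig.
by move=> f kf; split; [exact: kf.1|exact: (@iter_kernel 1)].
Qed.

Lemma alg_mult_eig : alg_mult mu (Complex (z n) 0) A 1.
Proof.
apply: has_dim_eig; first by exists 1%N => //; split => //; exact: sub_scalar_eig.
by move=> f [k _ kf]; split; [exact: kf.1|exact: (iter_kernel kf)].
Qed.

End Eigenvector.

(** The range of [A - z n] is orthogonal to [w n], hence not dense. An eigenvector, being orthogonal
    to the other [w m], could be normalized into a dual vector of index [n], which is excluded. *)
Lemma residual_spectrum_mem n : injective z -> ~ aeq mu (w n) (fun=> 0) ->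
  (forall u, L2 mu u -> ~ forall m, inner mu u (w m) = (n == m)%:R) ->
  residual_spectrum mu A (Complex (z n) 0).
Proof.
move=> zinj wn0 nou; split.
  move=> f kf; have lf := kf.1; have h m (mn : m != n) : inner mu f (w m) = 0.
    exact: (@iter_kernel n zinj 1 f kf m mn).
  apply: HC => // m; have [->|/h//] := eqVneq m n.
  apply/eqP; apply: contrapT => /negP c0.
  apply: (nou (fun x => (inner mu f (w n))^-1 * f x)); first exact: L2Z.
  move=> k; have -> : (fun x => (inner mu f (w n))^-1 * f x) =
      fun x => (inner mu f (w n))^-1 * f x + 0 by apply/funext => x; rewrite addr0.
  rewrite inner_lin ?inner0l ?addr0//; last exact: L2_0.
  case: eqVneq => [<-|nk]; first by rewrite mulVf.
  have kn : k != n by rewrite eq_sym.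
  by rewrite (h k kn) mulr0.
move=> dR; apply: wn0; apply: (dense_orth dR) => //.
  by move=> g [f lf <-]; exact: L2_sub_scalar.
move=> g [f lf <-]; rewrite inner_conj//; last exact: L2_sub_scalar.
by rewrite inner_sub_scalar// subrr mul0r conjc0.
Qed.

End DiagonalOperators.

(** * Operators with a complete family of eigenvectors *)

Section ResidualEmpty.
Context {R : realType} (mu : probability (mR R) R).
Local Notation cplx := (complex R).
Variables (A : (R -> cplx) -> R -> cplx) (u : nat -> R -> cplx) (z : nat -> R).
Hypotheses (bA : bounded_op mu A) (lu : forall n, L2 mu (u n))
  (eig : forall n, aeq mu (sub_scalar A (Complex (z n) 0) (u n)) (fun=> 0))
  (u0 : forall n, ~ aeq mu (u n) (fun=> 0))
  (du : dense_in_L2 mu (lspan u)).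

Lemma op_lincomb n c : aeq mu (A (lincomb n c u)) (fun x => \sum_(k < n) c k * A (u k) x).
Proof.
have [LA linA _] := bA; elim: n => [|n IH].
  have E0 : lincomb 0 c u = fun=> 0 by apply/funext => x; rewrite /lincomb big_ord0.
  have E1 : (fun x => \sum_(k < 0) c k * A (u k) x) = fun=> 0 by apply/funext => x; rewrite big_ord0.
  rewrite E0 E1; have := linA (-1) (fun=> 0) (fun=> 0) (L2_0 mu) (L2_0 mu).
  have -> : (fun x : R => -1 * 0 + 0 : cplx) = fun=> 0 by apply/funext => x; rewrite mulr0 addr0.
  by apply: ae_mono => x h _; rewrite (h I) mulN1r addNr.
have -> : lincomb n.+1 c u = fun x => c n * u n x + lincomb n c u x.
  by apply/funext => x; rewrite /lincomb big_ord_recr/= addrC.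
have h := linA (c n) (u n) (lincomb n c u) (lu n) (L2_lincomb n c lu).
apply: ae_mono2 h IH => x a b _; rewrite (a I) (b I) big_ord_recr/=.
by rewrite addrC.
Qed.

(** If [l] is not an eigenvalue, [A - l] maps the span of the eigenvectors onto itself, up to null
    functions, and this span is dense. *)
Lemma residual_spectrum0 : residual_spectrum mu A = set0.
Proof.
apply/seteqP; split => // l [kl nd]; apply: nd => f lf e e0.
have zl n : Complex (z n) 0 - l != 0.
  apply/eqP => zl; apply: (u0 (n := n)); apply: kl; split => //.
  have -> : l = Complex (z n) 0 by apply/esym/eqP; rewrite -subr_eq0 zl.
  exact: eig.
have [g [n [c ->]] hg] := du lf e0.
pose c' k := c k / (Complex (z k) 0 - l); pose g' := lincomb n c' u.
have lg' : L2 mu g' by exact: L2_lincomb.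
exists (sub_scalar A l g'); first by exists g'.
have [LA _ _] := bA.
have h : aeq mu (sub_scalar A l g') (lincomb n c u).
  have hall : {ae mu, forall x, forall k, (k < n)%N -> A (u k) x = Complex (z k) 0 * u k x}.
    elim: n {hg g' lg'} => [|n IH]; first exact: aeW.
    apply: ae_mono2 IH (eig n) => x a b k; rewrite ltnS leq_eqVlt => /predU1P[->|]; last exact: a.
    by apply/eqP; rewrite -subr_eq0; apply/eqP; exact: b I.
  apply: ae_mono2 (op_lincomb n c') hall => x a b _.
  rewrite /sub_scalar (a I) /g' /lincomb mulr_sumr -sumrB; apply: eq_bigr => k _.
  rewrite b// /c'; have := zl k; move: (Complex (z k) 0) (u k x) (c k) => r s q r0.
  by field.
have l1 := L2B lf (L2_lincomb n c lu).
have l2 : L2 mu (fun x => f x - sub_scalar A l g' x).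
  by apply: L2B => //; apply: L2B; [exact: LA|exact: L2Z].
rewrite (aeq_norm l2 l1)//.
by apply: ae_mono h => x a _; rewrite (a I).
Qed.

End ResidualEmpty.

(** * Bessel bound, dual vectors and eigenfunctions *)

Section Spectrum.
Context {R : realType} (p : laguerre_exponent R) (P : R -> (R -> R) -> R -> R)
  (mu : probability (mR R) R) (nu : R -> R).
Hypotheses (HP : generalized_laguerre p P) (Hnu : invariant_density p P mu nu).
Local Notation l2 := (l2 mu).
Local Notation ip := (ip mu).
Local Notation nrm := (nrm mu).
Local Notation cplx := (complex R).
Local Notation L n := (lpoly (W p) n).
Implicit Types (f g : R -> R) (n k : nat).

Let W_pos n : 0 < W p n := W_gt0 (phir1_gt0 Hnu) n.

Lemma polPE n : polP p n = horner (L n).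
Proof.
apply/funext => x; rewrite /polP /lpoly horner_sum big_mkord; apply: eq_bigr => k _.
by rewrite hornerZ hornerXn WphiE.
Qed.

Lemma l2_polP n : l2 (polP p n). Proof. by rewrite polPE; exact: l2_poly Hnu _. Qed.

Lemma ip_polP_sum f N (c : nat -> R) : l2 f ->
  ip f (horner (\sum_(k < N) c k *: L k)) = \sum_(k < N) c k * ip f (polP p k).
Proof.
move=> lf; elim: N => [|N IH].
  rewrite !big_ord0 (_ : horner 0 = fun=> 0); first exact: ip0r.
  by apply/funext => x; rewrite horner0.
rewrite !big_ord_recr/= -IH -(@ip_linr _ _ _ (c N) (polP p N)).
- congr Submission.ip; apply/funext => x; by rewrite polPE hornerD hornerZ.
- exact: l2_poly Hnu _.
- exact: l2_polP.
- exact: lf.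
Qed.

Lemma dense_polP : dense_in_L2 mu (lspan (fun n => ofR (polP p n))).
Proof.
apply: dense_real; first exact: l2_polP.
move=> f lf d d0; have [q hq] := dense_poly Hnu lf d0.
exists (size q), (fun k => (-1) ^+ k * mom (binw (W p) k) q); apply: le_trans hq.
rewrite le_eqVlt; apply/orP; left; apply/eqP; apply: eq_nrm => x.
rewrite [in RHS](poly_lpoly W_pos (leqnn (size q))) horner_sum; congr (_ - _).
by apply: eq_bigr => k _; rewrite hornerZ polPE.
Qed.

Lemma nrm_sum_lpoly N (c : nat -> R) :
  nrm (horner (\sum_(k < N) c k *: L k)) ^+ 2 <= \sum_(k < N) c k ^+ 2.
Proof.
rewrite (nrm_poly Hnu) sqr_sqrtr; last by apply: mom_sqr_ge0; exact: hpsd_W Hnu.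
by apply: bessel_lpoly => //; [exact: hpsd_W Hnu|exact: hpsd_fact_div_W (phir1_gt0 Hnu)|exact: W0].
Qed.

(** Dual form of [nrm_sum_lpoly]: testing [f] against the sum of the [c_k P_k] with [c_k = <f, P_k>]
    gives [S ^ 2 <= ||f|| ^ 2 S]. *)
Lemma bessel_real N f : l2 f -> \sum_(k < N) ip f (polP p k) ^+ 2 <= nrm f ^+ 2.
Proof.
move=> lf; pose c k := ip f (polP p k); set S := \sum_(k < N) _.
have S0 : 0 <= S by apply: sumr_ge0 => k _; exact: sqr_ge0.
have E : S = ip f (horner (\sum_(k < N) c k *: L k)).
  by rewrite ip_polP_sum//; apply: eq_bigr => k _; rewrite expr2.
have h1 := ip_cauchy lf (l2_poly Hnu (\sum_(k < N) c k *: L k)).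
have h2 := nrm_sum_lpoly N c; rewrite -/S in h2.
rewrite -E (ger0_norm S0) in h1.
move: h1 h2; set y := nrm (horner _) => h1 h2.
have y0 : 0 <= y := nrm_ge0 mu _; have x0 := nrm_ge0 mu f.
move: (nrm f) x0 h1 => x x0 h1.
have h3 : S ^+ 2 <= x ^+ 2 * S.
  apply: (@le_trans _ _ ((x * y) ^+ 2)); first by rewrite ler_sqr ?nnegrE ?mulr_ge0.
  by rewrite exprMn; apply: ler_wpM2l => //; exact: sqr_ge0.
have [S1|S1] := ltP 0 S; last exact: le_trans S1 (sqr_ge0 _).
by move: h3; rewrite expr2 ler_pM2r.
Qed.

(** The finite zero set of the polynomial is Lebesgue null, hence null for [mu]. *)
Lemma polP_neq0 n : ~ polP p n = cst 0 %[ae mu].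
Proof.
move=> h; pose q := L n.
have q0 : q != 0.
  apply/eqP => q0; have := mom_binw_lpoly W_pos n n; rewrite -/q q0 mom0 eqxx mulr1.
  by move/eqP; rewrite eq_sym signr_eq0.
have fin : finite_set [set x : R | q.[x] = 0].
  apply: contrapT => inf; have [B BZ sB] := @infinite_set_fset _ _ (size q) inf.
  have := @max_poly_roots _ q (finmap.enum_fset B) q0.
  rewrite ltnNge sB => H; suff : false by [].
  apply: H; last exact: finmap.fset_uniq.
  by apply/allP => x xB; apply/rootP; exact: BZ.
pose Z : set (mR R) := [set x : R | q.[x] = 0].
have mZ : measurable Z.
  have [mq _] := l2_poly Hnu q.
  by rewrite (_ : Z = horner q @^-1` [set 0])// -[X in measurable X]setTI; apply: mq.
have Z0 : mu Z = 0%E.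
  have /null_content_dominatesP := mu_dominated Hnu; apply => //.
  by apply: countable_lebesgue_measure0; exact: finite_set_countable.
move: h => [N [mN N0 sN]]; have := null_set_setU mN mZ N0 Z0.
rewrite (_ : N `|` Z = setT); last first.
  apply/seteqP; split => // x _; have [qx|qx] := pselect (q.[x] = 0); [by right|left].
  by apply: sN => /= /(_ I); rewrite polPE.
move=> m0; have e1 : (1%E = 0%E :> \bar R) := etrans (esym (probability_setT mu)) m0.
by move/eqP: e1; rewrite onee_eq0.
Qed.

Lemma dual_ex n B : bfun (W p) (binw (W p) n) B ->
  exists v, l2 v /\ forall q, ip v (horner q) = (-1) ^+ n * mom (binw (W p) n) q.
Proof.
move=> [B0 hB].
have [] := @riesz R mu horner (fun q => (-1) ^+ n * mom (binw (W p) n) q) B.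
- exact: l2_poly Hnu.
- by move=> r a q x; rewrite hornerD hornerZ.
- by move=> r a q; rewrite momD momZ; ring.
- by move=> q; rewrite normrM normr_sign mul1r (nrm_poly Hnu).
by move=> v [lv hv _]; exists v.
Qed.

Lemma dual_polP n v k : (forall q, ip v (horner q) = (-1) ^+ n * mom (binw (W p) n) q) ->
  ip v (polP p k) = (k == n)%:R.
Proof.
move=> hv; rewrite polPE hv mom_binw_lpoly//; case: eqVneq => [->|_]; last by rewrite !mulr0.
by rewrite mulr1 -exprMn mulrNN mulr1 expr1n.
Qed.

Lemma rodV_dual n B : bfun (W p) (binw (W p) n) B ->
  l2 (rodV nu n) /\ forall q, ip (rodV nu n) (horner q) = (-1) ^+ n * mom (binw (W p) n) q.
Proof.
move=> hB; have [v [lv hv]] := dual_ex hB.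
have lr := l2_rodV Hnu lv hv; split => // q; rewrite -hv.
have lq := l2_poly Hnu q.
by apply: eq_ae_ip => //; apply: ae_mono (rodV_ae Hnu lv hv) => x -> _.
Qed.

Variables (t : R) (Q Qs : (R -> cplx) -> R -> cplx).
Hypotheses (t0 : 0 <= t) (HQ : L2_extension mu (P t) Q) (HQs : adjoint mu Q Qs).
Local Notation z n := (expR (- (n%:R * t))).
Local Notation Pn n := (ofR (polP p n)).

Lemma L2_Pn n : L2 mu (Pn n). Proof. exact: L2_ofR (l2_polP n). Qed.

(** [Q] is given on [C_0] only, so [P_n] is replaced by the function of [lpoly_core]. The three
    errors are controlled by the bound of [Q], the approximate eigenvector property and the
    approximation itself, whence the choice of [d]. *)
Lemma Q_Pn n : aeq mu (sub_scalar Q (Complex (z n) 0) (Pn n)) (fun=> 0).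
Proof.
have [[LQ linQ [b hb]] extQ] := HQ; have lP := L2_Pn n.
have lD : L2 mu (sub_scalar Q (Complex (z n) 0) (Pn n)).
  by apply: L2B; [exact: LQ|exact: L2Z].
apply: (L2norm0_aeq lD); apply: le_eps0 => e e0; rewrite (ger0_norm (L2norm_ge0 _ _)).
pose d := e / (`|b| + t + 1).
have K0 : 0 < `|b| + t + 1 by rewrite ltr_wpDl// addr_ge0.
have d0 : 0 < d by rewrite divr_gt0.
have [f [cf h1 h2]] := lpoly_core HP Hnu n d0.
have lf := l2_C0 mu cf; have lF : L2 mu (ofR f) := L2_ofR lf.
pose G x := (-1) * ofR f x + Pn n x; have lG : L2 mu G := L2_lin (-1) lF lP.
have nG : L2norm mu G <= d.
  have -> : G = ofR (fun x => (L n).[x] - f x).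
    apply/funext => x; rewrite /G /ofR polPE; apply/eqP; rewrite eq_complex/=.
    by rewrite !mulr0 subr0 mulN1r oppr0 mul0r !addr0 addrC !eqxx.
  rewrite L2norm_ofR; last by apply: l2B => //; exact: l2_poly Hnu _.
  by rewrite (nrmB_sym (l2_poly Hnu (L n)) lf).
have lPf : l2 (P t f) := l2_C0 mu (feller_C0 HP.1 t0 cf).
pose U := fun x => P t f x - z n * f x.
pose V := fun x => z n * (f x - (L n).[x]).
have lU : l2 U by apply: l2B => //; exact: l2Z.
have lV : l2 V by apply: l2Z; apply: l2B => //; exact: l2_poly Hnu _.
have lQG : L2 mu (Q G) := LQ G lG.
have lU' : L2 mu (ofR U) := L2_ofR lU.
have lV' : L2 mu (ofR V) := L2_ofR lV.
have lUV : L2 mu (fun x => 1 * ofR U x + ofR V x) := L2_lin 1 lU' lV'.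
have lS : L2 mu (fun x => 1 * Q G x + (1 * ofR U x + ofR V x)) := L2_lin 1 lQG lUV.
have E : aeq mu (sub_scalar Q (Complex (z n) 0) (Pn n)) (fun x => 1 * Q G x + (1 * ofR U x + ofR V x)).
  have e1 := linQ (-1) (ofR f) (Pn n) lF lP; have e2 := extQ f cf.
  apply: ae_mono2 e1 e2 => x a1 a2 _; rewrite /sub_scalar (a1 I) (a2 I) !mul1r /ofR /U /V polPE.
  apply/eqP; rewrite eq_complex/=; case: (Q _ x) => [q1 q2] /=.
  by apply/andP; split; apply/eqP; ring.
rewrite (aeq_norm lD lS E).
have e1 : (fun x => 1 * Q G x) = Q G by apply/funext => x; rewrite mul1r.
have e2 : (fun x => 1 * ofR U x) = ofR U by apply/funext => x; rewrite mul1r.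
have n1 : L2norm mu (fun x => 1 * Q G x + (1 * ofR U x + ofR V x)) <=
    L2norm mu (Q G) + (L2norm mu (ofR U) + L2norm mu (ofR V)).
  have l1 : L2 mu (fun x => 1 * Q G x) by rewrite e1.
  have l2 : L2 mu (fun x => 1 * ofR U x) by rewrite e2.
  have := L2norm_tri l1 lUV; have := L2norm_tri l2 lV'; rewrite e1 e2; lra.
apply: le_trans n1 _; rewrite !L2norm_ofR//.
have b1 : L2norm mu (Q G) <= `|b| * d.
  apply: le_trans (hb G lG) _; apply: (@le_trans _ _ (`|b| * L2norm mu G)).
    by apply: ler_wpM2r; [exact: L2norm_ge0|exact: ler_norm].
  by apply: ler_wpM2l.
have b2 : nrm U <= t * d by exact: h2.
have b3 : nrm V <= d.
  rewrite /V nrmZ; last by apply: l2B => //; exact: l2_poly Hnu _.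
  rewrite ger0_norm ?expR_ge0//; apply: le_trans h1.
  by rewrite ler_piMl ?nrm_ge0// expRN_le1// mulr_ge0.
have -> : e = `|b| * d + (t * d + d) by rewrite /d; field; rewrite gt_eqF.
by apply: lerD => //; exact: lerD.
Qed.

Lemma Qs_Pn (f : R -> cplx) n : L2 mu f -> inner mu (Qs f) (Pn n) = Complex (z n) 0 * inner mu f (Pn n).
Proof.
move=> lf; have [[LQ _ _] _] := HQ; have [[LQs _ _] adj] := HQs.
have lP := L2_Pn n; have lQs := LQs f lf; have lQP := LQ _ lP.
rewrite (inner_conj lP lQs) -(adj _ _ lP lf).
have e : aeq mu (Q (Pn n)) (fun x => Complex (z n) 0 * Pn n x) by apply: aeq_sub0; exact: Q_Pn.
rewrite (aeq_inner lQP (L2Z _ lP) lf e).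
have -> : (fun x => Complex (z n) 0 * Pn n x) = fun x => Complex (z n) 0 * Pn n x + 0.
  by apply/funext => x; rewrite addr0.
rewrite (inner_lin _ lP (L2_0 mu) lf) (inner0 lf) addr0 (inner_conj lP lf).
case: (inner mu (Pn n) f) => [a b] /=; apply/eqP; rewrite eq_complex/=.
by apply/andP; split; apply/eqP; ring.
Qed.

Lemma Q_dual (f v : R -> cplx) n : L2 mu v -> aeq mu (sub_scalar Qs (Complex (z n) 0) v) (fun=> 0) ->
  L2 mu f -> inner mu (Q f) v = Complex (z n) 0 * inner mu f v.
Proof.
move=> lv ev lf; have [[LQs _ _] adj] := HQs.
rewrite (adj _ _ lf lv); have lQv := LQs v lv.
have e : aeq mu (Qs v) (fun x => Complex (z n) 0 * v x) by apply: aeq_sub0.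
rewrite (inner_conj lQv lf) (aeq_inner lQv (L2Z _ lv) lf e).
have -> : (fun x => Complex (z n) 0 * v x) = fun x => Complex (z n) 0 * v x + 0.
  by apply/funext => x; rewrite addr0.
rewrite (inner_lin _ lv (L2_0 mu) lf) (inner0 lf) addr0 (inner_conj lv lf).
case: (inner mu v f) => [a b] /=; apply/eqP; rewrite eq_complex/=.
by apply/andP; split; apply/eqP; ring.
Qed.

Lemma complete_Pn (f : R -> cplx) : L2 mu f -> (forall n, inner mu f (Pn n) = 0) -> aeq mu f (fun=> 0).
Proof. by move=> lf h; apply: (dense_orth_seq dense_polP L2_Pn lf h). Qed.

End Spectrum.

(** * Completeness of the dual family *)

Section DualCompleteness.
Context {R : realType} (p : laguerre_exponent R) (P : R -> (R -> R) -> R -> R)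
  (mu : probability (mR R) R) (nu : R -> R).
Hypotheses (HP : generalized_laguerre p P) (Hnu : invariant_density p P mu nu)
  (chain : chain_hyp p).
Local Notation l2 := (l2 mu).
Local Notation ip := (ip mu).
Local Notation nrm := (nrm mu).
Implicit Types (f : R -> R) (q : {poly R}) (n k j : nat).

Let W_pos n : 0 < W p n := W_gt0 (phir1_gt0 Hnu) n.

Lemma lag_sg_cont q d : 0 < d -> exists2 e : R, 0 < e &
  forall c, 0 <= c <= 1 -> 1 - c <= e -> nrm (fun x => (lag_sg (W p) c q).[x] - q.[x]) <= d.
Proof.
move=> d0; pose a k := (-1) ^+ k * mom (binw (W p) k) q.
pose N := size q; have E := poly_lpoly W_pos (leqnn (size q)); rewrite -/N in E.
pose S := \sum_(k < N) (`|a k| * k%:R * nrm (horner (lpoly (W p) k))).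
have S0 : 0 <= S by apply: sumr_ge0 => k _; rewrite !mulr_ge0 ?nrm_ge0.
have S1 : 0 < S + 1 by rewrite ltr_wpDl.
exists (d / (S + 1)); first exact: divr_gt0.
move=> c /andP[c0 c1] ce.
have LE x : (lag_sg (W p) c q).[x] - q.[x] =
    \sum_(k < N) (a k * (c ^+ k - 1)) * (lpoly (W p) k).[x].
  rewrite (_ : lag_sg (W p) c q = \sum_(k < N) a k *: (c ^+ k *: lpoly (W p) k)); last first.
    rewrite (_ : lag_sg (W p) c q = lag_sg (W p) c (\sum_(k < N) a k *: lpoly (W p) k)); last first.
      by congr (lag_sg _ _ _); exact: E.
    by rewrite lag_sg_sum; apply: eq_bigr => k _; rewrite lag_sg_lpoly.
  rewrite [in X in _ - X = _]E !horner_sum -sumrB; apply: eq_bigr => k _.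
  by rewrite !hornerZ /a; ring.
have lL k : l2 (fun x => (a k * (c ^+ k - 1)) * (lpoly (W p) k).[x]).
  by apply: l2Z; exact: l2_poly Hnu _.
have [_] := nrm_sum N lL.
rewrite (@eq_nrm _ _ _ (fun x => (lag_sg (W p) c q).[x] - q.[x])); last by move=> x; rewrite LE.
move=> /le_trans; apply.
apply: (@le_trans _ _ (S * (1 - c))).
  rewrite /S mulr_suml; apply: ler_sum => k _.
  rewrite nrmZ; last exact: l2_poly Hnu _.
  rewrite normrM -!mulrA; apply: ler_wpM2l => //; rewrite [_ * (1 - c)]mulrC mulrA.
  apply: ler_wpM2r; first exact: nrm_ge0.
  rewrite distrC ger0_norm ?subr_ge0 ?exprn_ile1//.
  elim: (k : nat) => [|i IH]; first by rewrite expr0 subrr mul0r.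
  rewrite exprS -natr1 mulrDl mul1r.
  have -> : 1 - c * c ^+ i = c * (1 - c ^+ i) + (1 - c) by ring.
  rewrite lerD2r; apply: le_trans IH; rewrite ler_piMl// subr_ge0 exprn_ile1//.
apply: (@le_trans _ _ (S * (d / (S + 1)))); first exact: ler_wpM2l.
by rewrite mulrCA ler_piMr ?(ltW d0)// ler_pdivrMr// mul1r lerDl.
Qed.

Lemma complete_dual f : l2 f ->
  (forall n v, l2 v -> (forall q, ip v (horner q) = (-1) ^+ n * mom (binw (W p) n) q) -> ip f v = 0) ->
  f = cst 0 %[ae mu].
Proof.
move=> lf orth; have [kap [B [C [M [hkap hB M1 hBM xgrow]]]]] := chain.
have hW := hpsd_W Hnu.
have h2 j : 0 < (2^-1 : R) ^+ j by rewrite exprn_gt0.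
have [q hq] := choice (fun j => dense_poly Hnu lf (h2 j)).
have lq j := l2_poly Hnu (q j).
pose K := nrm f + 1.
have qK j : Num.sqrt (mom (W p) (q j ^+ 2)) <= K.
  rewrite -(nrm_poly Hnu).
  have e1 : nrm (horner (q j)) <= nrm (fun x => f x - (q j).[x]) + nrm f.
    have := nrmD (l2B (lq j) lf) lf; rewrite (nrmB_sym (lq j) lf).
    by rewrite (@eq_nrm _ _ _ (horner (q j)))// => x; rewrite subrK.
  apply: le_trans e1 _; rewrite addrC lerD2l; apply: le_trans (hq j) _.
  by apply: exprn_ile1; [rewrite invr_ge0|rewrite invf_le1 ?ler1n].
have smallq e : 0 < e -> exists J, forall j, (J <= j)%N -> nrm (fun x => f x - (q j).[x]) <= e.
  move=> e0; have [J hJ] := cvg_geo_half e0; exists J => j Jj.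
  apply: le_trans (hq j) _; apply: le_trans (ltW hJ).
  by apply: ler_wiXn2l => //; rewrite ?invr_ge0 ?invf_le1 ?ler1n.
(* The start of the chain: at [a = 1] the functionals are, up to sign, inner products with dual
   vectors, which annihilate [f]. *)
have van1 : vanish (W p) q 1.
  move=> k e e0; have [v [lv hv]] := dual_ex Hnu (hB k).
  have v0 : 0 <= nrm v := nrm_ge0 mu v.
  have e'0 : 0 < e / (nrm v + 1) by rewrite divr_gt0// ltr_wpDl.
  have [J hJ] := smallq _ e'0; exists J => j /hJ hj.
  have -> : mom (dilf (W p) 1 k) (q j) = mom (binw (W p) k) (q j).
    by apply: eq_mom => n; rewrite /dilf expr1n mul1r.
  have -> : `|mom (binw (W p) k) (q j)| = `|ip (fun x => f x - (q j).[x]) v|.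
    rewrite ipBl// (orth k v lv hv) sub0r normrN [in RHS]ipC hv.
    by rewrite normrM normr_sign mul1r.
  apply: le_trans (ip_cauchy (l2B lf (lq j)) lv) _.
  apply: (@le_trans _ _ (e / (nrm v + 1) * nrm v)); first exact: ler_wpM2r.
  by rewrite mulrAC ler_pdivrMr ?ltr_wpDl// ler_pM2l// lerDl.
pose rho := 1 - (4 * M)^-1.
have M0 : 0 < M by apply: lt_le_trans M1.
have rho0 : 0 < rho.
  by rewrite subr_gt0 invf_lt1 ?mulr_gt0//; move: M1; lra.
have rho1 : rho < 1 by rewrite ltrBlDr ltrDl invr_gt0 mulr_gt0.
(* [f] is within [4 e] of [P_t q_j] in norm, and [P_t q_j] is at most [e] on [[0, r]]. The
   polynomial [q i0] is fixed before [a], so that continuity at time 0 can be used on it. *)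
have key (r e : R) : 0 <= r -> 0 < e -> nrm (fun x => if x <= r then f x else 0) <= 5 * e.
  move=> r0 e0; have [i0 hi0] := smallq e e0.
  have [e1 e10 hc] := lag_sg_cont (q i0) e0.
  have [m hm] : exists m, rho ^+ m.+1 <= e1.
    have : (fun m => rho ^+ m) @ \oo --> (0 : R).
      by apply: cvg_expr; rewrite ger0_norm// ltW.
    move=> /cvgr0Pnorm_le/(_ _ e10)[m _ hm]; exists m.
    by have := hm m.+1 (leqnSn m); rewrite /= ger0_norm// exprn_ge0// ltW.
  pose a := rho ^+ m.+1.
  have a0 : 0 < a by rewrite exprn_gt0.
  have a1 : a < 1 by rewrite exprn_ilt1// ltW.
  have a01 : 0 < a <= 1 by rewrite a0 ltW.
  have va : vanish (W p) q a by exact: (vanish_pow hW hkap hB M1 hBM qK m.+1 van1).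
  have [J1 hJ1] := lag_sg_vanish W_pos hW hkap hB M1 hBM xgrow qK a01 va r0 e0.
  have [J2 hJ2] := smallq e e0; pose j := maxn J1 J2.
  (* The time at which [exp (- t)] is [1 - a], for [lag_sg_contraction]. *)
  pose t := - ln (1 - a).
  have ct : expR (- t) = 1 - a by rewrite /t opprK lnK// posrE subr_gt0.
  have t0 : 0 <= t by rewrite /t oppr_ge0 ln_le0// lerBlDr lerDl ltW.
  pose Lj := lag_sg (W p) (1 - a) (q j); pose Li := lag_sg (W p) (1 - a) (q i0).
  have lLj := l2_poly Hnu Lj; have lLi := l2_poly Hnu Li.
  have b1 : nrm (fun x => Lj.[x] - Li.[x]) <= 2 * e.
    have := lag_sg_contraction HP Hnu (q j - q i0) t0; rewrite ct.
    have -> : lag_sg (W p) (1 - a) (q j - q i0) = Lj - Li.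
      rewrite lag_sgD (_ : - q i0 = -1 *: q i0); last by rewrite scaleN1r.
      by rewrite lag_sgZ scaleN1r.
    rewrite (@eq_nrm _ _ (horner (Lj - Li)) (fun x => Lj.[x] - Li.[x])); last first.
      by move=> x; rewrite hornerD hornerN.
    move=> /le_trans; apply.
    rewrite (@eq_nrm _ _ (horner (q j - q i0)) (fun x => (q j).[x] - (q i0).[x])); last first.
      by move=> x; rewrite hornerD hornerN.
    apply: le_trans (nrm_tri (lq j) lf (lq i0)) _; rewrite (nrmB_sym (lq j) lf).
    have := hJ2 j (leq_maxr _ _); have := hi0 i0 (leqnn _); lra.
  have b2 : nrm (fun x => Li.[x] - (q i0).[x]) <= e.
    apply: hc; first by rewrite subr_ge0 ltW//= lerBlDr lerDl ltW.
    by rewrite opprB addrCA subrr addr0.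
  have b3 : nrm (fun x => f x - Lj.[x]) <= 4 * e.
    apply: le_trans (nrm_tri lf (lq i0) lLj) _.
    have := nrm_tri (lq i0) lLi lLj; rewrite (nrmB_sym (lq i0) lLi) (nrmB_sym lLi lLj).
    have := hi0 i0 (leqnn _); move: b1 b2; lra.
  have mr : measurable_fun [set: mR R] (fun x : mR R => x <= r) by exact: measurable_fun_ler.
  have lcut g : l2 g -> l2 (fun x => if x <= r then g x else 0) /\
      nrm (fun x => if x <= r then g x else 0) <= nrm g.
    move=> [mg ig].
    have lc : l2 (fun x => if x <= r then g x else 0).
      split; first exact: measurable_fun_ifT.
      apply: (integrable_dominated (T := mR R) (g := fun x => g x ^+ 2)) => //.
        by apply: measurable_funX; exact: measurable_fun_ifT.
      by move=> x _; case: ifP => _; rewrite ?expr0n/= ?normr0 ?sqr_ge0// ger0_norm// sqr_ge0.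
    split => //; rewrite -(nrm_norm mu g); apply: (nrm_le_pos Hnu) => //; first exact: l2_norm.
    by move=> x _; case: ifP => // _; rewrite normr0.
  have [l1 n1] := lcut _ (l2B lf lLj); have [l2' _] := lcut _ lLj.
  have n2 : nrm (fun x => if x <= r then Lj.[x] else 0) <= e.
    have := l2_bounded mu (f := fun x => if 0 < x then (if x <= r then Lj.[x] else 0) else 0) (c := e).
    have mf : measurable_fun [set: mR R]
        ((fun x => if 0 < x then (if x <= r then Lj.[x] else 0) else 0) : mR R -> R).
      by apply: measurable_fun_ifT; [exact: measurable_fun_ltr|exact: l2'.1|exact: measurable_cst].
    move=> /(_ mf) [x|lb nb].
      case: (ltP 0 x) => [x0|_]; last by rewrite normr0 ltW.
      case: (leP x r) => [xr|_]; last by rewrite normr0 ltW.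
      by apply: hJ1; rewrite ?leq_maxl// ltW.
    apply: le_trans nb; rewrite -(nrm_norm mu (fun x => if 0 < x then _ else 0)).
    apply: (nrm_le_pos Hnu); [exact: l2'|exact: l2_norm lb|].
    by move=> x x0; rewrite x0.
  have := nrmD l1 l2'.
  rewrite (@eq_nrm _ _ _ (fun x => if x <= r then f x else 0)); last first.
    by move=> x; case: ifP => _; [rewrite subrK|rewrite addr0].
  by move: n1 n2 b3; lra.
have cut0 m : {ae mu, forall x, x <= m%:R -> f x = 0}.
  have m0 : 0 <= m%:R :> R by [].
  have lc : l2 (fun x => if x <= m%:R then f x else 0).
    have [mf jf] := lf; have mr : measurable_fun [set: mR R] (fun x : mR R => x <= m%:R) by exact: measurable_fun_ler.
    split; first exact: measurable_fun_ifT.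
    apply: (integrable_dominated (T := mR R) (g := fun x => f x ^+ 2)) => //.
      by apply: measurable_funX; exact: measurable_fun_ifT.
    by move=> x _; case: ifP => _; rewrite ?expr0n/= ?normr0 ?sqr_ge0// ger0_norm// sqr_ge0.
  have n0 : nrm (fun x => if x <= m%:R then f x else 0) = 0.
    apply: le_eps0 => d d0; rewrite ger0_norm ?nrm_ge0//.
    have d5 : 0 < d / 5 by rewrite divr_gt0.
    by apply: le_trans (key _ _ m0 d5) _; rewrite mulrC divfK.
  by apply: ae_mono (ae_nrm0 lc n0) => x h xm; have := h I; rewrite xm.
have all0 : {ae mu, forall x m, x <= m%:R -> f x = 0} by apply/ae_foralln.
apply: ae_mono all0 => x h _; apply: (h (Num.truncn x).+1).
by apply: ltW; exact: truncnS_gt.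
Qed.

End DualCompleteness.

(** * Basis properties of the two families *)

Section Assembly.
Context {R : realType} (p : laguerre_exponent R) (P : R -> (R -> R) -> R -> R)
  (mu : probability (mR R) R) (nu : R -> R).
Hypotheses (HP : generalized_laguerre p P) (Hnu : invariant_density p P mu nu).
Local Notation l2 := (l2 mu).
Local Notation ip := (ip mu).
Local Notation nrm := (nrm mu).
Local Notation cplx := (complex R).
Local Notation Pn := (fun n => ofR (polP p n) : R -> cplx).
Local Notation Vn := (fun n => ofR (rodV nu n) : R -> cplx).
Implicit Types (f g : R -> R) (n k : nat).

Let W_pos n : 0 < W p n := W_gt0 (phir1_gt0 Hnu) n.

Lemma series_le (u : nat -> R) S : (forall n, 0 <= u n) ->
  (forall N, \sum_(k < N) u k <= S) -> (\sum_(0 <= n <oo) (u n)%:E <= S%:E)%E.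
Proof.
move=> u0 h; apply: lime_le; first by apply: is_cvg_nneseries => n _ _; rewrite lee_fin.
by apply: nearW => N; rewrite big_mkord sumEFin lee_fin.
Qed.

Lemma sqabs_inner (f : R -> cplx) g : L2 mu f -> l2 g ->
  sqabs (inner mu f (ofR g)) = ip (re f) g ^+ 2 + ip (im f) g ^+ 2.
Proof. by move=> lf lg; rewrite (inner_ofRr lf lg). Qed.

Lemma bessel_Pn : bessel mu Pn.
Proof.
split; first exact: L2_Pn Hnu.
exists 1 => // f lf; rewrite mul1r; have [a b] := (L2P mu f).1 lf.
apply: series_le => [n|N]; first by rewrite addr_ge0 ?sqr_ge0.
under eq_bigr => k _ do rewrite (sqabs_inner lf (l2_polP Hnu k)).
by rewrite big_split/= (L2norm_sqr lf); apply: lerD; [exact: (bessel_real Hnu _ a)|exact: (bessel_real Hnu _ b)].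
Qed.

Lemma re_nat (b : bool) : complex.Re (b%:R : cplx) = b%:R.
Proof. by case: b. Qed.

(** A biorthogonal sequence yields [g] whose pairings with the [P_k] are the coefficients [c_k] of
    ['X^N] along the [P_k]. The sum [S] of the [c_k ^ 2] is then also [<g, 'X^N>], so the lower
    bound and Cauchy-Schwarz give [A S <= W (2 N)], while [S = 'C(2 N, N) W_N ^ 2]. *)
Lemma not_riesz_Pn : 0 < 2 * phir p 1 - phir p 2 -> ~ riesz_basis mu Pn.
Proof.
move=> c0 [[v [lP lv bi]] [A [B [A0 B0 h]]]].
pose w k := re (v k); have lw k : l2 (w k) by have [] := (L2P mu (v k)).1 (lv k).
have bw n k : ip (w k) (polP p n) = (n == k)%:R.
  have /(congr1 (@complex.Re R)) := bi n k.
  by rewrite re_nat (inner_conj (lv k) (lP n)) (inner_ofRr (lv k) (l2_polP Hnu n)).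
have [N hN] := W_ratio_decay (phir1_gt0 Hnu) A0 c0.
pose c k : R := W p N * ((-1) ^+ k * 'C(N, k)%:R).
pose S := \sum_(k < N.+1) c k ^+ 2.
have lcw k : l2 (fun x => c k * w k x) by exact: l2Z.
have [lg _] := nrm_sum N.+1 lcw; set g := (fun x => _) in lg.
have gip f : l2 f -> ip g f = \sum_(k < N.+1) c k * ip (w k) f.
  move=> lf; rewrite /g; elim: (N.+1) => [|m IH].
    rewrite big_ord0 (_ : (fun x => _) = fun=> 0); first by rewrite ipC ip0r.
    by apply/funext => x; rewrite big_ord0.
  rewrite big_ord_recr/= -IH; have [l1 _] := nrm_sum m lcw.
  rewrite -(ip_linl (c m) l1 (lw m) lf); congr Submission.ip.
  by apply/funext => x; rewrite big_ord_recr.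
have gP n : ip g (polP p n) = if (n < N.+1)%N then c n else 0.
  rewrite (gip _ (l2_polP Hnu n)); case: ifPn => nN.
    rewrite (bigD1 (Ordinal nN))//= bw eqxx mulr1 big1 ?addr0// => k kn.
    rewrite bw; case: eqVneq => [e|_]; last by rewrite mulr0.
    by case/eqP: kn; apply: val_inj; rewrite /= e.
  rewrite big1// => k _; rewrite bw; case: eqVneq => [e|_]; last by rewrite mulr0.
  by move: nN; rewrite e ltn_ord.
have frame : A * nrm g ^+ 2 <= S.
  have [h1 _] := h _ (L2_ofR lg); rewrite (L2norm_ofR lg) in h1.
  rewrite -lee_fin; apply: le_trans h1 _; apply: series_le => [n|M].
    by rewrite addr_ge0 ?sqr_ge0.
  have E n : sqabs (inner mu (ofR g) (ofR (polP p n))) = if (n < N.+1)%N then c n ^+ 2 else 0.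
    rewrite (sqabs_inner (L2_ofR lg) (l2_polP Hnu n)).
    rewrite (_ : re (ofR g) = g)// gP (ipC mu (im _)) (_ : im (ofR g) = fun=> 0)// ip0r.
    by case: ifP => _; rewrite expr0n/= addr0// expr0n.
  under eq_bigr => k _ do rewrite E.
  rewrite -big_mkcond/=; case: (leqP M N.+1) => MN.
    rewrite /S -(big_mkord (fun k => k < N.+1)%N (fun k => c k ^+ 2)) -(big_mkord xpredT (fun k => c k ^+ 2)).
    rewrite [leRHS](big_cat_nat (n := M))//= big_mkcond/=.
    rewrite (_ : \sum_(0 <= i < M) _ = \sum_(0 <= i < M) c i ^+ 2); last first.
      by apply: eq_big_nat => i /andP[_ iM]; rewrite (leq_trans iM).
    by rewrite lerDl; apply: sumr_ge0 => i _; exact: sqr_ge0.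
  rewrite big_mkcond/= (sum_ord_widen (n := N.+1) (F := fun k => if (k < N.+1)%N then c k ^+ 2 else 0) (ltnW MN)).
    by rewrite /S; apply: ler_sum => k _; rewrite ltn_ord.
  by move=> i iN; rewrite ltnNge iN.
have SX : S = ip g (horner 'X^N).
  rewrite (Xn_lpoly W_pos (ltnSn N)) (ip_polP_sum Hnu _ c lg).
  by apply: eq_bigr => k _; rewrite gP ltn_ord expr2.
have X2 : nrm (horner 'X^N) ^+ 2 = W p (N + N).
  by rewrite nrm_sqr (ip_poly Hnu) -exprD momXn.
have CS := ip_cauchy lg (l2_poly Hnu 'X^N); rewrite -SX in CS.
have SE : S = W p N ^+ 2 * 'C(N + N, N)%:R.
  have VD : (\sum_(j < N.+1) 'C(N, j) * 'C(N, N - j) = 'C(N + N, N))%N by exact: binomial.Vandermonde.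
  rewrite -VD natr_sum mulr_sumr; apply: eq_bigr => k _.
  rewrite (bin_sub (leq_ord k)) natrM /c !exprMn sqrr_sign mul1r; ring.
have S0 : 0 < S by rewrite SE mulr_gt0 ?exprn_gt0// ltr0n bin_gt0 leq_addr.
have S2 : S ^+ 2 <= nrm g ^+ 2 * W p (N + N).
  rewrite -X2 -exprMn; apply: le_trans (_ : `|S| ^+ 2 <= _).
    by rewrite real_normK ?num_real.
  by rewrite ler_sqr ?nnegrE ?mulr_ge0 ?nrm_ge0.
have : A * S <= W p (N + N).
  rewrite -(ler_pM2r S0) -mulrA -expr2.
  apply: (@le_trans _ _ (A * (nrm g ^+ 2 * W p (N + N)))); first by rewrite ler_pM2l.
  by rewrite mulrA [leRHS]mulrC; apply: ler_wpM2r => //; exact: ltW.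
rewrite leNgt SE => /negP; apply; move: hN; congr (_ < _); ring.
Qed.

Lemma unique_of_complete (u v w : nat -> R -> cplx) : 
  (forall f : R -> cplx, L2 mu f -> (forall n, inner mu f (u n) = 0) -> aeq mu f (fun=> 0)) ->
  biorthogonal mu u v -> biorthogonal mu u w -> forall n, aeq mu (w n) (v n).
Proof.
move=> HC [lu lv bv] [_ lw bw] n; have lk := L2_lin (-1) (lv n) (lw n).
have h := HC _ lk; apply: aeq_sub0.
have -> : (fun x => w n x - v n x) = fun x => -1 * v n x + w n x.
  by apply/funext => x; rewrite mulN1r addrC.
apply: h => m; rewrite (inner_lin (-1) (lv n) (lw n) (lu m)).
by rewrite (inner_conj (lu m) (lv n)) (inner_conj (lu m) (lw n)) bv bw mulN1r addNr.
Qed.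

Section Dual.
Hypothesis HB : forall n, exists B, bfun (W p) (binw (W p) n) B.

Let lV n : l2 (rodV nu n). Proof. by have [B hB] := HB n; have [] := rodV_dual Hnu hB. Qed.
Let hV n q : ip (rodV nu n) (horner q) = (-1) ^+ n * mom (binw (W p) n) q.
Proof. by have [B hB] := HB n; have [_] := rodV_dual Hnu hB; apply. Qed.

Lemma L2_Vn n : L2 mu (Vn n). Proof. exact: L2_ofR (lV n). Qed.

Lemma ip_VP n k : ip (rodV nu n) (polP p k) = (k == n)%:R.
Proof. exact: (dual_polP Hnu _ (hV n)). Qed.

Lemma inner_VP n k : inner mu (Vn n) (Pn k) = (n == k)%:R.
Proof.
rewrite (inner_ofR (lV n) (l2_polP Hnu k)) ip_VP eq_sym.
by case: eqP.
Qed.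

Lemma biorthogonal_PV : biorthogonal mu Pn Vn.
Proof.
split; [exact: L2_Pn Hnu|exact: L2_Vn|move=> n k].
rewrite (inner_ofR (l2_polP Hnu n) (lV k)) ipC ip_VP.
by case: eqP.
Qed.

Lemma biorthogonal_VP : biorthogonal mu Vn Pn.
Proof. by split; [exact: L2_Vn|exact: L2_Pn Hnu|exact: inner_VP]. Qed.

(** Pairing the combination with the sum of the [a_k P_k] returns the sum of the [a_k ^ 2], and
    [nrm_sum_lpoly] bounds the norm of the second factor. *)
Lemma riesz_fischer_real N (a : nat -> R) : \sum_(k < N) a k ^+ 2 <=
  nrm (fun x => \sum_(k < N) a k * rodV nu k x) ^+ 2.
Proof.
have lav k : l2 (fun x => a k * rodV nu k x) by exact: l2Z.
have [lg _] := nrm_sum N lav; set g := (fun x => _) in lg *.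
have gip h : l2 h -> ip g h = \sum_(i < N) a i * ip (rodV nu i) h.
  move=> lh; rewrite /g; elim: (N) => [|m IH].
    rewrite big_ord0 (_ : (fun x => _) = fun=> 0); first by rewrite ipC ip0r.
    by apply/funext => x; rewrite big_ord0.
  rewrite big_ord_recr/= -IH; have [l1 _] := nrm_sum m lav.
  rewrite -(ip_linl (a m) l1 (lV m) lh); congr Submission.ip.
  by apply/funext => x; rewrite big_ord_recr.
set S := \sum_(k < N) _; pose q := \sum_(k < N) a k *: lpoly (W p) k.
have S0 : 0 <= S by apply: sumr_ge0 => k _; exact: sqr_ge0.
have E : S = ip g (horner q).
  rewrite /q (ip_polP_sum Hnu _ a lg); apply: eq_bigr => k _; rewrite expr2; congr (_ * _).
  rewrite (gip _ (l2_polP Hnu k)).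
  rewrite (bigD1 k)//= ip_VP eqxx mulr1 big1 ?addr0// => i ik.
  rewrite ip_VP; case: eqVneq => [e|_]; last by rewrite mulr0.
  by case/eqP: ik; apply: val_inj.
have h1 := ip_cauchy lg (l2_poly Hnu q); rewrite -E (ger0_norm S0) in h1.
have h2 := nrm_sum_lpoly Hnu N a; rewrite -/S -/q in h2.
have y0 := nrm_ge0 mu (horner q); have x0 := nrm_ge0 mu g.
move: (nrm g) (nrm (horner q)) x0 y0 h1 h2 => x y x0 y0 h1 h2.
have h3 : S ^+ 2 <= x ^+ 2 * S.
  apply: (@le_trans _ _ ((x * y) ^+ 2)); first by rewrite ler_sqr ?nnegrE ?mulr_ge0.
  by rewrite exprMn; apply: ler_wpM2l => //; exact: sqr_ge0.
have [S1|S1] := ltP 0 S; last exact: le_trans S1 (sqr_ge0 _).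
by move: h3; rewrite expr2 ler_pM2r.
Qed.

Lemma riesz_fischer_Vn : riesz_fischer mu Vn.
Proof.
split; first exact: L2_Vn.
exists 1 => // n c; rewrite mul1r; have lc := L2_lincomb n c L2_Vn.
rewrite (L2norm_sqr lc) /sqabs big_split/=.
have E x : lincomb n c Vn x = Complex (\sum_(k < n) complex.Re (c k) * rodV nu k x)
    (\sum_(k < n) complex.Im (c k) * rodV nu k x).
  rewrite /lincomb; elim: (n) => [|m IH]; first by rewrite !big_ord0.
  rewrite !big_ord_recr/= IH /ofR; case: (c m) => [a b].
  apply/eqP; rewrite eq_complex/=; apply/andP; split; apply/eqP; ring.
have -> : re (lincomb n c Vn) = fun x => \sum_(k < n) complex.Re (c k) * rodV nu k x.
  by apply/funext => x; rewrite /re E.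
have -> : im (lincomb n c Vn) = fun x => \sum_(k < n) complex.Im (c k) * rodV nu k x.
  by apply/funext => x; rewrite /im E.
apply: lerD; first exact: (riesz_fischer_real n (fun k => complex.Re (c k))).
exact: (riesz_fischer_real n (fun k => complex.Im (c k))).
Qed.

Hypothesis chain : chain_hyp p.

Lemma dense_Vn : dense_in_L2 mu (lspan Vn).
Proof.
apply: dense_real => // f lf d d0.
(* A polynomial is used here only as a finite sequence of coefficients. *)
pose e (q : {poly R}) x := \sum_(k < size q) q`_k * rodV nu k x.
have eN (q : {poly R}) N x : (size q <= N)%N -> e q x = \sum_(k < N) q`_k * rodV nu k x.
  move=> qN; rewrite /e (sum_ord_widen (F := fun k => q`_k * rodV nu k x) qN)// => i qi.
  by rewrite nth_default// mul0r.
have le (q : {poly R}) : l2 (e q).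
  have lq k : l2 (fun x => q`_k * rodV nu k x) by exact: l2Z.
  by have [] := nrm_sum (size q) lq.
have elin (r : {poly R}) a (q : {poly R}) x : e (r + a *: q) x = e r x + a * e q x.
  pose N := maxn (size (r + a *: q)) (maxn (size r) (size q)).
  rewrite !(eN _ N) ?leq_max ?leqnn ?orbT// mulr_sumr -big_split/=.
  by apply: eq_bigr => k _; rewrite coefD coefZ; ring.
have eorth h : l2 h -> (forall q, ip h (e q) = 0) -> h = cst 0 %[ae mu].
  move=> lh oh; apply: (complete_dual HP Hnu chain lh) => n v lv hv.
  have vV : rodV nu n = v %[ae mu] by apply: ae_mono (rodV_ae Hnu lv hv) => x -> _.
  rewrite ipC -(eq_ae_ip (lV n) lv lh vV) ipC -(oh 'X^n); congr Submission.ip.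
  apply/funext => x; rewrite /e size_polyXn big_ord_recr/= coefXn eqxx mul1r big1 ?add0r// => k _.
  by rewrite coefXn ltn_eqF// mul0r.
have [q hq] := dense_of_orthogonal le elin eorth lf d0.
by exists (size q), (fun k => q`_k).
Qed.

Lemma complete_Vn (f : R -> cplx) : L2 mu f -> (forall n, inner mu f (Vn n) = 0) -> aeq mu f (fun=> 0).
Proof. by move=> lf h; apply: (dense_orth_seq dense_Vn L2_Vn lf h). Qed.

End Dual.
End Assembly.

(** * Which dual functionals are bounded *)

Section BoundedFunctionals.
Context {R : realType} (p : laguerre_exponent R).

Lemma bfun_binw_density n (A b : R) : 0 < phir p 1 -> (n.*2)%:R < A -> 0 < b -> density_ge0 p A b ->
  exists B, bfun (W p) (binw (W p) n) B.
Proof.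
move=> phi1 nA b0 db; have A0 : 0 < A by apply: le_lt_trans nA.
have [B hB] := bfun_bet_ex (ltW b0) nA; exists B.
by have h := bfun_W phi1 A0 b0 db hB; exact: h.
Qed.

Lemma bfun_binw_infty n : 0 < phir p 1 -> classNinfty p -> exists B, bfun (W p) (binw (W p) n) B.
Proof.
move=> phi1 h; have A0 : 0 < (n.*2).+1%:R :> R by [].
have [b b0 db] := density_infty h A0.
by apply: (bfun_binw_density phi1 _ b0 db); rewrite ltr_nat.
Qed.

Lemma bfun_binw_mass n : ~ classNinfty p -> 0 < phir p 1 -> n%:R < mass p / (2 * phi_lim p) ->
  exists B, bfun (W p) (binw (W p) n) B.
Proof.
move=> s0 phi1 nm; have r0 := phi_lim_gt0 s0 phi1.
have r2 : 0 < 2 * phi_lim p by rewrite mulr_gt0.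
have m0 : 2 * n%:R * phi_lim p < mass p.
  by move: nm; rewrite ltr_pdivlMr//; congr (_ < _); ring.
have n0 : 0 <= n%:R :> R by [].
have mp : 0 < mass p.
  by apply: le_lt_trans m0; rewrite !mulr_ge0// ltW.
(* Midpoint of the admissible interval: [2 n < A] for the Beta functional and [A phi_lim < mass] for
   the density inequality. *)
pose A := (2 * n%:R + mass p / phi_lim p) / 2.
have E : mass p / phi_lim p * phi_lim p = mass p by rewrite divfK// gt_eqF.
have h1 : 2 * n%:R < mass p / phi_lim p by rewrite ltr_pdivlMr.
have nA : (n.*2)%:R < A by rewrite /A -muln2 natrM; lra.
have A0 : 0 < A by apply: le_lt_trans nA.
have Am : A * phi_lim p < mass p.
  by rewrite -ltr_pdivlMr// /A; lra.
have [b b0 db] := density_mass s0 A0 mp Am.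
exact: bfun_binw_density phi1 nA b0 db.
Qed.

End BoundedFunctionals.

(** * Absence of dual vectors for finite Levy mass *)

Section FiniteMass.
Context {R : realType} (p : laguerre_exponent R) (P : R -> (R -> R) -> R -> R)
  (mu : probability (mR R) R) (nu : R -> R).
Hypotheses (Hnu : invariant_density p P mu nu) (s0 : ~ classNinfty p).
Local Notation cplx := (complex R).

(** A dual vector would pair with ['X^k] to ['C(k, n) W_k] up to sign, and Cauchy-Schwarz would
    bound the ratio that [binom_unbounded] shows to be unbounded. *)
Lemma no_dual n : mass p / (2 * phi_lim p) < n%:R -> forall u : R -> cplx, L2 mu u ->
  ~ forall m, inner mu u (ofR (polP p m)) = (n == m)%:R.
Proof.
move=> nm u lu bu; have phi1 := phir1_gt0 Hnu; have r0 := phi_lim_gt0 s0 phi1.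
have W_pos k : 0 < W p k := W_gt0 phi1 k.
have r2 : 0 < 2 * phi_lim p by rewrite mulr_gt0.
have m0 : mass p < 2 * n%:R * phi_lim p.
  by move: nm; rewrite ltr_pdivrMr//; congr (_ < _); ring.
have [lr _] := (L2P mu u).1 lu.
have br m : ip mu (re u) (polP p m) = (n == m)%:R.
  have /(congr1 (@complex.Re R)) := bu m.
  by rewrite re_nat (inner_ofRr lu (l2_polP Hnu m)).
have [k hk] := binom_unbounded s0 phi1 (nrm mu (re u) ^+ 2) m0.
have E : ip mu (re u) (horner 'X^k) ^+ 2 = ('C(k, n)%:R * W p k) ^+ 2.
  rewrite (Xn_lpoly W_pos (ltnSn k)) (ip_polP_sum Hnu k.+1 (fun i => W p k * ((-1) ^+ i * 'C(k, i)%:R)) lr).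
  have [nk|nk] := leqP n.+1 k.+1.
    rewrite (bigD1 (Ordinal nk))//= br eqxx mulr1 big1 ?addr0; last first.
      move=> i ik; rewrite br; case: eqVneq => [e|_]; last by rewrite mulr0.
      by case/eqP: ik; apply: val_inj.
    by rewrite !exprMn sqrr_sign mul1r mulrC.
  rewrite big1 ?bin_small//; last first.
    move=> i _; rewrite br; case: eqVneq => [e|_]; last by rewrite mulr0.
    have h : (n < k.+1)%N by rewrite e ltn_ord.
    by have := leq_ltn_trans h nk; rewrite ltnn.
  by rewrite mul0r.
have CS := ip_cauchy lr (l2_poly Hnu 'X^k).
have X2 : nrm mu (horner 'X^k) ^+ 2 = W p (k + k).
  by rewrite nrm_sqr (ip_poly Hnu) -exprD momXn.
move: hk; rewrite -E -X2 ltNge => /negP; apply.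
rewrite -exprMn -(real_normK (num_real (ip mu (re u) _))).
by rewrite ler_sqr ?nnegrE ?mulr_ge0 ?nrm_ge0.
Qed.

End FiniteMass.

(** * Spectra of [P_t] and of its adjoint *)

Section SpectrumOfSemigroup.
Context {R : realType} (p : laguerre_exponent R) (P : R -> (R -> R) -> R -> R)
  (mu : probability (mR R) R) (nu : R -> R).
Hypotheses (HP : generalized_laguerre p P) (Hnu : invariant_density p P mu nu).
Local Notation cplx := (complex R).
Variables (t : R) (Q Qs : (R -> cplx) -> R -> cplx).
Hypotheses (t0 : 0 <= t) (HQ : L2_extension mu (P t) Q) (HQs : adjoint mu Q Qs).
Local Notation z := (fun n : nat => expR (- (n%:R * t))).
Local Notation Pn := (fun n => ofR (polP p n) : R -> cplx).
Local Notation Vn := (fun n => ofR (rodV nu n) : R -> cplx).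

Let bQ : bounded_op mu Q := HQ.1.
Let bQs : bounded_op mu Qs := HQs.1.

Lemma Pn_neq0 n : ~ aeq mu (Pn n) (fun=> 0).
Proof. by move=> /aeqP[h _]; exact: (polP_neq0 Hnu (n := n) h). Qed.

Lemma expnt_inj : 0 < t -> injective z.
Proof.
move=> tp i j /expR_inj/oppr_inj/(mulIf (lt0r_neq0 tp))/eqP.
by rewrite eqr_nat => /eqP.
Qed.

Lemma Et_sub_point_Q : Et t `<=` point_spectrum mu Q.
Proof.
move=> _ [n _ <-]; exists (Pn n); last exact: Pn_neq0.
by split; [exact: L2_Pn Hnu n|exact: (Q_Pn HP Hnu t0 HQ n)].
Qed.

Lemma residual_Q : residual_spectrum mu Q = set0.
Proof.
apply: (residual_spectrum0 (u := Pn) (z := z) bQ).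
- exact: L2_Pn Hnu.
- by move=> n; exact: (Q_Pn HP Hnu t0 HQ n).
- exact: Pn_neq0.
- exact: dense_polP Hnu.
Qed.

Let HEs f n : L2 mu f -> inner mu (Qs f) (Pn n) = Complex (z n) 0 * inner mu f (Pn n).
Proof. exact: (Qs_Pn HP Hnu t0 HQ HQs). Qed.
Let HCs f : L2 mu f -> (forall n, inner mu f (Pn n) = 0) -> aeq mu f (fun=> 0).
Proof. exact: complete_Pn Hnu f. Qed.

Lemma point_Qs_eig n (u : R -> cplx) : L2 mu u -> (forall m, inner mu u (Pn m) = (n == m)%:R) ->
  point_spectrum mu Qs (expnt t n).
Proof. exact: (point_spectrum_eig (w := Pn) (z := z) bQs (L2_Pn Hnu) HEs HCs). Qed.

Section Dual.
Hypothesis HB : forall n, exists B, bfun (W p) (binw (W p) n) B.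

Lemma Et_sub_point_Qs : Et t `<=` point_spectrum mu Qs.
Proof.
by move=> _ [n _ <-]; apply: (point_Qs_eig (L2_Vn Hnu HB n)); exact: inner_VP Hnu HB n.
Qed.

Lemma mult_Qs n : 0 < t -> alg_mult mu (expnt t n) Qs 1 /\ geom_mult mu (expnt t n) Qs 1.
Proof.
move=> /expnt_inj zi; split.
  exact: (alg_mult_eig (w := Pn) (z := z) bQs (L2_Pn Hnu) HEs HCs (L2_Vn Hnu HB n) (inner_VP Hnu HB n) zi).
exact: (geom_mult_eig (w := Pn) (z := z) bQs (L2_Pn Hnu) HEs HCs (L2_Vn Hnu HB n) (inner_VP Hnu HB n) zi).
Qed.

Let eigV n : aeq mu (sub_scalar Qs (Complex (z n) 0) (Vn n)) (fun=> 0).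
Proof. exact: (sub_scalar_eig (w := Pn) (z := z) bQs (L2_Pn Hnu) HEs HCs (L2_Vn Hnu HB n) (inner_VP Hnu HB n)). Qed.

Hypothesis chain : chain_hyp p.

Let HE f n : L2 mu f -> inner mu (Q f) (Vn n) = Complex (z n) 0 * inner mu f (Vn n).
Proof. by move=> lf; exact: (Q_dual HQs (L2_Vn Hnu HB n) (eigV n) lf). Qed.
Let HC f : L2 mu f -> (forall n, inner mu f (Vn n) = 0) -> aeq mu f (fun=> 0).
Proof. exact: (complete_Vn HP Hnu HB chain). Qed.

Lemma Et_point_Q : Et t = point_spectrum mu Q.
Proof.
apply/seteqP; split; first exact: Et_sub_point_Q.
move=> l /(point_spectrum_sub (w := Vn) (z := z) bQ (L2_Vn Hnu HB) HE HC)[n ->].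
by exists n.
Qed.

Lemma Et_point_Qs : Et t = point_spectrum mu Qs.
Proof.
apply/seteqP; split; first exact: Et_sub_point_Qs.
move=> l /(point_spectrum_sub (w := Pn) (z := z) bQs (L2_Pn Hnu) HEs HCs)[n ->].
by exists n.
Qed.

Lemma mult_Q n : 0 < t -> alg_mult mu (expnt t n) Q 1.
Proof.
move=> /expnt_inj zi; have [_ _ bi] := biorthogonal_PV Hnu HB.
exact: (alg_mult_eig (w := Vn) (z := z) bQ (L2_Vn Hnu HB) HE HC (L2_Pn Hnu n) (bi n) zi).
Qed.

Lemma residual_Qs : residual_spectrum mu Qs = set0.
Proof.
apply: (residual_spectrum0 (u := Vn) (z := z) bQs).
- exact: L2_Vn Hnu HB.
- exact: eigV.
- by move=> n; exact: (eig_neq0 (w := Pn) (L2_Pn Hnu) (L2_Vn Hnu HB n) (inner_VP Hnu HB n)).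
- exact: dense_Vn HP Hnu HB chain.
Qed.

End Dual.

Lemma residual_Qs_mem n : 0 < t ->
  (forall u : R -> cplx, L2 mu u -> ~ forall m, inner mu u (Pn m) = (n == m)%:R) ->
  residual_spectrum mu Qs (expnt t n).
Proof.
move=> /expnt_inj zi; apply: (residual_spectrum_mem (w := Pn) (z := z) bQs (L2_Pn Hnu) HEs HCs zi).
exact: Pn_neq0.
Qed.

Lemma point_Qs_mass n B : bfun (W p) (binw (W p) n) B -> point_spectrum mu Qs (expnt t n).
Proof.
move=> hB; have [v [lv hv]] := dual_ex Hnu hB.
apply: (point_Qs_eig (L2_ofR lv)) => m.
rewrite (inner_ofR lv (l2_polP Hnu m)) (dual_polP Hnu _ hv) eq_sym.
by case: eqP.
Qed.

End SpectrumOfSemigroup.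

Theorem theorem1p22 (R : realType) (p : laguerre_exponent R)
    (P : R -> (R -> R) -> R -> R)
    (mu : probability (measurableTypeR R) R) (nu : R -> R)
    (Q Qs : R -> (R -> R[i]) -> R -> R[i]) (alpha mm : R)
    (HP : generalized_laguerre p P)
    (Hnu : invariant_density p P mu nu)
    (HQ : forall t : R, 0 <= t -> L2_extension mu (P t) (Q t))
    (HQs : forall t : R, 0 <= t -> adjoint mu (Q t) (Qs t))
    (Halpha : 0 < alpha <= 1) (Hmm : 1 - alpha^-1 <= mm) :
  let Pn : nat -> R -> R[i] := fun n => ofR (polP p n) in
  let Vn : nat -> R -> R[i] := fun n => ofR (rodV nu n) in
  [/\ (* (1) *)
      [/\ dense_in_L2 mu (lspan Pn),
          bessel mu Pn &
          (* if m = 0 and Pi = 0, (P_n) is the orthonormal Laguerre basis *)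
          ~ (ldrift p = 0 /\ lPi p setT = 0%E) -> ~ riesz_basis mu Pn],
      (* (2) *)
      classNinfty p ->
        [/\ minimal_seq mu Vn, riesz_fischer mu Vn, exact_seq mu Pn &
            unique_biorthogonal mu Pn Vn],
      (* (3) *)
      classNP p \/ classNamd alpha mm p ->
        [/\ dense_in_L2 mu (lspan Vn), exact_seq mu Vn &
            unique_biorthogonal mu Vn Pn] &
      (* (4); the claims guarded by 0 < t fail for t = 0, as P_0 = id *)
      forall t : R, 0 <= t ->
        [/\ (* (a) *)
            Et t `<=` point_spectrum mu (Q t) /\
            residual_spectrum mu (Q t) = set0,
            (* (b) *)
            classNinfty p ->
              Et t `<=` point_spectrum mu (Qs t) /\
              (0 < t -> forall n,
                 alg_mult mu (expnt t n) (Qs t) 1 /\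
                 geom_mult mu (expnt t n) (Qs t) 1),
            (* (c) *)
            classNP p \/ classNamd alpha mm p ->
              [/\ Et t = point_spectrum mu (Q t),
                  Et t = point_spectrum mu (Qs t),
                  0 < t -> forall n,
                    alg_mult mu (expnt t n) (Q t) 1 /\
                    alg_mult mu (expnt t n) (Qs t) 1,
                  residual_spectrum mu (Q t) = set0 &
                  residual_spectrum mu (Qs t) = set0] &
            (* (d) *)
            ~ classNinfty p -> (1 <= Nr p)%E ->
              let a := fine (Pibar0 p) / (2 * fine (phi_infty p)) in
              [set expnt t n | n in [set n : nat | n%:R < a]]
                `<=` point_spectrum mu (Qs t) /\
              (0 < t ->
               [set expnt t n | n in [set n : nat | a < n%:R]]
                 `<=` residual_spectrum mu (Qs t))]].
Proof.
move=> Pn Vn; have phi1 := phir1_gt0 Hnu; have hW := hpsd_W Hnu.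
have lP := L2_Pn Hnu.
have HBi : classNinfty p -> forall n, exists B, bfun (W p) (binw (W p) n) B.
  by move=> h n; exact: bfun_binw_infty phi1 h.
have ch : classNP p \/ classNamd alpha mm p -> chain_hyp p.
  case=> [h|[h _]]; first exact: chain_hyp_NP phi1 hW h.
  by apply: (@chain_hyp_Nam R p phi1 alpha mm).
have HBc : chain_hyp p -> forall n, exists B, bfun (W p) (binw (W p) n) B.
  by move=> [kap [B [C [M [_ hB _ _ _]]]]] n; exists (B n).
have dP : dense_in_L2 mu (lspan Pn) := dense_polP Hnu.
split.
- split; [exact: dP|exact: bessel_Pn Hnu|].
  by move=> nz; apply: (not_riesz_Pn Hnu); exact: phir_conv_gt0.
- move=> h; have HB := HBi h; have bPV := biorthogonal_PV Hnu HB.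
  split.
  + by exists Pn; exact: biorthogonal_VP Hnu HB.
  + exact: riesz_fischer_Vn Hnu HB.
  + by split; [exists Vn|split].
  + split => // w bw; exact: (unique_of_complete (complete_Pn Hnu) bPV bw).
- move=> /ch hc; have HB := HBc hc; have bVP := biorthogonal_VP Hnu HB.
  have dV := dense_Vn HP Hnu HB hc; have lV := L2_Vn Hnu HB.
  split; [exact: dV|by split; [exists Pn|split]|].
  by split => // w bw; exact: (unique_of_complete (complete_Vn HP Hnu HB hc) bVP bw).
move=> t t0; have hQ := HQ t t0; have hQs := HQs t t0; split.
- by split; [exact: (Et_sub_point_Q HP Hnu t0 hQ)|exact: (residual_Q HP Hnu t0 hQ)].
- move=> h; have HB := HBi h; split; first exact: (Et_sub_point_Qs HP Hnu t0 hQ hQs HB).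
  by move=> tp n; exact: (mult_Qs HP Hnu t0 hQ hQs HB n tp).
- move=> /ch hc; have HB := HBc hc; split.
  + exact: (Et_point_Q HP Hnu t0 hQ hQs HB hc).
  + exact: (Et_point_Qs HP Hnu t0 hQ hQs HB).
  + move=> tp n; split; first exact: (mult_Q HP Hnu t0 hQ hQs HB hc n tp).
    by have [] := mult_Qs HP Hnu t0 hQ hQs HB n tp.
  + exact: (residual_Q HP Hnu t0 hQ).
  + exact: (residual_Qs HP Hnu t0 hQ hQs HB hc).
move=> s0 _ a; have aE : a = mass p / (2 * phi_lim p) by rewrite /a (phi_inftyE s0).
split.
  move=> _ [n na <-]; have [|B hB] := bfun_binw_mass (n := n) s0 phi1; first by rewrite -aE.
  exact: (point_Qs_mass HP Hnu t0 hQ hQs hB).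
move=> tp _ [n na <-]; apply: (residual_Qs_mem HP Hnu t0 hQ hQs tp).
by apply: (no_dual Hnu s0); rewrite -aE.
Qed.
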